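(* One has $$\sigma(\Phi_{KZ})_{\big|\,x\mapsto2\pi\mathrm ix,\ y\mapsto(2\pi\mathrm i)^{-1}y}=\lim_{\tau\to\mathrm i\infty}e(\tau)*\exp\Big(\frac\tau{2\pi\mathrm i}\big(e_-+\sum_{k\ge0}2(2k+1)\zeta(2k+2)\delta_{2k}\big)\Big).$$ Explicitly, with $\tilde y:=-\frac{\mathrm{ad}x}{e^{2\pi\mathrm i\,\mathrm{ad}x}-1}(y)$, the left-hand side is the pair $$\Big(\Phi_{KZ}(\tilde y,t)e^{2\pi\mathrm i\tilde y}\Phi_{KZ}(\tilde y,t)^{-1},\ e^{\pi\mathrm it}\Phi_{KZ}(-\tilde y-t,t)e^{2\pi\mathrm ix}\Phi_{KZ}(\tilde y,t)^{-1}\Big).$$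
   Context: $\mathfrak H=\{\tau\in\mathbb C\mid\Im\tau>0\}$. $\hat{\mathfrak f}_2^{\mathbb C}$ is the degree-completed free complex Lie algebra on $x,y$; $t:=-[x,y]$. For an automorphism $\phi$ of $\hat{\mathfrak f}_2^{\mathbb C}$ (or the exponential of a derivation) and $e=(A,B)$, $e*\phi:=(\phi(A),\phi(B))$. The limit is coefficientwise. $\Phi_{KZ}(a,b)=G_1(z)^{-1}G_0(z)$, where $G_0,G_1$ are the solutions on $]0,1[$ of $G'(z)=(\frac az+\frac b{z-1})G(z)$ with $G_0(z)\sim z^a$ ($z\to0$), $G_1(z)\sim(1-z)^b$ ($z\to1$), a group-like series in the noncommuting variables $a,b$. $\sigma(\Phi_{KZ})$ is the elliptic associator obtained from $(\mu,\Phi)=(2\pi\mathrm i,\Phi_{KZ})$: with $x=x_1$, $y=y_1$, $x_2=-x$, $y_2=-y$, $t=t_{12}$, $\sigma(\Phi_{KZ})=(A_+,A_-)$, $A_+=\Phi(u,t)e^{\mu u}\Phi(u,t)^{-1}$, $A_-=e^{\mu t/2}\Phi(v,t)e^{x_1}\Phi(u,t)^{-1}$, $u=\frac{\mathrm{ad}x_1}{e^{\mathrm{ad}x_1}-1}(y_2)$, $v=\frac{\mathrm{ad}x_2}{e^{\mathrm{ad}x_2}-1}(y_1)$. $\theta(z|\tau)$ is the holomorphic function on $\mathbb C\times\mathfrak H$ with $\theta(z+1|\tau)=-\theta(z|\tau)=\theta(-z|\tau)$, $\theta(z+\tau|\tau)=-e^{-2\pi\mathrm iz-\pi\mathrm i\tau}\theta(z|\tau)$,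 zero set $\mathbb Z+\tau\mathbb Z$ in $z$, $\partial_z\theta(0|\tau)=1$. $F(z|\tau)$ is the holomorphic function on $\{z=a+b\tau\mid a,b\in\mathbb R,\ a\in]0,1[\text{ or }b\in]0,1[\}$ with values in $\exp(\hat{\mathfrak f}_2^{\mathbb C})$ such that $$\partial_zF(z|\tau)=-\frac{\theta(z+\mathrm{ad}x|\tau)\,\mathrm{ad}x}{\theta(z|\tau)\theta(\mathrm{ad}x|\tau)}(y)\cdot F(z|\tau),\qquad F(z|\tau)\sim(-2\pi\mathrm iz)^t\ (z\to0)$$ (branch of $\log(-2\pi\mathrm iz)$ continuous on the domain near $0$, with imaginary part $-\pi/2$ for small $z>0$). $e(\tau)=(A(\tau),B(\tau))$ with $A(\tau)=F(z|\tau)^{-1}F(z+1|\tau)$, $B(\tau)=F(z|\tau)^{-1}e^{2\pi\mathrm ix}F(z+\tau|\tau)$. Derivations of $\mathfrak f_2$: $e_-:x\mapsto y,\ y\mapsto0$; $\delta_{2k}:x\mapsto(\mathrm{ad}x)^{2k+2}(y)$, $y\mapsto\frac12\sum_{p,q\ge0,p+q=2k+1}(-1)^p[(\mathrm{ad}x)^p(y),(\mathrm{ad}x)^q(y)]$. $\zeta$ is the Riemann zeta function. *)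

(* Defs.v *)
From Stdlib Require Import Reals List Bool ZArith.
From Stdlib Require Import ClassicalEpsilon.
From Coquelicot Require Import Coquelicot.

Open Scope C_scope.

Definition Cexp (z : C) : C :=
  RtoC (exp (Re z)) * (cos (Im z), sin (Im z)).

Definition two_pi_i : C := RtoC (2 * PI) * Ci.

(** C<<x,y>>: a series is its family of coefficients on words in two letters; [false]
    is the first generator and [true] the second. The completed free Lie algebra
    embeds in it, and automorphisms and derivations of the Lie algebra act
    through their continuous extensions to it. *)

Definition word := list bool.
Definition ncs := word -> C.

Declare Scope ncs_scope.
Delimit Scope ncs_scope with ncs.
Bind Scope ncs_scope with ncs.

Definition szero : ncs := fun _ => RtoC 0.
Definition sone : ncs := fun w => match w with nil => RtoC 1 | _ => RtoC 0 end.
Definition letter (l : bool) : ncs := fun w =>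
  match w with cons l' nil => if Bool.eqb l l' then RtoC 1 else RtoC 0
             | _ => RtoC 0 end.
Definition sadd (f g : ncs) : ncs := fun w => f w + g w.
Definition sopp (f : ncs) : ncs := fun w => - f w.
Definition sscal (c : C) (f : ncs) : ncs := fun w => c * f w.
Definition smul (f g : ncs) : ncs := fun w =>
  sum_n (fun i => f (firstn i w) * g (skipn i w)) (length w).

Notation "f + g" := (sadd f g) : ncs_scope.
Notation "- f" := (sopp f) : ncs_scope.
Notation "f - g" := (sadd f (sopp g)) : ncs_scope.
Notation "f * g" := (smul f g) : ncs_scope.
Notation "c *: f" := (sscal c f) (at level 40, f at next level) : ncs_scope.

Definition spow (f : ncs) (n : nat) : ncs := Nat.iter n (smul f) sone.
Definition bracket (f g : ncs) : ncs := (f * g - g * f)%ncs.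
Definition ad_pow (f : ncs) (n : nat) (g : ncs) : ncs := Nat.iter n (bracket f) g.

(* Coquelicot's [Series] is real-valued. *)
Definition CSeries (a : nat -> C) : C :=
  (Series (fun n => Re (a n)), Series (fun n => Im (a n))).

Definition ssum (f : nat -> ncs) : ncs := fun w => CSeries (fun n => f n w).

Definition sexp (f : ncs) : ncs :=
  ssum (fun n => RtoC (/ INR (fact n)) *: spow f n)%ncs.

(* Geometric series: this is the inverse of a series with constant term 1. *)
Definition sinv (f : ncs) : ncs := ssum (spow (sone - f)%ncs).

Fixpoint words (n : nat) : list word :=
  match n with
  | O => cons nil nil
  | S m => flat_map (fun w => cons (cons false w) (cons (cons true w) nil)) (words m)
  end.

Definition eval_word (a b : ncs) (w : word) : ncs :=
  fold_right (fun (l : bool) g => ((if l then b else a) * g)%ncs) sone w.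

(* [subst f a b] is f(a,b), for a and b without constant term. *)
Definition subst (f a b : ncs) : ncs :=
  ssum (fun n => fold_right (fun w g => (f w *: eval_word a b w + g)%ncs)
                            szero (words n)).

Definition sx : ncs := letter false.
Definition sy : ncs := letter true.
Definition st : ncs := (- bracket sx sy)%ncs.

Inductive lie_poly : ncs -> Prop :=
| lie_letter : forall l, lie_poly (letter l)
| lie_add : forall f g, lie_poly f -> lie_poly g -> lie_poly (f + g)%ncs
| lie_scal : forall c f, lie_poly f -> lie_poly (c *: f)%ncs
| lie_bracket : forall f g, lie_poly f -> lie_poly g -> lie_poly (bracket f g).

Definition hom_part (n : nat) (f : ncs) : ncs :=
  fun w => if Nat.eqb (length w) n then f w else RtoC 0.

Definition lie_series (f : ncs) : Prop := forall n, lie_poly (hom_part n f).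

Definition exp_lie (g : ncs) : Prop := exists f, lie_series f /\ g = sexp f.

(* Coefficients of phi at 0. The point 0 is excluded, so that removable singularities are allowed. *)
Definition is_expansion (phi : C -> C) (a : nat -> C) : Prop :=
  locally' (RtoC 0) (fun s : C =>
    is_pseries (K := C_AbsRing) (V := C_NormedModule) a s (phi s)).

Definition expansion (phi : C -> C) : nat -> C :=
  epsilon (inhabits (fun _ => RtoC 0)) (is_expansion phi).

(* phi(ad f)(g), for phi holomorphic near 0. *)
Definition fun_ad (phi : C -> C) (f g : ncs) : ncs :=
  ssum (fun n => expansion phi n *: ad_pow f n g)%ncs.

(* The continuous derivation with x |-> p and y |-> q. It sends a word w to the
   sum over the positions in w of the words obtained by replacing the letter
   there by its image. So, for each factorization v = a b c and each letter l,
   the coefficient of the result on v receives the coefficient of f on a l c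
   times that of the image of l on b; here |a| = i and |b| = k. *)
Definition der (p q : ncs) (f : ncs) : ncs := fun v =>
  sum_n (fun i =>
    sum_n (fun k =>
      let a := firstn i v in
      let b := firstn k (skipn i v) in
      let c := skipn (i + k) v in
      f (a ++ false :: c)%list * p b + f (a ++ true :: c)%list * q b)
    (length v - i)) (length v).

Definition e_minus : ncs -> ncs := der sy szero.

(* delta k is $\delta_{2k}$. *)
Definition delta (k : nat) : ncs -> ncs :=
  der (ad_pow sx (2 * k + 2) sy)
      (RtoC (/ 2) *: (fun w => sum_n (fun p =>
         (RtoC ((-1) ^ p) *:
            bracket (ad_pow sx p sy) (ad_pow sx (2 * k + 1 - p) sy))%ncs w)
         (2 * k + 1)))%ncs.

Definition exp_der (D : ncs -> ncs) (f : ncs) : ncs :=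
  ssum (fun n => RtoC (/ INR (fact n)) *: Nat.iter n D f)%ncs.

(* Used at even integers s >= 2 only. *)
Definition zeta (s : nat) : R := Series (fun n => / INR (S n) ^ s)%R.

(* The derivation (tau / 2 pi i) (e_- + sum_k 2 (2k+1) zeta(2k+2) delta_{2k}). *)
Definition D_tau (tau : C) (f : ncs) : ncs :=
  ((tau / two_pi_i) *:
    (e_minus f +
     ssum (fun k => RtoC (2 * INR (2 * k + 1) * zeta (2 * k + 2)) *: delta k f)))%ncs.

Definition star (e : ncs * ncs) (phi : ncs -> ncs) : ncs * ncs :=
  (phi (fst e), phi (snd e)).

(* f ~ g: the quotient f g^{-1} tends to 1 coefficientwise. *)
Definition asymp {T : Type} (F : (T -> Prop) -> Prop) (f g : T -> ncs) : Prop :=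
  forall w, filterlim (fun z => (f z * sinv (g z))%ncs w) F (locally (sone w)).

Definition KZ_solution (G : R -> ncs) : Prop :=
  forall z : R, (0 < z < 1)%R -> forall w,
    is_derive (K := R_AbsRing) (V := C_R_NormedModule) (fun s => G s w) z
      (((RtoC (/ z) *: letter false + RtoC (/ (z - 1)) *: letter true) * G z)%ncs w).

Definition real_spow (z : R) (f : ncs) : ncs := sexp (RtoC (ln z) *: f)%ncs.

(* The variables a, b of Phi are the letters [false], [true]. *)
Definition is_PhiKZ (Phi : ncs) : Prop :=
  exists G0 G1 : R -> ncs,
    KZ_solution G0 /\
    asymp (at_right 0%R) G0 (fun z => real_spow z (letter false)) /\
    KZ_solution G1 /\
    asymp (at_left 1%R) G1 (fun z => real_spow (1 - z)%R (letter true)) /\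
    forall z : R, (0 < z < 1)%R -> Phi = (sinv (G1 z) * G0 z)%ncs.

Definition ell_sigma (mu : C) (Phi : ncs) : ncs * ncs :=
  let phi := fun s : C => s / (Cexp s - RtoC 1) in
  let x1 := sx in let y1 := sy in
  let x2 := (- sx)%ncs in let y2 := (- sy)%ncs in
  let u := fun_ad phi x1 y2 in
  let v := fun_ad phi x2 y1 in
  (subst Phi u st * sexp (mu *: u) * sinv (subst Phi u st),
   sexp ((mu / RtoC 2) *: st) * subst Phi v st * sexp x1 * sinv (subst Phi u st))%ncs.

(* x |-> 2 pi i x, y |-> (2 pi i)^{-1} y *)
Definition rescale (f : ncs) : ncs :=
  subst f (two_pi_i *: sx)%ncs (/ two_pi_i *: sy)%ncs.

Definition y_tilde : ncs :=
  (- fun_ad (fun s : C => s / (Cexp (two_pi_i * s) - RtoC 1)) sx sy)%ncs.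

Definition ell_sigma_explicit (Phi : ncs) : ncs * ncs :=
  (subst Phi y_tilde st * sexp (two_pi_i *: y_tilde) * sinv (subst Phi y_tilde st),
   sexp ((RtoC PI * Ci) *: st) * subst Phi (- y_tilde - st) st
     * sexp (two_pi_i *: sx) * sinv (subst Phi y_tilde st))%ncs.

Definition upper (tau : C) : Prop := (0 < Im tau)%R.

Definition is_theta (theta : C -> C -> C) : Prop :=
  (forall z tau, upper tau ->
     ex_filterdiff (K := C_AbsRing)
       (U := prod_NormedModule C_AbsRing C_NormedModule C_NormedModule)
       (V := C_NormedModule)
       (fun p => theta (fst p) (snd p)) (locally (z, tau))) /\
  forall tau, upper tau ->
    (forall z, theta (z + RtoC 1) tau = - theta z tau) /\
    (forall z, theta (- z) tau = - theta z tau) /\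
    (forall z, theta (z + tau) tau
       = - Cexp (- (two_pi_i * z) - RtoC PI * Ci * tau) * theta z tau) /\
    (forall z, theta z tau = RtoC 0 <->
       exists m n : Z, z = RtoC (IZR m) + RtoC (IZR n) * tau) /\
    is_derive (K := C_AbsRing) (V := C_NormedModule)
      (fun z => theta z tau) (RtoC 0) (RtoC 1).

Definition dom (tau z : C) : Prop :=
  exists a b : R, z = RtoC a + RtoC b * tau /\ ((0 < a < 1)%R \/ (0 < b < 1)%R).

Definition KZB_kernel (theta : C -> C -> C) (tau z : C) : ncs :=
  (- fun_ad (fun s : C => theta (z + s)%C tau * s / (theta z tau * theta s tau))%C
            sx sy)%ncs.

(* L is the branch of log(-2 pi i z) on [dom tau] near 0. *)
Definition log_branch (tau : C) (L : C -> C) : Prop :=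
  exists r : R, (0 < r)%R /\
    (forall z, dom tau z -> (Cmod z < r)%R ->
       continuous L z /\ Cexp (L z) = - (two_pi_i * z)) /\
    (forall z : R, (0 < z < r)%R -> Im (L (RtoC z)) = (- (PI / 2))%R).

(* F is $F(\cdot|\tau)$. *)
Definition is_KZB_solution (theta : C -> C -> C) (tau : C) (F : C -> ncs) : Prop :=
  (forall z, dom tau z -> exp_lie (F z)) /\
  (forall z, dom tau z -> forall w,
     is_derive (K := C_AbsRing) (V := C_NormedModule) (fun s => F s w) z
       ((KZB_kernel theta tau z * F z)%ncs w)) /\
  exists L, log_branch tau L /\
    asymp (within (dom tau) (locally (RtoC 0))) F (fun z => sexp (L z *: st)%ncs).

(* e is $(A(\tau),B(\tau))$ for F = $F(\cdot|\tau)$. *)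
Definition is_KZB_pair (tau : C) (F : C -> ncs) (e : ncs * ncs) : Prop :=
  (forall z, dom tau z -> dom tau (z + RtoC 1) ->
     fst e = (sinv (F z) * F (z + RtoC 1)%C)%ncs) /\
  (forall z, dom tau z -> dom tau (z + tau) ->
     snd e = (sinv (F z) * (sexp (two_pi_i *: sx) * F (z + tau)%C))%ncs).

(* The limit tau -> i oo: Im tau -> +oo with Re tau bounded, that is,
   inside every vertical strip. The limit is not uniform in Re tau: changing tau
   to tau + 1 twists e(tau), which makes the error polynomial in Re tau. *)

Definition i_infty (M : R) (P : C -> Prop) : Prop :=
  exists N : R, forall tau : C, (N < Im tau)%R -> (Rabs (Re tau) <= M)%R -> P tau.

Definition lim_i_infty (e : C -> ncs * ncs) (l : ncs * ncs) : Prop :=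
  forall (M : R) (w : word),
    filterlim (fun tau => fst (e tau) w) (i_infty M) (locally (fst l w)) /\
    filterlim (fun tau => snd (e tau) w) (i_infty M) (locally (snd l w)).

(* Main.v *)
(* Kronecker's formula, proved here by comparing two doubly quasi-periodic functions, turns the KZB kernel into a
   q-series; for Im tau >= 1 and |Im z| <= Im tau / 2 the kernel is the trigonometric KZ kernel in yt (the series y
   tilde) and t up to O(exp (-pi Im tau)).  Hence, along the imaginary axis from 0 to i Im tau / 2, the solution F follows
   the KZ solution G0(exp (-2 pi y)) with letters yt and t, and then, by definition of Phi, exp (2 pi i z yt) Phi(yt,t);
   the same holds for exp (2 pi i x) F(tau + z) on the negative imaginary axis, with yt replaced by - yt - t.
   Integrating along the horizontal segments iY -> iY + 1 and iY -> iY + Re tau, Y = Im tau / 2, gives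
     A = P exp (2 pi i yt) P^-1,  B = exp (pi i t) Phi(-yt-t,t) exp (2 pi i x) exp (2 pi i tau yt) P^-1,
   with P = Phi(yt,t), up to errors that are exponentially small in Im tau.  The values of zeta at the even integers
   show that the derivation kills yt and t and that its exponential multiplies exp (2 pi i x) on the right by
   exp (-2 pi i tau yt); its coefficients being polynomial in tau, the errors still tend to 0. *)

Require Import Defs.
From Stdlib Require Import Reals ZArith Lra Lia List Bool FunctionalExtensionality ClassicalEpsilon.
From Coquelicot Require Import Coquelicot.
Open Scope R_scope.
Open Scope C_scope.

(* The asymptotic conditions sit at singular points and give no rate, and the comparison has to be
   carried over a path whose length grows with Im tau. Nilpotency makes this possible: modulo words
   longer than n, kernels without constant term are nilpotent, so solutions grow like powers of the
   integrated kernel instead of exponentially. A perturbation of size exp(-pi Im tau) then stays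
   small, and near 0 only powers of logarithms have to be beaten. The point -i Im tau / 2 + tau lies
   on the horizontal line through i Im tau / 2, which is how the two half-axes meet. Near 0 the
   function exp(2 pi i x) F(z + tau) is known on the positive reals only, where it is F B; so the
   solutions are carried from there to the imaginary axis along small quarter circles. Their phases
   exp(pi i t / 2) and exp(-pi i t / 2) meet the phase exp(-pi i t / 2) of F on the positive reals:
   it is cancelled above and doubled below, whence the factor exp(pi i t) of B. The derivation is
   not evaluated on y tilde by its formulas: its values on exp(2 pi i x), then on y tilde, are
   forced by commutation relations. *)
Create HintDb pos.

Tactic Notation "le_via" uconstr(t) := eapply Rle_trans; [apply t |].

(** Sums over abstract structures leave equations whose type is only convertible to [C]; [ring]
    needs to see [C] itself. *)
Ltac cring := match goal with |- @eq _ ?x ?y => change (@eq C x y) end; ring.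

Lemma Rmin_le (a b : R) : Rmin a b <= a /\ Rmin a b <= b.
Proof. split; [apply Rmin_l | apply Rmin_r]. Qed.

Lemma exp_le (x y : R) : x <= y -> exp x <= exp y.
Proof. intros [H | ->]; [left; now apply exp_increasing | lra]. Qed.

Lemma exp_lt_1 (x : R) : x < 0 -> 0 < exp x < 1.
Proof. split; [apply exp_pos|]. rewrite <- exp_0. now apply exp_increasing. Qed.

Lemma PI_gt_3 : 3 < PI.
Proof. assert (H := PI2_3_2). lra. Qed.

(** Meant for sign conditions; through [assumption] and [auto] it also closes goals that hold by
    computation or directly by a hypothesis. *)
Ltac pos := solve [repeat first [assumption | lra | apply Rmult_lt_0_compat | apply Rmult_le_pos | apply Rplus_le_le_0_compat
 | apply Rinv_0_lt_compat | apply Rdiv_lt_0_compat | apply Rmin_glb_lt | apply pow_lt | apply pow_le | apply PI_RGT_0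
 | apply lt_0_INR; lia | apply pos_INR | apply Cmod_ge_0 | apply Rabs_pos | apply sqrt_pos | apply exp_pos
 | left; apply exp_pos | solve [auto with pos] | left; apply Rinv_0_lt_compat]].

Ltac mono := solve [assumption | apply Rle_refl | lra | pos | apply Cmod_triangle | apply Rmult_le_compat_l; [pos | mono]
 | apply Rmult_le_compat_r; [pos | mono] | apply Rmult_le_compat; [pos | pos | mono | mono]
 | apply Rplus_le_compat; mono | apply Rinv_le_contravar; [pos | mono] | apply exp_le; mono].

(** * Finite sums of complex numbers *)

Lemma csum_O (a : nat -> C) : sum_n a 0 = a O :> C.
Proof. apply (sum_O a). Qed.

Lemma csum_S (a : nat -> C) n : sum_n a (S n) = sum_n a n + a (S n) :> C.
Proof. apply (sum_Sn a). Qed.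

Lemma csum_ext (a b : nat -> C) n :
 (forall k, (k <= n)%nat -> a k = b k) -> sum_n a n = sum_n b n :> C.
Proof. apply sum_n_ext_loc. Qed.

Lemma csum_head (a : nat -> C) n :
 sum_n a (S n) = a O + sum_n (fun k => a (S k)) n :> C.
Proof.
 induction n as [|n IH].
 - pos.
 - rewrite csum_S, IH, (csum_S (fun k => a (S k))). cring.
Qed.

Lemma csum_zero (a : nat -> C) n :
 (forall k, (k <= n)%nat -> a k = (0:C)) -> sum_n a n = 0 :> C.
Proof.
 induction n as [|n IH]; intros H.
 - rewrite csum_O; apply H; lia.
 - rewrite csum_S, IH, H; try lia; [cring | intros; apply H; lia].
Qed.

Lemma csum_extend (a : nat -> C) n m :
 (n <= m)%nat -> (forall k, (n < k)%nat -> a k = 0) -> sum_n a m = sum_n a n :> C.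
Proof.
 intros Hnm H; induction m as [|m IH].
 - replace n with O by lia; reflexivity.
 - destruct (Nat.eq_dec n (S m)) as [->|Hne]; auto.
  rewrite csum_S, IH, H by lia. cring.
Qed.

Lemma csum_plus (a b : nat -> C) n :
 sum_n (fun k => a k + b k) n = sum_n a n + sum_n b n :> C.
Proof. apply (sum_n_plus a b n). Qed.

Lemma csum_scal (c : C) (a : nat -> C) n :
 sum_n (fun k => c * a k) n = c * sum_n a n :> C.
Proof. apply (sum_n_mult_l (K := C_AbsRing) c a n). Qed.

Lemma csum_swap (a : nat -> nat -> C) n m :
 sum_n (fun i => sum_n (fun j => a i j) m) n =
 sum_n (fun j => sum_n (fun i => a i j) n) m :> C.
Proof. apply (sum_n_switch a). Qed.

Lemma csum_one (a : nat -> C) n m :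
 (m <= n)%nat -> (forall k, (k <= n)%nat -> k <> m -> a k = 0) -> sum_n a n = a m :> C.
Proof.
 induction n as [|n IH]; intros Hm H.
 - rewrite csum_O. f_equal; lia.
 - rewrite csum_S. destruct (Nat.eq_dec m (S n)) as [->|Hne].
  + rewrite csum_zero; [cring | intros; apply H; lia].
  + rewrite IH; [rewrite (H (S n)) by lia; cring | lia | intros; apply H; lia].
Qed.

Lemma Re_csum (a : nat -> C) n : Re (sum_n a n) = sum_n (fun k => Re (a k)) n.
Proof.
 induction n as [|n IH]; auto.
 now rewrite csum_S, sum_Sn, <- IH.
Qed.

Lemma Im_csum (a : nat -> C) n : Im (sum_n a n) = sum_n (fun k => Im (a k)) n.
Proof.
 induction n as [|n IH]; auto.
 now rewrite csum_S, sum_Sn, <- IH.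
Qed.

Lemma C_eq (z w : C) : Re z = Re w -> Im z = Im w -> z = w.
Proof. destruct z, w; simpl; congruence. Qed.

Lemma Series_finite (a : nat -> R) N :
 (forall n, (N < n)%nat -> a n = 0%R) -> Series a = sum_n a N.
Proof.
 intros H. apply is_series_unique.
 apply filterlim_ext_loc with (fun _ : nat => sum_n a N).
 - exists N. intros n Hn. induction n as [|n IH].
  + replace N with O by lia; reflexivity.
  + destruct (Nat.eq_dec N (S n)) as [->|]; auto.
   rewrite sum_Sn, <- IH, H by lia. auto with real.
 - apply filterlim_const.
Qed.

Lemma CSeries_finite (a : nat -> C) N :
 (forall n, (N < n)%nat -> a n = 0) -> CSeries a = sum_n a N.
Proof.
 intros H.
 apply C_eq; simpl; rewrite (Series_finite _ N);
  try (intros n Hn; rewrite H by pos; reflexivity).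
 - symmetry; apply Re_csum.
 - symmetry; apply Im_csum.
Qed.

(** * The algebra of noncommutative series *)

Section Series.

Implicit Types (f g h a b p q : ncs) (c d : C) (w : word) (n m : nat) (l : bool).

(** With this condition every coefficient of [ssum f] is a finite sum, so exponentials, inverses,
    substitutions and functions of ad x raise no question of convergence. Only [exp_der] needs
    another argument. *)
Definition graded (f : nat -> ncs) : Prop :=
 forall n w, (length w < n)%nat -> f n w = 0.

Lemma ssum_graded (f : nat -> ncs) (w : word) N :
 graded f -> (length w <= N)%nat -> ssum f w = sum_n (fun n => f n w) N.
Proof.
 intros H HN. apply CSeries_finite. intros n Hn. apply H; lia.
Qed.

Lemma ncs_ext (f g : ncs) : (forall w, f w = g w) -> f = g.
Proof. intros; apply functional_extensionality; assumption. Qed.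

(** The left residual of a series by a letter. Since [shift_smul] expresses the residual of a
    product by those of its factors, identities about products are proved by induction on the word,
    for all series at once. *)
Definition shift (l : bool) (f : ncs) : ncs := fun w => f (l :: w).

Lemma smul_nil (f g : ncs) : (f * g)%ncs nil = f nil * g nil.
Proof. unfold smul; simpl. now rewrite csum_O. Qed.

Lemma smul_cons (f g : ncs) l w :
 (f * g)%ncs (l :: w) = f nil * g (l :: w) + (shift l f * g)%ncs w.
Proof. unfold smul; simpl length. rewrite csum_head. pos. Qed.

Lemma shift_smul l (f g : ncs) :
 shift l (f * g) = (f nil *: shift l g + shift l f * g)%ncs.
Proof. apply ncs_ext; intros w. unfold shift at 1. now rewrite smul_cons. Qed.

Lemma smul_add_l f g h : ((f + g) * h = f * h + g * h)%ncs.
Proof.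
 apply ncs_ext; intros w. unfold smul, sadd. rewrite <- csum_plus.
 apply csum_ext; intros; cring.
Qed.

Lemma smul_add_r f g h : (h * (f + g) = h * f + h * g)%ncs.
Proof.
 apply ncs_ext; intros w. unfold smul, sadd. rewrite <- csum_plus.
 apply csum_ext; intros; cring.
Qed.

Lemma smul_scal_l c f g : ((c *: f) * g = c *: (f * g))%ncs.
Proof.
 apply ncs_ext; intros w. unfold smul, sscal. rewrite <- csum_scal.
 apply csum_ext; intros; cring.
Qed.

Lemma smul_scal_r c f g : (f * (c *: g) = c *: (f * g))%ncs.
Proof.
 apply ncs_ext; intros w. unfold smul, sscal. rewrite <- csum_scal.
 apply csum_ext; intros; cring.
Qed.

Lemma sopp_scal f : (- f = (- (1)) *: f)%ncs.
Proof. apply ncs_ext; intros w. unfold sopp, sscal. cring. Qed.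

Lemma smul_opp_l f g : ((- f) * g = - (f * g))%ncs.
Proof. now rewrite !sopp_scal, smul_scal_l. Qed.

Lemma smul_opp_r f g : (f * (- g) = - (f * g))%ncs.
Proof. now rewrite !sopp_scal, smul_scal_r. Qed.

Lemma smul_assoc f g h : (f * (g * h) = (f * g) * h)%ncs.
Proof.
 apply ncs_ext; intros w; revert f; induction w as [|l w IH]; intros f.
 - rewrite !smul_nil; cring.
 - rewrite !smul_cons, smul_nil, shift_smul, smul_add_l, smul_scal_l.
  unfold sadd at 1, sscal at 1. rewrite IH. cring.
Qed.

Lemma smul_zero_l f : (szero * f = szero)%ncs.
Proof. apply ncs_ext; intros w; apply csum_zero; intros; unfold szero; cring. Qed.

Lemma smul_zero_r f : (f * szero = szero)%ncs.
Proof. apply ncs_ext; intros w; apply csum_zero; intros; unfold szero; cring. Qed.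

Lemma shift_one l : shift l sone = szero.
Proof. pos. Qed.

Lemma smul_one_l f : (sone * f = f)%ncs.
Proof.
 apply ncs_ext; intros [|l w]; [rewrite smul_nil; simpl; cring|].
 rewrite smul_cons, smul_zero_l. unfold szero; simpl; cring.
Qed.

Lemma smul_one_r f : (f * sone = f)%ncs.
Proof.
 apply ncs_ext; intros w; revert f; induction w as [|l w IH]; intros f.
 - rewrite smul_nil; simpl; cring.
 - rewrite smul_cons, IH. unfold shift; simpl; cring.
Qed.

End Series.

Ltac ncs_lin := apply ncs_ext; intro; unfold sadd, sopp, sscal, szero; cring.

Ltac ncs_ring :=
 repeat progress rewrite ?smul_add_l, ?smul_add_r, ?smul_opp_l, ?smul_opp_r,
  ?smul_scal_l, ?smul_scal_r, ?smul_assoc;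
 ncs_lin.

Section Operators.

Implicit Types (f g h a b p q : ncs) (c d : C) (w : word) (n m : nat) (l : bool).

Lemma sadd_zero_l f : (szero + f = f)%ncs. Proof. ncs_lin. Qed.
Lemma sadd_zero_r f : (f + szero = f)%ncs. Proof. ncs_lin. Qed.
Lemma sscal_sscal (a b : C) f : (a *: (b *: f) = (a * b) *: f)%ncs. Proof. ncs_lin. Qed.
Lemma sscal_one f : (1 *: f = f)%ncs. Proof. ncs_lin. Qed.
Lemma sscal_zero_l f : (0 *: f = szero)%ncs. Proof. ncs_lin. Qed.
Lemma sscal_zero_r c : (c *: szero = szero)%ncs. Proof. ncs_lin. Qed.

Lemma ssub_eq0 f g : (f - g = szero)%ncs -> f = g.
Proof.
 intros H; apply ncs_ext; intros w.
 assert (E := f_equal (fun h : ncs => h w) H). unfold sadd, sopp, szero in E.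
 replace (f w) with (f w + - g w + g w) by ring. rewrite E. cring.
Qed.

Definition vanish (n : nat) (f : ncs) : Prop :=
 forall w, (length w < n)%nat -> f w = 0.

Lemma vanish_mono n m f : (m <= n)%nat -> vanish n f -> vanish m f.
Proof. intros H Hf w Hw; apply Hf; lia. Qed.

Lemma vanish_all f : (forall n, vanish n f) -> f = szero.
Proof. intros H; apply ncs_ext; intros w. apply (H (S (length w))). lia. Qed.

Lemma vanish_add n f g : vanish n f -> vanish n g -> vanish n (f + g).
Proof. intros Hf Hg w Hw. unfold sadd. rewrite Hf, Hg by pos. cring. Qed.

Lemma vanish_scal n c f : vanish n f -> vanish n (c *: f).
Proof. intros Hf w Hw. unfold sscal. rewrite Hf by pos. cring. Qed.

Lemma vanish_opp n f : vanish n f -> vanish n (- f).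
Proof. intros Hf w Hw. unfold sopp. rewrite Hf by pos. cring. Qed.

Lemma vanish_mul n m f g : vanish n f -> vanish m g -> vanish (n + m) (f * g).
Proof.
 intros Hf Hg w Hw. apply csum_zero. intros k Hk.
 destruct (lt_dec k n) as [H|H].
 - rewrite Hf; [cring|]. rewrite firstn_length. lia.
 - rewrite Hg; [cring|]. rewrite skipn_length. lia.
Qed.

Lemma vanish_0 f : vanish 0 f.
Proof. easy. Qed.

Lemma vanish_1 f : vanish 1 f <-> f nil = 0.
Proof.
 split.
 - pos.
 - intros H [|l w] Hw; [exact H | simpl in Hw; lia].
Qed.

Lemma vanish_mul_l n f g : f nil = 0 -> vanish n g -> vanish (S n) (f * g).
Proof. intros Hf Hg. apply (vanish_mul 1 n); [now apply vanish_1 | exact Hg]. Qed.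

Lemma spow_S f n : spow f (S n) = (f * spow f n)%ncs.
Proof. pos. Qed.

Lemma spow_Sr f n : spow f (S n) = (spow f n * f)%ncs.
Proof.
 induction n as [|n IH]; [now rewrite spow_S, smul_one_r, smul_one_l|].
 now rewrite spow_S, IH, smul_assoc, <- IH.
Qed.

Lemma vanish_pow f n : f nil = 0 -> vanish n (spow f n).
Proof.
 intros H; induction n as [|n IH]; [apply vanish_0|].
 rewrite spow_S; now apply vanish_mul_l.
Qed.

Lemma spow_scal c f n : spow (c *: f) n = (Cpow c n *: spow f n)%ncs.
Proof.
 induction n as [|n IH]; [simpl; now rewrite sscal_one|].
 now rewrite !spow_S, IH, smul_scal_l, smul_scal_r, sscal_sscal.
Qed.

Lemma smul_ssum_graded_l (f : nat -> ncs) g w N :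
 graded f -> (length w <= N)%nat ->
 (ssum f * g)%ncs w = sum_n (fun n => (f n * g)%ncs w) N.
Proof.
 intros Hf HN. unfold smul. rewrite csum_swap. apply csum_ext. intros k Hk.
 rewrite (ssum_graded _ _ N Hf).
 2: rewrite firstn_length; lia.
 rewrite Cmult_comm, <- csum_scal. apply csum_ext; intros; cring.
Qed.

Lemma smul_ssum_graded_r (f : nat -> ncs) g w N :
 graded f -> (length w <= N)%nat ->
 (g * ssum f)%ncs w = sum_n (fun n => (g * f n)%ncs w) N.
Proof.
 intros Hf HN. unfold smul. rewrite csum_swap. apply csum_ext. intros k Hk.
 rewrite (ssum_graded _ _ N Hf).
 2: rewrite skipn_length; lia.
 now rewrite <- csum_scal.
Qed.

Lemma ssum_zero (f : nat -> ncs) : (forall n, f n = szero) -> ssum f = szero.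
Proof.
 intros H; apply ncs_ext; intros w. rewrite (ssum_graded _ w (length w)); [|intros n v _; now rewrite H|lia].
 apply csum_zero; intros k _; now rewrite H.
Qed.

(** * Inverses *)

Lemma graded_pow f : f nil = 0 -> graded (spow f).
Proof. intros H n w Hw. now apply vanish_pow. Qed.

Lemma graded_scal (a : nat -> C) (f : nat -> ncs) : graded f -> graded (fun n => a n *: f n)%ncs.
Proof. intros H n w Hw. unfold sscal. rewrite H by pos. cring. Qed.

Lemma sinv_aux f : f nil = 1 -> (sone - f)%ncs nil = 0.
Proof. intros H. unfold sadd, sopp, sone. rewrite H. cring. Qed.

Lemma sinv_nil f : f nil = 1 -> sinv f nil = 1.
Proof.
 intros H. unfold sinv. rewrite (ssum_graded _ _ 0).
 - now rewrite csum_O.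
 - apply graded_pow. now apply sinv_aux.
 - pos.
Qed.

Lemma sinv_l f : f nil = 1 -> (sinv f * f = sone)%ncs.
Proof.
 intros H. set (h := (sone - f)%ncs).
 assert (Hh : h nil = 0) by now apply sinv_aux.
 apply ncs_ext; intros w. unfold sinv. fold h.
 rewrite (smul_ssum_graded_l _ _ _ (length w)); [|now apply graded_pow|lia].
 rewrite (csum_ext _ (fun n => spow h n w - spow h (S n) w)).
 2:{ intros k _. replace f with ((sone - h)%ncs) by (apply ncs_ext; intro; unfold h, sadd, sopp; cring). rewrite smul_add_r, smul_opp_r, smul_one_r, <- spow_Sr. pos. }
 (* The product of the geometric series with 1 - h telescopes, and the remaining power of h has too
    high an order to be seen on w. *)
 assert (T : forall N, sum_n (fun n => spow h n w - spow h (S n) w) N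
            = sone w - spow h (S N) w).
 { induction N as [|N IHN]; [rewrite csum_O; reflexivity|].
  rewrite csum_S, IHN. cring. }
 rewrite T. rewrite (vanish_pow h (S (length w)) Hh) by lia. cring.
Qed.

Lemma inv_unique f g h : (g * f = sone)%ncs -> (f * h = sone)%ncs -> g = h.
Proof.
 intros H1 H2. rewrite <- (smul_one_r g), <- H2, smul_assoc, H1. apply smul_one_l.
Qed.

Lemma sinv_r f : f nil = 1 -> (f * sinv f = sone)%ncs.
Proof.
 intros H. assert (H2 := sinv_l (sinv f) (sinv_nil f H)).
 assert (E := inv_unique _ _ _ H2 (sinv_l f H)). congruence.
Qed.

Lemma sinv_unique f g : f nil = 1 -> (f * g = sone)%ncs -> g = sinv f.
Proof. intros H H1. symmetry. apply (inv_unique f); [now apply sinv_l | exact H1]. Qed.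

Lemma sinv_mul f g : f nil = 1 -> g nil = 1 -> sinv (f * g) = (sinv g * sinv f)%ncs.
Proof.
 intros Hf Hg. symmetry. apply sinv_unique.
 - rewrite smul_nil, Hf, Hg; cring.
 - rewrite smul_assoc, <- (smul_assoc f g), (sinv_r g Hg), smul_one_r. now apply sinv_r.
Qed.

Lemma sinv_sinv f : f nil = 1 -> sinv (sinv f) = f.
Proof.
 symmetry. apply sinv_unique; [now apply sinv_nil | now apply sinv_l].
Qed.

(** * Substitution of series without constant term *)

Definition subst_part (f a b : ncs) (n : nat) : ncs :=
 fold_right (fun w g => (f w *: eval_word a b w + g)%ncs) szero (words n).

Lemma subst_part_S f a b n :
 subst_part f a b (S n) =
 (a * subst_part (shift false f) a b n + b * subst_part (shift true f) a b n)%ncs.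
Proof.
 unfold subst_part. simpl words. induction (words n) as [|v l IH]; simpl.
 - rewrite !smul_zero_r, sadd_zero_l. pos.
 - rewrite IH, !smul_add_r, !smul_scal_r. unfold shift. ncs_lin.
Qed.

Lemma graded_subst f a b : a nil = 0 -> b nil = 0 -> graded (subst_part f a b).
Proof.
 intros Ha Hb n. revert f. induction n as [|n IH]; intros f w Hw; [lia|].
 rewrite subst_part_S.
 apply (vanish_add (S n)); auto; apply vanish_mul_l; trivial; intros v Hv; apply IH; lia.
Qed.

Lemma subst_nil f a b : a nil = 0 -> b nil = 0 -> subst f a b nil = f nil.
Proof.
 intros Ha Hb. unfold subst. rewrite (ssum_graded _ _ 0); [|now apply graded_subst|simpl; lia].
 rewrite csum_O. simpl. unfold sadd, sscal, sone, szero. cring.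
Qed.

Lemma subst_rec f a b : a nil = 0 -> b nil = 0 ->
 subst f a b = (f nil *: sone + (a * subst (shift false f) a b
                 + b * subst (shift true f) a b))%ncs.
Proof.
 intros Ha Hb. apply ncs_ext; intros w.
 unfold subst. fold (subst_part f a b) (subst_part (shift false f) a b) (subst_part (shift true f) a b).
 rewrite (ssum_graded _ _ (S (length w))); [|now apply graded_subst|lia].
 rewrite csum_head. unfold sadd at 1 2.
 rewrite !(smul_ssum_graded_r _ _ w (length w)); try apply graded_subst; trivial; try lia.
 rewrite <- csum_plus. f_equal.
 - unfold subst_part; simpl. unfold sadd, szero; cring.
 - apply csum_ext; intros k Hk. rewrite subst_part_S. pos.
Qed.

(** Since a and b have no constant term, each turn of the recursion raises the order of X by one, so
    X vanishes to all orders. Together with [subst_rec] this proves the algebraic rules for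
    substitution without expanding words. *)
Lemma rec_unique (X : ncs -> ncs) a b : a nil = 0 -> b nil = 0 ->
 (forall f, X f = (a * X (shift false f) + b * X (shift true f))%ncs) ->
 forall f, X f = szero.
Proof.
 intros Ha Hb H f. apply vanish_all. intros n. revert f.
 induction n as [|n IH]; intros f; [apply vanish_0|].
 rewrite H. apply vanish_add; apply vanish_mul_l; trivial.
Qed.

Lemma rec_unique2 (X Y : ncs -> ncs) a b : a nil = 0 -> b nil = 0 ->
 (forall f, X f = (f nil *: sone + (a * X (shift false f) + b * X (shift true f)))%ncs) ->
 (forall f, Y f = (f nil *: sone + (a * Y (shift false f) + b * Y (shift true f)))%ncs) ->
 forall f, X f = Y f.
Proof.
 intros Ha Hb HX HY f. apply ssub_eq0.
 apply (rec_unique (fun f => X f - Y f)%ncs a b Ha Hb). intros g.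
 rewrite (HX g), (HY g) at 1. rewrite !smul_add_r, !smul_opp_r. ncs_lin.
Qed.

Lemma subst_add f g a b : a nil = 0 -> b nil = 0 ->
 subst (f + g) a b = (subst f a b + subst g a b)%ncs.
Proof.
 intros Ha Hb. apply ssub_eq0.
 (* Both series change along the recursion, so the induction runs over pairs. *)
 enough (forall p : ncs * ncs, subst (fst p + snd p) a b - (subst (fst p) a b + subst (snd p) a b) = szero)%ncs
  by exact (H (f, g)).
 intros p; apply vanish_all; intros n; revert p; induction n as [|n IH]; intros p; [apply vanish_0|].
 rewrite (subst_rec (_ + _)), (subst_rec (fst p)), (subst_rec (snd p)) by pos.
 assert (E := IH (shift false (fst p), shift false (snd p))).
 assert (E' := IH (shift true (fst p), shift true (snd p))). simpl in E, E'.
 assert (V := vanish_mul_l n a _ Ha E). assert (V' := vanish_mul_l n b _ Hb E').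
 intros w Hw. generalize (vanish_add _ _ _ V V' w Hw).
 change (shift false (fst p + snd p)) with (shift false (fst p) + shift false (snd p))%ncs.
 change (shift true (fst p + snd p)) with (shift true (fst p) + shift true (snd p))%ncs.
 rewrite !smul_add_r, !smul_opp_r, !smul_add_r.
 unfold sadd, sopp, sscal. intros <-. cring.
Qed.

Lemma subst_scal c f a b : a nil = 0 -> b nil = 0 ->
 subst (c *: f) a b = (c *: subst f a b)%ncs.
Proof.
 intros Ha Hb. apply ssub_eq0.
 apply (rec_unique (fun f => subst (c *: f) a b - c *: subst f a b)%ncs a b Ha Hb).
 clear f; intros f. rewrite (subst_rec (c *: f)), (subst_rec f) at 1 by pos.
 change (shift false (c *: f)) with (c *: shift false f)%ncs.
 change (shift true (c *: f)) with (c *: shift true f)%ncs.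
 rewrite !smul_add_r, !smul_opp_r, !smul_scal_r. ncs_lin.
Qed.

Lemma subst_opp f a b : a nil = 0 -> b nil = 0 ->
 subst (- f) a b = (- subst f a b)%ncs.
Proof. intros Ha Hb. now rewrite !sopp_scal, subst_scal. Qed.

Lemma subst_zero a b : a nil = 0 -> b nil = 0 -> subst szero a b = szero.
Proof.
 intros Ha Hb. rewrite <- (sscal_zero_l szero), subst_scal by pos. now rewrite !sscal_zero_l.
Qed.

Lemma subst_one a b : a nil = 0 -> b nil = 0 -> subst sone a b = sone.
Proof.
 intros Ha Hb. rewrite subst_rec, !shift_one, subst_zero, !smul_zero_r by pos.
 simpl. ncs_lin.
Qed.

Lemma subst_mul f g a b : a nil = 0 -> b nil = 0 ->
 subst (f * g) a b = (subst f a b * subst g a b)%ncs.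
Proof.
 intros Ha Hb. apply ssub_eq0.
 apply (rec_unique (fun f => subst (f * g) a b - subst f a b * subst g a b)%ncs a b Ha Hb).
 clear f; intros f.
 rewrite (subst_rec (f * g)), (subst_rec f) at 1 by pos.
 rewrite !shift_smul, !subst_add, !subst_scal by pos.
 rewrite smul_nil. rewrite !smul_add_l, !smul_scal_l, smul_one_l, (subst_rec g) at 1 by pos.
 rewrite !smul_add_r, !smul_opp_r, !smul_scal_r, !smul_assoc. ncs_lin.
Qed.

Lemma shift_letter l l' : shift l (letter l') = if eqb l l' then sone else szero.
Proof.
 apply ncs_ext; intros [|x w]; unfold letter; destruct l, l'; reflexivity.
Qed.

Lemma subst_letter l a b : a nil = 0 -> b nil = 0 ->
 subst (letter l) a b = if l then b else a.
Proof.
 intros Ha Hb. rewrite subst_rec, !shift_letter by pos.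
 destruct l; simpl; rewrite subst_zero, subst_one by pos;
 rewrite !smul_one_r, !smul_zero_r; ncs_lin.
Qed.

Lemma subst_bracket f g a b : a nil = 0 -> b nil = 0 ->
 subst (bracket f g) a b = bracket (subst f a b) (subst g a b).
Proof. intros Ha Hb. unfold bracket. now rewrite subst_add, subst_opp, !subst_mul. Qed.

Lemma subst_subst f a b a' b' : a nil = 0 -> b nil = 0 -> a' nil = 0 -> b' nil = 0 ->
 subst (subst f a b) a' b' = subst f (subst a a' b') (subst b a' b').
Proof.
 intros Ha Hb Ha' Hb'.
 assert (Ha2 : subst a a' b' nil = 0) by now rewrite subst_nil.
 assert (Hb2 : subst b a' b' nil = 0) by now rewrite subst_nil.
 apply (rec_unique2 (fun f => subst (subst f a b) a' b')
      (fun f => subst f (subst a a' b') (subst b a' b')) _ _ Ha2 Hb2); clear f; intros f.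
 - rewrite (subst_rec f) at 1 by pos.
  now rewrite !subst_add, subst_scal, subst_one, !subst_mul.
 - apply subst_rec; trivial.
Qed.

Lemma subst_sinv f a b : a nil = 0 -> b nil = 0 -> f nil = 1 ->
 subst (sinv f) a b = sinv (subst f a b).
Proof.
 intros Ha Hb Hf. apply sinv_unique; [now rewrite subst_nil|].
 now rewrite <- subst_mul, sinv_r, subst_one.
Qed.

Lemma subst_pow f n a b : a nil = 0 -> b nil = 0 ->
 subst (spow f n) a b = spow (subst f a b) n.
Proof.
 intros Ha Hb; induction n as [|n IH]; [now apply subst_one|].
 now rewrite !spow_S, subst_mul, IH.
Qed.

Lemma subst_local f g a b n : a nil = 0 -> b nil = 0 ->
 vanish n (f - g) -> vanish n (subst f a b - subst g a b).
Proof.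
 intros Ha Hb. revert f g.
 induction n as [|n IH]; intros f g H; [apply vanish_0|].
 assert (E := IH (shift false f) (shift false g)).
 assert (E' := IH (shift true f) (shift true g)).
 assert (V := vanish_mul_l n a _ Ha (E ltac:(intros w Hw; apply (H (false :: w)); simpl; lia))).
 assert (V' := vanish_mul_l n b _ Hb (E' ltac:(intros w Hw; apply (H (true :: w)); simpl; lia))).
 intros w Hw. generalize (vanish_add _ _ _ V V' w Hw).
 rewrite (subst_rec f), (subst_rec g) by pos.
 assert (H0 : f nil = g nil).
 { assert (Q := H nil ltac:(simpl; lia)). unfold sadd, sopp in Q.
  replace (f nil) with (f nil + - g nil + g nil) by ring. rewrite Q; cring. }
 rewrite H0, !smul_add_r, !smul_opp_r. unfold sadd, sopp. intros <-. cring.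
Qed.

Lemma subst_ssum (F : nat -> ncs) a b : a nil = 0 -> b nil = 0 -> graded F ->
 subst (ssum F) a b = ssum (fun n => subst (F n) a b).
Proof.
 intros Ha Hb HF. apply ncs_ext; intros w.
 assert (HG : graded (fun n => subst (F n) a b)).
 { intros n v Hv. assert (V : vanish n (F n - szero)).
  { intros u Hu. unfold sadd, sopp, szero. rewrite HF by pos. cring. }
  generalize (subst_local _ _ a b n Ha Hb V v Hv). rewrite subst_zero by pos.
  unfold sadd, sopp, szero. intros <-. cring. }
 rewrite (ssum_graded _ w (length w)) by pos.
 set (G := fix G N := match N with O => F O | S M => (G M + F (S M))%ncs end).
 assert (EG : forall N v, G N v = sum_n (fun n => F n v) N).
 { induction N as [|N IHN]; intros v; [now rewrite csum_O|]. rewrite csum_S, <- IHN. pos. }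
 assert (ES : forall N, subst (G N) a b w = sum_n (fun n => subst (F n) a b w) N).
 { induction N as [|N IHN]; [now rewrite csum_O|].
  rewrite csum_S, <- IHN. simpl G. rewrite subst_add by pos. pos. }
 rewrite <- ES.
 assert (V : vanish (S (length w)) (ssum F - G (length w))).
 { intros v Hv. unfold sadd, sopp. rewrite EG, (ssum_graded _ v (length w)) by (trivial; lia). cring. }
 generalize (subst_local _ _ a b _ Ha Hb V w ltac:(lia)). unfold sadd, sopp.
 intros E. replace (subst (ssum F) a b w) with
  (subst (ssum F) a b w + - subst (G (length w)) a b w + subst (G (length w)) a b w) by ring.
 rewrite E; cring.
Qed.

(** * Continuous operators and power series in them *)

(** Continuity for the topology of word length, in the strong form that T never lowers the order. It
    lets T pass through graded sums ([contin_ssum]) and gives bounds on truncations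
    ([contin_bounded]). *)
Record contin (T : ncs -> ncs) : Prop := {
 contin_add : forall f g, T (f + g)%ncs = (T f + T g)%ncs;
 contin_scal : forall c f, T (c *: f)%ncs = (c *: T f)%ncs;
 contin_vanish : forall n f, vanish n f -> vanish n (T f) }.

Definition raising (T : ncs -> ncs) : Prop :=
 contin T /\ forall n f, vanish n f -> vanish (S n) (T f).

Lemma contin_opp T f : contin T -> T (- f)%ncs = (- T f)%ncs.
Proof. intros H. now rewrite !sopp_scal, (contin_scal T H). Qed.

Lemma contin_zero T : contin T -> T szero = szero.
Proof.
 intros H. rewrite <- (sscal_zero_l szero), (contin_scal T H). now rewrite !sscal_zero_l.
Qed.

Definition nsum (F : nat -> ncs) (n : nat) : ncs := fun w => sum_n (fun k => F k w) n.

Lemma nsum_O F : nsum F 0 = F O.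
Proof. apply ncs_ext; intros w; apply csum_O. Qed.

Lemma nsum_S F n : nsum F (S n) = (nsum F n + F (S n))%ncs.
Proof. apply ncs_ext; intros w; apply csum_S. Qed.

Lemma contin_nsum T F n : contin T -> T (nsum F n) = nsum (fun k => T (F k)) n.
Proof.
 intros H; induction n as [|n IH]; [now rewrite !nsum_O|].
 now rewrite !nsum_S, (contin_add T H), IH.
Qed.

Lemma ssum_nsum (F : nat -> ncs) n : graded F -> vanish (S n) (ssum F - nsum F n).
Proof.
 intros HF w Hw. unfold sadd, sopp, nsum. rewrite (ssum_graded _ w n) by (trivial; lia). cring.
Qed.

Lemma vanish_sub n f g w : vanish n (f - g) -> (length w < n)%nat -> f w = g w.
Proof.
 intros H Hw. assert (E := H w Hw). unfold sadd, sopp in E.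
 replace (f w) with (f w + - g w + g w) by ring. rewrite E; cring.
Qed.

Lemma contin_graded T F : contin T -> graded F -> graded (fun n => T (F n)).
Proof. intros HT HF n. apply (contin_vanish T HT). intros w; apply HF. Qed.

Lemma contin_ssum T F : contin T -> graded F -> T (ssum F) = ssum (fun n => T (F n)).
Proof.
 intros HT HF. apply ncs_ext; intros w.
 rewrite (ssum_graded (fun n => T (F n)) w (length w)); [|now apply contin_graded|lia].
 assert (V := contin_vanish T HT _ _ (ssum_nsum F (length w) HF)).
 rewrite (contin_add T HT), (contin_opp T _ HT), contin_nsum in V by pos.
 apply (vanish_sub _ _ _ w V). lia.
Qed.

Lemma contin_smul_l f : contin (smul f).
Proof.
 split; [intros; apply smul_add_r| intros; apply smul_scal_r|].
 - intros n g Hg. apply (vanish_mul 0 n); easy.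
Qed.

Lemma contin_smul_r f : contin (fun g => g * f)%ncs.
Proof.
 split; [intros; apply smul_add_l| intros; apply smul_scal_l|].
 intros n g Hg. rewrite <- (Nat.add_0_r n).
 apply (vanish_mul n 0); easy.
Qed.

Lemma raising_smul f : f nil = 0 -> raising (smul f).
Proof. split; [apply contin_smul_l | intros; now apply vanish_mul_l]. Qed.

Lemma vanish_mul_r n f g : f nil = 0 -> vanish n g -> vanish (S n) (g * f).
Proof.
 intros Hf Hg. replace (S n) with (n + 1)%nat by lia.
 apply (vanish_mul n 1); [exact Hg | now apply vanish_1].
Qed.

Lemma raising_bracket f : f nil = 0 -> raising (bracket f).
Proof.
 split; [split|]; unfold bracket.
 - intros g h. rewrite smul_add_r, smul_add_l. ncs_lin.
 - intros c g. rewrite smul_scal_r, smul_scal_l. ncs_lin.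
 - intros n g Hg. apply (vanish_mono (S n)); auto.
  apply vanish_add; [|apply vanish_opp]; [now apply vanish_mul_l | now apply vanish_mul_r].
 - intros n g Hg. apply vanish_add; [|apply vanish_opp]; [now apply vanish_mul_l | now apply vanish_mul_r].
Qed.

Lemma contin_subst a b : a nil = 0 -> b nil = 0 -> contin (fun f => subst f a b).
Proof.
 intros Ha Hb. split; intros; [now apply subst_add | now apply subst_scal|].
 assert (V := subst_local f szero a b n Ha Hb).
 rewrite subst_zero in V by pos. intros w Hw.
 rewrite (vanish_sub n (subst f a b) szero w); auto.
 apply V. intros v Hv. unfold sadd, sopp, szero. rewrite H by pos. cring.
Qed.

Definition convol (a b : nat -> C) (n : nat) : C := sum_n (fun i => a i * b (n - i)%nat) n.

Lemma csum_triangle (G : nat -> nat -> C) N :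
 sum_n (fun k => sum_n (fun i => G i (k - i)%nat) k) N =
 sum_n (fun i => sum_n (fun j => G i j) (N - i)) N :> C.
Proof.
 induction N as [|N IH]; auto.
 rewrite csum_S, IH, (csum_S (fun i => sum_n _ (S N - i))).
 rewrite (csum_ext (fun i => sum_n (fun j => G i j) (S N - i))
      (fun i => sum_n (fun j => G i j) (N - i) + G i (S N - i)%nat)).
 2:{ intros k Hk. replace (S N - k)%nat with (S (N - k)) by lia. apply csum_S. }
 rewrite csum_plus, (csum_S (fun i => G i (S N - i)%nat)), Nat.sub_diag, csum_O. cring.
Qed.

Lemma csum_convol (G : nat -> nat -> C) N :
 (forall i j, (N < i + j)%nat -> G i j = (0 : C)) ->
 sum_n (fun i => sum_n (fun j => G i j) N) N =
 sum_n (fun k => sum_n (fun i => G i (k - i)%nat) k) N :> C.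
Proof.
 intros H. rewrite csum_triangle. apply csum_ext; intros i Hi.
 apply csum_extend; [lia|]. intros j Hj. apply H. lia.
Qed.

(** The functional calculus a(T). With T = ad x acting on y it gives [fun_ad], with T = left
    multiplication by f acting on 1 it gives the exponential of f. By [opser_comp], identities
    between such operators reduce to identities between sequences of Taylor coefficients. *)
Definition opser (a : nat -> C) (T : ncs -> ncs) (g : ncs) : ncs :=
 ssum (fun n => a n *: Nat.iter n T g)%ncs.

Lemma contin_iter T n : contin T -> contin (Nat.iter n T).
Proof.
 intros H; induction n as [|n IH]; [now split|].
 split; intros; simpl.
 - now rewrite (contin_add _ IH), (contin_add _ H).
 - now rewrite (contin_scal _ IH), (contin_scal _ H).
 - now apply (contin_vanish _ H), (contin_vanish _ IH).
Qed.

Lemma raising_iter T n g : raising T -> vanish n (Nat.iter n T g).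
Proof.
 intros H; induction n as [|n IH]; [apply vanish_0|]. now apply (proj2 H).
Qed.

Lemma graded_iter T g : raising T -> graded (fun n => Nat.iter n T g).
Proof. intros H n. now apply raising_iter. Qed.

Lemma graded_opser (a : nat -> C) T g : raising T -> graded (fun n => a n *: Nat.iter n T g)%ncs.
Proof. intros H. now apply graded_scal, graded_iter. Qed.

Lemma opser_val (a : nat -> C) T g w N : raising T -> (length w <= N)%nat ->
 opser a T g w = sum_n (fun n => a n * Nat.iter n T g w) N :> C.
Proof. intros H HN. unfold opser. now rewrite (ssum_graded _ _ N) by (trivial; now apply graded_opser). Qed.

Lemma contin_opser (a : nat -> C) T : raising T -> contin (opser a T).
Proof.
 intros H. assert (HI := fun n => contin_iter T n (proj1 H)). split.
 - intros f g; apply ncs_ext; intros w. unfold sadd at 2.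
  rewrite !(opser_val _ _ _ w (length w)) by pos.
  rewrite <- csum_plus. apply csum_ext; intros k _. rewrite (contin_add _ (HI k)).
  unfold sadd; cring.
 - intros c f; apply ncs_ext; intros w. unfold sscal at 2.
  rewrite !(opser_val _ _ _ w (length w)) by pos.
  rewrite <- csum_scal. apply csum_ext; intros k _. rewrite (contin_scal _ (HI k)).
  unfold sscal; cring.
 - intros n f Hf w Hw. rewrite (opser_val _ _ _ w (length w)) by pos.
  apply csum_zero; intros k _. rewrite (contin_vanish _ (HI k) n f Hf w Hw). cring.
Qed.

Lemma opser_comp (a b : nat -> C) T g : raising T ->
 opser a T (opser b T g) = opser (convol a b) T g.
Proof.
 intros H. apply ncs_ext; intros w.
 rewrite !(opser_val _ _ _ w (length w)) by pos.
 set (N := length w).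
 rewrite (csum_ext _ (fun i => sum_n (fun j => a i * b j * Nat.iter (i + j) T g w) N)).
 - rewrite csum_convol.
  + apply csum_ext; intros k Hk. unfold convol. rewrite Cmult_comm, <- csum_scal.
   apply csum_ext; intros i Hi. replace (i + (k - i))%nat with k by lia. cring.
  + intros i j Hij. rewrite (raising_iter T (i + j) g H) by pos. cring.
 - intros i Hi. unfold opser at 1.
  rewrite (contin_ssum (Nat.iter i T)); [|apply contin_iter, H|now apply graded_opser].
  rewrite (ssum_graded _ w N); auto.
  + rewrite <- csum_scal. apply csum_ext; intros j Hj.
   rewrite (contin_scal _ (contin_iter T i (proj1 H))), Nat.iter_add. unfold sscal; cring.
  + apply contin_graded; [apply contin_iter, H|now apply graded_opser].
Qed.

Lemma opser_ext (a b : nat -> C) T g : (forall n, a n = b n) -> opser a T g = opser b T g.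
Proof. intros H. replace b with a; [reflexivity | now apply functional_extensionality]. Qed.

Lemma opser_scal (a : nat -> C) c T g : raising T ->
 opser (fun n => c * a n) T g = (c *: opser a T g)%ncs.
Proof.
 intros H. apply ncs_ext; intros w. unfold sscal.
 rewrite !(opser_val _ _ _ w (length w)) by pos.
 rewrite <- csum_scal. apply csum_ext; intros; cring.
Qed.

Lemma opser_plus (a b : nat -> C) T g : raising T ->
 opser (fun n => a n + b n) T g = (opser a T g + opser b T g)%ncs.
Proof.
 intros H. apply ncs_ext; intros w. unfold sadd.
 rewrite !(opser_val _ _ _ w (length w)) by pos.
 rewrite <- csum_plus. apply csum_ext; intros; cring.
Qed.

(** Taylor coefficients of the monomial c s^k. *)
Definition cseq (c : C) (k n : nat) : C := if Nat.eqb n k then c else 0.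

Lemma opser_cseq c k T g : raising T -> opser (cseq c k) T g = (c *: Nat.iter k T g)%ncs.
Proof.
 intros H. apply ncs_ext; intros w.
 rewrite (opser_val _ _ _ w (length w + k)) by (trivial; lia).
 rewrite (csum_one _ _ k); unfold cseq.
 - rewrite Nat.eqb_refl. pos.
 - lia.
 - intros j _ Hj. apply Nat.eqb_neq in Hj. rewrite Hj. cring.
Qed.

(** * Exponentials *)

(** Taylor coefficients of s -> exp(c s). *)
Definition eseq (c : C) (n : nat) : C := RtoC (/ INR (fact n)) * Cpow c n.

Lemma eseq_O c : eseq c 0 = 1.
Proof. unfold eseq; simpl. rewrite Rinv_1. cring. Qed.

Lemma eseq_S c n : (INR (S n)) * eseq c (S n) = c * eseq c n.
Proof.
 unfold eseq. change (Cpow c (S n)) with (c * Cpow c n).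
 replace (RtoC (/ INR (fact n))) with ((INR (S n)) * RtoC (/ INR (fact (S n)))); [cring|].
 rewrite <- RtoC_mult. f_equal. rewrite fact_simpl, mult_INR. field.
 split; [apply INR_fact_neq_0 | apply not_0_INR; lia].
Qed.

Lemma INR_S_neq_0 n : RtoC (INR (S n)) <> 0.
Proof. intros H. apply RtoC_inj in H. revert H. apply not_0_INR; lia. Qed.

Lemma Cmult_cancel (c x y : C) : c <> 0 -> c * x = c * y -> x = y.
Proof.
 intros Hc E. replace x with (/ c * (c * x)) by now field.
 rewrite E. now field.
Qed.

(** The weight n + 1 = i + (n + 1 - i) acts as a derivation on convolutions. It replaces binomial
    coefficients: exponential sequences are handled through their recurrence (n + 1) a_(n+1) = c a_n
    alone. *)
Lemma csum_weight (G : nat -> nat -> C) n :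
 (INR (S n)) * sum_n (fun i => G i (S n - i)%nat) (S n) =
 sum_n (fun i => (INR (S i)) * G (S i) (n - i)%nat) n +
 sum_n (fun i => (INR (S (n - i))) * G i (S (n - i))) n.
Proof.
 rewrite <- csum_scal.
 rewrite (csum_ext _ (fun i => (INR i) * G i (S n - i)%nat
                + (INR (S n - i)) * G i (S n - i)%nat)).
 2:{ intros k Hk. rewrite <- Cmult_plus_distr_r, <- RtoC_plus, <- plus_INR.
   do 4 f_equal. lia. }
 rewrite csum_plus. f_equal.
 - rewrite csum_head. simpl; ring.
 - rewrite csum_S, Nat.sub_diag. rewrite Cmult_0_l, Cplus_0_r.
  apply csum_ext; intros k Hk. replace (S n - k)%nat with (S (n - k)) by lia. pos.
Qed.

Lemma eseq_convol c d n : convol (eseq c) (eseq d) n = eseq (c + d) n.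
Proof.
 induction n as [|n IH].
 - unfold convol. rewrite csum_O, !eseq_O. cring.
 - apply (Cmult_cancel ((INR (S n)))); [apply INR_S_neq_0|].
  rewrite eseq_S, <- IH.
  rewrite (csum_weight (fun i j => eseq c i * eseq d j)).
  unfold convol. rewrite Cmult_plus_distr_r, <- !csum_scal. f_equal; apply csum_ext; intros k Hk.
  + rewrite Cmult_assoc, eseq_S. cring.
  + rewrite Cmult_assoc, (Cmult_comm _ (eseq c k)), <- Cmult_assoc, eseq_S. cring.
Qed.

Lemma sexp_opser c f : sexp (c *: f) = opser (eseq c) (smul f) sone.
Proof.
 unfold sexp, opser. f_equal. apply functional_extensionality; intros n.
 rewrite spow_scal. now rewrite sscal_sscal.
Qed.

Lemma sexp_opser1 f : sexp f = opser (eseq 1) (smul f) sone.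
Proof. rewrite <- sexp_opser. now rewrite sscal_one. Qed.

Lemma opser_smul (a : nat -> C) f g : f nil = 0 ->
 opser a (smul f) g = (opser a (smul f) sone * g)%ncs.
Proof.
 intros Hf. assert (HR := raising_smul f Hf). unfold opser at 2.
 rewrite (contin_ssum (fun h => h * g)%ncs); [|apply contin_smul_r|now apply graded_opser].
 unfold opser. f_equal. apply functional_extensionality; intros n.
 rewrite smul_scal_l. f_equal.
 induction n as [|n IH]; simpl; [now rewrite smul_one_l|].
 now rewrite IH, smul_assoc.
Qed.

Lemma opser_nil (a : nat -> C) T g : raising T -> opser a T g nil = a O * g nil.
Proof. intros H. rewrite (opser_val _ _ _ nil 0) by pos. now rewrite csum_O. Qed.

Lemma sexp_nil f : f nil = 0 -> sexp f nil = 1.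
Proof.
 intros Hf. rewrite sexp_opser1, opser_nil, eseq_O by now apply raising_smul. simpl; ring.
Qed.

Lemma sexp_add c d f : f nil = 0 ->
 (sexp (c *: f) * sexp (d *: f) = sexp ((c + d) *: f))%ncs.
Proof.
 intros Hf. rewrite !sexp_opser, <- opser_smul, opser_comp by (trivial; now apply raising_smul).
 apply opser_ext. apply eseq_convol.
Qed.

Lemma sexp_zero : sexp szero = sone.
Proof.
 unfold sexp. apply ncs_ext; intros w.
 rewrite (ssum_graded _ w (length w)); [|apply graded_scal, graded_pow; reflexivity|lia].
 rewrite (csum_one _ _ 0); [|lia|].
 - unfold sscal; simpl. rewrite Rinv_1. cring.
 - intros [|k] _ Hk; [congruence|]. unfold sscal. rewrite spow_S, smul_zero_l. unfold szero; cring.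
Qed.

Lemma sexp_inv c f : f nil = 0 -> sinv (sexp (c *: f)) = sexp ((- c) *: f).
Proof.
 intros Hf. symmetry. apply sinv_unique.
 - apply sexp_nil. unfold sscal. rewrite Hf; cring.
 - rewrite sexp_add by pos. replace (c + - c) with (RtoC 0) by ring.
  rewrite sscal_zero_l. apply sexp_zero.
Qed.

Lemma sexp_intertwine f g h : f nil = 0 -> g nil = 0 ->
 (h * f = g * h)%ncs -> (h * sexp f = sexp g * h)%ncs.
Proof.
 intros Hf Hg E. unfold sexp.
 assert (Gf : graded (fun n => RtoC (/ INR (fact n)) *: spow f n)%ncs) by now apply graded_scal, graded_pow.
 assert (Gg : graded (fun n => RtoC (/ INR (fact n)) *: spow g n)%ncs) by now apply graded_scal, graded_pow.
 rewrite (contin_ssum (smul h)); [|apply contin_smul_l|exact Gf].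
 rewrite (contin_ssum (fun g => g * h)%ncs); [|apply contin_smul_r|exact Gg].
 f_equal. apply functional_extensionality; intros n. rewrite smul_scal_l, smul_scal_r. f_equal.
 induction n as [|n IH]; [simpl; now rewrite smul_one_l, smul_one_r|].
 now rewrite !spow_S, smul_assoc, E, <- smul_assoc, IH, smul_assoc.
Qed.

Lemma subst_sexp f a b : a nil = 0 -> b nil = 0 -> f nil = 0 ->
 subst (sexp f) a b = sexp (subst f a b).
Proof.
 intros Ha Hb Hf. unfold sexp.
 rewrite (contin_ssum (fun f => subst f a b)); [|now apply contin_subst|now apply graded_scal, graded_pow].
 f_equal. apply functional_extensionality; intros n. rewrite subst_scal, subst_pow by pos. pos.
Qed.

(** The terms u_k of degree k in c satisfy (k + 1) u_(k+1) = c f u_k on both sides: on the right,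
    the factor ad f produced by the first series and the factor f produced by the second add up to
    left multiplication by f. *)
Lemma sexp_ad c f g : f nil = 0 ->
 (sexp (c *: f) * g = opser (eseq c) (bracket f) g * sexp (c *: f))%ncs.
Proof.
 intros Hf. assert (Rl := raising_smul f Hf). assert (Rb := raising_bracket f Hf).
 rewrite !sexp_opser, <- opser_smul by pos.
 apply ncs_ext; intros w. set (N := length w).
 rewrite (opser_val _ _ _ w N) by pos.
 unfold opser at 1. rewrite (smul_ssum_graded_l _ _ w N); [|now apply graded_opser|unfold N; lia].
 set (A := fun i : nat => (eseq c i *: Nat.iter i (bracket f) g)%ncs).
 set (B := fun j : nat => (eseq c j *: Nat.iter j (smul f) sone)%ncs).
 assert (VA : forall n, vanish n (A n)) by (intros n; apply vanish_scal; now apply raising_iter).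
 assert (VB : forall n, vanish n (B n)) by (intros n; apply vanish_scal; now apply raising_iter).
 rewrite (csum_ext (fun n => (A n * ssum B)%ncs w) (fun i => sum_n (fun j => (A i * B j)%ncs w) N)).
 2:{ intros k _. apply smul_ssum_graded_r; auto. }
 rewrite csum_convol.
 2:{ intros i j Hij. apply (vanish_mul i j); auto. }
 apply csum_ext; intros k _. revert w N.
 enough (H : (eseq c k *: Nat.iter k (smul f) g)%ncs = nsum (fun i => A i * B (k - i)%nat)%ncs k).
 { intros w N. apply (f_equal (fun h : ncs => h w) H). }
 assert (SA : forall i, ((INR (S i)) *: A (S i) = c *: (f * A i - A i * f))%ncs).
 { intros i. unfold A. rewrite sscal_sscal, eseq_S, smul_scal_l, smul_scal_r.
  simpl Nat.iter. unfold bracket at 1. ncs_lin. }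
 assert (SB : forall i, ((INR (S i)) *: B (S i) = c *: (f * B i))%ncs).
 { intros i. unfold B. rewrite sscal_sscal, eseq_S, smul_scal_r. simpl Nat.iter. ncs_lin. }
 induction k as [|k IH].
 - rewrite nsum_O. unfold A, B. simpl. rewrite eseq_O, !sscal_one. now rewrite smul_one_r.
 - assert (E : ((INR (S k)) *: (eseq c (S k) *: Nat.iter (S k) (smul f) g) =
        (INR (S k)) *: nsum (fun i => A i * B (S k - i)%nat) (S k))%ncs).
  { rewrite sscal_sscal, eseq_S. simpl Nat.iter.
   replace ((c * eseq c k) *: (f * Nat.iter k (smul f) g))%ncs with
    (c *: (f * (eseq c k *: Nat.iter k (smul f) g)))%ncs by (rewrite smul_scal_r; ncs_lin).
   rewrite IH, (contin_nsum _ _ _ (contin_smul_l f)).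
   apply ncs_ext; intros w. unfold sscal at 1 2. unfold nsum.
   rewrite (csum_weight (fun i j => (A i * B j)%ncs w)), <- csum_scal, <- csum_plus.
   apply csum_ext; intros i Hi.
   transitivity ((((INR (S i)) *: A (S i)) * B (k - i)%nat +
           A i * ((INR (S (k - i))) *: B (S (k - i))))%ncs w).
   2: rewrite smul_scal_l, smul_scal_r; reflexivity.
   rewrite SA, SB, smul_scal_l, smul_scal_r, smul_add_l, smul_opp_l, !smul_assoc.
   unfold sadd, sopp, sscal; cring. }
  apply ncs_ext; intros w. apply (Cmult_cancel ((INR (S k)))); [apply INR_S_neq_0|].
  exact (f_equal (fun h : ncs => h w) E).
Qed.

(** * Derivations *)

Lemma der_nil p q f : der p q f nil = (p * shift false f + q * shift true f)%ncs nil.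
Proof.
 unfold der, sadd. rewrite !smul_nil. rewrite !csum_O. simpl. unfold shift. cring.
Qed.

(** Either the replaced letter stands in front, which yields products of its image with residuals of
    f, or l is kept and the replacement happens further on. *)
Lemma der_cons p q f l w :
 der p q f (l :: w) = (p * shift false f + q * shift true f)%ncs (l :: w) + der p q (shift l f) w.
Proof.
 unfold der at 1. simpl length. rewrite csum_head. f_equal.
 unfold sadd, smul. rewrite <- csum_plus.
 apply csum_ext; intros k Hk. f_equal; apply Cmult_comm.
Qed.

Lemma contin_der p q : p nil = 0 -> q nil = 0 -> contin (der p q).
Proof.
 assert (Sa : forall l f g, shift l (f + g) = (shift l f + shift l g)%ncs) by pos.
 assert (Sc : forall l c f, shift l (c *: f) = (c *: shift l f)%ncs) by pos.
 split.
 - intros f g; apply ncs_ext; intros w; revert f g; induction w as [|l w IH]; intros f g;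
  unfold sadd at 2; [rewrite !der_nil | rewrite !der_cons, !Sa, IH];
  rewrite ?Sa, !smul_add_r; unfold sadd; cring.
 - intros c f; apply ncs_ext; intros w; revert f; induction w as [|l w IH]; intros f;
  unfold sscal at 2; [rewrite !der_nil | rewrite !der_cons, !Sc, IH];
  rewrite ?Sc, !smul_scal_r; unfold sadd, sscal; cring.
 - intros n f Hf w; revert n f Hf.
  assert (HE : forall n f, vanish n f -> vanish n (p * shift false f + q * shift true f)).
  { intros [|n] f Hf; [apply vanish_0|].
   apply vanish_add; apply vanish_mul_l; trivial; intros v Hv; apply Hf; simpl; lia. }
  induction w as [|l w IH]; intros n f Hf Hw.
  + rewrite der_nil. now apply (HE n).
  + rewrite der_cons, (HE n f Hf (l :: w) Hw). simpl in Hw.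
   rewrite (IH (n - 1)%nat); [cring| |lia]. intros v Hv; apply Hf; simpl; lia.
Qed.

Lemma der_smul p q f g : p nil = 0 -> q nil = 0 ->
 der p q (f * g) = (der p q f * g + f * der p q g)%ncs.
Proof.
 intros Hp Hq. assert (HD := contin_der p q Hp Hq).
 set (E := fun f => (p * shift false f + q * shift true f)%ncs).
 (* The front part E is not a derivation: in place of f times E g it only has the constant term of
    f; the later positions supply the rest along the induction. *)
 assert (EM : forall f g, E (f * g)%ncs = (f nil *: E g + E f * g)%ncs).
 { clear f g; intros f g. unfold E. rewrite !shift_smul, !smul_add_r, !smul_add_l, !smul_scal_r, !smul_assoc.
  ncs_lin. }
 apply ncs_ext; intros w; revert f; induction w as [|l w IH]; intros f.
 - unfold sadd at 1. rewrite !smul_nil, !der_nil. fold (E (f * g)%ncs) (E f) (E g).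
  rewrite EM. unfold sadd, sscal. rewrite smul_nil. cring.
 - unfold sadd at 1. rewrite der_cons. fold (E (f * g)%ncs). rewrite EM.
  rewrite (smul_cons f (der p q g)), (smul_cons (der p q f) g), der_cons, der_nil. fold (E f) (E g).
  rewrite shift_smul, (contin_add _ HD), (contin_scal _ HD).
  assert (SD : shift l (der p q f) = (shift l (E f) + der p q (shift l f))%ncs).
  { apply ncs_ext; intros v. unfold shift at 1. now rewrite der_cons. }
  rewrite SD, smul_add_l. unfold sadd. rewrite IH. unfold sadd, sscal. rewrite (smul_cons (E f)).
  cring.
Qed.

Lemma der_one p q : p nil = 0 -> q nil = 0 -> der p q sone = szero.
Proof.
 intros Hp Hq. assert (H := der_smul p q sone sone Hp Hq).
 rewrite smul_one_l, smul_one_l, smul_one_r in H.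
 apply ncs_ext; intros w. assert (Hw := f_equal (fun h : ncs => h w) H). unfold sadd in Hw.
 unfold szero. set (z := der p q sone w) in *.
 replace z with (z + z - z) by ring. rewrite <- Hw. cring.
Qed.

Lemma der_letter p q l : p nil = 0 -> q nil = 0 -> der p q (letter l) = if l then q else p.
Proof.
 intros Hp Hq.
 assert (E : (p * shift false (letter l) + q * shift true (letter l))%ncs = if l then q else p).
 { rewrite !shift_letter. destruct l; simpl; rewrite smul_zero_r, smul_one_r; ncs_lin. }
 apply ncs_ext; intros [|l' w]; [now rewrite der_nil, E|].
 rewrite der_cons, E, shift_letter.
 replace (der p q (if eqb l' l then sone else szero) w) with (RtoC 0); [cring|].
 destruct (eqb l' l); [now rewrite der_one|].
 now rewrite (contin_zero _ (contin_der p q Hp Hq)).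
Qed.

Lemma der_bracket p q f g : p nil = 0 -> q nil = 0 ->
 der p q (bracket f g) = (bracket (der p q f) g + bracket f (der p q g))%ncs.
Proof.
 intros Hp Hq. assert (HD := contin_der p q Hp Hq). unfold bracket.
 rewrite (contin_add _ HD), (contin_opp _ _ HD), !der_smul by pos. ncs_lin.
Qed.

Lemma der_subst p q f a b : p nil = 0 -> q nil = 0 -> a nil = 0 -> b nil = 0 ->
 der p q a = szero -> der p q b = szero -> der p q (subst f a b) = szero.
Proof.
 intros Hp Hq Ha Hb Da Db. assert (HD := contin_der p q Hp Hq).
 apply (rec_unique (fun f => der p q (subst f a b)) a b Ha Hb). clear f; intros f.
 rewrite subst_rec at 1 by pos.
 rewrite !(contin_add _ HD), (contin_scal _ HD), der_one, !der_smul, Da, Db, !smul_zero_l by pos.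
 ncs_lin.
Qed.

Lemma der_sinv p q f : p nil = 0 -> q nil = 0 -> f nil = 1 ->
 der p q f = szero -> der p q (sinv f) = szero.
Proof.
 intros Hp Hq Hf Df.
 assert (H := f_equal (der p q) (sinv_l f Hf)).
 rewrite der_smul, Df, smul_zero_r, sadd_zero_r, der_one in H by pos.
 apply (f_equal (fun h => h * sinv f)%ncs) in H.
 now rewrite <- smul_assoc, sinv_r, smul_one_r, smul_zero_l in H.
Qed.

Lemma der_sexp p q f : p nil = 0 -> q nil = 0 -> f nil = 0 ->
 der p q f = szero -> der p q (sexp f) = szero.
Proof.
 intros Hp Hq Hf Df. assert (HD := contin_der p q Hp Hq). unfold sexp.
 rewrite (contin_ssum _ _ HD) by now apply graded_scal, graded_pow.
 apply ssum_zero. intros n. rewrite (contin_scal _ HD).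
 enough (E : der p q (spow f n) = szero) by (rewrite E; apply sscal_zero_r).
 induction n as [|n IH]; [now apply der_one|].
 rewrite spow_S, der_smul, Df, IH, smul_zero_l, smul_zero_r by pos. apply sadd_zero_l.
Qed.

Lemma der_scal_coef p q c f : der (c *: p) (c *: q) f = (c *: der p q f)%ncs.
Proof.
 apply ncs_ext; intros w; revert f; induction w as [|l w IH]; intros f; unfold sscal at 3.
 - rewrite !der_nil, !smul_scal_l. unfold sadd, sscal; cring.
 - rewrite !der_cons, IH, !smul_scal_l. unfold sadd, sscal; cring.
Qed.

Lemma der_add_coef p q p' q' f :
 der (p + p') (q + q') f = (der p q f + der p' q' f)%ncs.
Proof.
 apply ncs_ext; intros w; revert f; induction w as [|l w IH]; intros f; unfold sadd at 3.
 - rewrite !der_nil, !smul_add_l. unfold sadd; cring.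
 - rewrite !der_cons, IH, !smul_add_l. unfold sadd; cring.
Qed.

Lemma der_ssum_coef (P Q : nat -> ncs) f : graded P -> graded Q ->
 (forall n, P n nil = 0) -> (forall n, Q n nil = 0) ->
 der (ssum P) (ssum Q) f = ssum (fun n => der (P n) (Q n) f).
Proof.
 intros HP HQ P0 Q0.
 assert (VE : forall n m f, vanish n (P m) -> vanish n (Q m) -> vanish n (der (P m) (Q m) f)).
 { intros n m f0 Vp Vq w. revert n f0 Vp Vq. induction w as [|l w IH]; intros n f0 Vp Vq Hw.
  - rewrite der_nil. assert (V := vanish_add _ _ _
     (contin_vanish _ (contin_smul_r (shift false f0)) _ _ Vp)
     (contin_vanish _ (contin_smul_r (shift true f0)) _ _ Vq)). pos.
  - rewrite der_cons.
   rewrite ((vanish_add _ _ _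
     (contin_vanish _ (contin_smul_r (shift false f0)) _ _ Vp)
     (contin_vanish _ (contin_smul_r (shift true f0)) _ _ Vq)) (l :: w) Hw).
   rewrite (IH (n - 1)%nat); [cring| | |simpl in Hw; lia];
   apply (vanish_mono n); trivial; lia. }
 apply ncs_ext; intros w. rewrite (ssum_graded _ w (length w)); auto.
 2:{ intros n v Hv. apply (VE n); trivial; intros u; auto. }
 assert (HN : (length w <= length w)%nat) by lia. revert HN. generalize (length w) at 2 3 as N.
 revert f; induction w as [|l w IH]; intros f N HN.
 - rewrite der_nil. unfold sadd. rewrite !(smul_ssum_graded_l _ _ nil N) by pos.
  rewrite <- csum_plus. apply csum_ext; intros k _. now rewrite der_nil.
 - rewrite der_cons. unfold sadd. rewrite !(smul_ssum_graded_l _ _ (l :: w) N) by pos.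
  simpl in HN. rewrite (IH _ N) by lia.
  rewrite <- !csum_plus. apply csum_ext; intros k _. now rewrite der_cons.
Qed.

(** * Series without pure powers of x *)

(** The centraliser of x in C<<x,y>> consists of the power series in x. Excluding pure powers of x
    therefore turns commutation with x into vanishing ([commute_sx]), which is how values of the
    derivation are identified below. *)
Definition purex (f : ncs) : Prop := forall k, f (repeat false k) = 0.

Lemma purex_add f g : purex f -> purex g -> purex (f + g).
Proof. intros Hf Hg k. unfold sadd. rewrite Hf, Hg. cring. Qed.

Lemma purex_scal c f : purex f -> purex (c *: f).
Proof. intros Hf k. unfold sscal. rewrite Hf. cring. Qed.

Lemma purex_opp f : purex f -> purex (- f).
Proof. rewrite sopp_scal. apply purex_scal. Qed.

Lemma purex_mul_l f g : purex f -> purex (f * g).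
Proof.
 intros Hf k; revert f Hf; induction k as [|k IH]; intros f Hf; simpl.
 - rewrite smul_nil, (Hf O : f nil = 0). cring.
 - rewrite smul_cons, (Hf O : f nil = 0), IH; [cring|]. intros j. exact (Hf (S j)).
Qed.

Lemma purex_mul_r f g : purex g -> purex (f * g).
Proof.
 intros Hg k; revert f; induction k as [|k IH]; intros f; simpl.
 - rewrite smul_nil, (Hg O : g nil = 0). cring.
 - rewrite smul_cons, IH, (Hg (S k) : g (false :: repeat false k) = 0). cring.
Qed.

Lemma purex_ssum (F : nat -> ncs) : (forall n, purex (F n)) -> purex (ssum F).
Proof.
 intros H k. unfold ssum. rewrite (CSeries_finite _ 0); [rewrite csum_O; apply H|]. congruence.
Qed.

Lemma purex_bracket f g : purex g -> purex (bracket f g).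
Proof. intros Hg. apply purex_add; [now apply purex_mul_r | apply purex_opp; now apply purex_mul_l]. Qed.

Lemma purex_der p q f : purex p -> purex q -> purex (der p q f).
Proof.
 intros Hp Hq k.
 assert (HE : forall f, purex (p * shift false f + q * shift true f)).
 { intros g. apply purex_add; now apply purex_mul_l. }
 revert f; induction k as [|k IH]; intros f.
 - rewrite der_nil. apply (HE f O).
 - simpl. rewrite der_cons, IH. change (false :: repeat false k) with (repeat false (S k)). rewrite HE. cring.
Qed.

Lemma letter_mul l f l' w : (letter l * f)%ncs (l' :: w) = if eqb l' l then f w else 0.
Proof.
 rewrite smul_cons, shift_letter. simpl.
 destruct (eqb l' l); [rewrite smul_one_l | rewrite smul_zero_l; unfold szero]; cring.
Qed.

Lemma mul_letter l f l' w : (f * letter l)%ncs (w ++ l' :: nil)%list = if eqb l l' then f w else 0.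
Proof.
 revert f; induction w as [|a w IH]; intros f; simpl app; rewrite smul_cons.
 - rewrite smul_nil. simpl. destruct (eqb l l'); cring.
 - rewrite IH. replace (letter l (a :: w ++ l' :: nil)%list) with (RtoC 0); [unfold shift; cring|].
  destruct w; reflexivity.
Qed.

Lemma word_split w :
 w = repeat false (length w) \/ exists u k, w = (u ++ true :: repeat false k)%list.
Proof.
 induction w as [|l w IH]; auto.
 destruct IH as [IH|[u [k IH]]].
 - destruct l.
  + right. exists nil, (length w). simpl. congruence.
  + left. simpl. congruence.
 - right. exists (l :: u), k. now rewrite IH.
Qed.

(* Commutation with x says that a coefficient is invariant under moving a final x to the front;
  moving all of them yields a word that ends in y, where the coefficient is zero. *)
Lemma commute_sx_vanish f n : purex f ->
 (forall w, length w = S n -> (sx * f)%ncs w = (f * sx)%ncs w) ->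
 forall w, length w = n -> f w = 0.
Proof.
 intros Hp H.
 assert (R : forall w, length w = n -> f w = (f * sx)%ncs (false :: w)).
 { intros w Hw. rewrite <- H by (simpl; lia). unfold sx at 1. now rewrite letter_mul. }
 assert (K : forall k u, length (u ++ true :: repeat false k) = n ->
             f (u ++ true :: repeat false k)%list = 0).
 { induction k as [|k IH]; intros u Hu; rewrite R by pos.
  - rewrite app_comm_cons. unfold sx. now rewrite mul_letter.
  - replace (false :: u ++ true :: repeat false (S k))%list with
    (((false :: u) ++ true :: repeat false k) ++ false :: nil)%list.
   2:{ rewrite <- !app_assoc. simpl. do 3 f_equal.
     symmetry; apply (repeat_cons k false). }
   unfold sx. rewrite mul_letter. apply IH.
   rewrite <- Hu. rewrite !length_app. simpl. lia. }
 intros w Hw. destruct (word_split w) as [E|[u [k E]]]; rewrite E; auto.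
 apply K. congruence.
Qed.

Lemma commute_sx f : purex f -> (sx * f = f * sx)%ncs -> f = szero.
Proof.
 intros Hp H. apply ncs_ext; intros w. apply (commute_sx_vanish f (length w)); trivial.
 now rewrite H.
Qed.

(** If f has no words shorter than n, then, exp(cx) - 1 - cx having order 2, the part of degree n +
    1 of the commutator is c [x, f_n], with f_n the part of f of degree n; so f_n = 0. *)
Lemma commute_sexp f c : c <> 0 -> purex f ->
 (sexp (c *: sx) * f = f * sexp (c *: sx))%ncs -> f = szero.
Proof.
 intros Hc Hp H. apply vanish_all. induction n as [|n IH]; [apply vanish_0|].
 intros w Hw. destruct (Nat.eq_dec (length w) n) as [E|E]; [|apply IH; lia].
 apply (commute_sx_vanish f n Hp); auto. clear w Hw E. intros w Hw.
 assert (Rx : raising (smul sx)) by now apply raising_smul.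
 set (r := (sexp (c *: sx) - (sone + c *: sx))%ncs).
 assert (Vr : vanish 2 r).
 { intros v Hv. unfold r, sadd, sopp. rewrite sexp_opser, (opser_val _ _ _ v 1) by (trivial; lia).
  rewrite csum_S, csum_O. simpl Nat.iter. rewrite smul_one_r. unfold sscal.
  unfold eseq. simpl. rewrite Rinv_1. cring. }
 assert (E : sexp (c *: sx) = (sone + c *: sx + r)%ncs) by (unfold r; ncs_lin).
 rewrite E in H. apply (f_equal (fun h : ncs => h w)) in H.
 rewrite !smul_add_l, !smul_add_r, smul_one_l, smul_one_r, smul_scal_l, smul_scal_r in H.
 unfold sadd, sscal in H.
 rewrite (vanish_mul 2 n r f Vr IH w) in H by lia.
 rewrite (vanish_mul n 2 f r IH Vr w) in H by lia.
 apply (Cmult_cancel c); auto.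
 replace (c * (sx * f)%ncs w) with (f w + c * (sx * f)%ncs w + 0 - f w) by ring.
 rewrite H. cring.
Qed.

(** * Power series in ad x applied to y *)

Definition Lser (a : nat -> C) : ncs := opser a (bracket sx) sy.

Lemma raising_adx : raising (bracket sx).
Proof. now apply raising_bracket. Qed.

Lemma Lser_nil (a : nat -> C) : Lser a nil = 0.
Proof. unfold Lser. rewrite opser_nil by apply raising_adx. simpl; ring. Qed.

Lemma purex_ad k : purex (Nat.iter k (bracket sx) sy).
Proof.
 induction k as [|k IH]; simpl; [|now apply purex_bracket].
 intros [|[|j]]; reflexivity.
Qed.

Lemma purex_Lser (a : nat -> C) : purex (Lser a).
Proof. apply purex_ssum. intros n. apply purex_scal, purex_ad. Qed.

Lemma convol_shift (a : nat -> C) n :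
 convol (cseq 1 1) a n = match n with O => 0 | S m => a m end.
Proof.
 unfold convol. destruct n as [|m].
 - rewrite csum_O. unfold cseq; simpl. cring.
 - rewrite (csum_one _ _ 1); [|lia|].
  + unfold cseq; simpl. rewrite Nat.sub_0_r. cring.
  + intros k _ Hk. unfold cseq. apply Nat.eqb_neq in Hk. rewrite Hk. cring.
Qed.

Lemma bracket_Lser (a : nat -> C) :
 bracket sx (Lser a) = Lser (fun n => match n with O => 0 | S m => a m end).
Proof.
 transitivity (opser (cseq 1 1) (bracket sx) (Lser a)).
 - rewrite opser_cseq by apply raising_adx. now rewrite sscal_one.
 - unfold Lser. rewrite opser_comp by apply raising_adx. apply opser_ext, convol_shift.
Qed.

Lemma st_Lser : st = Lser (cseq (- (1)) 1).
Proof.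
 unfold Lser. rewrite opser_cseq by apply raising_adx. apply sopp_scal.
Qed.

Lemma st_nil : st nil = 0.
Proof. unfold st, bracket, sadd, sopp. rewrite !smul_nil. ring. Qed.

(** * Values of the derivation on exp(cx), y tilde and t *)

Section Derivation.

Variables (c : C) (beta zc : nat -> C).
Hypothesis c_neq_0 : c <> 0.
Let X : ncs := sexp (c *: sx)%ncs.
Let yt : ncs := (- Lser beta)%ncs.

(* exp(c s) beta(s) = beta(s) + s, that is, beta(s) = s / (exp(c s) - 1). *)
Hypothesis beta_rec : forall n, convol (eseq c) beta n = beta n + cseq 1 1 n.

Lemma X_nil : X nil = 1.
Proof. apply sexp_nil. unfold sscal, sx, letter. cring. Qed.

Lemma yt_nil : yt nil = 0.
Proof. unfold yt, sopp. rewrite Lser_nil. cring. Qed.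

(** Conjugation by X is exp(c ad x), and exp(cs) beta(s) = beta(s) + s sends - beta(ad x)(y) to
    itself minus [x, y], that is, plus t. *)
Lemma X_yt : (X * yt = (yt + st) * X)%ncs.
Proof.
 unfold X. rewrite sexp_ad by pos. f_equal.
 unfold yt. rewrite (contin_opp _ _ (contin_opser (eseq c) _ raising_adx)).
 unfold Lser at 1. rewrite opser_comp by apply raising_adx.
 rewrite (opser_ext _ _ _ _ beta_rec), opser_plus, opser_cseq by apply raising_adx.
 unfold st. simpl Nat.iter. fold (Lser beta). ncs_lin.
Qed.

(* The coefficients [p(s)] with D(x) = p(ad x)(y); zc k = 2(2k+1) zeta(2k+2). *)
Definition pser (n : nat) : C :=
 match n with O => 1 | S (S m) => if Nat.even m then zc (Nat.div2 m) else 0 | _ => 0 end.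

(** In generating functions: p(s) (1 - exp(-cs)) = c^2 s beta(s), so p(s) = c^2 s^2 exp(cs) /
    (exp(cs) - 1)^2. For c = 2 pi i this is (pi s / sin(pi s))^2, and the hypothesis becomes Euler's
    evaluation of zeta at the even integers ([pser_zcoef_rec]). *)
Hypothesis pser_rec : forall n,
 pser n - convol (eseq (- c)) pser n = match n with O => 0 | S m => c * c * beta m end.

Let p2 (k : nat) : ncs := ad_pow sx (2 * k + 2) sy.
Let q2 (k : nat) : ncs :=
 (RtoC (/ 2) *: (fun w => sum_n (fun p : nat => (RtoC ((-1) ^ p) *:
   bracket (ad_pow sx p sy) (ad_pow sx (2 * k + 1 - p) sy))%ncs w) (2 * k + 1)))%ncs.
Let Dx : ncs := (sy + ssum (fun k => zc k *: p2 k))%ncs.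
Let Dy : ncs := ssum (fun k => zc k *: q2 k)%ncs.
Let D := der Dx Dy.

Lemma vanish_ad k : vanish (S k) (ad_pow sx k sy).
Proof.
 induction k as [|k IH]; [now apply vanish_1|]. now apply raising_adx.
Qed.

Lemma vanish_p2 k : vanish (2 * k + 3) (p2 k).
Proof. replace (2 * k + 3)%nat with (S (2 * k + 2)) by lia. apply vanish_ad. Qed.

Lemma vanish_q2 k : vanish (2 * k + 3) (q2 k).
Proof.
 apply vanish_scal. intros w Hw. apply csum_zero. intros j Hj.
 assert (V1 := vanish_ad j). assert (V2 := vanish_ad (2 * k + 1 - j)).
 unfold sscal. unfold bracket, sadd, sopp.
 rewrite (vanish_mul _ _ _ _ V1 V2 w) by lia. rewrite (vanish_mul _ _ _ _ V2 V1 w) by lia. cring.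
Qed.

Lemma graded_p2 : graded (fun k => zc k *: p2 k)%ncs.
Proof. apply graded_scal. intros k. apply (vanish_mono (2 * k + 3)); [lia | apply vanish_p2]. Qed.

Lemma graded_q2 : graded (fun k => zc k *: q2 k)%ncs.
Proof. apply graded_scal. intros k. apply (vanish_mono (2 * k + 3)); [lia | apply vanish_q2]. Qed.

Lemma p2_nil k : p2 k nil = 0.
Proof. apply vanish_p2; simpl; lia. Qed.

Lemma q2_nil k : q2 k nil = 0.
Proof. apply vanish_q2; simpl; lia. Qed.

Lemma ssum_nil (F : nat -> ncs) : (forall k, F k nil = 0) -> ssum F nil = 0.
Proof. intros H. unfold ssum. rewrite (CSeries_finite _ 0); [rewrite csum_O|intros]; apply H. Qed.

Lemma Dx_nil : Dx nil = 0.
Proof.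
 unfold Dx, sadd. rewrite ssum_nil; [unfold sy, letter; cring|].
 intros k. unfold sscal. rewrite p2_nil; cring.
Qed.

Lemma Dy_nil : Dy nil = 0.
Proof. apply ssum_nil. intros k. unfold sscal. rewrite q2_nil; cring. Qed.

Lemma Dx_Lser : Dx = Lser pser.
Proof.
 apply ncs_ext; intros w. set (N := length w).
 unfold Lser. rewrite (opser_val _ _ _ w (S (S (2 * N)))); [|apply raising_adx|unfold N; lia].
 unfold Dx, sadd. rewrite (ssum_graded _ w N graded_p2) by pos.
 induction N as [|N IH].
 - rewrite !csum_S, !csum_O. unfold sscal, p2. simpl; ring.
 - replace (2 * S N)%nat with (S (S (2 * N))) by lia.
  rewrite (csum_S _ (S (S (S (2 * N))))), (csum_S _ (S (S (2 * N)))), <- IH, csum_S.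
  assert (P1 : pser (S (S (S (2 * N)))) = 0).
  { unfold pser. replace (Nat.even (S (2 * N))) with false; auto.
   symmetry. rewrite Nat.even_succ. apply Nat.odd_even. }
  assert (P2 : pser (S (S (S (S (2 * N))))) = zc (S N)).
  { unfold pser. replace (S (S (2 * N))) with (2 * S N)%nat by lia.
   rewrite Nat.even_even, Nat.div2_double. pos. }
  rewrite P1, P2. unfold sscal at 2. unfold p2, ad_pow.
  replace (2 * S N + 2)%nat with (S (S (S (S (2 * N))))) by lia.
  cring.
Qed.

Lemma purex_Dx : purex Dx.
Proof. rewrite Dx_Lser. apply purex_Lser. Qed.

Lemma purex_Dy : purex Dy.
Proof.
 apply purex_ssum. intros k. apply purex_scal, purex_scal. intros j. apply csum_zero. intros i _.
 apply purex_scal, purex_bracket, purex_ad.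
Qed.

(* The sum defining [q2 k] telescopes under ad x. *)
Lemma bracket_q2 k : bracket sx (q2 k) = bracket sy (p2 k).
Proof.
 set (A := fun n => ad_pow sx n sy). set (M := (2 * k + 1)%nat).
 set (G := fun j => (((-1) ^ j) *: bracket (A j) (A (S M - j)%nat))%ncs).
 assert (J : forall f g, bracket sx (bracket f g) = (bracket (bracket sx f) g + bracket f (bracket sx g))%ncs).
 { intros f g. unfold bracket. ncs_ring. }
 assert (S1 : forall n, (n <= M)%nat ->
   bracket sx (nsum (fun j => RtoC ((-1) ^ j) *: bracket (A j) (A (M - j)%nat))%ncs n)
   = (G O - RtoC ((-1) ^ (S n)) *: bracket (A (S n)) (A (M - n)%nat))%ncs).
 { intros n Hn. induction n as [|n IH].
  - rewrite nsum_O, (contin_scal _ (proj1 raising_adx)), J. unfold G. simpl pow.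
   rewrite !Nat.sub_0_r. change (bracket sx (A O)) with (A 1%nat).
   change (bracket sx (A M)) with (A (S M)).
   replace (RtoC (-1 * 1)) with (- RtoC 1) by (rewrite <- RtoC_opp; f_equal; lra). ncs_lin.
  - rewrite nsum_S, (contin_add _ (proj1 raising_adx)), IH, (contin_scal _ (proj1 raising_adx)), J by lia.
   change (bracket sx (A (S n))) with (A (S (S n))).
   change (bracket sx (A (M - S n)%nat)) with (A (S (M - S n))).
   replace (S (M - S n)) with (M - n)%nat by lia.
   replace (RtoC ((-1) ^ (S (S n)))) with (- RtoC ((-1) ^ (S n))).
   2:{ rewrite <- RtoC_opp. f_equal. simpl; lra. }
   ncs_lin. }
 unfold q2. rewrite (contin_scal _ (proj1 raising_adx)). fold M.
 change (fun w => sum_n _ M) with (nsum (fun j => RtoC ((-1) ^ j) *: bracket (A j) (A (M - j)%nat))%ncs M).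
 rewrite S1 by lia. unfold G. rewrite Nat.sub_diag, Nat.sub_0_r.
 replace ((-1) ^ S M)%R with 1%R.
 2:{ unfold M. replace (S (2 * k + 1)) with (2 * S k)%nat by lia. now rewrite pow_1_even. }
 unfold p2. replace (2 * k + 2)%nat with (S M) by lia. fold (A (S M)).
 change (A O) with sy. unfold bracket.
 apply ncs_ext; intros w. unfold sscal, sadd, sopp.
 rewrite RtoC_inv. field. lra.
Qed.

Lemma contin_bracket_r g : contin (fun f => bracket f g).
Proof.
 split; unfold bracket.
 - intros. rewrite smul_add_l, smul_add_r. ncs_lin.
 - intros. rewrite smul_scal_l, smul_scal_r. ncs_lin.
 - intros n f Hf. apply vanish_add; [now apply (contin_smul_r g) | apply vanish_opp; now apply (contin_smul_l g)].
Qed.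

(** The identity [Dx, y] + [x, Dy] = 0 holds for each k separately, by [bracket_q2]; the summand y
    of Dx contributes [y, y]. *)
Lemma D_st : D st = szero.
Proof.
 unfold st. rewrite (contin_opp _ _ (contin_der _ _ Dx_nil Dy_nil)), der_bracket by apply Dx_nil || apply Dy_nil.
 unfold sx at 1, sy at 2. rewrite !der_letter by apply Dx_nil || apply Dy_nil.
 enough (E : (bracket Dx sy = - bracket sx Dy)%ncs) by (fold sx sy; rewrite E; ncs_lin).
 unfold Dx at 1. rewrite (contin_add _ (contin_bracket_r sy)).
 replace (bracket sy sy) with szero by (unfold bracket; ncs_lin).
 rewrite (contin_ssum _ _ (contin_bracket_r sy) graded_p2).
 unfold Dy. rewrite <- (contin_opp _ _ (proj1 raising_adx)).
 rewrite sadd_zero_l, sopp_scal, (contin_scal _ (proj1 raising_adx)), (contin_ssum _ _ (proj1 raising_adx) graded_q2).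
 assert (Gq : graded (fun n => bracket sx (zc n *: q2 n))).
 { apply (contin_graded _ _ (proj1 raising_adx) graded_q2). }
 assert (CS : contin (sscal (- (1)))).
 { split; intros; [ncs_lin|ncs_lin|now apply vanish_scal]. }
 rewrite (contin_ssum _ _ CS Gq). f_equal. apply functional_extensionality; intros k.
 rewrite (contin_scal _ (proj1 raising_adx)), bracket_q2, (contin_scal _ (contin_bracket_r sy)).
 unfold bracket. ncs_lin.
Qed.

(** Applying the derivation to [X, x] = 0 gives, for Z = X^-1 D(X), the equation [x, Z] = Dx - X^-1
    (Dx) X. The right side is (1 - exp(-c ad x)) p(ad x)(y) = c^2 [x, beta(ad x)(y)], so Z + c^2 yt
    commutes with x; it has no pure powers of x, hence it is 0. *)
Lemma D_X : D X = ((- (c * c)) *: (X * yt))%ncs.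
Proof.
 assert (HX := X_nil). set (Xi := sinv X). set (Z := (Xi * D X)%ncs).
 assert (EXi : Xi = sexp ((- c) *: sx)) by (apply sexp_inv; reflexivity).
 assert (CX : (X * sx = sx * X)%ncs).
 { symmetry. apply sexp_intertwine; try (unfold sscal, sx, letter; cring).
  now rewrite smul_scal_l, smul_scal_r. }
 assert (CXi : (Xi * sx = sx * Xi)%ncs).
 { symmetry. rewrite EXi. apply sexp_intertwine; try (unfold sscal, sx, letter; cring).
  now rewrite smul_scal_l, smul_scal_r. }
 assert (E1 : (D X * sx + X * Dx = Dx * X + sx * D X)%ncs).
 { assert (H := f_equal D CX). unfold D in H. rewrite !der_smul in H by apply Dx_nil || apply Dy_nil.
  assert (Ex : der Dx Dy sx = Dx) by (apply (der_letter Dx Dy false); [apply Dx_nil | apply Dy_nil]).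
  rewrite Ex in H. pos. }
 assert (E2 : (sx * Z - Z * sx = Dx - Xi * Dx * X)%ncs).
 { assert (H := f_equal (smul Xi) E1). rewrite !smul_add_r, !smul_assoc, CXi in H.
  unfold Xi at 2 in H. rewrite sinv_l, smul_one_l in H by pos.
  rewrite <- (smul_assoc sx) in H. fold Z in H.
  apply ncs_ext; intros w. apply (f_equal (fun h : ncs => h w)) in H. unfold sadd in H.
  unfold sadd, sopp. set (u := (Z * sx)%ncs w) in *. set (v := (sx * Z)%ncs w) in *.
  replace v with (u + Dx w - (Xi * Dx * X)%ncs w); [cring|]. rewrite H. cring. }
 assert (E3 : (Xi * Dx * X = Lser (convol (eseq (- c)) pser))%ncs).
 { rewrite EXi at 1. rewrite sexp_ad, <- EXi, <- smul_assoc by pos.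
  unfold Xi. rewrite sinv_l, smul_one_r by pos. rewrite Dx_Lser. unfold Lser at 1.
  now rewrite opser_comp by apply raising_adx. }
 assert (E4 : (Dx - Xi * Dx * X = (c * c) *: bracket sx (Lser beta))%ncs).
 { rewrite E3, Dx_Lser, bracket_Lser, sopp_scal. unfold Lser.
  rewrite <- !opser_scal, <- opser_plus by apply raising_adx. apply opser_ext; intros n.
  transitivity (pser n - convol (eseq (- c)) pser n); [cring|]. rewrite pser_rec.
  destruct n; cring. }
 set (W := (Z + (c * c) *: yt)%ncs).
 assert (HW : W = szero).
 { apply commute_sx.
  - apply purex_add; [apply purex_mul_r, purex_der; [apply purex_Dx|apply purex_Dy]|].
   apply purex_scal, purex_opp, purex_Lser.
  - apply ssub_eq0. unfold W. rewrite smul_add_l, smul_add_r, smul_scal_l, smul_scal_r.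
   transitivity ((sx * Z - Z * sx) + (c * c) *: bracket sx yt)%ncs; [unfold bracket; ncs_lin|].
   rewrite E2, E4. unfold yt. rewrite (contin_opp _ _ (proj1 raising_adx)). ncs_lin. }
 assert (EZ : Z = ((- (c * c)) *: yt)%ncs).
 { apply ssub_eq0. rewrite <- HW. unfold W. ncs_lin. }
 rewrite <- (smul_one_l (D X)), <- (sinv_r X HX), <- smul_assoc. fold Xi Z.
 now rewrite EZ, smul_scal_r.
Qed.

(** When X yt = (yt + t) X is differentiated, the two terms containing D(X) are both -c^2 X yt yt
    and cancel, and D(t) = 0; what remains says that D(yt) commutes with X. *)
Lemma D_yt : D yt = szero.
Proof.
 assert (H := f_equal D X_yt). unfold D in H. rewrite !der_smul in H by apply Dx_nil || apply Dy_nil.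
 rewrite (contin_add _ (contin_der _ _ Dx_nil Dy_nil)) in H. fold D in H.
 rewrite D_st, D_X, sadd_zero_r, smul_scal_r, smul_scal_l, smul_assoc, <- X_yt in H.
 apply (commute_sexp _ c c_neq_0); [apply purex_der; [apply purex_Dx|apply purex_Dy]|].
 fold X. apply ncs_ext; intros w. apply (f_equal (fun h : ncs => h w)) in H. unfold sadd in H.
 set (k := ((- (c * c)) *: (X * yt * yt))%ncs w) in *.
 replace ((X * D yt)%ncs w) with (k + (X * D yt)%ncs w - k) by ring. rewrite H. cring.
Qed.

Lemma D_iter_X (f g : ncs) n : D f = szero -> D g = szero ->
 Nat.iter n D (f * X * g)%ncs = (Cpow (- (c * c)) n *: (f * (X * spow yt n) * g))%ncs.
Proof.
 intros Hf Hg. assert (HD : contin D) by apply (contin_der _ _ Dx_nil Dy_nil).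
 induction n as [|n IH].
 - now rewrite smul_one_r, sscal_one.
 - simpl Nat.iter. rewrite IH, (contin_scal _ HD). unfold D at 1.
  rewrite !der_smul by apply Dx_nil || apply Dy_nil. fold D. rewrite Hf, Hg, D_X, smul_zero_l, smul_zero_r.
  replace (D (spow yt n)) with szero.
  2:{ symmetry. clear IH. induction n as [|m IHm]; [apply der_one; [apply Dx_nil|apply Dy_nil]|].
    transitivity (D yt * spow yt m + yt * D (spow yt m))%ncs;
     [apply der_smul; [apply Dx_nil|apply Dy_nil]|].
    rewrite D_yt, IHm, smul_zero_l, smul_zero_r. apply sadd_zero_l. }
  rewrite smul_zero_r, sadd_zero_r, sadd_zero_l, sadd_zero_r.
  rewrite smul_scal_l, smul_scal_r, smul_scal_l, sscal_sscal, <- (smul_assoc X).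
  simpl Cpow. f_equal. cring.
Qed.

End Derivation.

(** * A submultiplicative seminorm on words of bounded length *)

(** The sum of the moduli of the coefficients on words of length at most n, arranged by residuals so
    that submultiplicativity is an induction on n. *)
Fixpoint nrm (n : nat) (f : ncs) : R :=
 match n with
 | O => Cmod (f nil)
 | S m => (Cmod (f nil) + nrm m (shift false f) + nrm m (shift true f))%R
 end.

Lemma nrm_ge0 n f : 0 <= nrm n f.
Proof.
 revert f; induction n as [|n IH]; intros f; simpl; [apply Cmod_ge_0|].
 pos.
Qed.

#[local] Hint Resolve nrm_ge0 : pos.

Lemma nrm_nil n f : Cmod (f nil) <= nrm n f.
Proof.
 destruct n as [|n]; simpl; [lra|].
 assert (H1 := nrm_ge0 n (shift false f)). assert (H2 := nrm_ge0 n (shift true f)). lra.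
Qed.

Lemma nrm_mono_S n f : nrm n f <= nrm (S n) f.
Proof.
 revert f; induction n as [|n IH]; intros f; [apply nrm_nil|].
 mono.
Qed.

Lemma nrm_mono n m f : (n <= m)%nat -> nrm n f <= nrm m f.
Proof.
 induction 1 as [|m _ IH]; [lra|]. eapply Rle_trans; [exact IH | apply nrm_mono_S].
Qed.

Lemma nrm_coef n f w : (length w <= n)%nat -> Cmod (f w) <= nrm n f.
Proof.
 revert f w; induction n as [|n IH]; intros f w Hw.
 - destruct w; easy.
 - destruct w as [|l w]; [apply nrm_nil|]. simpl in Hw.
  assert (H := IH (shift l f) w ltac:(lia)). unfold shift in H at 1.
  assert (H0 := Cmod_ge_0 (f nil)).
  assert (H1 := nrm_ge0 n (shift false f)). assert (H2 := nrm_ge0 n (shift true f)).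
  simpl. destruct l; lra.
Qed.

Lemma nrm_add n f g : nrm n (f + g) <= nrm n f + nrm n g.
Proof.
 revert f g; induction n as [|n IH]; intros f g; simpl; unfold sadd at 1.
 - mono.
 - assert (H := Cmod_triangle (f nil) (g nil)).
  assert (H1 := IH (shift false f) (shift false g)).
  assert (H2 := IH (shift true f) (shift true g)).
  change (shift false (f + g)) with (shift false f + shift false g)%ncs.
  change (shift true (f + g)) with (shift true f + shift true g)%ncs. lra.
Qed.

Lemma nrm_scal n c f : (nrm n (c *: f) = Cmod c * nrm n f)%R.
Proof.
 revert f; induction n as [|n IH]; intros f; simpl; unfold sscal at 1; rewrite Cmod_mult.
 - lra.
 - change (shift false (c *: f)) with (c *: shift false f)%ncs.
  change (shift true (c *: f)) with (c *: shift true f)%ncs. rewrite !IH. ring.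
Qed.

Lemma nrm_opp n f : nrm n (- f) = nrm n f.
Proof. rewrite sopp_scal, nrm_scal, Cmod_opp, Cmod_1. ring. Qed.

Lemma nrm_sub n f g : nrm n (f - g) <= nrm n f + nrm n g.
Proof. rewrite <- (nrm_opp n g). apply nrm_add. Qed.

Lemma nrm_sub_sym n f g : nrm n (f - g) = nrm n (g - f).
Proof. rewrite <- nrm_opp. f_equal. ncs_lin. Qed.

Lemma nrm_mul n f g : nrm n (f * g) <= nrm n f * nrm n g.
Proof.
 revert f g; induction n as [|n IH]; intros f g.
 - simpl. rewrite smul_nil, Cmod_mult. lra.
 - change (nrm (S n) (f * g)) with
   (Cmod ((f * g)%ncs nil) + nrm n (shift false (f * g)) + nrm n (shift true (f * g)))%R.
  rewrite smul_nil, Cmod_mult, !shift_smul.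
  assert (A1 := nrm_add n (f nil *: shift false g) (shift false f * g)).
  assert (A2 := nrm_add n (f nil *: shift true g) (shift true f * g)).
  rewrite nrm_scal in A1, A2.
  assert (B1 := IH (shift false f) g). assert (B2 := IH (shift true f) g).
  assert (Cg := nrm_mono_S n g).
  assert (P1 := nrm_ge0 n (shift false f)). assert (P2 := nrm_ge0 n (shift true f)).
  change (nrm (S n) f) with (Cmod (f nil) + nrm n (shift false f) + nrm n (shift true f))%R.
  change (nrm (S n) g) with (Cmod (g nil) + nrm n (shift false g) + nrm n (shift true g))%R in *.
  nra.
Qed.

Lemma nrm_mul3 n f g h : nrm n (f * g * h) <= nrm n f * nrm n g * nrm n h.
Proof.
 le_via nrm_mul. apply Rmult_le_compat_r; [apply nrm_ge0 | apply nrm_mul].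
Qed.

(** A factor without constant term uses up one letter, so only words of length at most n of the
    other factor enter. This gain of one degree drives the inductions on word length for
    differential equations. *)
Lemma nrm_mul_raise n f g : f nil = 0 ->
 nrm (S n) (f * g) <= nrm (S n) f * nrm n g.
Proof.
 intros Hf.
 change (nrm (S n) (f * g)) with
   (Cmod ((f * g)%ncs nil) + nrm n (shift false (f * g)) + nrm n (shift true (f * g)))%R.
 change (nrm (S n) f) with (Cmod (f nil) + nrm n (shift false f) + nrm n (shift true f))%R.
 rewrite smul_nil, !shift_smul, Hf, Cmult_0_l, !sscal_zero_l, !sadd_zero_l, Cmod_0.
 assert (A1 := nrm_mul n (shift false f) g). assert (A2 := nrm_mul n (shift true f) g). lra.
Qed.

Lemma nrm_zero n : nrm n szero = 0%R.
Proof.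
 induction n as [|n IH]; simpl; [apply Cmod_0|].
 change (shift false szero) with szero. change (shift true szero) with szero.
 rewrite IH. unfold szero. rewrite Cmod_0. ring.
Qed.

Lemma nrm_one n : nrm n sone = 1%R.
Proof.
 destruct n as [|n]; simpl; rewrite ?nrm_zero, Cmod_1; ring.
Qed.

Lemma nrm_ext n f g : vanish (S n) (f - g) -> nrm n f = nrm n g.
Proof.
 intros H. assert (H' : forall w, (length w <= n)%nat -> f w = g w).
 { intros w Hw. apply (vanish_sub (S n)); [exact H | lia]. }
 clear H. revert f g H'; induction n as [|n IH]; intros f g H; simpl.
 - now rewrite H.
 - rewrite (H nil), (IH (shift false f) (shift false g)), (IH (shift true f) (shift true g));
   try reflexivity; try (simpl; lia); intros w Hw; apply H; simpl; lia.
Qed.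

Lemma nrm_vanish n f : vanish (S n) f -> nrm n f = 0%R.
Proof.
 intros H. rewrite <- (nrm_zero n). apply nrm_ext.
 intros w Hw. unfold sadd, sopp, szero. rewrite H by pos. cring.
Qed.

Lemma nrm_words n f (e : R) : (forall w, (length w <= n)%nat -> Cmod (f w) <= e) ->
 nrm n f <= (2 ^ (S n) - 1) * e.
Proof.
 revert f; induction n as [|n IH]; intros f H.
 - simpl. assert (H0 := H nil ltac:(pos)). lra.
 - assert (H0 := H nil ltac:(simpl; lia)).
  assert (H1 := IH (shift false f) ltac:(intros w Hw; apply H; simpl; lia)).
  assert (H2 := IH (shift true f) ltac:(intros w Hw; apply H; simpl; lia)).
  change (nrm (S n) f) with (Cmod (f nil) + nrm n (shift false f) + nrm n (shift true f))%R.
  change (2 ^ S (S n))%R with (2 * 2 ^ S n)%R. lra.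
Qed.

Lemma nrm_nsum n (F : nat -> ncs) (B : nat -> R) m :
 (forall k, (k <= m)%nat -> nrm n (F k) <= B k) -> nrm n (nsum F m) <= sum_f_R0 B m.
Proof.
 intros H; induction m as [|m IH]; [rewrite nsum_O; apply H; lia|].
 rewrite nsum_S. le_via nrm_add.
 mono.
Qed.

Lemma nrm_ssum n (F : nat -> ncs) : graded F -> nrm n (ssum F) = nrm n (nsum F n).
Proof. intros HF. apply nrm_ext. now apply ssum_nsum. Qed.

Lemma nrm_pow n f k : nrm n (spow f k) <= nrm n f ^ k.
Proof.
 induction k as [|k IH]; [simpl; rewrite nrm_one; lra|].
 le_via nrm_mul. mono.
Qed.

Lemma sum_pow_le (B : R) m n : 1 <= B -> (m <= n)%nat ->
 (sum_f_R0 (fun k => B ^ k) m <= INR (S m) * B ^ n)%R.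
Proof.
 intros HB Hm; induction m as [|m IH].
 - simpl. assert (H := pow_R1_Rle B n HB). lra.
 - rewrite tech5. rewrite (S_INR (S m)).
  assert (H := Rle_pow B (S m) n HB ltac:(lia)). specialize (IH ltac:(lia)). lra.
Qed.

(** Up to length n only n + 1 powers contribute, whence a bound polynomial in B; [nrm_sexp] is of
    the same kind. Inverses and exponentials of series of polynomial or logarithmic growth therefore
    keep this kind of growth. *)
Lemma nrm_sinv n f (B : R) : f nil = 1 -> nrm n f <= B ->
 nrm n (sinv f) <= INR (S n) * (1 + B) ^ n.
Proof.
 intros Hf HB. unfold sinv. rewrite nrm_ssum by now apply graded_pow, sinv_aux.
 assert (HB0 : 0 <= B) by (assert (H := nrm_ge0 n f); lra).
 assert (H1 : nrm n (sone - f) <= 1 + B).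
 { le_via nrm_sub. rewrite nrm_one. lra. }
 le_via ((nrm_nsum n _ (fun k => (1 + B) ^ k)%R)).
 - intros k _. le_via nrm_pow. apply pow_incr. pos.
 - apply sum_pow_le; pos.
Qed.

Lemma nrm_sexp n f (B : R) : f nil = 0 -> nrm n f <= B ->
 nrm n (sexp f) <= INR (S n) * (1 + B) ^ n.
Proof.
 intros Hf HB. unfold sexp. rewrite nrm_ssum by now apply graded_scal, graded_pow.
 assert (HB0 : 0 <= B) by (assert (H := nrm_ge0 n f); lra).
 le_via ((nrm_nsum n _ (fun k => (1 + B) ^ k)%R)).
 - intros k _. rewrite nrm_scal, Cmod_R.
  assert (Hk : Rabs (/ INR (fact k)) <= 1).
  { rewrite Rabs_pos_eq.
   - rewrite <- Rinv_1. apply Rinv_le_contravar; [lra|]. apply (le_INR 1). apply lt_O_fact.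
   - left. apply Rinv_0_lt_compat, INR_fact_lt_0. }
  assert (Hp : nrm n (spow f k) <= (1 + B) ^ k).
  { le_via nrm_pow. apply pow_incr. split; pos. }
  assert (H0 := nrm_ge0 n (spow f k)). nra.
 - apply sum_pow_le; pos.
Qed.

Lemma ncs_decomp f :
 f = (f nil *: sone + (sx * shift false f + sy * shift true f))%ncs.
Proof.
 apply ncs_ext; intros [|l w]; unfold sadd, sscal, sx, sy.
 - rewrite !smul_nil. simpl; ring.
 - rewrite !letter_mul. destruct l; simpl; unfold shift; cring.
Qed.

(** A linear map between truncations is a map of finite-dimensional spaces. Two lengths are needed
    because the induction composes T with left multiplication by a letter, which lowers k but not
    n. *)
Lemma linear_bounded n k (T : ncs -> ncs) :
 (forall f g, T (f + g)%ncs = (T f + T g)%ncs) ->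
 (forall c f, T (c *: f)%ncs = (c *: T f)%ncs) ->
 (forall f, vanish (S k) f -> vanish (S n) (T f)) ->
 exists B, 0 <= B /\ forall f, nrm n (T f) <= B * nrm k f.
Proof.
 revert T; induction k as [|k IH]; intros T Ha Hs Hv.
 - exists (nrm n (T sone)). split; try pos. intros f. rewrite (ncs_decomp f) at 1.
  rewrite Ha, Hs. le_via nrm_add.
  rewrite (nrm_vanish n (T (_ + _)%ncs)).
  + rewrite nrm_scal. simpl. lra.
  + apply Hv, vanish_add; apply vanish_mul_l; try reflexivity; apply vanish_0.
 - assert (R : forall l, exists B, 0 <= B /\ forall f, nrm n (T (letter l * f)%ncs) <= B * nrm k f).
  { intros l. apply (IH (fun f => T (letter l * f)%ncs)); intros.
   - now rewrite smul_add_r.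
   - now rewrite smul_scal_r.
   - apply Hv. now apply vanish_mul_l. }
  destruct (R false) as [B1 [P1 H1]]. destruct (R true) as [B2 [P2 H2]].
  assert (P0 := nrm_ge0 n (T sone)).
  exists (nrm n (T sone) + B1 + B2)%R. split; [lra|].
  intros f. rewrite (ncs_decomp f) at 1. rewrite Ha, Hs, Ha.
  le_via nrm_add. eapply Rle_trans; [apply Rplus_le_compat_l, nrm_add|].
  rewrite nrm_scal. specialize (H1 (shift false f)). specialize (H2 (shift true f)).
  unfold sx, sy. simpl (nrm (S k) f).
  assert (Q0 := Cmod_ge_0 (f nil)). assert (Q1 := nrm_ge0 k (shift false f)).
  assert (Q2 := nrm_ge0 k (shift true f)). nra.
Qed.

Lemma contin_bounded n (T : ncs -> ncs) : contin T ->
 exists B, 0 <= B /\ forall f, nrm n (T f) <= B * nrm n f.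
Proof. intros [Ha Hs Hv]. apply linear_bounded; trivial. pos. Qed.

(** * The exponential of the derivation *)

(* D raises the degree in y; hence the exponential series of D is finite on each word. *)
Definition yvanish (n : nat) (f : ncs) : Prop :=
 forall w, (count_occ bool_dec w true < n)%nat -> f w = 0.

Lemma yvanish_mono n m f : (m <= n)%nat -> yvanish n f -> yvanish m f.
Proof. intros H Hf w Hw; apply Hf; lia. Qed.

Lemma yvanish_add n f g : yvanish n f -> yvanish n g -> yvanish n (f + g).
Proof. intros Hf Hg w Hw. unfold sadd. rewrite Hf, Hg by pos. cring. Qed.

Lemma yvanish_scal n c f : yvanish n f -> yvanish n (c *: f).
Proof. intros Hf w Hw. unfold sscal. rewrite Hf by pos. cring. Qed.

Lemma yvanish_opp n f : yvanish n f -> yvanish n (- f).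
Proof. rewrite sopp_scal. apply yvanish_scal. Qed.

Lemma yvanish_mul n m f g : yvanish n f -> yvanish m g -> yvanish (n + m) (f * g).
Proof.
 intros Hf Hg w Hw. apply csum_zero. intros k Hk.
 assert (E : (count_occ bool_dec w true = count_occ bool_dec (firstn k w) true
        + count_occ bool_dec (skipn k w) true)%nat).
 { rewrite <- count_occ_app. now rewrite firstn_skipn. }
 destruct (lt_dec (count_occ bool_dec (firstn k w) true) n) as [H|H].
 - rewrite Hf by pos. cring.
 - rewrite Hg by lia. cring.
Qed.

Lemma yvanish_0 f : yvanish 0 f.
Proof. easy. Qed.

Lemma yvanish_bracket n m f g : yvanish n f -> yvanish m g -> yvanish (n + m) (bracket f g).
Proof.
 intros Hf Hg. apply yvanish_add; [now apply yvanish_mul|]. apply yvanish_opp.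
 rewrite Nat.add_comm. now apply yvanish_mul.
Qed.

Lemma yvanish_ssum n (F : nat -> ncs) : (forall k, yvanish n (F k)) -> yvanish n (ssum F).
Proof.
 intros H w Hw. unfold ssum. rewrite (CSeries_finite _ 0); [rewrite csum_O|intros]; now apply H.
Qed.

Lemma yvanish_ad k : yvanish 1 (ad_pow sx k sy).
Proof.
 induction k as [|k IH]; simpl.
 - intros w Hw. destruct w as [|[|] [|]]; simpl in *; try reflexivity; lia.
 - apply (yvanish_bracket 0 1); easy.
Qed.

Lemma yvanish_der p q n f : yvanish 1 p -> yvanish 2 q -> yvanish n f -> yvanish (S n) (der p q f).
Proof.
 intros Hp Hq Hf w; revert n f Hf.
 assert (HE : forall n f, yvanish n f -> yvanish (S n) (p * shift false f + q * shift true f)).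
 { intros n f Hf. apply yvanish_add.
  - apply (yvanish_mul 1 n); auto. intros v Hv. eauto.
  - apply (yvanish_mono (2 + (n - 1))); [lia|]. apply yvanish_mul; auto.
   intros v Hv. apply Hf. simpl. lia. }
 induction w as [|l w IH]; intros n f Hf Hw.
 - rewrite der_nil. apply (HE n f Hf). pos.
 - rewrite der_cons, (HE n f Hf) by pos.
  destruct l; simpl in Hw.
  + destruct n as [|n]; [lia|].
   rewrite (IH n); [cring| |lia]. intros v Hv. apply Hf. simpl. lia.
  + rewrite (IH n); [cring| |lia]. intros v Hv. eauto.
Qed.

Definition zcoef (k : nat) : C := RtoC (2 * INR (2 * k + 1) * zeta (2 * k + 2)).

Definition D0x : ncs := (sy + ssum (fun k => zcoef k *: ad_pow sx (2 * k + 2) sy))%ncs.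
Definition D0q (k : nat) : ncs :=
 (RtoC (/ 2) *: (fun w => sum_n (fun p : nat => (RtoC ((-1) ^ p) *:
   bracket (ad_pow sx p sy) (ad_pow sx (2 * k + 1 - p) sy))%ncs w) (2 * k + 1)))%ncs.
Definition D0y : ncs := ssum (fun k => zcoef k *: D0q k)%ncs.
Definition D0 : ncs -> ncs := der D0x D0y.

Lemma D0x_nil : D0x nil = 0. Proof. apply Dx_nil. Qed.
Lemma D0y_nil : D0y nil = 0. Proof. apply Dy_nil. Qed.

Lemma contin_D0 : contin D0.
Proof. apply contin_der; [apply D0x_nil | apply D0y_nil]. Qed.

Lemma D_tau_D0 tau f : D_tau tau f = ((tau / two_pi_i) *: D0 f)%ncs.
Proof.
 unfold D_tau. f_equal. unfold D0, D0x, D0y.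
 rewrite <- (sadd_zero_l (ssum (fun k => zcoef k *: D0q k)%ncs)), der_add_coef.
 f_equal.
 rewrite der_ssum_coef; [| apply graded_p2 | apply graded_q2 | |].
 - f_equal. apply functional_extensionality; intros k. now rewrite der_scal_coef.
 - intros k. unfold sscal. rewrite (p2_nil k : ad_pow sx (2 * k + 2) sy nil = 0). cring.
 - intros k. unfold sscal. rewrite (q2_nil k : D0q k nil = 0). cring.
Qed.

Lemma yvanish_D0 n f : yvanish n f -> yvanish (S n) (D0 f).
Proof.
 apply yvanish_der.
 - apply yvanish_add; [apply (yvanish_ad 0)|]. apply yvanish_ssum. intros k.
  apply yvanish_scal, yvanish_ad.
 - apply yvanish_ssum. intros k. apply yvanish_scal, yvanish_scal.
  intros w Hw. apply csum_zero. intros j Hj. refine (yvanish_scal 2 _ _ _ w Hw).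
  apply (yvanish_bracket 1 1); apply yvanish_ad.
Qed.

Lemma iter_D_tau tau f n :
 Nat.iter n (D_tau tau) f = (Cpow (tau / two_pi_i) n *: Nat.iter n D0 f)%ncs.
Proof.
 induction n as [|n IH]; simpl; [now rewrite sscal_one|].
 rewrite IH, D_tau_D0, (contin_scal _ contin_D0), sscal_sscal. pos.
Qed.

Lemma exp_der_val tau f w N : (length w <= N)%nat ->
 exp_der (D_tau tau) f w = sum_n (fun n => eseq (tau / two_pi_i) n * Nat.iter n D0 f w) N :> C.
Proof.
 intros HN. unfold exp_der, ssum. rewrite (CSeries_finite _ N).
 - apply csum_ext; intros k _. rewrite iter_D_tau. unfold sscal, eseq. cring.
 - intros n Hn. rewrite iter_D_tau. unfold sscal.
  replace (Nat.iter n D0 f w) with (RtoC 0); [cring|]. symmetry.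
  assert (Y : yvanish n (Nat.iter n D0 f)).
  { clear. induction n as [|n IH]; [apply yvanish_0 | now apply yvanish_D0]. }
  apply Y. assert (H := count_occ_bound bool_dec true w). lia.
Qed.

Lemma exp_der_sub tau f g w :
 exp_der (D_tau tau) (f - g) w = exp_der (D_tau tau) f w - exp_der (D_tau tau) g w.
Proof.
 rewrite !(exp_der_val tau _ w (length w)) by lia.
 unfold Cminus. replace (- sum_n (fun n => eseq (tau / two_pi_i) n * Nat.iter n D0 g w) (length w))
  with (- (1) * sum_n (fun n => eseq (tau / two_pi_i) n * Nat.iter n D0 g w) (length w)) by ring.
 rewrite <- csum_scal, <- csum_plus. apply csum_ext; intros k _.
 rewrite (contin_add _ (contin_iter _ k contin_D0)), (contin_opp _ _ (contin_iter _ k contin_D0)).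
 unfold sadd, sopp. cring.
Qed.

Lemma exp_der_bound w : exists B, 0 <= B /\ forall tau f,
 Cmod (exp_der (D_tau tau) f w) <= B * (1 + Cmod tau) ^ (length w) * nrm (length w) f.
Proof.
 set (N := length w).
 assert (H : forall m, exists B, 0 <= B /\ forall tau f,
   (m <= N)%nat -> (Cmod (sum_n (fun n => (eseq (tau / two_pi_i) n * Nat.iter n D0 f w)) m : C)
   <= B * (1 + Cmod tau) ^ N * nrm N f)).
 { assert (S1 : forall k, exists B, 0 <= B /\ forall tau f, (k <= N)%nat ->
    (Cmod (eseq (tau / two_pi_i) k * Nat.iter k D0 f w) <= B * (1 + Cmod tau) ^ N * nrm N f)).
  { intros k. destruct (contin_bounded N _ (contin_iter _ k contin_D0)) as [B [HB H]].
   exists (Cmod (eseq (/ two_pi_i) k) * B)%R. split.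
   { pos. }
   intros tau f Hk. rewrite Cmod_mult.
   replace (eseq (tau / two_pi_i) k) with (Cpow tau k * eseq (/ two_pi_i) k).
   2:{ unfold eseq, Cdiv. rewrite Cpow_mult_l. cring. }
   rewrite Cmod_mult, Cmod_pow.
   assert (P1 : Cmod tau ^ k <= (1 + Cmod tau) ^ N).
   { assert (H0 := Cmod_ge_0 tau). apply Rle_trans with ((1 + Cmod tau) ^ k)%R.
    - apply pow_incr. lra.
    - apply Rle_pow; pos. }
   assert (P2 : Cmod (Nat.iter k D0 f w) <= B * nrm N f).
   { eapply Rle_trans; [apply (nrm_coef N); unfold N; lia | apply H]. }
   replace (Cmod (eseq (/ two_pi_i) k) * B * (1 + Cmod tau) ^ N * nrm N f)%R with
    ((1 + Cmod tau) ^ N * Cmod (eseq (/ two_pi_i) k) * (B * nrm N f))%R by lra.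
   mono. }
  induction m as [|m [B [HB IH]]].
  - destruct (S1 O) as [B [HB H]]. exists B. split; auto. intros tau f Hm. rewrite csum_O.
   pos.
  - destruct (S1 (S m)) as [B' [HB' H]]. exists (B + B')%R. split; [lra|]. intros tau f Hm.
   rewrite csum_S. le_via Cmod_triangle.
   specialize (IH tau f ltac:(lia)). specialize (H tau f Hm). lra. }
 destruct (H N) as [B [HB HH]]. exists B. split; auto.
 intros tau f. rewrite (exp_der_val tau f w N) by pos. pos.
Qed.

Lemma exp_der_killed tau f : D0 f = szero -> exp_der (D_tau tau) f = f.
Proof.
 intros H. apply ncs_ext; intros w. rewrite (exp_der_val tau f w (length w)) by lia.
 rewrite (csum_one _ _ 0); [|lia|].
 - rewrite eseq_O. simpl; ring.
 - intros [|k] _ Hk; [congruence|].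
  replace (Nat.iter (S k) D0 f) with szero; [unfold szero; cring|].
  symmetry. rewrite Nat.iter_succ_r, H. clear - k. induction k as [|k IH]; auto.
  simpl. rewrite IH. apply (contin_zero _ contin_D0).
Qed.

(** * The exponential of the derivation on the limits of A and B *)

Section Target.

Variable beta : nat -> C.
Hypothesis beta_rec : forall n, convol (eseq two_pi_i) beta n = beta n + cseq 1 1 n.
Hypothesis pser_rec : forall n,
 pser zcoef n - convol (eseq (- two_pi_i)) (pser zcoef) n =
 match n with O => 0 | S m => two_pi_i * two_pi_i * beta m end.
Hypothesis two_pi_i_neq_0 : two_pi_i <> 0.
Let yt : ncs := (- Lser beta)%ncs.

Lemma D0_st : D0 st = szero.
Proof. apply D_st. Qed.

Lemma D0_yt : D0 yt = szero.
Proof. exact (D_yt two_pi_i beta zcoef two_pi_i_neq_0 beta_rec pser_rec). Qed.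

(** With c = 2 pi i, the n-th power of D puts (-c^2)^n yt^n to the right of X and leaves the other
    factors alone. With the weight (tau / c)^n / n! this sums to exp(-c tau yt), which cancels the
    exponential standing behind X. *)
Lemma exp_der_X tau f g : D0 f = szero -> D0 g = szero ->
 exp_der (D_tau tau) (f * sexp (two_pi_i *: sx) * sexp ((two_pi_i * tau) *: yt) * g)
 = (f * sexp (two_pi_i *: sx) * g)%ncs.
Proof.
 intros Hf Hg. assert (Yn : yt nil = 0) by apply yt_nil.
 assert (Ry := raising_smul yt Yn).
 set (X := sexp (two_pi_i *: sx)). set (g' := (sexp ((two_pi_i * tau) *: yt) * g)%ncs).
 assert (Hg' : D0 g' = szero).
 { unfold g', D0. rewrite der_smul by apply D0x_nil || apply D0y_nil. fold D0. rewrite Hg.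
  unfold D0. rewrite der_sexp; [rewrite smul_zero_l, smul_zero_r; apply sadd_zero_l| | | |].
  - apply D0x_nil. - apply D0y_nil. - unfold sscal. rewrite Yn. cring.
  - rewrite (contin_scal _ contin_D0), D0_yt. apply sscal_zero_r. }
 set (L := fun h => (f * (X * h) * g')%ncs).
 assert (HL : contin L).
 { split; unfold L; intros.
  - now rewrite smul_add_r, smul_add_r, smul_add_l.
  - now rewrite smul_scal_r, smul_scal_r, smul_scal_l.
  - apply (contin_vanish _ (contin_smul_r g')), (contin_vanish _ (contin_smul_l f)),
    (contin_vanish _ (contin_smul_l X)), H. }
 rewrite <- smul_assoc. fold g'.
 assert (E : exp_der (D_tau tau) (f * X * g') = L (sexp ((- (two_pi_i * tau)) *: yt))).
 { rewrite sexp_opser. unfold opser. rewrite (contin_ssum _ _ HL) by now apply graded_opser.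
  apply ncs_ext; intros w. rewrite (exp_der_val tau _ w (length w)) by lia.
  rewrite (ssum_graded _ w (length w)); [|apply (contin_graded _ _ HL); now apply graded_opser|lia].
  apply csum_ext; intros k _.
  rewrite (D_iter_X two_pi_i beta zcoef two_pi_i_neq_0 beta_rec pser_rec) by pos.
  fold yt X. rewrite (contin_scal _ HL). unfold sscal, L, spow.
  unfold eseq.
  replace (Cpow (- (two_pi_i * tau)) k) with (Cpow (tau / two_pi_i) k * Cpow (- (two_pi_i * two_pi_i)) k); [cring|].
  rewrite <- Cpow_mult_l. f_equal. now field. }
 rewrite E. unfold L, g'.
 replace (f * (X * sexp ((- (two_pi_i * tau)) *: yt)) * (sexp ((two_pi_i * tau) *: yt) * g))%ncs with
  (f * X * (sexp ((- (two_pi_i * tau)) *: yt) * sexp ((two_pi_i * tau) *: yt)) * g)%ncs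
  by (rewrite !smul_assoc; reflexivity).
 rewrite sexp_add by pos. replace (- (two_pi_i * tau) + two_pi_i * tau) with (RtoC 0) by ring.
 now rewrite sscal_zero_l, sexp_zero, smul_one_r.
Qed.

End Target.

End Operators.

#[export] Hint Resolve nrm_ge0 : pos.

(** * Complex series *)

Lemma Cmod_le_parts (z : C) : Cmod z <= Rabs (Re z) + Rabs (Im z).
Proof.
 destruct z as [x y]. unfold Cmod; simpl.
 apply Rsqr_incr_0_var; try pos.
 rewrite Rsqr_sqrt by nra. unfold Rsqr.
 assert (H1 := Rabs_pos x); assert (H2 := Rabs_pos y).
 assert (E1 : (x * x = Rabs x * Rabs x)%R) by (rewrite <- Rabs_mult, Rabs_pos_eq; nra).
 assert (E2 : (y * y = Rabs y * Rabs y)%R) by (rewrite <- Rabs_mult, Rabs_pos_eq; nra).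
 nra.
Qed.

Lemma Re_le_Cmod (z : C) : Rabs (Re z) <= Cmod z.
Proof. eapply Rle_trans; [|apply Rmax_Cmod]. apply Rmax_l. Qed.

Lemma Im_le_Cmod (z : C) : Rabs (Im z) <= Cmod z.
Proof. eapply Rle_trans; [|apply Rmax_Cmod]. apply Rmax_r. Qed.

Lemma Cmod_sub_sym (x y : C) : Cmod (x - y) = Cmod (y - x).
Proof. rewrite <- Cmod_opp. f_equal. ring. Qed.

Lemma Cmod_small (z : C) : (forall e, 0 < e -> Cmod z <= e) -> z = 0.
Proof.
 intros H. apply Cmod_eq_0. apply Rle_antisym; try pos.
 apply Rnot_lt_le. intros Hz. specialize (H (Cmod z / 2)%R ltac:(lra)). lra.
Qed.

Definition cser (a : nat -> C) (l : C) : Prop :=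
 forall e, 0 < e -> exists N, forall n, (N <= n)%nat -> Cmod (sum_n a n - l)%C < e.

Lemma cser_unique (a : nat -> C) (l l' : C) : cser a l -> cser a l' -> l = l'.
Proof.
 intros H H'. enough (E : l - l' = 0) by (replace l with (l - l' + l') by ring; rewrite E; ring).
 apply Cmod_small. intros e He.
 destruct (H (e / 2)%R ltac:(lra)) as [N HN]. destruct (H' (e / 2)%R ltac:(lra)) as [N' HN'].
 specialize (HN (N + N')%nat ltac:(lia)). specialize (HN' (N + N')%nat ltac:(lia)).
 set (s := sum_n a (N + N') : C) in *.
 replace (l - l') with ((s - l') - (s - l)) by ring.
 le_via Cmod_triangle. rewrite Cmod_opp. lra.
Qed.

Lemma cser_ext (a b : nat -> C) (l : C) : (forall n, a n = b n) -> cser a l -> cser b l.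
Proof. intros H. replace b with a; [trivial | now apply functional_extensionality]. Qed.

Lemma cser_plus (a b : nat -> C) (la lb : C) :
 cser a la -> cser b lb -> cser (fun n => a n + b n) (la + lb).
Proof.
 intros Ha Hb e He.
 destruct (Ha (e / 2)%R ltac:(lra)) as [N HN]. destruct (Hb (e / 2)%R ltac:(lra)) as [N' HN'].
 exists (N + N')%nat. intros n Hn. rewrite csum_plus.
 specialize (HN n ltac:(lia)). specialize (HN' n ltac:(lia)).
 set (s := sum_n a n : C) in *. set (s' := sum_n b n : C) in *.
 replace (s + s' - (la + lb)) with ((s - la) + (s' - lb)) by ring.
 eapply Rle_lt_trans; [apply Cmod_triangle|]. lra.
Qed.

Lemma cser_scal (k : C) (a : nat -> C) (l : C) : cser a l -> cser (fun n => k * a n) (k * l).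
Proof.
 intros Ha e He. assert (Hk := Cmod_ge_0 k).
 destruct (Ha (e / (1 + Cmod k))%R) as [N HN]; try pos.
 exists N. intros n Hn. rewrite csum_scal. specialize (HN n Hn).
 set (s := sum_n a n : C) in *. replace (k * s - k * l) with (k * (s - l)) by ring.
 rewrite Cmod_mult.
 apply Rmult_lt_compat_r with (r := (1 + Cmod k)%R) in HN; [|lra].
 unfold Rdiv in HN. rewrite Rmult_assoc, Rinv_l in HN by lra. nra.
Qed.

Lemma cser_head (a : nat -> C) (l : C) : cser (fun n => a (S n)) l -> cser a (a O + l).
Proof.
 intros H e He. destruct (H e He) as [N HN]. exists (S N). intros [|n] Hn; [lia|].
 rewrite csum_head. specialize (HN n ltac:(lia)).
 set (s := sum_n (fun k => a (S k)) n : C) in *.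
 replace (a O + s - (a O + l)) with (s - l) by ring. lra.
Qed.

Lemma cser_finite (a : nat -> C) N : (forall n, (N < n)%nat -> a n = 0) -> cser a (sum_n a N).
Proof.
 exists N. intros n Hn. rewrite (csum_extend a N n Hn H).
 replace (sum_n a N - sum_n a N) with (RtoC 0) by ring. rewrite Cmod_0. lra.
Qed.

Lemma is_series_limit (a : nat -> R) (l : R) : is_series a l ->
 forall e, 0 < e -> exists N, forall n, (N <= n)%nat -> Rabs (sum_n a n - l) < e.
Proof.
 intros H e He. specialize (H (ball l (mkposreal e He)) (locally_ball l (mkposreal e He))).
 pos.
Qed.

Lemma cser_parts (a : nat -> C) (l : C) :
 is_series (fun n => Re (a n)) (Re l) -> is_series (fun n => Im (a n)) (Im l) -> cser a l.
Proof.
 intros H1 H2 e He.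
 destruct (is_series_limit _ _ H1 (e / 2) ltac:(lra)) as [N1 HN1].
 destruct (is_series_limit _ _ H2 (e / 2) ltac:(lra)) as [N2 HN2].
 exists (N1 + N2)%nat. intros n Hn. specialize (HN1 n ltac:(lia)). specialize (HN2 n ltac:(lia)).
 eapply Rle_lt_trans; [apply Cmod_le_parts|].
 assert (E1 : Re (sum_n a n - l) = (sum_n (fun n => Re (a n)) n - Re l)%R)
  by (rewrite <- (Re_csum a n); reflexivity).
 assert (E2 : Im (sum_n a n - l) = (sum_n (fun n => Im (a n)) n - Im l)%R)
  by (rewrite <- (Im_csum a n); reflexivity).
 rewrite E1, E2. lra.
Qed.

Lemma is_series_of_limit (a : nat -> R) (l : R) :
 (forall e, 0 < e -> exists N, forall n, (N <= n)%nat -> Rabs (sum_n a n - l) < e) ->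
 is_series a l.
Proof.
 intros H P [e He]. destruct (H e (cond_pos e)) as [N HN]. exists N. intros n Hn.
 apply He. exact (HN n Hn).
Qed.

Lemma cser_Re (a : nat -> C) (l : C) : cser a l -> is_series (fun n => Re (a n)) (Re l).
Proof.
 intros H. apply is_series_of_limit. intros e He. destruct (H e He) as [N HN]. exists N.
 intros n Hn. specialize (HN n Hn). eapply Rle_lt_trans; [|exact HN].
 assert (E1 : Re (sum_n a n - l) = (sum_n (fun n => Re (a n)) n - Re l)%R)
  by (rewrite <- (Re_csum a n); reflexivity).
 rewrite <- E1. apply Re_le_Cmod.
Qed.

Lemma cser_Im (a : nat -> C) (l : C) : cser a l -> is_series (fun n => Im (a n)) (Im l).
Proof.
 intros H. apply is_series_of_limit. intros e He. destruct (H e He) as [N HN]. exists N.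
 intros n Hn. specialize (HN n Hn). eapply Rle_lt_trans; [|exact HN].
 assert (E1 : Im (sum_n a n - l) = (sum_n (fun n => Im (a n)) n - Im l)%R)
  by (rewrite <- (Im_csum a n); reflexivity).
 rewrite <- E1. apply Im_le_Cmod.
Qed.

Lemma cser_CSeries (a : nat -> C) (l : C) : cser a l -> CSeries a = l.
Proof.
 intros H. unfold CSeries. rewrite (is_series_unique _ _ (cser_Re a l H)), (is_series_unique _ _ (cser_Im a l H)).
 now destruct l.
Qed.

Lemma Cmod_csum (a : nat -> C) (b : nat -> R) n :
 (forall k, (k <= n)%nat -> Cmod (a k) <= b k) -> Cmod (sum_n a n : C) <= sum_n b n.
Proof.
 intros H; induction n as [|n IH].
 - rewrite csum_O, sum_O. pos.
 - rewrite csum_S, sum_Sn. le_via Cmod_triangle.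
  mono.
Qed.

Lemma ex_series_nonneg_le (b : nat -> R) n : (forall k, 0 <= b k) -> ex_series b ->
 sum_n b n <= Series b.
Proof.
 intros Hb [l Hl]. rewrite (is_series_unique _ _ Hl).
 apply Rnot_lt_le. intros H.
 destruct (is_series_limit _ _ Hl (sum_n b n - l) ltac:(lra)) as [N HN].
 specialize (HN (N + n)%nat ltac:(lia)).
 assert (M : sum_n b n <= sum_n b (N + n)).
 { clear HN. induction N as [|N IH]; try mono. change (S N + n)%nat with (S (N + n)). rewrite sum_Sn.
  specialize (Hb (S (N + n))). unfold plus; simpl. lra. }
 apply Rabs_def2 in HN. lra.
Qed.

Lemma cser_le (a : nat -> C) (l : C) (B : R) :
 cser a l -> (forall n, Cmod (sum_n a n : C) <= B) -> Cmod l <= B.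
Proof.
 intros H HB. apply Rnot_lt_le. intros Hl.
 destruct (H (Cmod l - B)%R ltac:(lra)) as [N HN]. specialize (HN N (le_n _)). specialize (HB N).
 set (s := sum_n a N : C) in *. assert (T := Cmod_triangle (- (s - l)) s).
 rewrite Cmod_opp in T. replace (- (s - l) + s) with l in T by ring. lra.
Qed.

Lemma cser_bound (a : nat -> C) (l : C) (b : nat -> R) :
 cser a l -> (forall n, Cmod (a n) <= b n) -> ex_series b -> Cmod l <= Series b.
Proof.
 intros H Hb Eb. apply (cser_le a); auto. intros n.
 eapply Rle_trans; [apply (Cmod_csum a b); intros; apply Hb|].
 apply ex_series_nonneg_le; auto. intros k. specialize (Hb k). assert (H0 := Cmod_ge_0 (a k)). lra.
Qed.

Lemma cser_exists (a : nat -> C) (b : nat -> R) :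
 (forall n, Cmod (a n) <= b n) -> ex_series b -> exists l, cser a l.
Proof.
 intros Hb Eb.
 destruct (ex_series_le (V := R_CompleteNormedModule) (fun n => Re (a n)) b) as [x Hx]; auto.
 { intros n. eapply Rle_trans; [apply (Re_le_Cmod (a n)) | apply Hb]. }
 destruct (ex_series_le (V := R_CompleteNormedModule) (fun n => Im (a n)) b) as [y Hy]; auto.
 { intros n. eapply Rle_trans; [apply (Im_le_Cmod (a n)) | apply Hb]. }
 exists (x, y). apply cser_parts; assumption.
Qed.

Lemma cser_csum (A : nat -> nat -> C) (l : nat -> C) J :
 (forall j, cser (fun n => A n j) (l j)) -> cser (fun n => sum_n (fun j => A n j) J) (sum_n l J).
Proof.
 intros H; induction J as [|J IH].
 - rewrite csum_O. apply cser_ext with (2 := H O). intros; now rewrite csum_O.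
 - rewrite csum_S. apply cser_ext with (2 := cser_plus _ _ _ _ IH (H (S J))).
  intros; now rewrite csum_S.
Qed.

(** Dominated convergence for series along an arbitrary filter: T controls the tail, and the finite
    head is treated term by term. If no x at all satisfies the bound, the filter is improper and
    there is nothing to prove; otherwise T is nonnegative. Hence the case distinction at the
    start. *)
Lemma tannery {X : Type} (F : (X -> Prop) -> Prop) (FF : Filter F) (g : X -> nat -> C) (T : nat -> R) :
 ex_series T ->
 F (fun x => forall n, Cmod (g x n) <= T n) ->
 (forall n e, 0 < e -> F (fun x => (Cmod (g x n) < e))) ->
 forall e, 0 < e -> F (fun x => forall l, cser (g x) l -> Cmod l < e).
Proof.
 intros ET HT Hg e He.
 destruct (classic (exists x : X, forall n, Cmod (g x n) <= T n)) as [[x0 H0]|Hno].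
 2:{ generalize HT. apply filter_imp. intros x Hx. exfalso. eauto. }
 assert (T0 : forall n, 0 <= T n) by (intros n; specialize (H0 n); assert (C0 := Cmod_ge_0 (g x0 n)); lra).
 destruct ET as [s Hs].
 destruct (is_series_limit _ _ Hs (e / 4) ltac:(lra)) as [N HN]. specialize (HN N (le_n _)).
 assert (HF : forall m e', 0 < e' -> F (fun x => (Cmod (sum_n (g x) m : C) < e'))).
 { induction m as [|m IH]; intros e' He'.
  - generalize (Hg O e' He'). apply filter_imp. intros x Hx. rewrite csum_O. lra.
  - assert (He2 : 0 < e' / 2) by lra.
   generalize (filter_and _ _ (IH _ He2) (Hg (S m) _ He2)). apply filter_imp. intros x [H1 H2]. rewrite csum_S.
   eapply Rle_lt_trans; [apply Cmod_triangle|]. lra. }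
 assert (He4 : 0 < e / 4) by lra.
 generalize (filter_and _ _ HT (HF N _ He4)). apply filter_imp.
 intros x [H1 H2] l Hl.
 assert (TN : forall n, (N <= n)%nat -> Cmod (sum_n (g x) n - sum_n (g x) N) <= sum_n T n - sum_n T N).
 { intros n Hn. induction Hn as [|n Hn IH].
  - replace (sum_n (g x) N - sum_n (g x) N) with (RtoC 0) by ring. rewrite Cmod_0. lra.
  - rewrite csum_S, sum_Sn. unfold plus; simpl.
   replace (sum_n (g x) n + g x (S n) - sum_n (g x) N) with
    ((sum_n (g x) n - sum_n (g x) N) + g x (S n)) by ring.
   le_via Cmod_triangle. specialize (H1 (S n)). lra. }
 destruct (Hl (e / 4)%R ltac:(lra)) as [N' HN']. specialize (HN' (N + N')%nat ltac:(lia)).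
 specialize (TN (N + N')%nat ltac:(lia)).
 assert (S1 : sum_n T (N + N') <= s).
 { rewrite <- (is_series_unique _ _ Hs). apply ex_series_nonneg_le; [exact T0 | now exists s]. }
 apply Rabs_def2 in HN.
 set (u := sum_n (g x) (N + N') : C) in *. set (v := sum_n (g x) N : C) in *.
 replace l with (- (u - l) + ((u - v) + v)) by ring.
 eapply Rle_lt_trans; [apply Cmod_triangle|]. rewrite Cmod_opp.
 assert (T1 := Cmod_triangle (u - v) v). lra.
Qed.

(** Tannery's theorem applied, for J going to infinity, to the remainders of the rows after J terms:
    they are dominated by 2 B, and their sum over n is l minus the J-th partial sum of the column
    sums. *)
Lemma cser_fubini (A : nat -> nat -> C) (B : nat -> R) (r : nat -> C) (l : C) :
 (forall n, ex_series (fun j => Cmod (A n j))) ->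
 (forall n, (Series (fun j => Cmod (A n j)) <= B n)) -> ex_series B ->
 (forall n, cser (A n) (r n)) -> cser r l ->
 forall s, (forall j, cser (fun n => A n j) (s j)) -> cser s l.
Proof.
 intros EA HB EB Hr Hl s Hs e He.
 set (g := fun J n => r n - sum_n (A n) J).
 assert (A0 : forall n J, Cmod (sum_n (A n) J : C) <= B n).
 { intros n J. eapply Rle_trans; [apply (Cmod_csum _ (fun j => Cmod (A n j))); intros; lra|].
  eapply Rle_trans; auto. apply ex_series_nonneg_le; [intros; apply Cmod_ge_0 | apply EA]. }
 assert (R0 : forall n, Cmod (r n) <= B n).
 { intros n. apply (cser_le (A n)); auto. }
 assert (G0 : forall J n, Cmod (g J n) <= 2 * B n).
 { intros J n. le_via Cmod_triangle. rewrite Cmod_opp.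
  specialize (A0 n J). specialize (R0 n). lra. }
 destruct ((tannery (@eventually) _ g (fun n => (2 * B n)%R)) (ex_series_scal_l 2%R B EB) ltac:(exists O; intros J _ n; apply G0)) with (e := e) as [N HN].
 - intros n e' He'. destruct (Hr n e' He') as [N HN]. exists N. intros J HJ.
  unfold g. rewrite Cmod_sub_sym. pos.
 - lra.
 - exists N. intros J HJ. specialize (HN J HJ (l - sum_n s J)).
  rewrite Cmod_sub_sym. apply HN. unfold g.
  replace (l - sum_n s J) with (l + - (1) * sum_n s J) by ring.
  apply cser_ext with (2 := (cser_plus _ _ _ _ Hl (cser_scal (- (1)) _ _ (cser_csum A s J Hs)))). intros n.
  change (sum_n (fun j => A n j) J) with (sum_n (A n) J). ring.
Qed.

Lemma cser_mult (a b : nat -> C) (la lb : C) :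
 cser a la -> cser b lb -> ex_series (fun n => Cmod (a n)) -> ex_series (fun n => Cmod (b n)) ->
 cser (convol a b) (la * lb).
Proof.
 intros Ha Hb Ea Eb.
 assert (AR : forall u : nat -> C, ex_series (fun n => Cmod (u n)) -> ex_series (fun n => Rabs (Re (u n)))).
 { intros u Hu. apply (ex_series_le (V := R_CompleteNormedModule) _ (fun n => Cmod (u n))); auto.
  intros n. rewrite Rabs_Rabsolu. apply Re_le_Cmod. }
 assert (AI : forall u : nat -> C, ex_series (fun n => Cmod (u n)) -> ex_series (fun n => Rabs (Im (u n)))).
 { intros u Hu. apply (ex_series_le (V := R_CompleteNormedModule) _ (fun n => Cmod (u n))); auto.
  intros n. rewrite Rabs_Rabsolu. apply Im_le_Cmod. }
 apply cser_parts.
 - apply is_series_ext with (2 := is_series_minus _ _ _ _ (is_series_mult _ _ _ _ (cser_Re _ _ Ha) (cser_Re _ _ Hb) (AR _ Ea) (AR _ Eb)) (is_series_mult _ _ _ _ (cser_Im _ _ Ha) (cser_Im _ _ Hb) (AI _ Ea) (AI _ Eb))).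
  intros n. unfold convol. rewrite Re_csum, sum_n_Reals.
  change (plus ?x (opp ?y)) with (x - y)%R. rewrite <- minus_sum. pos.
 - apply is_series_ext with (2 := is_series_plus _ _ _ _ (is_series_mult _ _ _ _ (cser_Re _ _ Ha) (cser_Im _ _ Hb) (AR _ Ea) (AI _ Eb)) (is_series_mult _ _ _ _ (cser_Im _ _ Ha) (cser_Re _ _ Hb) (AI _ Ea) (AR _ Eb))).
  intros n. unfold convol. rewrite Im_csum, sum_n_Reals.
  rewrite <- plus_sum. pos.
Qed.

(** * Expansions at 0 *)

Lemma pow_n_Cpow (s : C) n : pow_n (K := C_Ring) s n = Cpow s n.
Proof. pos. Qed.

Lemma is_pseries_cser (a : nat -> C) (s l : C) :
 is_pseries (K := C_AbsRing) (V := C_NormedModule) a s l <-> cser (fun n => a n * Cpow s n) l.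
Proof.
 assert (E : is_pseries (K := C_AbsRing) (V := C_NormedModule) a s l <->
       is_series (K := C_AbsRing) (V := C_NormedModule) (fun n => a n * Cpow s n) l).
 { split; apply is_series_ext; intros n; rewrite <- pow_n_Cpow; apply Cmult_comm. }
 rewrite E. split.
 - intros H e He.
  assert (He2 : 0 < e / 2) by lra.
  destruct (H (fun z => (Cmod (z - l) < e))) as [N HN]; [|exists N; exact HN].
  exists (mkposreal _ He2). intros z [H1 H2].
  eapply Rle_lt_trans; [apply Cmod_le_parts|].
  change (Rabs (Re z - Re l) < e / 2) in H1. change (Rabs (Im z - Im l) < e / 2) in H2.
  change (Re (z - l)) with (Re z - Re l)%R. change (Im (z - l)) with (Im z - Im l)%R. lra.
 - intros H P [e He]. destruct (H e (cond_pos e)) as [N HN]. exists N. intros n Hn.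
  apply He. specialize (HN n Hn). split.
  + change (Rabs (Re (sum_n (fun k => (a k * Cpow s k)) n - l)) < e).
   eapply Rle_lt_trans; [apply Re_le_Cmod | exact HN].
  + change (Rabs (Im (sum_n (fun k => (a k * Cpow s k)) n - l)) < e).
   eapply Rle_lt_trans; [apply Im_le_Cmod | exact HN].
Qed.

Definition has_expansion (phi : C -> C) (a : nat -> C) : Prop :=
 exists d, 0 < d /\ forall s : C, s <> 0 -> Cmod s < d -> cser (fun n => a n * Cpow s n) (phi s).

Lemma has_expansion_is phi (a : nat -> C) : has_expansion phi a <-> is_expansion phi a.
Proof.
 split.
 - intros [d [Hd H]].
  assert (Hd2 : 0 < d / 2) by lra. exists (mkposreal _ Hd2). intros s [H1 H2] Hs.
  apply is_pseries_cser, H; auto.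
  eapply Rle_lt_trans; [apply Cmod_le_parts|].
  change (Rabs (Re s - 0) < d / 2) in H1. change (Rabs (Im s - 0) < d / 2) in H2.
  rewrite Rminus_0_r in H1, H2. lra.
 - intros [d H]. exists d. split; [apply cond_pos|]. intros s Hs Hd.
  apply is_pseries_cser, H; auto. split.
  + change (Rabs (Re s - 0) < d). rewrite Rminus_0_r. eapply Rle_lt_trans; [apply Re_le_Cmod | exact Hd].
  + change (Rabs (Im s - 0) < d). rewrite Rminus_0_r. eapply Rle_lt_trans; [apply Im_le_Cmod | exact Hd].
Qed.

(** The identity theorem for a sum known at positive points only: continuity of the sum at 0 gives
    the constant term, and division by x shifts the sequence. *)
Lemma real_pseries_zero (a : nat -> R) (d : R) : 0 < d ->
 (forall x, 0 < x < d -> is_series (fun n => a n * x ^ n)%R 0%R) -> forall n, a n = 0%R.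
Proof.
 intros Hd H.
 assert (Hs : forall x, 0 < x < d -> PSeries a x = 0%R).
 { intros x Hx. apply is_series_unique. pos. }
 assert (CV : Rbar_lt 0 (CV_radius a)).
 { apply Rbar_lt_le_trans with (Finite (d / 2)); try pos.
  apply Rbar_not_lt_le. intros Hlt.
  apply (CV_disk_outside a (d / 2)).
  - rewrite Rabs_pos_eq by lra. pos.
  - apply ex_series_lim_0. exists 0%R. apply H. lra. }
 assert (main : forall b : nat -> R, Rbar_lt 0 (CV_radius b) ->
   (forall x, 0 < x < d -> PSeries b x = 0%R) -> b O = 0%R).
 { intros b Cb Hb. rewrite <- (PSeries_0 b).
  assert (Cont : continuity_pt (PSeries b) 0%R).
  { apply PSeries_continuity. rewrite Rabs_R0. pos. }

  destruct (Req_dec (PSeries b 0) 0) as [E|E]; auto.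
  assert (Ep : 0 < Rabs (PSeries b 0)) by now apply Rabs_pos_lt.
  destruct (Cont _ Ep) as [al [Hal HH]].
  destruct (Rmin_le al d) as [M1 M2].
  assert (M3 : 0 < Rmin al d) by pos.
  assert (K : Rabs (PSeries b (Rmin al d / 2) - PSeries b 0) < Rabs (PSeries b 0)).
  { apply HH. split; [split; [exact I | lra]|]. simpl. unfold Rdist.
   rewrite Rabs_pos_eq by lra. lra. }
  rewrite Hb in K by lra. rewrite Rminus_0_l, Rabs_Ropp in K. lra. }
 intros n. revert a H Hs CV. induction n as [|n IH]; intros a H Hs CV; auto.
 assert (H' : forall x, 0 < x < d -> is_series (fun n => PS_decr_1 a n * x ^ n)%R 0%R).
 { intros x Hx. assert (Hx' := H x Hx).
  assert (Hx2 : is_series (fun n => a (S n) * x ^ (S n))%R 0%R).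
  { apply (is_series_incr_1 (fun n => a n * x ^ n)%R).
   refine (eq_ind 0%R (fun l : R => is_series _ l) Hx' _ _).
   rewrite (main a CV Hs). change (0 = 0 + 0 * 1)%R. ring. }
  apply (is_series_scal_l (V := R_NormedModule) (/ x)%R) in Hx2.
  refine (eq_ind _ (fun l : R => is_series _ l) _ _ (Rmult_0_r (/ x))).
  apply is_series_ext with (2 := Hx2). intros k. change (/ x * (a (S k) * (x * x ^ k)) = a (S k) * x ^ k)%R.
  field. lra. }
 apply (IH (PS_decr_1 a)).
 - pos.
 - intros x Hx. apply is_series_unique. pos.
 - now rewrite CV_radius_decr_1.
Qed.

Lemma cpseries_zero (a : nat -> C) (d : R) : 0 < d ->
 (forall x : R, 0 < x < d -> cser (fun n => a n * Cpow x n) 0) -> forall n, a n = 0.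
Proof.
 intros Hd H n. apply C_eq.
 - apply (real_pseries_zero (fun n => Re (a n)) d Hd). intros x Hx.
  apply is_series_ext with (2 := cser_Re _ _ (H x Hx)). intros k.
  rewrite <- RtoC_pow. destruct (a k); simpl. ring.
 - apply (real_pseries_zero (fun n => Im (a n)) d Hd). intros x Hx.
  apply is_series_ext with (2 := cser_Im _ _ (H x Hx)). intros k.
  rewrite <- RtoC_pow. destruct (a k); simpl. ring.
Qed.

Lemma expansion_unique phi (a b : nat -> C) : has_expansion phi a -> has_expansion phi b ->
 forall n, a n = b n.
Proof.
 intros [d [Hd H]] [d' [Hd' H']] n.
 enough (E : a n + - (1) * b n = 0) by (replace (a n) with (a n + - (1) * b n + b n) by ring; rewrite E; ring).
 apply (cpseries_zero (fun n => a n + - (1) * b n) (Rmin d d')); try pos.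
 intros x Hx. destruct (Rmin_le d d') as [M1 M2].
 assert (X0 : RtoC x <> 0) by (intros E; apply RtoC_inj in E; lra).
 assert (X1 : Cmod x = x) by (rewrite Cmod_R; apply Rabs_pos_eq; lra).
 assert (K := cser_plus _ _ _ _ (H x X0 ltac:(lra)) (cser_scal (- (1)) _ _ (H' x X0 ltac:(lra)))).
 replace (phi x + - (1) * phi x) with (RtoC 0) in K by ring.
 apply cser_ext with (2 := K). intros k. ring.
Qed.

(** Uniqueness pins down the sequence chosen by [epsilon], so that [fun_ad] can be computed from any
    expansion found by hand. *)
Lemma expansion_eq phi (a : nat -> C) : has_expansion phi a -> forall n, expansion phi n = a n.
Proof.
 intros H. assert (E : is_expansion phi (expansion phi)).
 { unfold expansion. apply epsilon_spec. exists a. now apply has_expansion_is. }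
 apply expansion_unique with phi; [now apply has_expansion_is | exact H].
Qed.

Lemma fun_ad_eq phi (a : nat -> C) f g : has_expansion phi a ->
 fun_ad phi f g = opser a (bracket f) g.
Proof.
 intros H. unfold fun_ad, opser. f_equal. apply functional_extensionality; intros n.
 now rewrite (expansion_eq phi a H).
Qed.

(** * The complex exponential *)

Lemma Cexp_add (z w : C) : Cexp (z + w) = Cexp z * Cexp w.
Proof.
 destruct z as [x y], w as [x' y']. unfold Cexp. simpl.
 rewrite exp_plus, cos_plus, sin_plus. apply C_eq; simpl; ring.
Qed.

Lemma Cexp_0 : Cexp 0 = 1.
Proof. unfold Cexp. simpl. rewrite exp_0, cos_0, sin_0. apply C_eq; simpl; ring. Qed.

Lemma Cmod_Cexp (z : C) : Cmod (Cexp z) = exp (Re z).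
Proof.
 unfold Cexp. rewrite Cmod_mult, Cmod_R, Rabs_pos_eq by pos.
 replace (Cmod (cos (Im z), sin (Im z))) with 1%R; [ring|].
 unfold Cmod. simpl. rewrite !Rmult_1_r.
 replace (cos (Im z) * cos (Im z) + sin (Im z) * sin (Im z))%R with 1%R; [now rewrite sqrt_1|].
 assert (H := sin2_cos2 (Im z)). unfold Rsqr in H. lra.
Qed.

Lemma Cexp_neq_0 (z : C) : Cexp z <> 0.
Proof. apply Cmod_gt_0. rewrite Cmod_Cexp. pos. Qed.

Lemma Cexp_opp (z : C) : Cexp (- z) = / Cexp z.
Proof.
 apply (Cmult_cancel (Cexp z)); [apply Cexp_neq_0|].
 rewrite <- Cexp_add, Cinv_r by apply Cexp_neq_0. rewrite <- Cexp_0. f_equal. ring.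
Qed.

Lemma Cexp_nat (z : C) n : Cexp ((INR n) * z) = Cpow (Cexp z) n.
Proof.
 induction n as [|n IH].
 - simpl. rewrite <- Cexp_0. f_equal. ring.
 - rewrite S_INR, RtoC_plus. simpl Cpow. rewrite <- IH, <- Cexp_add. f_equal. ring.
Qed.

Lemma Re_Cexp (z : C) : Re (Cexp z) = (exp (Re z) * cos (Im z))%R.
Proof. simpl; lra. Qed.

Lemma Im_Cexp (z : C) : Im (Cexp z) = (exp (Re z) * sin (Im z))%R.
Proof. simpl; lra. Qed.

Lemma two_pi_i_val : two_pi_i = (0%R, (2 * PI)%R).
Proof. unfold two_pi_i, Cmult; simpl. f_equal; ring. Qed.

Lemma two_pi_i_neq_0 : two_pi_i <> 0.
Proof.
 intros H. apply (f_equal Im) in H. simpl in H.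
 assert (P := PI_RGT_0). lra.
Qed.

Lemma Cmod_two_pi_i : Cmod two_pi_i = (2 * PI)%R.
Proof.
 unfold two_pi_i. rewrite Cmod_mult, Cmod_R. assert (P := PI_RGT_0).
 rewrite Rabs_pos_eq by lra. replace (Cmod Ci) with 1%R; [ring|].
 unfold Cmod; simpl. replace (0 * (0 * 1) + 1 * (1 * 1))%R with 1%R by lra. now rewrite sqrt_1.
Qed.

Lemma Re_two_pi_i (z : C) : Re (two_pi_i * z) = (- (2 * PI) * Im z)%R.
Proof. destruct z; simpl. ring. Qed.

Lemma Im_two_pi_i (z : C) : Im (two_pi_i * z) = (2 * PI * Re z)%R.
Proof. destruct z; simpl. ring. Qed.

Lemma Cexp_two_pi_i : Cexp two_pi_i = 1.
Proof.
 rewrite two_pi_i_val. unfold Cexp; simpl. rewrite exp_0, cos_2PI, sin_2PI.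
 apply C_eq; simpl; ring.
Qed.

Lemma Cexp_eq_1 (z : C) : Cexp (two_pi_i * z) = 1 -> exists k : Z, z = (IZR k).
Proof.
 intros H. assert (P := PI_RGT_0).
 assert (H0 : Im z = 0%R).
 { assert (E := f_equal Cmod H). rewrite Cmod_Cexp, Cmod_1, <- exp_0 in E.
  apply exp_inv in E. rewrite Re_two_pi_i in E. nra. }
 assert (H1 : cos (2 * (PI * Re z)) = 1%R).
 { apply (f_equal Re) in H. rewrite Re_Cexp, Re_two_pi_i, Im_two_pi_i, H0 in H.
  replace (- (2 * PI) * 0)%R with 0%R in H by lra. rewrite exp_0, Rmult_1_l in H.
  rewrite <- Rmult_assoc. pos. }
 rewrite cos_2a_sin in H1.
 assert (H2 : sin (PI * Re z) = 0%R) by nra.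
 apply sin_eq_0_0 in H2. destruct H2 as [k Hk]. exists k. apply C_eq; simpl; auto.
 nra.
Qed.

(** * Derivatives along the real line *)

Definition rder (f : R -> C) (t : R) (l : C) : Prop :=
 forall e, 0 < e -> exists d, 0 < d /\ forall h : R, h <> 0%R -> Rabs h < d ->
  Cmod ((f (t + h)%R - f t) / RtoC h - l)%C < e.

Lemma RtoC_neq_0 (x : R) : x <> 0%R -> RtoC x <> 0.
Proof. intros H E. now apply RtoC_inj in E. Qed.

Lemma Cdiv_R (z : C) (h : R) : h <> 0%R -> z / h = ((Re z / h)%R, (Im z / h)%R).
Proof.
 intros Hh. destruct z as [x y].
 apply C_eq; simpl; field; exact Hh.
Qed.

Lemma rder_parts f t (l : C) :
 rder f t l <-> is_derive (fun s => Re (f s)) t (Re l) /\ is_derive (fun s => Im (f s)) t (Im l).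
Proof.
 split.
 - intros H; split; apply is_derive_Reals; intros e He; destruct (H e He) as [d [Hd HH]];
  exists (mkposreal d Hd); intros h Hh Hd'; specialize (HH h Hh Hd');
  rewrite Cdiv_R in HH by lra.
  + eapply Rle_lt_trans; [|exact HH].
   eapply Rle_trans; [|apply Re_le_Cmod]. easy.
  + eapply Rle_lt_trans; [|exact HH].
   eapply Rle_trans; [|apply Im_le_Cmod]. easy.
 - intros [H1 H2] e He. apply is_derive_Reals in H1. apply is_derive_Reals in H2.
  assert (He2 : 0 < e / 2) by lra.
  destruct (H1 _ He2) as [d1 D1]. destruct (H2 _ He2) as [d2 D2].
  exists (Rmin d1 d2). split; [apply Rmin_glb_lt; apply cond_pos|].
  intros h Hh Hd. destruct (Rmin_le d1 d2) as [M1 M2].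
  specialize (D1 h Hh ltac:(lra)). specialize (D2 h Hh ltac:(lra)).
  rewrite Cdiv_R by lra. eapply Rle_lt_trans; [apply Cmod_le_parts|].
  replace e with (e / 2 + e / 2)%R by lra.
  auto with real.
Qed.

Lemma rder_const (k : C) t : rder (fun _ => k) t 0.
Proof. apply rder_parts; split; apply (is_derive_const (V := R_NormedModule)). Qed.

Lemma rder_plus f g t lf lg : rder f t lf -> rder g t lg -> rder (fun s => f s + g s) t (lf + lg).
Proof.
 rewrite !rder_parts. intros [A B] [A' B']; split.
 - apply (is_derive_plus (V := R_NormedModule) _ _ _ _ _ A A').
 - apply (is_derive_plus (V := R_NormedModule) _ _ _ _ _ B B').
Qed.

Lemma rder_mult f g t lf lg : rder f t lf -> rder g t lg ->
 rder (fun s => f s * g s) t (lf * g t + f t * lg).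
Proof.
 rewrite !rder_parts. intros [A B] [A' B'].
 assert (M := fun u v lu lv (Hu : is_derive u t lu) (Hv : is_derive v t lv) =>
  is_derive_mult u v t lu lv Hu Hv Rmult_comm). split.
 - replace (Re (lf * g t + f t * lg)) with
   (plus (plus (mult (Re lf) (Re (g t))) (mult (Re (f t)) (Re lg)))
     (opp (plus (mult (Im lf) (Im (g t))) (mult (Im (f t)) (Im lg))))).
  2:{ destruct lf, lg, (f t), (g t). unfold plus, opp, mult; simpl. ring. }
  apply (is_derive_minus (V := R_NormedModule) (fun s => Re (f s) * Re (g s))%R (fun s => Im (f s) * Im (g s))%R);
  apply M; assumption.
 - replace (Im (lf * g t + f t * lg)) with
   (plus (plus (mult (Re lf) (Im (g t))) (mult (Re (f t)) (Im lg)))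
     (plus (mult (Im lf) (Re (g t))) (mult (Im (f t)) (Re lg)))).
  2:{ destruct lf, lg, (f t), (g t). unfold plus, mult; simpl. ring. }
  apply (is_derive_plus (V := R_NormedModule) (fun s => Re (f s) * Im (g s))%R (fun s => Im (f s) * Re (g s))%R);
  apply M; assumption.
Qed.

Lemma rder_scal (k : C) f t lf : rder f t lf -> rder (fun s => k * f s) t (k * lf).
Proof.
 intros H. replace (k * lf) with (0 * f t + k * lf) by ring.
 apply (rder_mult (fun _ => k) f t 0 lf); [apply rder_const | exact H].
Qed.

Lemma rder_id t : rder (fun s => s) t 1.
Proof.
 apply rder_parts; split; simpl; [apply (is_derive_id (K := R_AbsRing))|apply (is_derive_const (V := R_NormedModule))].
Qed.

Lemma rder_RtoC (f : R -> R) (t k : R) : is_derive f t k -> rder (fun s => (f s)) t k.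
Proof.
 intros H. apply rder_parts; split; auto.
 exact (is_derive_const (V := R_NormedModule) 0%R t).
Qed.

Lemma rder_ext_loc f g t l : (exists d, 0 < d /\ forall s, Rabs (s - t) < d -> f s = g s) ->
 rder f t l -> rder g t l.
Proof.
 intros [d [Hd E]] H e He. destruct (H e He) as [d' [Hd' H']].
 exists (Rmin d d'). split; try pos. intros h Hh Hm.
 destruct (Rmin_le d d') as [M1 M2].
 rewrite <- (E (t + h)%R), <- (E t).
 - apply H'; lra.
 - rewrite Rminus_diag, Rabs_R0. lra.
 - replace (t + h - t)%R with h by lra. lra.
Qed.

Lemma rder_ext f g t l : (forall s, f s = g s) -> rder f t l -> rder g t l.
Proof. intros E. apply rder_ext_loc. exists 1%R. auto with real. Qed.

Lemma rder_Cexp (w : C) t : rder (fun s => Cexp (s * w)) t (w * Cexp (t * w)).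
Proof.
 apply rder_parts. destruct w as [x y]. split.
 - apply (is_derive_ext (fun s => exp (s * x) * cos (s * y))%R).
  { intros s. unfold Cexp; simpl. replace (s * x - 0 * y)%R with (s * x)%R by lra.
   replace (s * y + 0 * x)%R with (s * y)%R by lra. ring. }
  auto_derive; auto. unfold Cexp; simpl.
  replace (t * x - 0 * y)%R with (t * x)%R by lra.
  replace (t * y + 0 * x)%R with (t * y)%R by lra. ring.
 - apply (is_derive_ext (fun s => exp (s * x) * sin (s * y))%R).
  { intros s. unfold Cexp; simpl. replace (s * x - 0 * y)%R with (s * x)%R by lra.
   replace (s * y + 0 * x)%R with (s * y)%R by lra. ring. }
  auto_derive; auto. unfold Cexp; simpl.
  replace (t * x - 0 * y)%R with (t * x)%R by lra.
  replace (t * y + 0 * x)%R with (t * y)%R by lra. ring.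
Qed.

Lemma rder_of_is_derive (f : R -> C) t (l : C) :
 is_derive (K := R_AbsRing) (V := C_R_NormedModule) f t l -> rder f t l.
Proof.
 intros H. apply rder_parts. split.
 - apply (filterdiff_ext_lin _ (fun y : R => Re (scal (V := C_R_ModuleSpace) y l))).
  + apply (filterdiff_comp' (U := R_NormedModule) (V := prod_NormedModule R_AbsRing R_NormedModule R_NormedModule)
    (W := R_NormedModule) f (fun p => fst p) t (fun y : R => scal y l) (fun p => fst p)); auto.
   apply filterdiff_linear, is_linear_fst.
  + pos.
 - apply (filterdiff_ext_lin _ (fun y : R => Im (scal (V := C_R_ModuleSpace) y l))).
  + apply (filterdiff_comp' (U := R_NormedModule) (V := prod_NormedModule R_AbsRing R_NormedModule R_NormedModule)
    (W := R_NormedModule) f (fun p => snd p) t (fun y : R => scal y l) (fun p => snd p)); auto.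
   apply filterdiff_linear, is_linear_snd.
  + pos.
Qed.

Lemma Re_scal_le (u z : C) : Rabs (Re (u * z)) <= Cmod u * Cmod z.
Proof. rewrite <- Cmod_mult. apply Re_le_Cmod. Qed.

(** The increment is rotated onto the positive real axis by the unit number u; the real mean value
    theorem is then applied to Re(u f) - phi. *)
Lemma mvt_bound (f f' : R -> C) (phi phi' : R -> R) a b : a <= b ->
 (forall t, a <= t <= b -> rder f t (f' t)) ->
 (forall t, a <= t <= b -> is_derive phi t (phi' t)) ->
 (forall t, a <= t <= b -> Cmod (f' t) <= phi' t) ->
 Cmod (f b - f a) <= phi b - phi a.
Proof.
 intros Hab Hf Hphi Hb.
 set (z := f b - f a). destruct (Ceq_dec z 0) as [Hz|Hz].
 { rewrite Hz, Cmod_0.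
  destruct (MVT_gen phi a b phi') as [c [Hc E]].
  - rewrite Rmin_left, Rmax_right by lra. intros; apply Hphi; lra.
  - rewrite Rmin_left, Rmax_right by lra. intros x Hx.
   apply derivable_continuous_pt. exists (phi' x). now apply is_derive_Reals, Hphi.
  - rewrite Rmin_left, Rmax_right in Hc by lra.
   specialize (Hb c Hc). assert (H0 := Cmod_ge_0 (f' c)). nra. }
 set (m := Cmod z). assert (Hm : 0 < m) by now apply Cmod_gt_0.
 set (u := Cconj z / m).
 assert (Hu : Cmod u = 1%R).
 { unfold u. rewrite Cmod_div by (apply RtoC_neq_0; lra). rewrite Cmod_conj, Cmod_R, Rabs_pos_eq by lra. fold m.
  field. lra. }
 set (g := fun t => (Re (u * f t) - phi t)%R).
 assert (Hg : forall t, a <= t <= b -> is_derive g t (Re (u * f' t) - phi' t)%R).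
 { intros t Ht. apply (is_derive_minus (V := R_NormedModule)).
  - exact (proj1 (proj1 (rder_parts _ _ _) (rder_scal u f t (f' t) (Hf t Ht)))).
  - pos. }
 destruct (MVT_gen g a b (fun t => Re (u * f' t) - phi' t)%R) as [c [Hc E]].
 - rewrite Rmin_left, Rmax_right by lra. intros; apply Hg; lra.
 - rewrite Rmin_left, Rmax_right by lra. intros x Hx.
  apply derivable_continuous_pt. exists (Re (u * f' x) - phi' x)%R. now apply is_derive_Reals, Hg.
 - rewrite Rmin_left, Rmax_right in Hc by lra.
  assert (S1 : Re (u * f' c) <= phi' c).
  { le_via Rle_abs. le_via Re_scal_le.
   rewrite Hu, Rmult_1_l. pos. }
  assert (S2 : (Re (u * f b) - Re (u * f a) = m)%R).
  { transitivity (Re (u * z)).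
   - simpl; lra.
   - unfold u. replace (Cconj z / m * z) with ((z * Cconj z) / m) by (unfold Cdiv; ring).
    rewrite <- Cmod2_conj. simpl. fold m. field. lra. }
  unfold g in E. nra.
Qed.

Lemma mvt_const (f f' : R -> C) (M : R) a b : a <= b ->
 (forall t, a <= t <= b -> rder f t (f' t)) ->
 (forall t, a <= t <= b -> Cmod (f' t) <= M) ->
 Cmod (f b - f a) <= M * (b - a).
Proof.
 intros Hab Hf Hb. replace (M * (b - a))%R with (M * b - M * a)%R by lra.
 apply (mvt_bound f f' (fun t => M * t)%R (fun _ => M) a b Hab Hf); auto.
 intros t _. auto_derive; lra.
Qed.

(** The derivative in t of the remainder of order N + 1 is w times the remainder of order N, so
    [mvt_bound] integrates the estimate; the parameter t is there for this induction. *)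
Lemma Cexp_taylor (w : C) N t : 0 <= t <= 1 ->
 Cmod (Cexp (t * w) - sum_n (eseq (t * w)) N) <=
  exp (Cmod w) * Cmod w ^ (S N) * (t ^ (S N) / INR (fact (S N))).
Proof.
 revert t.
 assert (Hw := Cmod_ge_0 w).
 assert (Eb : forall t, 0 <= t <= 1 -> Cmod (Cexp (t * w)) <= exp (Cmod w)).
 { intros t Ht. rewrite Cmod_Cexp.
  assert (H1 : Re (t * w) <= Cmod w).
  { le_via Rle_abs. le_via Re_scal_le.
   rewrite Cmod_R, Rabs_pos_eq by lra. nra. }
  mono. }
 induction N as [|N IH]; intros t Ht.
 - rewrite csum_O, eseq_O.
  assert (H := mvt_const (fun s => Cexp (s * w)) (fun s => w * Cexp (s * w))
    (Cmod w * exp (Cmod w)) 0 t (proj1 Ht)).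
  cbv beta in H. replace (Cexp (0 * w)) with (RtoC 1) in H by (rewrite Cmult_0_l; symmetry; apply Cexp_0).
  le_via H.
  + intros s _. apply rder_Cexp.
  + intros s Hs. rewrite Cmod_mult. apply Rmult_le_compat_l; [exact Hw | apply Eb; lra].
  + simpl. lra.
 - assert (Dq : forall n s, rder (fun s => sum_n (eseq (s * w)) (S n)) s (w * sum_n (eseq (s * w)) n)).
  { assert (D1 : forall n s, rder (fun s => eseq (s * w) (S n)) s (w * eseq (s * w) n)).
   { intros n s.
    apply (rder_ext (fun s => eseq w (S n) * RtoC (s ^ (S n)))).
    { intros x. unfold eseq. rewrite RtoC_pow, Cpow_mult_l. ring. }
    replace (w * eseq (s * w) n) with (eseq w (S n) * ((INR (S n)) * RtoC (s ^ n))).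
    - apply rder_scal. rewrite <- RtoC_mult. apply rder_RtoC.
     apply is_derive_Reals, (derivable_pt_lim_pow s (S n)).
    - replace (eseq w (S n) * ((INR (S n)) * RtoC (s ^ n))) with
      (((INR (S n)) * eseq w (S n)) * RtoC (s ^ n)) by ring.
     rewrite eseq_S. unfold eseq. rewrite RtoC_pow, Cpow_mult_l. ring. }
   induction n as [|n IHn]; intros s.
   - apply (rder_ext (fun s => 1 + eseq (s * w) 1)).
    { intros x. now rewrite csum_S, csum_O, eseq_O. }
    rewrite csum_O. replace (w * eseq (s * w) 0) with (0 + w * eseq (s * w) 0) by ring.
    apply rder_plus; [apply rder_const | apply D1].
   - apply (rder_ext (fun s => sum_n (eseq (s * w)) (S n) + eseq (s * w) (S (S n)))).
    { intros x. now rewrite <- csum_S. }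
    rewrite csum_S, Cmult_plus_distr_l. apply rder_plus; auto. }
  set (K := (exp (Cmod w) * Cmod w ^ (S (S N)))%R).
  assert (H := mvt_bound
   (fun s => Cexp (s * w) + - (1) * sum_n (eseq (s * w)) (S N))
   (fun s => w * Cexp (s * w) + - (1) * (w * sum_n (eseq (s * w)) N))
   (fun s => K * (s ^ (S (S N)) / INR (fact (S (S N)))))%R
   (fun s => K * (s ^ (S N) / INR (fact (S N))))%R 0 t (proj1 Ht)).
  assert (Z : Cexp (0 * w) + - (1) * sum_n (eseq (0 * w)) (S N) = 0).
  { rewrite Cmult_0_l, Cexp_0, (csum_extend (eseq 0) 0 (S N)); [|lia|].
   - rewrite csum_O, eseq_O. ring.
   - intros [|k] Hk; [lia|]. unfold eseq. simpl. ring. }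
  cbv beta in H. rewrite Z in H.
  replace (Cexp (t * w) + - (1) * sum_n (eseq (t * w)) (S N) - 0)
   with (Cexp (t * w) - sum_n (eseq (t * w)) (S N)) in H by ring.
  le_via H.
  + intros s Hs. apply rder_plus; [apply rder_Cexp | apply rder_scal, Dq].
  + intros s Hs.
   replace (K * (s ^ S N / INR (fact (S N))))%R with
    (K / INR (fact (S (S N))) * (INR (S (S N)) * s ^ S N))%R.
   * apply (is_derive_ext (fun s => K / INR (fact (S (S N))) * s ^ (S (S N)))%R).
    { intros x. lra. }
    apply is_derive_scal, is_derive_Reals, (derivable_pt_lim_pow s (S (S N))).
   * rewrite (fact_simpl (S N)), mult_INR. field. split; [apply INR_fact_neq_0 | apply not_0_INR; lia].
  + intros s Hs.
   replace (w * Cexp (s * w) + - (1) * (w * sum_n (eseq (s * w)) N))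
    with (w * (Cexp (s * w) - sum_n (eseq (s * w)) N)) by ring.
   rewrite Cmod_mult. specialize (IH s ltac:(lra)).
   unfold K. simpl (Cmod w ^ S (S N))%R.
   replace (exp (Cmod w) * (Cmod w * (Cmod w * Cmod w ^ N)) * (s ^ S N / INR (fact (S N))))%R
    with (Cmod w * (exp (Cmod w) * Cmod w ^ (S N) * (s ^ S N / INR (fact (S N)))))%R by (simpl; ring).
   mono.
  + simpl; lra.
Qed.

Lemma Cexp_bound (w : C) N :
 Cmod (Cexp w - sum_n (eseq w) N) <= exp (Cmod w) * (Cmod w ^ (S N) / INR (fact (S N))).
Proof.
 assert (H := Cexp_taylor w N 1 ltac:(lra)). rewrite Cmult_1_l, pow1 in H.
 lra.
Qed.

Lemma cser_Cexp (w : C) : cser (eseq w) (Cexp w).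
Proof.
 intros e He. assert (Hp := exp_pos (Cmod w)).
 destruct (cv_speed_pow_fact (Cmod w) (e / exp (Cmod w))%R) as [N HN]; try pos.
 exists N. intros n Hn. rewrite Cmod_sub_sym. eapply Rle_lt_trans; [apply Cexp_bound|].
 specialize (HN (S n) ltac:(lia)).
 apply Rabs_def2 in HN. destruct HN as [HN _].
 apply Rmult_lt_compat_l with (r := exp (Cmod w)) in HN; auto.
 replace (exp (Cmod w) * (e / exp (Cmod w)))%R with e in HN by (field; lra). lra.
Qed.

Lemma Cexp_m1_bound (w : C) : Cmod (Cexp w - 1) <= exp (Cmod w) * Cmod w.
Proof.
 assert (H := Cexp_bound w 0). rewrite csum_O, eseq_O in H. le_via H.
 simpl; lra.
Qed.

Lemma Cexp_m1w_bound (w : C) : Cmod (Cexp w - 1 - w) <= exp (Cmod w) * Cmod w ^ 2.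
Proof.
 assert (H := Cexp_bound w 1). rewrite csum_S, csum_O, eseq_O in H.
 replace (Cexp w - (1 + eseq w 1)) with (Cexp w - 1 - w) in H.
 2:{ unfold eseq. simpl. rewrite Rinv_1. ring. }
 le_via H. apply Rmult_le_compat_l; try pos.
 simpl. nra.
Qed.

(** * Complex differentiability *)

Definition ctend0 (r : C -> C) : Prop :=
 forall e, 0 < e -> exists d, 0 < d /\
  forall h : C, h <> 0 -> Cmod h < d -> Cmod (r h) < e.

Definition cder (f : C -> C) (z l : C) : Prop := ctend0 (fun h => (f (z + h) - f z) / h - l).

Lemma ctend0_ext_loc (r r' : C -> C) :
 (exists d, 0 < d /\ forall h : C, h <> 0 -> Cmod h < d -> r h = r' h) -> ctend0 r -> ctend0 r'.
Proof.
 intros [d [Hd E]] H e He. destruct (H e He) as [d' [Hd' H']].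
 exists (Rmin d d'). split; try pos. intros h Hh Hm.
 destruct (Rmin_le d d') as [M1 M2].
 rewrite <- E by pos. apply H'; trivial; lra.
Qed.

Lemma ctend0_ext (r r' : C -> C) : (forall h : C, h <> 0 -> r h = r' h) -> ctend0 r -> ctend0 r'.
Proof. intros E. apply ctend0_ext_loc. exists 1%R. auto with real. Qed.

Lemma ctend0_plus (r s : C -> C) : ctend0 r -> ctend0 s -> ctend0 (fun h => r h + s h).
Proof.
 intros Hr Hs e He. destruct (Hr (e / 2)%R ltac:(lra)) as [d [Hd H]].
 destruct (Hs (e / 2)%R ltac:(lra)) as [d' [Hd' H']].
 exists (Rmin d d'). split; try pos. intros h Hh Hm.
 destruct (Rmin_le d d') as [M1 M2].
 specialize (H h Hh ltac:(lra)). specialize (H' h Hh ltac:(lra)).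
 eapply Rle_lt_trans; [apply Cmod_triangle|]. lra.
Qed.

Lemma ctend0_bounded (r s : C -> C) (M : R) :
 (exists d, 0 < d /\ forall h : C, h <> 0 -> Cmod h < d -> Cmod (s h) <= M) ->
 ctend0 r -> ctend0 (fun h => s h * r h).
Proof.
 intros [d [Hd HM]] Hr e He.
 destruct (Hr (e / (1 + Rabs M))%R) as [d' [Hd' H']].
 { apply Rdiv_lt_0_compat; auto. assert (P := Rabs_pos M). lra. }
 exists (Rmin d d'). split; try pos. intros h Hh Hm.
 destruct (Rmin_le d d') as [M1 M2].
 specialize (HM h Hh ltac:(lra)). specialize (H' h Hh ltac:(lra)).
 rewrite Cmod_mult. assert (P := Rabs_pos M). assert (P2 := Rle_abs M).
 assert (C1 := Cmod_ge_0 (r h)).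
 apply Rmult_lt_compat_l with (r := (1 + Rabs M)%R) in H'; [|lra].
 replace ((1 + Rabs M) * (e / (1 + Rabs M)))%R with e in H' by (field; lra). nra.
Qed.

Lemma ctend0_scal (k : C) (r : C -> C) : ctend0 r -> ctend0 (fun h => k * r h).
Proof.
 apply (ctend0_bounded r (fun _ => k) (Cmod k)). exists 1%R. auto with real.
Qed.

Lemma ctend0_id : ctend0 (fun h => h).
Proof. intros e He. eauto. Qed.

Lemma ctend0_mult (r s : C -> C) : ctend0 r -> ctend0 s -> ctend0 (fun h => r h * s h).
Proof.
 intros Hr. apply (ctend0_bounded s r 1). destruct (Hr 1%R ltac:(lra)) as [d [Hd H]].
 exists d. auto with real.
Qed.

Lemma cder_cont (f : C -> C) z (l : C) : cder f z l -> ctend0 (fun h => f (z + h) - f z).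
Proof.
 intros H. apply (ctend0_ext (fun h => h * ((f (z + h) - f z) / h - l) + l * h)).
 - intros h Hh. now field.
 - apply ctend0_plus; [apply ctend0_mult; [apply ctend0_id | exact H] | apply ctend0_scal, ctend0_id].
Qed.

Lemma ctend0_zero : ctend0 (fun _ => 0).
Proof. exists 1%R. split; [lra|]. now rewrite Cmod_0. Qed.

Lemma cder_const (k z : C) : cder (fun _ => k) z 0.
Proof. apply (ctend0_ext (fun _ => 0)); [|apply ctend0_zero]. intros h Hh. now field. Qed.

Lemma cder_plus (f g : C -> C) z (lf lg : C) : cder f z lf -> cder g z lg -> cder (fun s => f s + g s) z (lf + lg).
Proof.
 intros Hf Hg. apply (ctend0_ext (fun h => ((f (z + h) - f z) / h - lf) + ((g (z + h) - g z) / h - lg))).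
 - intros h Hh. now field.
 - now apply ctend0_plus.
Qed.

Lemma cder_mult (f g : C -> C) z (lf lg : C) : cder f z lf -> cder g z lg ->
 cder (fun s => f s * g s) z (lf * g z + f z * lg).
Proof.
 intros Hf Hg.
 apply (ctend0_ext (fun h => g z * ((f (z + h) - f z) / h - lf) + f z * ((g (z + h) - g z) / h - lg)
   + ((f (z + h) - f z) * ((g (z + h) - g z) / h - lg) + lg * (f (z + h) - f z)))).
 - intros h Hh. now field.
 - assert (Cf := cder_cont _ _ _ Hf).
  repeat apply ctend0_plus; try apply ctend0_scal; trivial. now apply ctend0_mult.
Qed.

Lemma cder_scal (k : C) (f : C -> C) z (lf : C) : cder f z lf -> cder (fun s => k * f s) z (k * lf).
Proof.
 intros Hf. apply (ctend0_ext (fun h => k * ((f (z + h) - f z) / h - lf))).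
 - intros h Hh. now field.
 - now apply ctend0_scal.
Qed.

Lemma cder_inv (f : C -> C) z (lf : C) : f z <> 0 -> cder f z lf -> cder (fun s => / f s) z (- lf / (f z * f z)).
Proof.
 intros H0 Hf. assert (Cf := cder_cont _ _ _ Hf).
 assert (Hm : 0 < Cmod (f z)) by (apply Cmod_gt_0; exact H0).
 destruct (Cf (Cmod (f z) / 2)%R ltac:(lra)) as [d [Hd H]].
 assert (LB : forall h : C, h <> 0 -> Cmod h < d -> Cmod (f z) / 2 <= Cmod (f (z + h))).
 { intros h Hh Hm'. specialize (H h Hh Hm').
  assert (T := Cmod_triangle (f (z + h)) (- (f (z + h) - f z))).
  rewrite Cmod_opp in T. replace (f (z + h) + - (f (z + h) - f z)) with (f z) in T by ring. lra. }
 assert (NZ : forall h : C, h <> 0 -> Cmod h < d -> f (z + h) <> 0).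
 { intros h Hh Hm' E. specialize (LB h Hh Hm'). rewrite E, Cmod_0 in LB. lra. }
 apply (ctend0_ext_loc (fun h => (/ (f z * f z * f (z + h))) *
   (- (f z) * ((f (z + h) - f z) / h - lf) + lf * (f (z + h) - f z)))).
 - exists d. split; auto. intros h Hh Hm'. field. pos.
 - apply (ctend0_bounded _ _ (/ (Cmod (f z) * Cmod (f z) * (Cmod (f z) / 2)))).
  + exists d. split; auto. intros h Hh Hm'.
   rewrite Cmod_inv, !Cmod_mult by (repeat apply Cmult_neq_0; trivial; now apply NZ).
   mono.
  + apply ctend0_plus; apply ctend0_scal; assumption.
Qed.

Lemma cder_shift (f : C -> C) (a z l : C) : cder f (a + z) l -> cder (fun s => f (a + s)) z l.
Proof.
 apply (ctend0_ext (fun h => (f (a + z + h) - f (a + z)) / h - l)); auto.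
 intros h Hh. now rewrite Cplus_assoc.
Qed.

Lemma cder_ext_loc (f g : C -> C) z (l : C) :
 (exists d, 0 < d /\ forall h : C, Cmod h < d -> f (z + h) = g (z + h)) ->
 cder f z l -> cder g z l.
Proof.
 intros [d [Hd E]]. apply ctend0_ext_loc. exists d. split; auto. intros h Hh Hm.
 rewrite E by lra. assert (E0 := E 0). rewrite Cplus_0_r, Cmod_0 in E0. now rewrite E0.
Qed.

Lemma cder_ext (f g : C -> C) z (l : C) : (forall s, f s = g s) -> cder f z l -> cder g z l.
Proof. intros E. apply cder_ext_loc. exists 1%R. auto with real. Qed.

Lemma ctend0_Cexp (k : C) : ctend0 (fun h => (Cexp (k * h) - 1) / h - k).
Proof.
 assert (Hk := Cmod_ge_0 k).
 assert (H : ctend0 (fun h => RtoC (exp (Cmod k) * Cmod k ^ 2) * h)) by apply ctend0_scal, ctend0_id.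
 intros e He. destruct (H e He) as [d [Hd HH]].
 exists (Rmin d 1). split; try pos. intros h Hh Hm.
 destruct (Rmin_le d 1) as [M1 M2].
 eapply Rle_lt_trans; [|apply (HH h Hh); lra].
 replace ((Cexp (k * h) - 1) / h - k) with ((Cexp (k * h) - 1 - k * h) / h) by now field.
 rewrite Cmod_div by pos. rewrite Cmod_mult, Cmod_R, Rabs_pos_eq.
 2:{ pos. }
 assert (Hp : 0 < Cmod h) by now apply Cmod_gt_0.
 apply (Rmult_le_reg_r (Cmod h)); auto.
 replace (Cmod (Cexp (k * h) - 1 - k * h) / Cmod h * Cmod h)%R with (Cmod (Cexp (k * h) - 1 - k * h))
  by (field; lra).
 le_via Cexp_m1w_bound. rewrite Cmod_mult.
 assert (E : exp (Cmod k * Cmod h) <= exp (Cmod k)).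
 { destruct (Rle_lt_or_eq_dec (Cmod k * Cmod h) (Cmod k)) as [L|L]; [nra| |].
  - mono.
  - mono. }
 replace (exp (Cmod k) * Cmod k ^ 2 * Cmod h * Cmod h)%R with (exp (Cmod k) * (Cmod k * Cmod h) ^ 2)%R by lra.
 mono.
Qed.

Lemma cder_Cexp (k z : C) : cder (fun s => Cexp (k * s)) z (k * Cexp (k * z)).
Proof.
 apply (ctend0_ext (fun h => Cexp (k * z) * ((Cexp (k * h) - 1) / h - k))).
 - intros h Hh. replace (k * (z + h)) with (k * z + k * h) by ring. rewrite Cexp_add. now field.
 - apply ctend0_scal, ctend0_Cexp.
Qed.

Lemma cder_of_is_derive (f : C -> C) (z l : C) :
 is_derive (K := C_AbsRing) (V := C_NormedModule) f z l -> cder f z l.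
Proof.
 intros [_ H] e He.
 assert (He2 : 0 < e / 2) by lra.
 specialize (H z (fun P HP => HP) (mkposreal _ He2)).
 destruct H as [d Hd]. exists d. split; [apply cond_pos|]. intros h Hh Hm.
 specialize (Hd (z + h)).
 assert (B : ball (M := AbsRing_UniformSpace C_AbsRing) z d (z + h)).
 { change (Cmod (z + h + - z) < d). replace (z + h + - z) with h by ring. lra. }
 specialize (Hd B). change (Cmod (f (z + h) + - f z + - ((z + h + - z) * l)) <= e / 2 * Cmod (z + h + - z)) in Hd.
 replace (z + h + - z) with h in Hd by ring.
 replace ((f (z + h) - f z) / h - l) with ((f (z + h) + - f z + - (h * l)) / h) by now field.
 assert (Hp : 0 < Cmod h) by now apply Cmod_gt_0.
 rewrite Cmod_div by pos. apply (Rmult_lt_reg_r (Cmod h)); auto.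
 replace (Cmod (f (z + h) + - f z + - (h * l))%C / Cmod h * Cmod h)%R with
  (Cmod (f (z + h) + - f z + - (h * l))) by (field; lra). nra.
Qed.

Lemma rder_comp (f : C -> C) (gam : R -> C) t (l k : C) :
 cder f (gam t) l -> rder gam t k -> rder (fun s => f (gam s)) t (l * k).
Proof.
 intros Hf Hg e He.
 assert (Hl := Cmod_ge_0 l). assert (Hk := Cmod_ge_0 k).
 set (e1 := (e / (2 * (1 + Cmod l)))%R).
 assert (He1 : 0 < e1) by pos.
 set (e2 := (e / (2 * (2 + Cmod k)))%R).
 assert (He2 : 0 < e2) by pos.
 destruct (Hf e2 He2) as [d2 [Hd2 H2]].
 destruct (Hg (Rmin e1 1) ltac:(pos)) as [d1 [Hd1 H1]].
 exists (Rmin d1 (d2 / (2 + Cmod k))). split.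
 { pos. }
 intros h Hh Hm.
 destruct (Rmin_le d1 (d2 / (2 + Cmod k))) as [M1 M2].
 destruct (Rmin_le e1 1) as [m1 m2].
 specialize (H1 h Hh ltac:(lra)).
 set (D := gam (t + h)%R - gam t) in *. assert (HC := RtoC_neq_0 h Hh).
 set (Q := D / h) in *.
 assert (HQ : Cmod Q <= 1 + Cmod k).
 { replace Q with ((Q - k) + k) by ring. le_via Cmod_triangle. lra. }
 (* The increment D of gam may be 0, where the difference quotient of f makes no sense; r = 0 serves
    there. *)
 assert (Hr : exists r : C, Cmod r <= e2 /\ f (gam (t + h)%R) - f (gam t) = D * (l + r)).
 { destruct (Ceq_dec D 0) as [D0|D0].
  - exists 0. rewrite Cmod_0. split; [lra|]. rewrite D0.
   replace (gam (t + h)%R) with (gam t); [ring|].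
   replace (gam (t + h)%R) with (D + gam t) by (unfold D; ring). rewrite D0. ring.
  - exists ((f (gam t + D) - f (gam t)) / D - l). split.
   + left. apply H2; auto. replace D with (h * Q) by (unfold Q; field; exact HC). rewrite Cmod_mult, Cmod_R.
    assert (P : 0 <= Rabs h) by pos.
    apply Rle_lt_trans with (Rabs h * (2 + Cmod k))%R; [nra|].
    assert (Z : Rabs h < d2 / (2 + Cmod k)) by lra.
    apply Rmult_lt_compat_r with (r := (2 + Cmod k)%R) in Z; [|lra].
    replace (d2 / (2 + Cmod k) * (2 + Cmod k))%R with d2 in Z by (field; lra). lra.
   + replace (gam t + D) with (gam (t + h)%R) by (unfold D; ring). now field. }
 destruct Hr as [r [Hr E]]. rewrite E.
 replace (D * (l + r) / h - l * k) with (l * (Q - k) + r * Q).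
 2:{ unfold Q. now field. }
 eapply Rle_lt_trans; [apply Cmod_triangle|]. rewrite !Cmod_mult.
 assert (Cr := Cmod_ge_0 r).
 assert (Z3 : ((1 + Cmod l) * e1 = e / 2)%R) by (unfold e1; field; lra).
 assert (Z4 : (e2 * (2 + Cmod k) = e / 2)%R) by (unfold e2; field; lra). nra.
Qed.

(** * The expansion of s/(exp(cs)-1) *)

Lemma recip_exists (a : nat -> C) : a O <> 0 ->
 exists b : nat -> C, forall n, convol a b n = cseq 1 0 n.
Proof.
 (* Course-of-values recursion: [R n] is a sequence already correct up to index n, and b reads off
    the diagonal. *)
 set (step := fun (b : nat -> C) (n k : nat) =>
  if Nat.leb k n then b k else - (/ a O) * sum_n (fun i => a (S i) * b (n - i)%nat) n).
 set (R := fix R n := match n with O => fun _ => / a O | S m => step (R m) m end).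
 set (b := fun n => R n n).
 assert (Rb : forall n k, (k <= n)%nat -> R n k = b k).
 { induction n as [|n IH]; intros k Hk; [replace k with O by lia; reflexivity|].
  destruct (Nat.eq_dec k (S n)) as [->|Hne]; auto.
  simpl. unfold step. rewrite (proj2 (Nat.leb_le k n)) by lia. apply IH; lia. }
 exists b. intros [|n].
 - unfold convol. rewrite csum_O. unfold b, cseq; simpl. now field.
 - unfold convol. rewrite csum_head. rewrite Nat.sub_0_r.
  assert (E : b (S n) = - (/ a O) * sum_n (fun i => a (S i) * b (n - i)%nat) n).
  { unfold b at 1. simpl. unfold step. rewrite (proj2 (Nat.leb_gt (S n) n)) by lia.
   f_equal. apply csum_ext; intros k Hk. now rewrite Rb by lia. }
  rewrite E. unfold cseq; simpl.
  now field.
Qed.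

Lemma recip_bound (a b : nat -> C) (A : R) : a O <> 0 -> 1 <= A ->
 (forall n, Cmod (a n) <= Cmod (a O) * A ^ n) ->
 (forall n, convol a b n = cseq 1 0 n) ->
 forall n, Cmod (b n) <= / Cmod (a O) * (2 * A) ^ n.
Proof.
 intros Ha HA Hb Hc. assert (Hm : 0 < Cmod (a O)) by (apply Cmod_gt_0; exact Ha).
 assert (B0 : b O = / a O).
 { specialize (Hc O). unfold convol in Hc. rewrite csum_O in Hc. unfold cseq in Hc; simpl in Hc.
  apply (Cmult_cancel (a O)); auto. rewrite Hc. now field. }
 induction n as [n IH] using lt_wf_ind. destruct n as [|n].
 - rewrite B0, Cmod_inv by pos. lra.
 - assert (E : a O * b (S n) = - sum_n (fun i => a (S i) * b (n - i)%nat) n).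
  { specialize (Hc (S n)). unfold convol in Hc. rewrite csum_head in Hc.
   unfold cseq in Hc. simpl in Hc. set (S0 := sum_n (fun i => a (S i) * b (n - i)%nat) n : C) in *.
   replace (a O * b (S n)) with (a O * b (S n) + S0 - S0) by ring. rewrite Hc. ring. }
  apply (Rmult_le_reg_l (Cmod (a O))); auto.
  rewrite <- Cmod_mult, E, Cmod_opp.
  replace (Cmod (a O) * (/ Cmod (a O) * (2 * A) ^ S n))%R with ((2 * A) ^ S n)%R by (field; lra).
  (* The majorants A^(i+1) (2A)^(n-i) sum exactly to this telescoping difference; the factor 2 in 2A
     keeps it below (2A)^(n+1). *)
  assert (P : forall m, (m <= n)%nat ->
   (Cmod (sum_n (fun i => (a (S i) * b (n - i)%nat)) m : C) <= (2 * A) ^ S n - A ^ (S m) * (2 * A) ^ (n - m))).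
  { induction m as [|m IHm]; intros Hmn.
   - rewrite csum_O, Cmod_mult, Nat.sub_0_r.
    specialize (Hb 1%nat).
    apply Rle_trans with (A * (2 * A) ^ n)%R; [|simpl; nra].
    replace (A * (2 * A) ^ n)%R with ((Cmod (a O) * A) * (/ Cmod (a O) * (2 * A) ^ n))%R by (field; lra).
    mono.
   - rewrite csum_S. le_via Cmod_triangle.
    specialize (IHm ltac:(lia)). rewrite Cmod_mult.
    specialize (IH (n - S m)%nat ltac:(lia)).
    assert (T : Cmod (a (S (S m))) * Cmod (b (n - S m)%nat) <= A ^ S (S m) * (2 * A) ^ (n - S m)).
    { replace (A ^ S (S m) * (2 * A) ^ (n - S m))%R with
      ((Cmod (a O) * A ^ S (S m)) * (/ Cmod (a O) * (2 * A) ^ (n - S m)))%R by (field; lra).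
     mono. }
    replace (A ^ S m * (2 * A) ^ (n - m))%R with (2 * (A ^ S (S m) * (2 * A) ^ (n - S m)))%R in IHm.
    2:{ replace (n - m)%nat with (S (n - S m)) by lia. simpl; lra. }
    lra. }
  specialize (P n (le_n n)). rewrite Nat.sub_diag in P.
  assert (Q := pow_le A (S n) ltac:(lra)). lra.
Qed.

Lemma geom_ex (x : R) : Rabs x < 1 -> ex_series (fun n => x ^ n)%R.
Proof. intros H. apply ex_series_geom. lra. Qed.

Lemma ex_series_Rle (u v : nat -> R) :
 (forall n, 0 <= u n <= v n) -> ex_series v -> ex_series u.
Proof.
 intros H. apply (ex_series_le (V := R_CompleteNormedModule)). intros n.
 rewrite Rabs_pos_eq; apply H.
Qed.

Lemma ex_series_geom_bound (a : nat -> C) (B K : R) (s : C) : 0 <= B -> 0 <= K ->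
 (forall n, Cmod (a n) <= B * K ^ n) -> K * Cmod s < 1 ->
 ex_series (fun n => Cmod (a n * Cpow s n)).
Proof.
 intros HB HK Ha Hs.
 apply (ex_series_Rle _ (fun n => B * (K * Cmod s) ^ n)%R).
 - split; try pos. rewrite Cmod_mult, Cmod_pow, Rpow_mult_distr, <- Rmult_assoc.
  mono.
 - apply (ex_series_scal_l B (fun n => (K * Cmod s) ^ n)%R). apply geom_ex.
  rewrite Rabs_pos_eq; auto. pos.
Qed.

Lemma convol_weight (a b : nat -> C) (s : C) n :
 convol (fun n => a n * Cpow s n) (fun n => b n * Cpow s n) n = convol a b n * Cpow s n.
Proof.
 unfold convol. rewrite Cmult_comm, <- csum_scal. apply csum_ext; intros k Hk.
 replace (Cpow s n) with (Cpow s k * Cpow s (n - k)); [ring|].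
 rewrite <- Cpow_add_r. f_equal. lia.
Qed.

Lemma cser_cseq (k : C) j (s : C) : cser (fun n => cseq k j n * Cpow s n) (k * Cpow s j).
Proof.
 replace (k * Cpow s j) with (sum_n (fun n => cseq k j n * Cpow s n) j : C).
 - apply cser_finite. intros n Hn. unfold cseq. rewrite (proj2 (Nat.eqb_neq n j)) by lia. ring.
 - rewrite (csum_one _ _ j); [unfold cseq; now rewrite Nat.eqb_refl | lia|].
  intros i _ Hi. unfold cseq. rewrite (proj2 (Nat.eqb_neq i j)) by pos. ring.
Qed.

Lemma Cmod_eseq (w : C) n : Cmod (eseq w n) <= Cmod w ^ n.
Proof.
 unfold eseq. rewrite Cmod_mult, Cmod_pow, Cmod_R.
 assert (P := pow_le (Cmod w) n (Cmod_ge_0 w)).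
 rewrite <- (Rmult_1_l (Cmod w ^ n)) at 2. apply Rmult_le_compat_r; auto.
 rewrite Rabs_pos_eq; [|left; apply Rinv_0_lt_compat, INR_fact_lt_0].
 rewrite <- Rinv_1. apply Rinv_le_contravar; [lra|]. apply (le_INR 1). apply lt_O_fact.
Qed.

Lemma eseq_scal (k s : C) n : eseq k n * Cpow s n = eseq (k * s) n.
Proof. unfold eseq. rewrite Cpow_mult_l. ring. Qed.

(** The sequence is c^(n-1) B_n / n!, with B_n the Bernoulli numbers, obtained as the reciprocal of
    the power series (exp(cs) - 1) / s; the recurrence is this reciprocity multiplied by s. *)
Lemma bernoulli_exists (c : C) : c <> 0 -> exists (beta : nat -> C) (B K : R),
 0 <= B /\ 0 < K /\ (forall n, Cmod (beta n) <= B * K ^ n) /\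
 (forall n, convol (eseq c) beta n = beta n + cseq 1 1 n) /\
 has_expansion (fun s => s / (Cexp (c * s) - 1)) beta.
Proof.
 intros Hc. set (a := fun n => eseq c (S n)).
 assert (A0 : a O = c). { unfold a, eseq. simpl. rewrite Rinv_1. ring. }
 assert (Hm : 0 < Cmod c) by (apply Cmod_gt_0; exact Hc).
 assert (HA0 : a O <> 0) by now rewrite A0.
 destruct (recip_exists a HA0) as [beta Hbeta].
 set (A := (1 + Cmod c)%R).
 assert (Ha : forall n, Cmod (a n) <= Cmod (a O) * A ^ n).
 { intros n. rewrite A0. le_via Cmod_eseq.
  apply Rmult_le_compat_l; [lra|]. apply pow_incr. unfold A; lra. }
 assert (HA : 1 <= A) by (unfold A; lra).
 assert (Hb := recip_bound a beta A HA0 HA Ha Hbeta). rewrite A0 in Hb, Ha.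
 assert (Iv : 0 <= / Cmod c) by pos.
 exists beta, (/ Cmod c)%R, (2 * A)%R. split; auto. split; [lra|]. split; auto. split.
 - intros [|n].
  + unfold convol. rewrite csum_O, eseq_O. unfold cseq; simpl. ring.
  + unfold convol. rewrite csum_head, eseq_O, Cmult_1_l. f_equal.
   eauto.
 - exists (/ (2 * A))%R. split; try pos. intros s Hs Hd.
  assert (Hd1 : 2 * A * Cmod s < 1).
  { apply Rmult_lt_compat_l with (r := (2 * A)%R) in Hd; [|lra]. rewrite Rinv_r in Hd by lra. lra. }
  assert (Hd2 : A * Cmod s < 1) by lra.
  assert (Eb := ex_series_geom_bound beta _ (2 * A) s Iv ltac:(lra) Hb Hd1).
  destruct (cser_exists (fun n => beta n * Cpow s n) _ (fun n => Rle_refl _) Eb) as [b Hbs].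
  assert (Has : cser (fun n => a n * Cpow s n) ((Cexp (c * s) - 1) / s)).
  { replace ((Cexp (c * s) - 1) / s) with (/ s * (Cexp (c * s) - 1)) by now field.
   apply (cser_ext (fun n => / s * eseq (c * s) (S n))).
   { intros n. unfold a. rewrite <- eseq_scal. simpl Cpow. now field. }
   apply cser_scal. intros e He. destruct (cser_Cexp (c * s) e He) as [N HN]. exists N. intros n Hn.
   specialize (HN (S n) ltac:(lia)). rewrite csum_head, eseq_O in HN.
   set (S0 := sum_n (fun k => eseq (c * s) (S k)) n : C) in *.
   replace (S0 - (Cexp (c * s) - 1)) with (1 + S0 - Cexp (c * s)) by ring. lra. }
  assert (M1 : cser (convol (fun n => a n * Cpow s n) (fun n => beta n * Cpow s n)) (1 * Cpow s 0)).
  { apply (cser_ext (fun n => cseq 1 0 n * Cpow s n)); [|apply cser_cseq].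
   intros n. now rewrite convol_weight, Hbeta. }
  assert (E := cser_unique _ _ _ (cser_mult _ _ _ _ Has Hbs (ex_series_geom_bound a (Cmod c) A s ltac:(lra) ltac:(lra) Ha Hd2) Eb) M1). rewrite Cmult_1_r in E.
  assert (D : Cexp (c * s) - 1 <> 0).
  { intros D. rewrite D in E. apply C1_nz. rewrite <- E. now field. }
  replace (s / (Cexp (c * s) - 1)) with b; auto.
  replace b with ((s / (Cexp (c * s) - 1)) * ((Cexp (c * s) - 1) / s * b)) by now field.
  rewrite E. ring.
Qed.

Lemma has_expansion_comp_scal phi (a : nat -> C) (k : C) : k <> 0 -> has_expansion phi a ->
 has_expansion (fun s => phi (k * s)) (fun n => a n * Cpow k n).
Proof.
 intros Hk [d [Hd H]]. assert (Hm : 0 < Cmod k) by (apply Cmod_gt_0; exact Hk).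
 exists (d / Cmod k)%R. split; try pos. intros s Hs Hds.
 apply (cser_ext (fun n => a n * Cpow (k * s) n)).
 { intros n. rewrite Cpow_mult_l. ring. }
 apply H; [now apply Cmult_neq_0|]. rewrite Cmod_mult.
 apply Rmult_lt_compat_l with (r := Cmod k) in Hds; auto.
 replace (Cmod k * (d / Cmod k))%R with d in Hds by (field; lra). lra.
Qed.

Lemma has_expansion_scal phi (a : nat -> C) (k : C) : has_expansion phi a ->
 has_expansion (fun s => k * phi s) (fun n => k * a n).
Proof.
 intros [d [Hd H]]. exists d. split; auto. intros s Hs Hds.
 apply (cser_ext (fun n => k * (a n * Cpow s n))); [intros; ring|]. now apply cser_scal, H.
Qed.

Lemma has_expansion_plus phi psi (a b : nat -> C) : has_expansion phi a -> has_expansion psi b ->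
 has_expansion (fun s => phi s + psi s) (fun n => a n + b n).
Proof.
 intros [d [Hd H]] [d' [Hd' H']]. exists (Rmin d d'). split; try pos. intros s Hs Hds.
 destruct (Rmin_le d d') as [M1 M2].
 apply (cser_ext (fun n => a n * Cpow s n + b n * Cpow s n)); [intros; ring|].
 apply cser_plus; [apply H | apply H']; trivial; lra.
Qed.

Lemma has_expansion_ext_loc phi psi (a : nat -> C) :
 (exists d, 0 < d /\ forall s : C, s <> 0 -> Cmod s < d -> phi s = psi s) ->
 has_expansion phi a -> has_expansion psi a.
Proof.
 intros [d [Hd E]] [d' [Hd' H']]. exists (Rmin d d'). split; try pos. intros s Hs Hds.
 destruct (Rmin_le d d') as [M1 M2].
 rewrite <- E by pos. apply H'; trivial; lra.
Qed.

(** * The values of zeta at even integers *)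

Lemma Series_nonneg (a : nat -> R) : (forall n, 0 <= a n) -> ex_series a -> 0 <= Series a.
Proof.
 intros H E. apply Rle_trans with (sum_n a 0); [rewrite sum_O; apply H|].
 now apply ex_series_nonneg_le.
Qed.

Lemma sin_cubic (y : R) : 0 <= y <= 2 -> y - y ^ 3 / 6 <= sin y <= y.
Proof.
 intros Hy. split.
 - assert (P : y <= PI) by (assert (P := PI2_1); lra).
  eapply Rle_trans; [|exact (proj1 (SIN y (proj1 Hy) P))].
  unfold sin_lb, sin_approx, sin_term. simpl.
  assert (y2 : 0 <= y * y <= 4) by nra.
  assert (y5 : 0 <= y * y * y * y * y) by pos.
  nra.
 - destruct (Rle_lt_or_eq_dec 0 y (proj1 Hy)) as [L|L]; [|rewrite <- L, sin_0; lra].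
  left. now apply sin_lt_x.
Qed.

Lemma inv_sin2_bound (y : R) : 0 < y <= 2 -> 0 <= / (sin y) ^ 2 - / y ^ 2 <= 3.
Proof.
 intros Hy. destruct (sin_cubic y ltac:(lra)) as [L U].
 assert (S3 : y / 3 <= sin y) by nra.
 assert (Sp : 0 < sin y) by lra.
 split.
 - assert (I : / y ^ 2 <= / sin y ^ 2); [|lra].
  mono.
 - replace (/ sin y ^ 2 - / y ^ 2)%R with ((y - sin y) * (y + sin y) / (y ^ 2 * sin y ^ 2))%R by (field; lra).
  apply (Rmult_le_reg_r (y ^ 2 * sin y ^ 2)); try pos.
  unfold Rdiv. rewrite Rmult_assoc, Rinv_l, Rmult_1_r by (assert (Q := pow_lt y 2 ltac:(lra)); assert (Q' := pow_lt (sin y) 2 Sp); nra).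
  apply Rle_trans with ((y ^ 3 / 6) * (2 * y))%R.
  + mono.
  + assert (Q : y ^ 2 / 9 <= sin y ^ 2) by nra.
   nra.
Qed.

Lemma ex_series_inv_sq : ex_series (fun n => / (INR (S n)) ^ 2)%R.
Proof.
 apply (ex_series_Rle _ (fun n => 2 * (/ INR (S n) - / INR (S (S n))))%R).
 - intros n. rewrite (S_INR (S n)). assert (H := pos_INR n). rewrite S_INR.
  set (x := INR n) in *. split.
  + pos.
  + replace (2 * (/ (x + 1) - / (x + 1 + 1)))%R with (2 / ((x + 1) * (x + 2)))%R by (field; lra).
   apply (Rmult_le_reg_r ((x + 1) ^ 2 * (x + 2))).
   * pos.
   * replace (/ (x + 1) ^ 2 * ((x + 1) ^ 2 * (x + 2)))%R with (x + 2)%R by (field; lra).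
    replace (2 / ((x + 1) * (x + 2)) * ((x + 1) ^ 2 * (x + 2)))%R with (2 * (x + 1))%R by (field; lra). lra.
 - apply (ex_series_scal_l 2%R (fun n => / INR (S n) - / INR (S (S n)))%R).
  exists 1%R. apply is_series_of_limit. intros e He.
  assert (T : forall n, sum_n (fun n => / INR (S n) - / INR (S (S n)))%R n = (1 - / INR (S (S n)))%R).
  { induction n as [|n IH]; [rewrite sum_O; simpl; field|].
   rewrite sum_Sn, IH. unfold plus; simpl plus. simpl; lra. }
  destruct (archimed_cor1 e He) as [N [HN HN0]]. exists N. intros n Hn. rewrite T.
  replace (1 - / INR (S (S n)) - 1)%R with (- / INR (S (S n)))%R by lra.
  rewrite Rabs_Ropp, Rabs_pos_eq by pos.
  eapply Rle_lt_trans; [|exact HN]. apply Rinv_le_contravar; [apply lt_0_INR; lia | apply le_INR; lia].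
Qed.

(* The terms, for opposite integers, of the partial fraction expansion of pi^2/sin^2(pi x). *)
Definition pfrac (x : R) (m : nat) : R := (/ (INR m + x) ^ 2 + / (INR m + 1 - x) ^ 2)%R.

Lemma pfrac_le (x : R) m : 0 < x < 1 -> 0 <= pfrac x (S m) <= 2 * / INR (S m) ^ 2.
Proof.
 intros Hx. unfold pfrac. assert (Hm := lt_0_INR (S m) ltac:(lia)).
 set (k := INR (S m)) in *.
 assert (A1 : / (k + x) ^ 2 <= / k ^ 2) by mono.
 assert (A2 : / (k + 1 - x) ^ 2 <= / k ^ 2) by mono.
 assert (A3 : 0 < / (k + x) ^ 2) by pos.
 assert (A4 : 0 < / (k + 1 - x) ^ 2) by pos. lra.
Qed.

Lemma ex_pfrac (x : R) : 0 < x < 1 -> ex_series (pfrac x).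
Proof.
 intros Hx. apply ex_series_incr_1.
 apply (ex_series_Rle _ (fun m => 2 * / INR (S m) ^ 2)%R).
 - intros m. now apply pfrac_le.
 - apply (ex_series_scal_l 2%R (fun m => / INR (S m) ^ 2)%R), ex_series_inv_sq.
Qed.

Lemma is_series_pairs (a : nat -> R) (l : R) : is_series a l ->
 is_series (fun n => a (2 * n)%nat + a (2 * n + 1)%nat)%R l.
Proof.
 intros H. apply is_series_of_limit. intros e He.
 destruct (is_series_limit _ _ H e He) as [N HN]. exists N. intros n Hn.
 replace (sum_n (fun n => a (2 * n)%nat + a (2 * n + 1)%nat)%R n) with (sum_n a (2 * n + 1)).
 - apply HN. lia.
 - clear. induction n as [|n IH].
  + simpl (2 * 0 + 1)%nat. rewrite sum_Sn, !sum_O. pos.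
  + replace (2 * S n + 1)%nat with (S (S (2 * n + 1))) by lia.
   rewrite !sum_Sn, IH. replace (S (2 * n + 1)) with (2 * S n)%nat by lia.
   replace (S (2 * S n)) with (2 * S n + 1)%nat by lia. auto with real.
Qed.

Lemma pfrac_double (x : R) : 0 < x < 1 ->
 (Series (pfrac (x / 2)) + Series (pfrac ((x + 1) / 2)) = 4 * Series (pfrac x))%R.
Proof.
 intros Hx.
 assert (E1 := ex_pfrac (x / 2) ltac:(lra)). assert (E2 := ex_pfrac ((x + 1) / 2) ltac:(lra)).
 rewrite <- Series_plus by pos.
 rewrite <- (is_series_unique _ _ (is_series_pairs _ _ (Series_correct _ (ex_pfrac x Hx)))), <- Series_scal_l.
 apply Series_ext. intros n. unfold pfrac.
 rewrite plus_INR, mult_INR. simpl (INR 2). simpl (INR 1). assert (Hn := pos_INR n).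
 field; lra.
Qed.

(** Herglotz's trick for pi^2 / sin^2(pi x): this difference h is bounded by some M on ]0,1[, and
    the duplication formula h(x/2) + h((x+1)/2) = 4 h(x) improves M to M/2, and so on; hence h =
    0. *)
Definition herglotz (x : R) : R := (PI ^ 2 / sin (PI * x) ^ 2 - Series (pfrac x))%R.

Lemma sin_PI_pos (x : R) : 0 < x < 1 -> 0 < sin (PI * x).
Proof. intros Hx. assert (P := PI_RGT_0). apply sin_gt_0; nra. Qed.

Lemma herglotz_double (x : R) : 0 < x < 1 ->
 (herglotz (x / 2) + herglotz ((x + 1) / 2) = 4 * herglotz x)%R.
Proof.
 intros Hx. unfold herglotz. assert (E := pfrac_double x Hx).
 assert (S1 := sin_PI_pos (x / 2) ltac:(lra)).
 assert (S2 : sin (PI * ((x + 1) / 2)) = cos (PI * (x / 2))).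
 { replace (PI * ((x + 1) / 2))%R with (PI / 2 + PI * (x / 2))%R by lra. symmetry. apply cos_sin. }
 assert (S3 := sin_PI_pos ((x + 1) / 2) ltac:(lra)).
 assert (S4 : sin (PI * x) = (2 * sin (PI * (x / 2)) * cos (PI * (x / 2)))%R).
 { rewrite <- sin_2a. f_equal. field. }
 assert (S5 := sin2_cos2 (PI * (x / 2))). unfold Rsqr in S5.
 rewrite S2, S4. set (s := sin (PI * (x / 2))) in *. set (c := cos (PI * (x / 2))) in *.
 replace (PI ^ 2 / s ^ 2)%R with (PI ^ 2 * (s * s + c * c) / s ^ 2)%R by (rewrite S5; field; lra).
 assert (F : (PI ^ 2 * (s * s + c * c) / s ^ 2 + PI ^ 2 / c ^ 2 = 4 * (PI ^ 2 / (2 * s * c) ^ 2))%R).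
 { replace (PI ^ 2 / c ^ 2)%R with (PI ^ 2 * (s * s + c * c) / c ^ 2)%R by (rewrite S5; field; lra).
  transitivity (PI ^ 2 * ((s * s + c * c) * (s * s + c * c)) / (s ^ 2 * c ^ 2))%R; [field; lra|].
  rewrite S5. field. lra. }
 lra.
Qed.

Lemma herglotz_bounded : exists M, forall x, 0 < x < 1 -> Rabs (herglotz x) <= M.
Proof.
 set (Z := Series (fun m => 2 * / INR (S m) ^ 2)%R).
 assert (EZ : ex_series (fun m => 2 * / INR (S m) ^ 2)%R).
 { apply (ex_series_scal_l 2%R (fun m => / INR (S m) ^ 2)%R), ex_series_inv_sq. }
 assert (P := PI_RGT_0). assert (P4 := PI_4).
 assert (half : forall x, 0 < x <= / 2 ->
   0 <= PI ^ 2 / sin (PI * x) ^ 2 - / x ^ 2 <= PI ^ 2 * 3).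
 { intros x Hx. assert (H := inv_sin2_bound (PI * x) ltac:(nra)).
  assert (S0 := sin_PI_pos x ltac:(lra)).
  replace (PI ^ 2 / sin (PI * x) ^ 2 - / x ^ 2)%R with
   (PI ^ 2 * (/ sin (PI * x) ^ 2 - / (PI * x) ^ 2))%R by (field; lra).
  nra. }
 assert (inv4 : forall x, / 2 <= x -> 0 <= / x ^ 2 <= 4).
 { split; try pos.
  replace 4%R with (/ (/ 2) ^ 2)%R by lra. mono. }
 exists (PI ^ 2 * 3 + 4 + Z)%R. intros x Hx. unfold herglotz.
 assert (E := ex_pfrac x Hx). rewrite (Series_incr_1 _ E).
 assert (Hz : (0 <= Series (fun m => pfrac x (S m)) <= Z)).
 { split.
  - apply Series_nonneg; [intros m; now apply pfrac_le|].
   now apply (ex_series_incr_1 (pfrac x)).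
  - apply Series_le; [intros m; now apply pfrac_le | exact EZ]. }
 (* The term m = 0 carries both poles, 1/x^2 and 1/(1-x)^2. By the symmetry x -> 1 - x it is enough
    to know the difference with 1/x^2 on ]0, 1/2]. *)
 assert (F : - 4 <= PI ^ 2 / sin (PI * x) ^ 2 - pfrac x 0 <= PI ^ 2 * 3).
 { unfold pfrac. rewrite !Rplus_0_l.
  destruct (Rle_dec x (/ 2)) as [L|L].
  - assert (H1 := half x ltac:(lra)). assert (H2 := inv4 (1 - x)%R ltac:(lra)). lra.
  - assert (H1 := half (1 - x)%R ltac:(lra)). assert (H2 := inv4 x ltac:(lra)).
   replace (sin (PI * (1 - x))) with (sin (PI * x)) in H1; [lra|].
   replace (PI * (1 - x))%R with (PI - PI * x)%R by lra. symmetry. apply sin_PI_x. }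
 assert (Q := pow_lt PI 2 P). apply Rabs_le. lra.
Qed.

Lemma herglotz_zero (x : R) : 0 < x < 1 -> herglotz x = 0%R.
Proof.
 intros Hx. destruct herglotz_bounded as [M HM].
 assert (H : forall n y, 0 < y < 1 -> Rabs (herglotz y) <= M * (/ 2) ^ n).
 { induction n as [|n IH]; intros y Hy.
  - rewrite Rmult_1_r. pos.
  -
   assert (H1 := IH (y / 2)%R ltac:(lra)). assert (H2 := IH ((y + 1) / 2)%R ltac:(lra)).
   assert (T := Rabs_triang (herglotz (y / 2)) (herglotz ((y + 1) / 2))).
   rewrite (herglotz_double y Hy), Rabs_mult, (Rabs_pos_eq 4) in T by lra. simpl. lra. }
 destruct (Req_dec (herglotz x) 0) as [E|E]; auto.
 assert (P := Rabs_pos_lt _ E). assert (M0 := H O x Hx).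
 destruct (pow_lt_1_zero (/ 2) ltac:(rewrite Rabs_pos_eq; lra) (Rabs (herglotz x) / M)) as [N HN].
 { pos. }
 specialize (HN N (le_n _)). rewrite Rabs_pos_eq in HN by pos.
 specialize (H N x Hx). apply Rmult_lt_compat_l with (r := M) in HN; [|lra].
 replace (M * (Rabs (herglotz x) / M))%R with (Rabs (herglotz x)) in HN by (field; lra). lra.
Qed.

(** At z = (x/m)^2 the sum is x^2/(m+x)^2 + x^2/(m-x)^2. This links the weights 2(2k+1) of the
    derivation with the partial fractions of 1/sin^2. *)
Lemma is_series_odd_geom (z : R) : 0 <= z < 1 ->
 is_series (fun k => 2 * INR (2 * k + 1) * z ^ (S k))%R (2 * z * (1 + z) / (1 - z) ^ 2)%R.
Proof.
 intros Hz. assert (Hz' : Rabs z < 1) by (rewrite Rabs_pos_eq; lra).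
 assert (G := is_series_geom z Hz').
 assert (GA : ex_series (fun n => Rabs (z ^ n))).
 { apply (ex_series_ext (fun n => z ^ n)%R); [|now apply geom_ex].
  symmetry. apply Rabs_pos_eq, pow_le, Hz. }
 replace (2 * z * (1 + z) / (1 - z) ^ 2)%R with
  (plus (scal (4 * z)%R (/ (1 - z) * / (1 - z))%R) (scal (- (2 * z))%R (/ (1 - z))%R)).
 2:{ unfold plus, scal; simpl. unfold mult; simpl. field. lra. }
 apply is_series_ext with (2 := (is_series_plus _ _ _ _ (is_series_scal_l (4 * z)%R _ _ (is_series_mult _ _ _ _ G G GA GA)) (is_series_scal_l (- (2 * z))%R _ _ G))). intros n.
 replace (sum_f_R0 (fun k => (z ^ k * z ^ (n - k))%R) n) with (INR (S n) * z ^ n)%R.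
 - rewrite plus_INR, mult_INR, S_INR.
  change (4 * z * ((INR n + 1) * z ^ n) + - (2 * z) * z ^ n = 2 * (INR 2 * INR n + INR 1) * (z * z ^ n))%R.
  simpl; lra.
 - rewrite (sum_eq _ (fun _ => z ^ n)%R).
  + rewrite sum_cte. ring.
  + intros i Hi. rewrite <- pow_add. f_equal. lia.
Qed.

Lemma cser_RtoC (a : nat -> R) (l : R) : is_series a l -> cser (fun n => (a n)) l.
Proof.
 intros H. apply cser_parts; auto. simpl.
 apply is_series_of_limit. intros e He. exists O. intros n _.
 replace (sum_n (fun _ => 0%R) n) with 0%R; [rewrite Rminus_0_r, Rabs_R0; exact He|].
 rewrite sum_n_Reals, sum_cte. ring.
Qed.

Lemma ex_zeta k : ex_series (fun n => / INR (S n) ^ (2 * k + 2))%R.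
Proof.
 apply (ex_series_Rle _ (fun n => / INR (S n) ^ 2)%R); [|apply ex_series_inv_sq].
 intros n. assert (H : 1 <= INR (S n)) by (apply (le_INR 1); lia). split.
 - pos.
 - apply Rinv_le_contravar; try pos. apply Rle_pow; [exact H | lia].
Qed.

(** The partial fraction expansion without its term 1/x^2: each pair of fractions is expanded in
    powers of x/m and the two summations are exchanged. The restriction x <= 1/2 gives m - x >= m/2,
    hence the summable bound 2/m^2. *)
Lemma zeta_series (x : R) : 0 < x <= / 2 ->
 cser (fun k => zcoef k * RtoC (x ^ (2 * k + 2))) (RtoC (PI ^ 2 * x ^ 2 / sin (PI * x) ^ 2 - 1)).
Proof.
 intros Hx. assert (Hx1 : 0 < x < 1) by lra.
 set (r := fun n : nat => (x ^ 2 * (/ (INR (S n) + x) ^ 2 + / (INR (S n) - x) ^ 2))%R).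
 assert (Pn : forall n, 1 <= INR (S n)) by (intros; apply (le_INR 1); lia).
 assert (E1 : ex_series (fun m => / (INR m + x) ^ 2)%R).
 { apply (ex_series_Rle _ (pfrac x)); [|now apply ex_pfrac]. intros m. assert (Hm := pos_INR m).
  assert (A3 : 0 < / (INR m + x) ^ 2) by pos.
  assert (A4 : 0 < / (INR m + 1 - x) ^ 2) by pos.
  unfold pfrac. lra. }
 assert (E2 : ex_series (fun m => / (INR m + 1 - x) ^ 2)%R).
 { apply (ex_series_Rle _ (pfrac x)); [|now apply ex_pfrac]. intros m. assert (Hm := pos_INR m).
  assert (A3 : 0 < / (INR m + x) ^ 2) by pos.
  assert (A4 : 0 < / (INR m + 1 - x) ^ 2) by pos.
  unfold pfrac. lra. }
 assert (Er : is_series r (PI ^ 2 * x ^ 2 / sin (PI * x) ^ 2 - 1)%R).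
 { assert (H := herglotz_zero x Hx1). unfold herglotz in H.
  assert (E : Series (pfrac x) = (/ x ^ 2 + Series (fun m => / (INR (S m) + x) ^ 2)
    + Series (fun m => / (INR m + 1 - x) ^ 2))%R).
  { unfold pfrac. rewrite (Series_plus _ _ E1 E2), (Series_incr_1 _ E1). simpl (INR 0). field; lra. }
  apply ex_series_incr_1 in E1.
  replace (PI ^ 2 * x ^ 2 / sin (PI * x) ^ 2 - 1)%R with
   (scal (x ^ 2)%R (plus (Series (fun m => / (INR (S m) + x) ^ 2)%R) (Series (fun m => / (INR m + 1 - x) ^ 2)%R))).
  - apply is_series_ext with (2 := (is_series_scal_l (x ^ 2)%R _ _ (is_series_plus _ _ _ _ (Series_correct _ E1) (Series_correct _ E2)))). intros n. unfold r. rewrite S_INR. pos.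
  - change (x ^ 2 * (Series (fun m => / (INR (S m) + x) ^ 2) + Series (fun m => / (INR m + 1 - x) ^ 2))
       = PI ^ 2 * x ^ 2 / sin (PI * x) ^ 2 - 1)%R.
   replace (PI ^ 2 * x ^ 2 / sin (PI * x) ^ 2)%R with (x ^ 2 * (PI ^ 2 / sin (PI * x) ^ 2))%R by lra.
   replace (PI ^ 2 / sin (PI * x) ^ 2)%R with (Series (pfrac x)) by lra.
   rewrite E. field. lra. }
 set (A := fun n k : nat => (2 * INR (2 * k + 1) * ((x / INR (S n)) ^ 2) ^ (S k))%R).
 assert (A0 : forall n k, 0 <= A n k).
 { intros n k. pos. }
 assert (EA : forall n k, A n k = (2 * INR (2 * k + 1) * x ^ (2 * k + 2) * / INR (S n) ^ (2 * k + 2))%R).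
 { intros n k. unfold A. rewrite <- pow_mult. replace (2 * S k)%nat with (2 * k + 2)%nat by lia.
  unfold Rdiv. rewrite Rpow_mult_distr, pow_inv. ring. }
 assert (SA : forall n, is_series (A n) (r n)).
 { intros n. specialize (Pn n). set (m := INR (S n)) in *.
  assert (Hq : 0 < x / m < 1).
  { split; try pos. apply (Rmult_lt_reg_r m); [lra|].
   unfold Rdiv. rewrite Rmult_assoc, Rinv_l by lra. lra. }
  assert (Hz : 0 <= (x / m) ^ 2 < 1) by nra.
  assert (G := is_series_odd_geom _ Hz).
  replace (r n) with (2 * (x / m) ^ 2 * (1 + (x / m) ^ 2) / (1 - (x / m) ^ 2) ^ 2)%R; auto.
  unfold r. fold m. field. nra. }
 apply (cser_fubini (fun n k => (A n k)) (fun n => 2 * / INR (S n) ^ 2)%R (fun n => (r n))).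
 - intros n. exists (r n). apply is_series_ext with (2 := SA n). intros k.
  rewrite Cmod_R, Rabs_pos_eq; auto.
 - intros n. rewrite (Series_ext _ (A n)) by (intros k; rewrite Cmod_R; apply Rabs_pos_eq, A0).
  rewrite (is_series_unique _ _ (SA n)). unfold r. specialize (Pn n). set (m := INR (S n)) in *.
  assert (B1 : / (m + x) ^ 2 <= / m ^ 2) by mono.
  assert (B2 : / (m - x) ^ 2 <= / (m / 2) ^ 2) by mono.
  replace (/ (m / 2) ^ 2)%R with (4 * / m ^ 2)%R in B2 by (field; lra).
  assert (x2 : 0 <= x ^ 2 <= / 4) by nra.
  assert (B0 : 0 < / m ^ 2) by pos.
  nra.
 - apply (ex_series_scal_l 2%R (fun m => / INR (S m) ^ 2)%R), ex_series_inv_sq.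
 - intros n. apply cser_RtoC, SA.
 - apply cser_RtoC, Er.
 - intros k. unfold zcoef. rewrite <- RtoC_mult. apply cser_RtoC.
  unfold zeta.
  replace (2 * INR (2 * k + 1) * Series (fun n => / INR (S n) ^ (2 * k + 2)) * x ^ (2 * k + 2))%R with
   (scal (2 * INR (2 * k + 1) * x ^ (2 * k + 2))%R (Series (fun n => / INR (S n) ^ (2 * k + 2))%R))
   by (unfold scal; simpl; unfold mult; simpl; ring).
  apply is_series_ext with (2 := (is_series_scal_l (2 * INR (2 * k + 1) * x ^ (2 * k + 2))%R _ _ (Series_correct _ (ex_zeta k)))). pos.
Qed.

Lemma cser_pser (zc : nat -> C) (x l : C) :
 cser (fun k => zc k * Cpow x (2 * k + 2)) l -> cser (fun j => pser zc j * Cpow x j) (1 + l).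
Proof.
 intros H e He. destruct (H e He) as [N HN].
 assert (P0 : forall k, pser zc (2 * k + 2) = zc k).
 { intros k. replace (2 * k + 2)%nat with (S (S (2 * k))) by lia. unfold pser.
  rewrite Nat.even_even, Nat.div2_double. pos. }
 assert (P1 : forall k, pser zc (2 * k + 3) = 0).
 { intros k. replace (2 * k + 3)%nat with (S (S (S (2 * k)))) by lia. unfold pser.
  replace (Nat.even (S (2 * k))) with false; auto.
  symmetry. rewrite Nat.even_succ. apply Nat.odd_even. }
 assert (E : forall k, sum_n (fun j => pser zc j * Cpow x j) (2 * k + 2) =
   1 + sum_n (fun k => zc k * Cpow x (2 * k + 2)) k :> C).
 { induction k as [|k IH].
  - simpl (2 * 0 + 2)%nat. rewrite !csum_S, !csum_O. simpl; ring.
  - replace (2 * S k + 2)%nat with (S (S (2 * k + 2))) at 1 by lia.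
   rewrite !csum_S, IH. replace (S (2 * k + 2)) with (2 * k + 3)%nat by lia. rewrite P1.
   replace (S (2 * k + 3)) with (2 * S k + 2)%nat by lia. rewrite P0. ring. }
 assert (E' : forall k, sum_n (fun j => pser zc j * Cpow x j) (2 * k + 3) =
   1 + sum_n (fun k => zc k * Cpow x (2 * k + 2)) k :> C).
 { intros k. replace (2 * k + 3)%nat with (S (2 * k + 2)) by lia. rewrite csum_S, E.
  replace (S (2 * k + 2)) with (2 * k + 3)%nat by lia. rewrite P1. ring. }
 exists (2 * N + 3)%nat. intros n Hn.
 assert (Hk : exists k, (N <= k)%nat /\ (n = 2 * k + 2 \/ n = 2 * k + 3)%nat).
 { exists (Nat.div2 (n - 2)). assert (D := Nat.div2_odd (n - 2)).
  destruct (Nat.odd (n - 2)); simpl Nat.b2n in D; lia. }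
 destruct Hk as [k [Hk [-> | ->]]]; [rewrite E | rewrite E']; specialize (HN k Hk);
 set (S0 := sum_n (fun k => zc k * Cpow x (2 * k + 2)) k : C) in *;
 replace (1 + S0 - (1 + l)) with (S0 - l) by ring; exact HN.
Qed.

(** Nonnegative coefficients turn convergence at x > 0 into absolute convergence, which the Cauchy
    product in [pser_zcoef_rec] needs. *)
Lemma pser_pos j : exists y : R, 0 <= y /\ pser zcoef j = y.
Proof.
 destruct j as [|[|j]].
 - exists 1%R. auto with real.
 - exists 0%R. easy.
 - simpl. destruct (Nat.even j).
  + exists (2 * INR (2 * Nat.div2 j + 1) * zeta (2 * Nat.div2 j + 2))%R. split; auto.
   apply Rmult_le_pos; try pos.
   apply Series_nonneg; [|apply ex_zeta].
   pos.
  + exists 0%R. easy.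
Qed.

(** Both sides are compared as power series at small positive s, where p(s) = (pi s / sin(pi s))^2.
    With U = exp(2 pi i s) the identity becomes (U - 1)^2 = -4 sin^2(pi s) U. *)
Lemma pser_zcoef_rec (beta : nat -> C) :
 has_expansion (fun s => s / (Cexp (two_pi_i * s) - 1)) beta ->
 forall n, pser zcoef n - convol (eseq (- two_pi_i)) (pser zcoef) n =
  match n with O => 0 | S m => two_pi_i * two_pi_i * beta m end.
Proof.
 intros [d [Hd Hbeta]].
 set (bs := fun n : nat => match n return C with O => 0 | S m => two_pi_i * two_pi_i * beta m end).
 enough (H : forall n, pser zcoef n + - (1) * (convol (eseq (- two_pi_i)) (pser zcoef) n + bs n) = 0).
 { intros n. fold (bs n).
  replace (pser zcoef n - convol (eseq (- two_pi_i)) (pser zcoef) n) with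
   (pser zcoef n + - (1) * (convol (eseq (- two_pi_i)) (pser zcoef) n + bs n) + bs n) by ring.
  rewrite H. ring. }
 apply (cpseries_zero _ (Rmin d (/ 2))); try pos.
 intros x Hx. destruct (Rmin_le d (/ 2)) as [M1 M2].
 set (s := RtoC x). assert (Hs : s <> 0) by (apply RtoC_neq_0; lra).
 set (Pv := RtoC (PI ^ 2 * x ^ 2 / sin (PI * x) ^ 2)).
 assert (HP : cser (fun j => pser zcoef j * Cpow s j) Pv).
 { replace Pv with (1 + RtoC (PI ^ 2 * x ^ 2 / sin (PI * x) ^ 2 - 1)).
  - apply cser_pser. apply cser_ext with (2 := zeta_series x ltac:(lra)). intros k.
   now rewrite RtoC_pow.
  - unfold Pv. rewrite <- RtoC_plus. f_equal. ring. }
 assert (EP : ex_series (fun j => Cmod (pser zcoef j * Cpow s j))).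
 { exists (Re Pv). apply is_series_ext with (2 := cser_Re _ _ HP). intros j.
  destruct (pser_pos j) as [y [Hy E]]. unfold s. rewrite E, <- RtoC_pow, <- RtoC_mult, Cmod_R, Rabs_pos_eq.
  - pos.
  - pos. }
 assert (HE : cser (fun j => eseq (- two_pi_i) j * Cpow s j) (Cexp (- two_pi_i * s))).
 { apply cser_ext with (2 := cser_Cexp (- two_pi_i * s)). symmetry. apply eseq_scal. }
 assert (EE : ex_series (fun j => Cmod (eseq (- two_pi_i) j * Cpow s j))).
 { exists (exp (Cmod (- two_pi_i * s))).
  apply is_series_ext with (2 := (is_exp_Reals (Cmod (- two_pi_i * s)))). intros n. rewrite eseq_scal. generalize (- two_pi_i * s); intros v. unfold eseq.
  rewrite Cmod_mult, Cmod_pow, Cmod_R, Rabs_pos_eq by (left; apply Rinv_0_lt_compat, INR_fact_lt_0).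
  auto with real. }
 set (Bv := s / (Cexp (two_pi_i * s) - 1)).
 assert (HB : cser (fun j => bs j * Cpow s j) (two_pi_i * two_pi_i * s * Bv)).
 { assert (Cs : Cmod s < d) by (unfold s; rewrite Cmod_R, Rabs_pos_eq; lra).
  assert (T := cser_head (fun j => bs j * Cpow s j) (two_pi_i * two_pi_i * s * Bv)).
  cbv beta in T. replace (bs O * Cpow s 0 + two_pi_i * two_pi_i * s * Bv) with (two_pi_i * two_pi_i * s * Bv) in T
   by (unfold bs; ring).
  apply T. apply (cser_ext (fun n => two_pi_i * two_pi_i * s * (beta n * Cpow s n))).
  - intros n. simpl; ring.
  - apply cser_scal. pos. }
 replace (RtoC 0) with (Pv + - (1) * (Cexp (- two_pi_i * s) * Pv + two_pi_i * two_pi_i * s * Bv)).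
 { apply cser_ext with (2 := (cser_plus _ _ _ _ HP (cser_scal (- (1)) _ _ (cser_plus _ _ _ _ (cser_mult _ _ _ _ HE HP EE EP) HB)))). intros n. rewrite convol_weight. ring. }
 assert (S0 := sin_PI_pos x ltac:(lra)).
 set (U := Cexp (two_pi_i * s)).
 assert (EU : U = (cos (2 * (PI * x)), sin (2 * (PI * x)))).
 { unfold U. apply C_eq.
  - rewrite Re_Cexp, Re_two_pi_i, Im_two_pi_i. unfold s; simpl. rewrite Rmult_0_r, exp_0.
   rewrite Rmult_assoc. lra.
  - rewrite Im_Cexp, Re_two_pi_i, Im_two_pi_i. unfold s; simpl. rewrite Rmult_0_r, exp_0.
   rewrite Rmult_assoc. lra. }
 replace (Cexp (- two_pi_i * s)) with (/ U).
 2:{ unfold U. rewrite <- Cexp_opp. f_equal. ring. }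
 unfold Bv. fold U.
 assert (U0 : U <> 0) by apply Cexp_neq_0.
 assert (T : (U - 1) * (U - 1) = - (4 * RtoC (sin (PI * x) ^ 2)) * U).
 { rewrite EU, cos_2a_sin, sin_2a. assert (S5 := sin2_cos2 (PI * x)). unfold Rsqr in S5.
  apply C_eq; simpl; [|ring].
  nra. }
 assert (U1 : U - 1 <> 0).
 { intros Z. rewrite Z in T. rewrite Cmult_0_l in T. symmetry in T.
  revert T. apply Cmult_neq_0; auto. rewrite <- RtoC_mult, <- RtoC_opp. apply RtoC_neq_0.
  nra. }
 assert (PvE : Pv * RtoC (sin (PI * x) ^ 2) = RtoC (PI ^ 2) * (s * s)).
 { unfold Pv, s. rewrite <- !RtoC_mult. f_equal. field. lra. }
 assert (cc : two_pi_i * two_pi_i = - (4 * RtoC (PI ^ 2))).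
 { apply C_eq; simpl; ring. }
 assert (main : (U - 1) * (U - 1) * Pv = two_pi_i * two_pi_i * (s * s) * U).
 { rewrite T, cc. transitivity (- 4 * U * (Pv * RtoC (sin (PI * x) ^ 2))); [ring|]. rewrite PvE. ring. }
 replace (Pv + - (1) * (/ U * Pv + two_pi_i * two_pi_i * s * (s / (U - 1)))) with
  (/ (U * (U - 1)) * ((U - 1) * (U - 1) * Pv - two_pi_i * two_pi_i * (s * s) * U)) by now field.
 rewrite main. ring.
Qed.

(** * Integrals of complex functions *)

Definition rcont (f : R -> C) (t : R) : Prop :=
 continuous (fun s => Re (f s)) t /\ continuous (fun s => Im (f s)) t.

Definition cint (f : R -> C) (a b : R) : C :=
 (RInt (fun t => Re (f t)) a b, RInt (fun t => Im (f t)) a b).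

Lemma rder_rcont f t (l : C) : rder f t l -> rcont f t.
Proof.
 rewrite rder_parts. intros [A B]; split; apply (ex_derive_continuous (V := R_NormedModule)); eexists; eassumption.
Qed.

Lemma rcont_plus f g t : rcont f t -> rcont g t -> rcont (fun s => f s + g s) t.
Proof.
 intros [A B] [A' B']; split; apply (continuous_plus (V := R_NormedModule)); assumption.
Qed.

Lemma rcont_scal (k : C) f t : rcont f t -> rcont (fun s => k * f s) t.
Proof.
 intros [A B]; split.
 - apply (continuous_minus (V := R_NormedModule) (fun s => Re k * Re (f s))%R (fun s => Im k * Im (f s))%R);
  apply (continuous_scal_r (V := R_NormedModule)); assumption.
 - apply (continuous_plus (V := R_NormedModule) (fun s => Re k * Im (f s))%R (fun s => Im k * Re (f s))%R);
  apply (continuous_scal_r (V := R_NormedModule)); assumption.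
Qed.

Lemma rcont_ext f g t : (forall s, f s = g s) -> rcont f t -> rcont g t.
Proof.
 intros E [A B]; split; [apply (continuous_ext (fun s => Re (f s)))|apply (continuous_ext (fun s => Im (f s)))];
 trivial; intros s; now rewrite E.
Qed.

Lemma rcont_minus f g t : rcont f t -> rcont g t -> rcont (fun s => f s - g s) t.
Proof.
 intros Hf Hg. apply (rcont_ext (fun s => f s + - (1) * g s)); [intros; ring|].
 now apply rcont_plus, rcont_scal.
Qed.

Definition rconti (f : R -> C) (a b : R) : Prop := forall t, a <= t <= b -> rcont f t.

Lemma rconti_ex f a b : a <= b -> rconti f a b ->
 ex_RInt (fun t => Re (f t)) a b /\ ex_RInt (fun t => Im (f t)) a b.
Proof.
 intros Hab H; split; apply (ex_RInt_continuous (V := R_CompleteNormedModule));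
 rewrite Rmin_left, Rmax_right by lra; intros t Ht; now apply H.
Qed.

Lemma rconti_sub f a b a' b' : a <= a' -> b' <= b -> rconti f a b -> rconti f a' b'.
Proof. intros Ha Hb H t Ht. apply H. lra. Qed.

Lemma cint_chasles f a b c : a <= b -> b <= c -> rconti f a c ->
 cint f a c = cint f a b + cint f b c.
Proof.
 intros Hab Hbc H.
 destruct (rconti_ex f a b Hab (rconti_sub _ _ _ _ _ (Rle_refl _) Hbc H)) as [A B].
 destruct (rconti_ex f b c Hbc (rconti_sub _ _ _ _ _ Hab (Rle_refl _) H)) as [A' B'].
 apply C_eq; simpl; symmetry; apply (RInt_Chasles (V := R_CompleteNormedModule)); assumption.
Qed.

Lemma cint_plus f g a b : a <= b -> rconti f a b -> rconti g a b ->
 cint (fun t => f t + g t) a b = cint f a b + cint g a b.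
Proof.
 intros Hab H H'. destruct (rconti_ex f a b Hab H) as [A B]. destruct (rconti_ex g a b Hab H') as [A' B'].
 apply C_eq; simpl; apply (RInt_plus (V := R_CompleteNormedModule)); assumption.
Qed.

Lemma cint_scal (k : C) f a b : a <= b -> rconti f a b ->
 cint (fun t => k * f t) a b = k * cint f a b.
Proof.
 intros Hab H. destruct (rconti_ex f a b Hab H) as [A B].
 assert (S1 := fun x : R => ex_RInt_scal (V := R_NormedModule) _ _ _ x A).
 assert (S2 := fun x : R => ex_RInt_scal (V := R_NormedModule) _ _ _ x B).
 assert (T1 := fun x : R => RInt_scal (V := R_CompleteNormedModule) _ _ _ x A).
 assert (T2 := fun x : R => RInt_scal (V := R_CompleteNormedModule) _ _ _ x B).
 apply C_eq.
 - transitivity (minus (RInt (fun t => scal (Re k) (Re (f t))) a b) (RInt (fun t => scal (Im k) (Im (f t))) a b)).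
  + apply (RInt_minus (V := R_CompleteNormedModule) (fun t => Re k * Re (f t))%R (fun t => Im k * Im (f t))%R); auto.
  + rewrite T1, T2. pos.
 - transitivity (plus (RInt (fun t => scal (Re k) (Im (f t))) a b) (RInt (fun t => scal (Im k) (Re (f t))) a b)).
  + apply (RInt_plus (V := R_CompleteNormedModule) (fun t => Re k * Im (f t))%R (fun t => Im k * Re (f t))%R); auto.
  + rewrite T1, T2. pos.
Qed.

Lemma cint_ext f g a b : a <= b -> (forall t, a <= t <= b -> f t = g t) -> cint f a b = cint g a b.
Proof.
 intros Hab H. apply C_eq; simpl; apply (RInt_ext (V := R_CompleteNormedModule));
 rewrite Rmin_left, Rmax_right by lra; intros t Ht; rewrite H by lra; reflexivity.
Qed.

Lemma cint_minus f g a b : a <= b -> rconti f a b -> rconti g a b ->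
 cint (fun t => f t - g t) a b = cint f a b - cint g a b.
Proof.
 intros Hab H H'. rewrite (cint_ext _ (fun t => f t + - (1) * g t)) by (trivial; intros; ring).
 rewrite cint_plus, cint_scal by (trivial; intros t Ht; apply rcont_scal; now apply H'). ring.
Qed.

Lemma cint_const (k : C) a b : cint (fun _ => k) a b = RtoC (b - a) * k.
Proof.
 destruct k as [u v]. apply C_eq; simpl; rewrite (RInt_const (V := R_CompleteNormedModule)); unfold scal; simpl; unfold mult; simpl; ring.
Qed.

Lemma rcont_const (k : C) t : rcont (fun _ => k) t.
Proof. split; apply continuous_const. Qed.

Lemma cint_bound f a b (M : R) : a <= b -> rconti f a b ->
 (forall t, a <= t <= b -> Cmod (f t) <= M) -> Cmod (cint f a b) <= 2 * M * (b - a).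
Proof.
 intros Hab H HM. destruct (rconti_ex f a b Hab H) as [A B].
 le_via Cmod_le_parts. simpl.
 assert (H1 : (Rabs (RInt (fun t => Re (f t)) a b) <= (b - a) * M)).
 { apply abs_RInt_le_const; trivial. intros t Ht. eapply Rle_trans; [apply Re_le_Cmod | now apply HM]. }
 assert (H2 : (Rabs (RInt (fun t => Im (f t)) a b) <= (b - a) * M)).
 { apply abs_RInt_le_const; trivial. intros t Ht. eapply Rle_trans; [apply Im_le_Cmod | now apply HM]. }
 lra.
Qed.

Lemma cint_near f (k : C) a b (M : R) : a <= b -> rconti f a b ->
 (forall t, a <= t <= b -> Cmod (f t - k) <= M) ->
 Cmod (cint f a b - RtoC (b - a) * k) <= 2 * M * (b - a).
Proof.
 intros Hab H HM. rewrite <- cint_const, <- cint_minus; trivial.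
 - apply cint_bound; trivial. intros t Ht. apply rcont_minus; [now apply H | apply rcont_const].
 - intros t _. apply rcont_const.
Qed.

Lemma cint_shift f (d a b : R) : a <= b -> rconti f (a + d) (b + d) ->
 cint (fun t => f (t + d)%R) a b = cint f (a + d) (b + d).
Proof.
 intros Hab H. destruct (rconti_ex f (a + d) (b + d) ltac:(lra) H) as [A B].
 assert (S : forall g : R -> R, ex_RInt g (a + d) (b + d) -> RInt (fun t => g (t + d)%R) a b = RInt g (a + d) (b + d)).
 { intros g Hg. assert (T := RInt_comp_lin (V := R_CompleteNormedModule) g 1 d a b).
  rewrite !Rmult_1_l in T. rewrite <- (T Hg). apply (RInt_ext (V := R_CompleteNormedModule)).
  intros t _. rewrite !Rmult_1_l. lra. }
 apply C_eq; simpl; [apply (S (fun t => Re (f t)) A) | apply (S (fun t => Im (f t)) B)].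
Qed.

Lemma cint_periodic f a b : a <= b -> (forall t, rcont f t) -> (forall t, f (t + 1)%R = f t) ->
 cint f a (a + 1) = cint f b (b + 1).
Proof.
 intros Hab Hc Hp.
 assert (HC : forall x y, rconti f x y) by easy.
 assert (E1 := cint_chasles f a (a + 1) (b + 1) ltac:(lra) ltac:(lra) (HC _ _)).
 rewrite <- (cint_shift f 1 a b Hab (HC _ _)) in E1.
 rewrite (cint_ext (fun t => f (t + 1)%R) f a b Hab) in E1 by pos.
 replace (cint f a (a + 1)) with (cint f a (b + 1) - cint f a b) by (rewrite E1; ring).
 rewrite (cint_chasles f a b (b + 1) ltac:(lra) ltac:(lra) (HC _ _)). ring.
Qed.

(** * Goursat's theorem for rectangles *)

Definition pt (x y : R) : C := (x, y).

Definition holo (f : C -> C) (z : C) : Prop := exists l : C, cder f z l.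

Lemma rder_horizontal (f : C -> C) x y (l : C) : cder f (pt x y) l -> rder (fun t => f (pt t y)) x l.
Proof.
 intros H. replace l with (l * 1) by ring. apply (rder_comp f (fun t => pt t y)); auto.
 apply rder_parts. split; simpl; [apply (is_derive_id (K := R_AbsRing)) | apply (is_derive_const (V := R_NormedModule))].
Qed.

Lemma rder_vertical (f : C -> C) x y (l : C) : cder f (pt x y) l -> rder (fun t => f (pt x t)) y (l * Ci).
Proof.
 intros H. apply (rder_comp f (fun t => pt x t)); auto.
 apply rder_parts. split; simpl; [apply (is_derive_const (V := R_NormedModule)) | apply (is_derive_id (K := R_AbsRing))].
Qed.

Lemma rcont_horizontal (f : C -> C) x y : holo f (pt x y) -> rcont (fun t => f (pt t y)) x.
Proof. intros [l H]. eapply rder_rcont, rder_horizontal, H. Qed.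

Lemma rcont_vertical (f : C -> C) x y : holo f (pt x y) -> rcont (fun t => f (pt x t)) y.
Proof. intros [l H]. eapply rder_rcont, rder_vertical, H. Qed.

Definition rect (f : C -> C) (x0 x1 y0 y1 : R) : C :=
 cint (fun x => f (pt x y0) - f (pt x y1)) x0 x1 + Ci * cint (fun y => f (pt x1 y) - f (pt x0 y)) y0 y1.

Definition holo_rect (f : C -> C) (x0 x1 y0 y1 : R) : Prop :=
 forall x y, x0 <= x <= x1 -> y0 <= y <= y1 -> holo f (pt x y).

Lemma rect_rconti_h f x0 x1 y0 y1 : y0 <= y1 -> holo_rect f x0 x1 y0 y1 ->
 rconti (fun x => f (pt x y0) - f (pt x y1)) x0 x1.
Proof. intros Hy H x Hx. apply rcont_minus; apply rcont_horizontal, H; lra. Qed.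

Lemma rect_rconti_v f x0 x1 y0 y1 : x0 <= x1 -> holo_rect f x0 x1 y0 y1 ->
 rconti (fun y => f (pt x1 y) - f (pt x0 y)) y0 y1.
Proof. intros Hx H y Hy. apply rcont_minus; apply rcont_vertical, H; lra. Qed.

Lemma rect_split_x f x0 x1 x2 y0 y1 : x0 <= x1 -> x1 <= x2 -> y0 <= y1 ->
 holo_rect f x0 x2 y0 y1 -> rect f x0 x2 y0 y1 = rect f x0 x1 y0 y1 + rect f x1 x2 y0 y1.
Proof.
 intros H1 H2 Hy H. unfold rect.
 assert (HA : holo_rect f x0 x1 y0 y1) by (intros x y Hx Hy'; apply H; lra).
 assert (HB : holo_rect f x1 x2 y0 y1) by (intros x y Hx Hy'; apply H; lra).
 rewrite (cint_chasles _ x0 x1 x2) by (trivial; now apply rect_rconti_h).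
 rewrite (cint_ext (fun y => f (pt x2 y) - f (pt x0 y))
   (fun y => (f (pt x1 y) - f (pt x0 y)) + (f (pt x2 y) - f (pt x1 y)))) by (trivial; intros; ring).
 rewrite cint_plus by (trivial; now apply rect_rconti_v). ring.
Qed.

Lemma rect_split_y f x0 x1 y0 y1 y2 : x0 <= x1 -> y0 <= y1 -> y1 <= y2 ->
 holo_rect f x0 x1 y0 y2 -> rect f x0 x1 y0 y2 = rect f x0 x1 y0 y1 + rect f x0 x1 y1 y2.
Proof.
 intros Hx H1 H2 H. unfold rect.
 assert (HA : holo_rect f x0 x1 y0 y1) by (intros x y Hx' Hy'; apply H; lra).
 assert (HB : holo_rect f x0 x1 y1 y2) by (intros x y Hx' Hy'; apply H; lra).
 rewrite (cint_chasles _ y0 y1 y2) by (trivial; now apply rect_rconti_v).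
 rewrite (cint_ext (fun x => f (pt x y0) - f (pt x y2))
   (fun x => (f (pt x y0) - f (pt x y1)) + (f (pt x y1) - f (pt x y2)))) by (trivial; intros; ring).
 rewrite cint_plus by (trivial; now apply rect_rconti_h). ring.
Qed.

(** An affine function has boundary integral 0: its differences between opposite sides are constant,
    and the contributions i l (y0 - y1)(x1 - x0) and i l (x1 - x0)(y1 - y0) cancel. Only the
    deviation of f from it counts. *)
Lemma rect_near (f : C -> C) (p l : C) (e : R) x0 x1 y0 y1 : x0 <= x1 -> y0 <= y1 ->
 holo_rect f x0 x1 y0 y1 ->
 (forall x y, x0 <= x <= x1 -> y0 <= y <= y1 -> Cmod (f (pt x y) - f p - l * (pt x y - p)) <= e) ->
 Cmod (rect f x0 x1 y0 y1) <= 4 * e * ((x1 - x0) + (y1 - y0)).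
Proof.
 intros Hx Hy H He. unfold rect.
 assert (P : forall a b : R, Cmod (f (pt a b) - f p - l * (pt a b - p)) <= e ->
       forall a' b' : R, Cmod (f (pt a' b') - f p - l * (pt a' b' - p)) <= e ->
   Cmod ((f (pt a b) - f (pt a' b')) - l * (pt a b - pt a' b')) <= 2 * e).
 { intros a b E1 a' b' E2.
  replace ((f (pt a b) - f (pt a' b')) - l * (pt a b - pt a' b')) with
   ((f (pt a b) - f p - l * (pt a b - p)) - (f (pt a' b') - f p - l * (pt a' b' - p))) by ring.
  le_via Cmod_triangle. rewrite Cmod_opp. lra. }
 assert (A := cint_near (fun x => f (pt x y0) - f (pt x y1)) (l * (pt 0 y0 - pt 0 y1)) x0 x1 (2 * e) Hx
  (rect_rconti_h f x0 x1 y0 y1 Hy H)).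
 assert (B := cint_near (fun y => f (pt x1 y) - f (pt x0 y)) (l * (pt x1 0 - pt x0 0)) y0 y1 (2 * e) Hy
  (rect_rconti_v f x0 x1 y0 y1 Hx H)).
 specialize (A ltac:(intros x Hx'; cbv beta;
  replace (pt 0 y0 - pt 0 y1) with (pt x y0 - pt x y1) by (unfold pt; apply C_eq; simpl; ring);
  apply P; apply He; lra)).
 specialize (B ltac:(intros y Hy'; cbv beta;
  replace (pt x1 0 - pt x0 0) with (pt x1 y - pt x0 y) by (unfold pt; apply C_eq; simpl; ring);
  apply P; apply He; lra)).
 set (I1 := cint _ x0 x1) in *. set (I2 := cint _ y0 y1) in *.
 replace (I1 + Ci * I2) with ((I1 - RtoC (x1 - x0) * (l * (pt 0 y0 - pt 0 y1)))
   + Ci * (I2 - RtoC (y1 - y0) * (l * (pt x1 0 - pt x0 0)))).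
 2:{
   apply C_eq; simpl; ring. }
 le_via Cmod_triangle. rewrite Cmod_mult.
 replace (Cmod Ci) with 1%R.
 2:{ unfold Cmod; simpl. replace (0 * (0 * 1) + 1 * (1 * 1))%R with 1%R by lra. now rewrite sqrt_1. }
 lra.
Qed.

Lemma four_max (a b c d : C) (M : R) :
 M <= Cmod (a + b + (c + d)) ->
 (M / 4 <= Cmod a \/ M / 4 <= Cmod b \/ M / 4 <= Cmod c \/ M / 4 <= Cmod d).
Proof.
 assert (T1 := Cmod_triangle (a + b) (c + d)). assert (T2 := Cmod_triangle a b).
 assert (T3 := Cmod_triangle c d). lra.
Qed.

Lemma pow2_pos n : 0 < / 2 ^ n.
Proof. pos. Qed.

Lemma goursat (f : C -> C) x0 x1 y0 y1 : x0 <= x1 -> y0 <= y1 ->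
 holo_rect f x0 x1 y0 y1 -> rect f x0 x1 y0 y1 = 0.
Proof.
 intros Hx Hy H. set (w := (x1 - x0)%R). set (h := (y1 - y0)%R). set (M := Cmod (rect f x0 x1 y0 y1)).
 (* p is the lower left corner of a rectangle 2^n times smaller that retains at least the fraction
    4^-n of the boundary integral. *)
 set (P := fun (n : nat) (p : R * R) =>
  (x0 <= fst p) /\ fst p + w * / 2 ^ n <= x1 /\ y0 <= snd p /\ snd p + h * / 2 ^ n <= y1 /\
  M * / 4 ^ n <= Cmod (rect f (fst p) (fst p + w * / 2 ^ n) (snd p) (snd p + h * / 2 ^ n))).
 assert (Hw : 0 <= w) by (unfold w; lra). assert (Hh : 0 <= h) by (unfold h; lra).
 assert (step : forall n p, P n p -> exists p', P (S n) p' /\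
   (fst p <= fst p' /\ fst p' + w * / 2 ^ (S n) <= fst p + w * / 2 ^ n /\
   snd p <= snd p' /\ snd p' + h * / 2 ^ (S n) <= snd p + h * / 2 ^ n)).
 { intros n [x y] [P1 [P2 [P3 [P4 P5]]]]. simpl fst in *; simpl snd in *.
  assert (E2 : (/ 2 ^ n = 2 * / 2 ^ (S n))%R) by (simpl; field; apply pow_nonzero; lra).
  assert (E4 : (M * / 4 ^ n / 4 = M * / 4 ^ (S n))%R) by (simpl; field; apply pow_nonzero; lra).
  set (a := (w * / 2 ^ (S n))%R). set (b := (h * / 2 ^ (S n))%R).
  assert (Ha : 0 <= a) by pos.
  assert (Hb : 0 <= b) by pos.
  assert (Ea : (w * / 2 ^ n = a + a)%R) by (rewrite E2; unfold a; ring).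
  assert (Eb : (h * / 2 ^ n = b + b)%R) by (rewrite E2; unfold b; ring).
  rewrite Ea, Eb in *.
  assert (HR : holo_rect f x (x + (a + a)) y (y + (b + b))) by (intros u v Hu Hv; apply H; lra).
  assert (HRs : forall u v u' v', x <= u -> u' <= x + (a + a) -> y <= v -> v' <= y + (b + b) ->
    holo_rect f u u' v v') by (intros u v u' v' ? ? ? ? s t Hs Ht; apply HR; lra).
  rewrite (rect_split_x f x (x + a) (x + (a + a))) in P5 by pos.
  rewrite (rect_split_y f x (x + a) y (y + b) (y + (b + b))) in P5 by (try apply HRs; lra).
  rewrite (rect_split_y f (x + a) (x + (a + a)) y (y + b) (y + (b + b))) in P5 by (try apply HRs; lra).
  apply four_max in P5. rewrite E4 in P5.
  assert (Q : exists p', ((fst p' = x \/ fst p' = x + a) /\ (snd p' = y \/ snd p' = y + b) /\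
    M * / 4 ^ (S n) <= Cmod (rect f (fst p') (fst p' + a) (snd p') (snd p' + b)))%R).
  { destruct P5 as [D|[D|[D|D]]].
   - exists (x, y). tauto.
   - exists (x, y + b)%R. simpl. rewrite (Rplus_assoc y b b). tauto.
   - exists (x + a, y)%R. simpl. rewrite (Rplus_assoc x a a). tauto.
   - exists (x + a, y + b)%R. simpl. rewrite (Rplus_assoc x a a), (Rplus_assoc y b b). tauto. }
  destruct Q as [p' [Q1 [Q2 Q3]]]. exists p'. unfold P. fold a b. lra. }
 assert (P0 : P O (x0, y0)).
 { unfold P. simpl. rewrite Rinv_1, !Rmult_1_r.
  replace (x0 + w)%R with x1 by (unfold w; ring). replace (y0 + h)%R with y1 by (unfold h; ring).
  easy. }
 (* Dependent choice of a nested sequence of such corners. *)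
 set (nxt := fun n (s : {p | P n p}) => constructive_indefinite_description _ (step n (proj1_sig s) (proj2_sig s))).
 set (sq := fix sq n : {p | P n p} := match n with
   | O => exist _ (x0, y0) P0
   | S m => exist _ (proj1_sig (nxt m (sq m))) (proj1 (proj2_sig (nxt m (sq m)))) end).
 set (X := fun n => fst (proj1_sig (sq n))). set (Y := fun n => snd (proj1_sig (sq n))).
 assert (HP : forall n, P n (X n, Y n)).
 { intros n. apply (proj2_sig (sq n)). }
 assert (HS : forall n, (X n <= X (S n) /\ X (S n) + w * / 2 ^ (S n) <= X n + w * / 2 ^ n /\
   Y n <= Y (S n) /\ Y (S n) + h * / 2 ^ (S n) <= Y n + h * / 2 ^ n)).
 { intros n. exact (proj2 (proj2_sig (nxt n (sq n)))). }
 assert (limit : forall (Z : nat -> R) (v : R), 0 <= v ->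
  (forall n, Z n <= Z (S n) /\ Z (S n) + v * / 2 ^ (S n) <= Z n + v * / 2 ^ n) ->
  exists z, forall n, Z n <= z <= Z n + v * / 2 ^ n).
 { intros Z v Hv HZ.
  assert (mono : forall n k, (Z n <= Z (n + k)%nat /\ Z (n + k)%nat + v * / 2 ^ (n + k) <= Z n + v * / 2 ^ n)).
  { intros n k; induction k as [|k IH]; [rewrite Nat.add_0_r; lra|].
   rewrite Nat.add_succ_r. specialize (HZ (n + k)%nat). lra. }
  assert (ub : forall n m, Z m <= Z n + v * / 2 ^ n).
  { intros n m. assert (Pm : 0 <= v * / 2 ^ (n + m)) by pos.
   destruct (mono n m) as [_ A]. destruct (mono m n) as [B _]. rewrite (Nat.add_comm m n) in B. lra. }
  destruct (completeness (fun z => exists n, z = Z n)) as [z [U L]].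
  - exists (Z O + v * / 2 ^ 0)%R. intros z [n ->]. pos.
  - exists (Z O). eauto.
  - exists z. split; [apply U; now exists n|]. apply L. intros z' [m ->]. pos. }
 destruct (limit X w Hw) as [px Hpx]; [intros n; split; apply HS|].
 destruct (limit Y h Hh) as [py Hpy]; [intros n; split; apply HS|].
 assert (Hp : holo f (pt px py)).
 { assert (A := Hpx O). assert (B := Hpy O). destruct (HP O) as [P1 [P2 [P3 [P4 _]]]]. simpl fst in *; simpl snd in *.
  apply H; lra. }
 destruct Hp as [l Hl].
 apply Cmod_small. intros e He.
 set (K := (4 * ((w + h) * (w + h)) + 1)%R). assert (HK : 0 < K) by (unfold K; nra).
 destruct (Hl (e / K)%R) as [d [Hd HD]]; try pos.
 destruct (pow_lt_1_zero (/ 2) ltac:(rewrite Rabs_pos_eq; lra) (d / (1 + w + h))) as [n Hn].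
 { pos. }
 specialize (Hn n (le_n _)). rewrite Rabs_pos_eq in Hn by pos.
 rewrite pow_inv in Hn. assert (Z := pow2_pos n).
 assert (Hsm : (w + h) * / 2 ^ n < d).
 { apply Rmult_lt_compat_l with (r := (1 + w + h)%R) in Hn; [|lra].
  replace ((1 + w + h) * (d / (1 + w + h)))%R with d in Hn by (field; lra). lra. }
 destruct (HP n) as [P1 [P2 [P3 [P4 P5]]]]. simpl fst in *; simpl snd in *.
 assert (Bx := Hpx n). assert (By := Hpy n).
 assert (N := rect_near f (pt px py) l (e / K * ((w + h) * / 2 ^ n)) (X n) (X n + w * / 2 ^ n)
   (Y n) (Y n + h * / 2 ^ n) ltac:(lra) ltac:(lra)).
 assert (N' : Cmod (rect f (X n) (X n + w * / 2 ^ n) (Y n) (Y n + h * / 2 ^ n)) <=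
   4 * (e / K * ((w + h) * / 2 ^ n)) * ((X n + w * / 2 ^ n - X n) + (Y n + h * / 2 ^ n - Y n))).
 { apply N.
  - intros u v Hu Hv. apply H; lra.
  - intros u v Hu Hv. set (dz := pt u v - pt px py).
   assert (Cd : Cmod dz <= (w + h) * / 2 ^ n).
   { le_via Cmod_le_parts. simpl.
    assert (A1 : Rabs (u + - px) <= w * / 2 ^ n) by (apply Rabs_le; lra).
    assert (A2 : Rabs (v + - py) <= h * / 2 ^ n) by (apply Rabs_le; lra). lra. }
   destruct (Ceq_dec dz 0) as [Z0|Z0].
   +
    replace (pt u v) with (pt px py) by (replace (pt u v) with (dz + pt px py) by (unfold dz; ring); rewrite Z0; ring). rewrite Z0. replace (f (pt px py) - f (pt px py) - l * 0) with (RtoC 0) by ring. rewrite Cmod_0.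
    pos.
   + specialize (HD dz Z0 ltac:(lra)).
    replace (pt px py + dz) with (pt u v) in HD by (unfold dz; ring).
    replace (f (pt u v) - f (pt px py) - l * dz) with (dz * ((f (pt u v) - f (pt px py)) / dz - l)) by now field.
    rewrite Cmod_mult, Rmult_comm. mono. }
 assert (E4 : (4 ^ n = 2 ^ n * 2 ^ n)%R) by (rewrite <- Rpow_mult_distr; f_equal; lra).
 assert (F : M * / 4 ^ n <= 4 * (e / K) * ((w + h) * (w + h)) * / 4 ^ n).
 { le_via P5. le_via (N'). right. rewrite E4. field.
  auto with real. }
 apply Rmult_le_reg_r in F; try pos.
 le_via F.
 apply (Rmult_le_reg_r K); auto.
 replace (4 * (e / K) * ((w + h) * (w + h)) * K)%R with (e * (4 * ((w + h) * (w + h))))%R by (field; lra).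
 auto with real.
Qed.

(** * Integrals over a period *)

Definition per (Q : C -> C) (a y : R) : C := cint (fun x => Q (pt x y)) a (a + 1).

(** Goursat on a rectangle of width 1: the vertical sides cancel by periodicity. *)
Lemma per_strip (Q : C -> C) a y0 y1 : y0 <= y1 ->
 (forall x y, y0 <= y <= y1 -> holo Q (pt x y)) ->
 (forall x y, y0 <= y <= y1 -> Q (pt (x + 1) y) = Q (pt x y)) ->
 per Q a y0 = per Q a y1.
Proof.
 intros Hy HQ Hp.
 assert (HR : holo_rect Q a (a + 1) y0 y1) by (intros x y _ Hy'; now apply HQ).
 assert (G := goursat Q a (a + 1) y0 y1 ltac:(lra) Hy HR). unfold rect in G.
 rewrite (cint_ext (fun y => Q (pt (a + 1) y) - Q (pt a y)) (fun _ => 0)) in G.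
 2: exact Hy.
 2:{ intros y Hy'. rewrite Hp by lra. ring. }
 rewrite cint_const in G.
 rewrite cint_minus in G; try lra; try (intros x _; apply rcont_horizontal, HQ; lra).
 unfold per. set (I0 := cint (fun x => Q (pt x y0)) a (a + 1)) in *.
 set (I1 := cint (fun x => Q (pt x y1)) a (a + 1)) in *.
 replace I0 with (I0 - I1 + Ci * (RtoC (y1 - y0) * 0) + I1) by ring. rewrite G. ring.
Qed.

Lemma per_base (Q : C -> C) a b y : (forall x, holo Q (pt x y)) -> (forall x, Q (pt (x + 1) y) = Q (pt x y)) ->
 per Q a y = per Q b y.
Proof.
 intros HQ Hp.
 destruct (Rle_dec a b) as [L|L]; [|symmetry]; apply (cint_periodic (fun x => Q (pt x y)));
 trivial; try lra; intros t; now apply rcont_horizontal.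
Qed.

(* The rectangle around the singularity is shrunk: its boundary integral tends to 0 because (z - p) Q(z) does. *)
Lemma per_cross (Q : C -> C) (px py : R) a y0 y1 : y0 < py < y1 ->
 (forall x y, y0 <= y <= y1 -> (y <> py \/ forall k : Z, x <> px + IZR k)%R -> holo Q (pt x y)) ->
 (forall x y, y0 <= y <= y1 -> Q (pt (x + 1) y) = Q (pt x y)) ->
 ctend0 (fun h => h * Q (pt px py + h)) ->
 per Q a y0 = per Q a y1.
Proof.
 intros Hy HQ Hp HT.
 enough (E : per Q a y0 - per Q a y1 = 0).
 { replace (per Q a y0) with (per Q a y0 - per Q a y1 + per Q a y1) by ring. rewrite E. ring. }
 apply Cmod_small. intros e He.
 destruct (HT (e / 16)%R ltac:(lra)) as [d [Hd HD]].
 (* The square of half-side r around the singularity lies in the disc of radius d, is disjoint from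
    its translates by nonzero integers and stays inside the strip. On its boundary |Q| <= e / (16
    r); integrating a difference of two such values over length 2r costs at most e/2, the factor 2
    of [cint_bound] included, and this happens twice. *)
 set (r := (Rmin (Rmin (d / 4) (/ 4)) (Rmin ((py - y0) / 2) ((y1 - py) / 2)))).
 assert (r1 : r <= d / 4) by (eapply Rle_trans; [apply Rmin_l | apply Rmin_l]).
 assert (r2 : r <= / 4) by (eapply Rle_trans; [apply Rmin_l | apply Rmin_r]).
 assert (r3 : r <= (py - y0) / 2) by (eapply Rle_trans; [apply Rmin_r | apply Rmin_l]).
 assert (r4 : r <= (y1 - py) / 2) by (eapply Rle_trans; [apply Rmin_r | apply Rmin_r]).
 assert (r0 : 0 < r) by pos.
 assert (HQy : forall x y, y0 <= y <= y1 -> y <> py -> holo Q (pt x y)) by pos.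
 rewrite (per_base Q a (px - r) y0), (per_base Q a (px - r) y1);
  try (intros; apply HQy; lra); try (intros; apply Hp; lra).
 rewrite (per_strip Q (px - r) y0 (py - r)); try lra;
  [|intros x y Hy'; apply HQy; lra | intros x y Hy'; apply Hp; lra].
 rewrite <- (per_strip Q (px - r) (py + r) y1); try lra;
  [|intros x y Hy'; apply HQy; lra | intros x y Hy'; apply Hp; lra].
 assert (small : forall u v, Rabs u <= r -> Rabs v <= r -> (Rabs u = r \/ Rabs v = r) ->
   Cmod (Q (pt (px + u) (py + v))) <= e / 16 / r).
 { intros u v Hu Hv Huv.
  assert (N1 : r <= Cmod (pt u v)).
  { destruct Huv as [<-|<-]; [apply (Re_le_Cmod (pt u v)) | apply (Im_le_Cmod (pt u v))]. }
  assert (N2 : Cmod (pt u v) <= r + r).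
  { le_via Cmod_le_parts. mono. }
  assert (NZ : pt u v <> 0) by (intros Z; rewrite Z, Cmod_0 in N1; lra).
  specialize (HD (pt u v) NZ ltac:(lra)).
  replace (pt px py + pt u v) with (pt (px + u) (py + v)) in HD by pos.
  rewrite Cmod_mult in HD.
  apply (Rmult_le_reg_l r); auto.
  replace (r * (e / 16 / r))%R with (e / 16)%R by (field; lra).
  nra. }
 assert (HC : forall y, y0 <= y <= y1 -> y <> py -> forall x x', rconti (fun x => Q (pt x y)) x x').
 { intros y Hy' Hne x x' t _. apply rcont_horizontal, HQy; assumption. }
 unfold per. rewrite <- cint_minus; try lra; [|apply HC; lra|apply HC; lra].
 set (G := fun x => Q (pt x (py - r)) - Q (pt x (py + r))).
 assert (GC : forall x x', rconti G x x').
 { intros x x' t _. apply rcont_minus; apply rcont_horizontal, HQy; lra. }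
 rewrite (cint_chasles G (px - r) (px + r)) by pos.
 assert (B1 : Cmod (cint G (px - r) (px + r)) <= 2 * (2 * (e / 16 / r)) * (px + r - (px - r))).
 { apply cint_bound; try pos. intros t Ht.
  replace t with (px + (t - px))%R by lra.
  assert (Ht' : Rabs (t - px) <= r) by (apply Rabs_le; lra).
  assert (Rr : Rabs r = r) by (apply Rabs_pos_eq; lra).
  le_via Cmod_triangle. rewrite Cmod_opp.
  assert (S1 := small (t - px)%R (- r)%R Ht' ltac:(rewrite Rabs_Ropp; lra) ltac:(right; rewrite Rabs_Ropp; lra)).
  assert (S2 := small (t - px)%R r Ht' ltac:(lra) ltac:(lra)).
  replace (py + - r)%R with (py - r)%R in S1 by lra. lra. }
 assert (HR : holo_rect Q (px + r) (px - r + 1) (py - r) (py + r)).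
 { intros x y Hx Hy'. apply HQ; [lra|]. right. intros k Hk.
  destruct (Z_lt_le_dec k 1) as [L|L].
  - assert (IZR k <= 0) by (apply (IZR_le k 0); lia). lra.
  - assert (1 <= IZR k) by (apply (IZR_le 1 k); lia). lra. }
 assert (GR := goursat Q (px + r) (px - r + 1) (py - r) (py + r) ltac:(lra) ltac:(lra) HR).
 unfold rect in GR. fold G in GR.
 set (V := fun y => Q (pt (px - r + 1) y) - Q (pt (px + r) y)) in GR.
 assert (B2 : Cmod (cint V (py - r) (py + r)) <= 2 * (2 * (e / 16 / r)) * (py + r - (py - r))).
 { apply cint_bound; try lra.
  - intros t Ht. apply rcont_minus; apply rcont_vertical, HR; lra.
  - intros t Ht. unfold V. rewrite Hp by lra.
   replace t with (py + (t - py))%R by lra.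
   assert (Ht' : Rabs (t - py) <= r) by (apply Rabs_le; lra).
   assert (Rr : Rabs r = r) by (apply Rabs_pos_eq; lra).
   le_via Cmod_triangle. rewrite Cmod_opp.
   assert (S1 := small (- r)%R (t - py)%R ltac:(rewrite Rabs_Ropp; lra) Ht' ltac:(left; rewrite Rabs_Ropp; lra)).
   assert (S2 := small r (t - py)%R ltac:(lra) Ht' ltac:(lra)).
   replace (px + - r)%R with (px - r)%R in S1 by lra. lra. }
 assert (E : cint G (px + r) (px - r + 1) = - (Ci * cint V (py - r) (py + r))).
 { set (A := cint G (px + r) (px - r + 1)) in *. set (B := cint V (py - r) (py + r)) in *.
  replace A with (A + Ci * B - Ci * B) by ring. rewrite GR. ring. }
 rewrite E. le_via Cmod_triangle. rewrite Cmod_opp, Cmod_mult.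
 replace (Cmod Ci) with 1%R.
 2:{ unfold Cmod; simpl. replace (0 * (0 * 1) + 1 * (1 * 1))%R with 1%R by lra. now rewrite sqrt_1. }
 replace (2 * (2 * (e / 16 / r)) * (px + r - (px - r)))%R with (e / 2)%R in B1 by (field; lra).
 replace (2 * (2 * (e / 16 / r)) * (py + r - (py - r)))%R with (e / 2)%R in B2 by (field; lra). lra.
Qed.

(** * Limits and derivatives *)

Lemma Csub_eq (a b : C) : a - b = 0 -> a = b.
Proof. intros E. replace a with (a - b + b) by ring. rewrite E. ring. Qed.

Definition clim (r : C -> C) (a : C) : Prop := ctend0 (fun h => r h - a).

Lemma clim_plus (r s : C -> C) (a b : C) : clim r a -> clim s b -> clim (fun h => r h + s h) (a + b).
Proof. intros H H'. apply (ctend0_ext (fun h => (r h - a) + (s h - b))); [intros; ring | now apply ctend0_plus]. Qed.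

Lemma clim_mult (r s : C -> C) (a b : C) : clim r a -> clim s b -> clim (fun h => r h * s h) (a * b).
Proof.
 intros H H'. apply (ctend0_ext (fun h => (r h - a) * (s h - b) + (b * (r h - a) + a * (s h - b)))); [intros; ring|].
 apply ctend0_plus; [now apply ctend0_mult | apply ctend0_plus; now apply ctend0_scal].
Qed.

Lemma clim_const (a : C) : clim (fun _ => a) a.
Proof. apply (ctend0_ext (fun _ => 0)); [intros; ring | apply ctend0_zero]. Qed.

Lemma clim_scal (k : C) (r : C -> C) (a : C) : clim r a -> clim (fun h => k * r h) (k * a).
Proof. apply clim_mult, clim_const. Qed.

Lemma clim_inv (r : C -> C) (a : C) : a <> 0 -> clim r a -> clim (fun h => / r h) (/ a).
Proof.
 intros Ha H. assert (Hm : 0 < Cmod a) by (apply Cmod_gt_0; exact Ha).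
 destruct (H (Cmod a / 2)%R ltac:(lra)) as [d [Hd HD]].
 assert (LB : forall h : C, h <> 0 -> Cmod h < d -> Cmod a / 2 <= Cmod (r h)).
 { intros h Hh Hhd. specialize (HD h Hh Hhd). assert (T := Cmod_triangle (r h) (- (r h - a))).
  rewrite Cmod_opp in T. replace (r h + - (r h - a)) with a in T by ring. lra. }
 assert (NZ : forall h : C, h <> 0 -> Cmod h < d -> r h <> 0).
 { intros h Hh Hhd E. specialize (LB h Hh Hhd). rewrite E, Cmod_0 in LB. lra. }
 apply (ctend0_ext_loc (fun h => (- / (a * r h)) * (r h - a))).
 - exists d. split; auto. intros h Hh Hhd. field. pos.
 - apply (ctend0_bounded _ _ (/ (Cmod a * (Cmod a / 2)))); auto.
  exists d. split; auto. intros h Hh Hhd.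
  rewrite Cmod_opp, Cmod_inv, Cmod_mult by (apply Cmult_neq_0; auto).
  mono.
Qed.

Lemma clim_ext_loc (r s : C -> C) (a : C) :
 (exists d, 0 < d /\ forall h : C, h <> 0 -> Cmod h < d -> r h = s h) -> clim r a -> clim s a.
Proof.
 intros [d [Hd E]]. apply ctend0_ext_loc. exists d. split; auto. intros h Hh Hhd. now rewrite E.
Qed.

Lemma clim_ext (r s : C -> C) (a : C) : (forall h : C, h <> 0 -> r h = s h) -> clim r a -> clim s a.
Proof. intros E. apply clim_ext_loc. exists 1%R. auto with real. Qed.

Lemma clim_val (r : C -> C) (a b : C) : a = b -> clim r a -> clim r b.
Proof. now intros ->. Qed.

Lemma clim_id : clim (fun h => h) 0.
Proof. apply (ctend0_ext (fun h => h)); [intros; ring | apply ctend0_id]. Qed.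

Lemma ctend0_clim (r : C -> C) : ctend0 r <-> clim r 0.
Proof. split; apply ctend0_ext; intros; ring. Qed.

Lemma holo_clim (f : C -> C) (z : C) : holo f z -> clim (fun h => f (z + h)) (f z).
Proof. intros [l H]. exact (cder_cont f z l H). Qed.

Lemma holo_plus (f g : C -> C) (z : C) : holo f z -> holo g z -> holo (fun s => f s + g s) z.
Proof. intros [l H] [l' H']. eexists. apply cder_plus; eassumption. Qed.

Lemma holo_mult (f g : C -> C) (z : C) : holo f z -> holo g z -> holo (fun s => f s * g s) z.
Proof. intros [l H] [l' H']. eexists. apply cder_mult; eassumption. Qed.

Lemma holo_scal (k : C) (f : C -> C) (z : C) : holo f z -> holo (fun s => k * f s) z.
Proof. intros [l H]. eexists. apply cder_scal; eassumption. Qed.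

Lemma holo_const (k z : C) : holo (fun _ => k) z.
Proof. eexists. apply cder_const. Qed.

Lemma holo_inv (f : C -> C) (z : C) : f z <> 0 -> holo f z -> holo (fun s => / f s) z.
Proof. intros Hz [l H]. eexists. apply cder_inv; eassumption. Qed.

Lemma holo_ext (f g : C -> C) (z : C) : (forall s, f s = g s) -> holo f z -> holo g z.
Proof. intros E [l H]. exists l. now apply (cder_ext f). Qed.

Lemma holo_shift (f : C -> C) (a z : C) : holo f (a + z) -> holo (fun s => f (a + s)) z.
Proof. intros [l H]. exists l. now apply cder_shift. Qed.

Lemma holo_minus (f g : C -> C) (z : C) : holo f z -> holo g z -> holo (fun s => f s - g s) z.
Proof.
 intros Hf Hg. apply (holo_ext (fun s => f s + - (1) * g s)); [intros; ring|].
 now apply holo_plus, holo_scal.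
Qed.

Definition punctured (P : C -> Prop) : Prop :=
 exists d, 0 < d /\ forall h : C, h <> 0 -> Cmod h < d -> P h.

Lemma punctured_filter : Filter punctured.
Proof.
 split.
 - exists 1%R. auto with real.
 - intros P Q [d [Hd H]] [d' [Hd' H']]. exists (Rmin d d'). split; try pos.
  destruct (Rmin_le d d') as [M1 M2]. split; [apply H | apply H']; trivial; lra.
 - intros P Q HPQ [d [Hd H]]. exists d. pos.
Qed.

Lemma small_nonzero (d : R) : 0 < d -> exists h : C, h <> 0 /\ Cmod h < d.
Proof.
 exists (RtoC (d / 2)). split; [apply RtoC_neq_0; lra|].
 rewrite Cmod_R, Rabs_pos_eq; lra.
Qed.

(** Termwise differentiation: difference quotients and derivatives are dominated by T, so the sum of
    the errors [g h n] tends to 0 by Tannery's theorem along punctured neighbourhoods. *)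
Lemma series_cder (f : nat -> C -> C) (F : C -> C) (z : C) (f' : nat -> C) (T : nat -> R) (d : R) :
 0 < d -> (forall n, cder (f n) z (f' n)) ->
 (forall n (h : C), Cmod h < d -> Cmod (f n (z + h) - f n z) <= T n * Cmod h) ->
 ex_series T ->
 (forall h : C, Cmod h < d -> cser (fun n => f n (z + h)) (F (z + h))) ->
 holo F z.
Proof.
 intros Hd Hf HT ET HF.
 assert (Hq : forall n (h : C), h <> 0 -> Cmod h < d -> Cmod ((f n (z + h) - f n z) / h) <= T n).
 { intros n h Hh Hm. assert (Hp : 0 < Cmod h) by (apply Cmod_gt_0; exact Hh).
  rewrite Cmod_div by pos. apply (Rmult_le_reg_r (Cmod h)); auto.
  unfold Rdiv. rewrite Rmult_assoc, Rinv_l, Rmult_1_r by lra. pos. }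
 assert (Hf' : forall n, Cmod (f' n) <= T n).
 { intros n. apply le_epsilon. intros e He. destruct (Hf n e He) as [d' [Hd' H']].
  destruct (small_nonzero (Rmin d d')) as [h [Hh Hm]]; try pos.
  destruct (Rmin_le d d') as [M1 M2].
  specialize (H' h Hh ltac:(lra)). specialize (Hq n h Hh ltac:(lra)).
  set (Qh := (f n (z + h) - f n z) / h) in *.
  replace (f' n) with (Qh + - (Qh - f' n)) by ring.
  le_via Cmod_triangle. rewrite Cmod_opp. lra. }
 destruct (cser_exists f' T Hf' ET) as [l Hl]. exists l.
 set (g := fun (h : C) (n : nat) => (f n (z + h) - f n z) / h - f' n).
 assert (T0 : forall n, 0 <= T n) by (intros n; assert (C0 := Cmod_ge_0 (f' n)); specialize (Hf' n); lra).
 assert (key : forall e, 0 < e -> punctured (fun h => forall l0 : C,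
   cser (fun n => if Rlt_dec (Cmod h) d then if Ceq_dec h 0 then 0 else g h n else 0) l0 -> Cmod l0 < e)).
 { apply (tannery punctured punctured_filter
   (fun (h : C) (n : nat) => if Rlt_dec (Cmod h) d then if Ceq_dec h 0 then 0 else g h n else 0) (fun n => 2 * T n)%R
   (ex_series_scal_l 2%R T ET)).
  - exists 1%R. split; [lra|]. intros h _ _ n. specialize (T0 n).
   destruct (Rlt_dec (Cmod h) d) as [L|L]; [|rewrite Cmod_0; lra].
   destruct (Ceq_dec h 0) as [Z|Z]; [rewrite Cmod_0; lra|].
   le_via Cmod_triangle. rewrite Cmod_opp.
   specialize (Hq n h Z L). specialize (Hf' n). lra.
  - intros n e He. destruct (Hf n e He) as [d' [Hd' H']]. exists d'. split; auto.
   intros h Hh Hm. destruct (Rlt_dec (Cmod h) d); [|rewrite Cmod_0; exact He].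
   destruct (Ceq_dec h 0); [rewrite Cmod_0; exact He|]. eauto. }
 intros e He. destruct (key e He) as [d' [Hd' H']].
 exists (Rmin d d'). split; try pos. intros h Hh Hm.
 destruct (Rmin_le d d') as [M1 M2].
 apply (H' h Hh ltac:(lra)).
 destruct (Rlt_dec (Cmod h) d) as [L|L]; [|lra]. destruct (Ceq_dec h 0) as [Z|Z]; [contradiction|].
 assert (F0 := HF 0 ltac:(rewrite Cmod_0; exact Hd)). rewrite Cplus_0_r in F0.
 replace ((F (z + h) - F z) / h - l) with (/ h * (F (z + h) + - (1) * F z) + - (1) * l) by now field.
 apply cser_ext with (2 := (cser_plus _ _ _ _ (cser_scal (/ h) _ _ (cser_plus _ _ _ _ (HF h L) (cser_scal (- (1)) _ _ F0)))
   (cser_scal (- (1)) _ _ Hl))). intros n. unfold g. now field.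
Qed.

Lemma exp_INR (n : nat) (x : R) : exp (INR n * x) = (exp x ^ n)%R.
Proof.
 induction n as [|n IH]; [simpl; now rewrite Rmult_0_l, exp_0|].
 rewrite S_INR, Rmult_plus_distr_r, exp_plus, IH, Rmult_1_l. simpl; lra.
Qed.

Lemma ex_series_geom1 (x : R) : 0 <= x < 1 -> ex_series (fun n => x ^ (S n))%R.
Proof.
 intros Hx. apply (ex_series_scal_l x (fun n => x ^ n)%R). apply geom_ex. rewrite Rabs_pos_eq; lra.
Qed.

Lemma ex_series_n_geom (x : R) : 0 <= x < 1 -> ex_series (fun n => INR (S n) * x ^ (S n))%R.
Proof.
 intros Hx. apply (ex_series_Rle _ (fun k => 2 * INR (2 * k + 1) * x ^ (S k))%R).
 - intros n. assert (Hp := pow_le x (S n) (proj1 Hx)). split.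
  + pos.
  + apply Rmult_le_compat_r; auto. rewrite plus_INR, mult_INR, S_INR. simpl (INR 2). simpl (INR 1).
   assert (Hn' := pos_INR n). lra.
 - eexists. now apply is_series_odd_geom.
Qed.

Lemma cser_geom1 (x : C) : Cmod x < 1 -> cser (fun n => Cpow x (S n)) (x / (1 - x)).
Proof.
 intros Hx. assert (N1 : 1 - x <> 0).
 { intros E. assert (E' : x = 1) by (replace x with (1 - (1 - x)) by ring; rewrite E; ring).
  rewrite E', Cmod_1 in Hx. lra. }
 assert (P : forall n, sum_n (fun n => Cpow x (S n)) n = (x - Cpow x (S (S n))) / (1 - x) :> C).
 { induction n as [|n IH]; [rewrite csum_O; simpl; field; exact N1|].
  rewrite csum_S, IH. simpl. now field. }
 assert (Hm : 0 < Cmod (1 - x)) by (apply Cmod_gt_0; exact N1).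
 intros e He.
 destruct (pow_lt_1_zero (Cmod x) ltac:(rewrite Rabs_pos_eq; pos) (e * Cmod (1 - x))) as [N HN].
 { pos. }
 exists N. intros n Hn. rewrite P. specialize (HN (S (S n)) ltac:(lia)).
 rewrite Rabs_pos_eq in HN by pos.
 replace ((x - Cpow x (S (S n))) / (1 - x) - x / (1 - x)) with (- (Cpow x (S (S n)) / (1 - x))) by now field.
 rewrite Cmod_opp, Cmod_div, Cmod_pow by pos.
 apply (Rmult_lt_reg_r (Cmod (1 - x))); auto.
 replace (Cmod x ^ S (S n) / Cmod (1 - x) * Cmod (1 - x))%R with (Cmod x ^ S (S n))%R by (field; lra). lra.
Qed.

(** * The kernel theta(z+s)/(theta(z)theta(s)) *)

Section Theta.

Variables (th : C -> C) (tau : C).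
Hypothesis tau_up : 0 < Im tau.
Hypothesis th_holo : forall z, holo th z.
Hypothesis th_1 : forall z, th (z + 1) = - th z.
Hypothesis th_tau : forall z, th (z + tau) = - Cexp (- (two_pi_i * z) - RtoC PI * Ci * tau) * th z.
Hypothesis th_opp : forall z, th (- z) = - th z.
Hypothesis th_zero : forall z, th z = 0 <-> exists m n : Z, z = RtoC (IZR m) + RtoC (IZR n) * tau.
Hypothesis th_der0 : cder th 0 1.

Definition lattice (z : C) : Prop := exists m n : Z, z = RtoC (IZR m) + RtoC (IZR n) * tau.

Let c := two_pi_i.

Lemma lattice_opp z : lattice (- z) -> lattice z.
Proof.
 intros [m [n E]]. exists (- m)%Z, (- n)%Z. rewrite !opp_IZR, !RtoC_opp.
 replace z with (- - z) by ring. rewrite E. ring.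
Qed.

Lemma th_neq_0 z : ~ lattice z -> th z <> 0.
Proof. intros H E. apply H. now apply th_zero. Qed.

(** Kronecker's function; the KZB kernel is -s phi(z, s) at s = ad x, applied to y. As a function of
    s it has period 1, the multiplier exp(-2 pi i z) under s -> s + tau, and a simple pole with
    residue 1 at 0. *)
Definition phi (z s : C) : C := th (z + s) * / (th z * th s).

Lemma phi_holo z s : ~ lattice z -> ~ lattice s -> holo (phi z) s.
Proof.
 intros Hz Hs. apply holo_mult; [apply holo_shift, th_holo|].
 apply holo_inv; [apply Cmult_neq_0; now apply th_neq_0|]. apply holo_scal, th_holo.
Qed.

Lemma phi_1 z s : ~ lattice z -> phi z (s + 1) = phi z s.
Proof.
 intros Hz. unfold phi. rewrite Cplus_assoc, !th_1.
 (* At a pole both sides are 0, the inverse of 0 being 0; periodicity thus holds without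
    exception. *)
 destruct (Ceq_dec (th s) 0) as [E|E]; [|field; split; [exact E | now apply th_neq_0]].
 rewrite E.
 apply C_eq; simpl; unfold Rdiv; ring.
Qed.

Lemma phi_tau z s : ~ lattice z -> ~ lattice s -> phi z (s + tau) = Cexp (- (c * z)) * phi z s.
Proof.
 intros Hz Hs. unfold phi. rewrite Cplus_assoc, !th_tau.
 replace (- (two_pi_i * (z + s)) - PI * Ci * tau) with
  (- (c * z) + (- (two_pi_i * s) - PI * Ci * tau)) by (unfold c; ring).
 rewrite Cexp_add. field. repeat split; try apply Cexp_neq_0; now apply th_neq_0.
Qed.

Lemma th_quot : clim (fun h => th h / h) 1.
Proof.
 assert (T0 : th 0 = 0) by (apply th_zero; exists 0%Z, 0%Z; ring).
 apply (ctend0_ext (fun h => (th (0 + h) - th 0) / h - 1)); auto.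
 intros h Hh. rewrite Cplus_0_l, T0. now field.
Qed.

Lemma phi_pole z : ~ lattice z -> clim (fun h => h * phi z h) 1.
Proof.
 intros Hz. apply (clim_val _ (/ th z * th z * / 1)).
 { field. now apply th_neq_0. }
 assert (A := holo_clim th z (th_holo z)).
 assert (B := clim_inv _ _ C1_nz th_quot).
 destruct (th_quot (/ 2)%R ltac:(lra)) as [d [Hd H]].
 apply (clim_ext_loc (fun h => / th z * th (z + h) * / (th h / h))).
 - exists d. split; auto. intros h Hh Hm. specialize (H h Hh Hm).
  unfold phi. field. repeat split; [|now apply th_neq_0 | exact Hh].
  intros E. rewrite E in H. replace (0 / h - 1) with (- (1)) in H by now field.
  rewrite Cmod_opp, Cmod_1 in H. lra.
 - apply clim_mult; auto. now apply clim_scal.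
Qed.

(** * Kronecker's formula *)

Section Expansion.

Variable z : C.
Hypothesis z_lat : ~ lattice z.

Let u := Cexp (c * z).
Let q := Cexp (c * tau).

Definition qcoef (v : C) (n : nat) : C := Cpow q (S n) * v / (1 - Cpow q (S n) * v).

Lemma Cpow_q n : Cpow q n = Cexp (c * ((INR n) * tau)).
Proof. unfold q. rewrite <- Cexp_nat. f_equal. ring. Qed.

Lemma Cmod_q : Cmod q = exp (- (2 * PI) * Im tau).
Proof. unfold q. now rewrite Cmod_Cexp, Re_two_pi_i. Qed.

Lemma Cmod_q_lt : 0 < Cmod q < 1.
Proof. rewrite Cmod_q. apply exp_lt_1. assert (P := PI_RGT_0). nra. Qed.

Lemma RtoC_m1 : RtoC (IZR (-1)) = - RtoC 1.
Proof. ring. Qed.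

Lemma qcoef_den n (k : Z) : (k = 1 \/ k = -1)%Z -> 1 - Cpow q (S n) * Cexp (c * ((IZR k) * z)) <> 0.
Proof.
 intros Hk E. rewrite Cpow_q, <- Cexp_add in E.
 assert (E1 : Cexp (two_pi_i * ((INR (S n)) * tau + (IZR k) * z)) = 1).
 {
  replace (two_pi_i * ((INR (S n)) * tau + (IZR k) * z)) with
   (two_pi_i * ((INR (S n)) * tau) + two_pi_i * ((IZR k) * z)) by ring.
  symmetry. apply Csub_eq. pos. }
 apply Cexp_eq_1 in E1. destruct E1 as [m Em]. apply z_lat.
 assert (E2 : (IZR k) * z = (IZR m) - (INR (S n)) * tau) by (rewrite <- Em; ring).
 rewrite INR_IZR_INZ in E2.
 destruct Hk as [-> | ->].
 - exists m, (- Z.of_nat (S n))%Z. rewrite opp_IZR, RtoC_opp.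
  replace z with (1 * z) by ring. rewrite E2. ring.
 - exists (- m)%Z, (Z.of_nat (S n)). rewrite opp_IZR, RtoC_opp.
  rewrite RtoC_m1 in E2. replace z with (- (- RtoC 1 * z)) by ring. rewrite E2. ring.
Qed.

Lemma u_den n : 1 - Cpow q (S n) * u <> 0.
Proof.
 assert (H := qcoef_den n 1 (or_introl eq_refl)). rewrite Cmult_1_l in H. pos.
Qed.

Lemma uinv_den n : 1 - Cpow q (S n) * / u <> 0.
Proof.
 assert (H := qcoef_den n (-1) (or_intror eq_refl)). unfold u. rewrite <- Cexp_opp.
 rewrite RtoC_m1 in H. replace (- (c * z)) with (c * (- RtoC 1 * z)) by ring. pos.
Qed.

Lemma u_neq_0 : u <> 0. Proof. apply Cexp_neq_0. Qed.

Lemma u_neq_1 : u - 1 <> 0.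
Proof.
 intros E. assert (E1 : Cexp (two_pi_i * z) = 1).
 { change (u = 1). replace u with (u - 1 + 1) by ring. rewrite E. ring. }
 apply Cexp_eq_1 in E1. destruct E1 as [m Em]. apply z_lat. exists m, 0%Z. rewrite Em. ring.
Qed.

Lemma qcoef_bound (v : C) : (forall n, 1 - Cpow q (S n) * v <> 0) ->
 exists A, 0 <= A /\ forall n, Cmod (qcoef v n) <= A * Cmod q ^ (S n).
Proof.
 intros Hv. assert (Q := Cmod_q_lt). assert (V0 := Cmod_ge_0 v).
 destruct (pow_lt_1_zero (Cmod q) ltac:(rewrite Rabs_pos_eq; lra) (/ (2 * (1 + Cmod v)))) as [N HN].
 { pos. }
 assert (B : forall n, (N <= n)%nat -> / 2 <= Cmod (1 - Cpow q (S n) * v)).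
 { intros n Hn. specialize (HN (S n) ltac:(lia)). rewrite Rabs_pos_eq in HN by pos.
  assert (T := Cmod_triangle (1 - Cpow q (S n) * v) (Cpow q (S n) * v)).
  replace (1 - Cpow q (S n) * v + Cpow q (S n) * v) with (RtoC 1) in T by ring.
  rewrite Cmod_1, Cmod_mult, Cmod_pow in T.
  assert (L : Cmod q ^ S n * Cmod v <= / (2 * (1 + Cmod v)) * (1 + Cmod v)) by mono.
  replace (/ (2 * (1 + Cmod v)) * (1 + Cmod v))%R with (/ 2)%R in L by (field; lra). lra. }
 assert (K : forall N', exists M, 0 < M /\ forall n, (n < N' \/ N <= n)%nat -> M <= Cmod (1 - Cpow q (S n) * v)).
 { induction N' as [|N' [M [HM IH]]].
  - exists (/ 2)%R. split; [lra|]. intros n [Hn|Hn]; [lia | now apply B].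
  - assert (Hp : 0 < Cmod (1 - Cpow q (S N') * v)) by (apply Cmod_gt_0; apply Hv).
   exists (Rmin M (Cmod (1 - Cpow q (S N') * v))). split; try pos.
   intros n Hn. destruct (Nat.eq_dec n N') as [->|Hne]; [apply Rmin_r|].
   eapply Rle_trans; [apply Rmin_l | apply IH; lia]. }
 destruct (K N) as [M [HM HK]].
 exists (Cmod v / M)%R. split; try pos.
 intros n. unfold qcoef. rewrite Cmod_div by pos. rewrite Cmod_mult, Cmod_pow.
 specialize (HK n ltac:(lia)). unfold Rdiv.
 replace (Cmod v * / M * Cmod q ^ S n)%R with (Cmod q ^ S n * Cmod v * / M)%R by lra.
 mono.
Qed.

Definition kterm (s : C) (n : nat) : C :=
 qcoef u n * Cexp (c * RtoC (INR (S n)) * s) + - (qcoef (/ u) n * Cexp (- (c * RtoC (INR (S n))) * s)).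

Definition kser (s : C) : C := CSeries (kterm s).

(** Kronecker's double series in powers of q, one index having been summed as a geometric series.
    The pole at s = 0 is isolated in the middle term, and [kser] is analytic for |Im s| < Im tau, a
    region large enough to compare s with s + tau. *)
Definition kron (s : C) : C := c * u / (u - 1) + c / (Cexp (c * s) - 1) + - (c * kser s).

Lemma Cmod_Cexp_n (s : C) n : Cmod (Cexp (c * (INR (S n)) * s)) <= exp (INR (S n) * (2 * PI * Rabs (Im s))).
Proof.
 rewrite Cmod_Cexp.
 replace (c * (INR (S n)) * s) with (two_pi_i * ((INR (S n)) * s)) by (unfold c; ring).
 rewrite Re_two_pi_i. replace (Im ((INR (S n)) * s)) with (INR (S n) * Im s)%R by (destruct s; simpl; ring).
 assert (P := PI_RGT_0). assert (A := Rle_abs (- Im s)). rewrite Rabs_Ropp in A.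
 replace (- (2 * PI) * (INR (S n) * Im s))%R with (INR (S n) * (2 * PI * - Im s))%R by lra.
 mono.
Qed.

Lemma Cmod_Cexp_n' (s : C) n : Cmod (Cexp (- (c * (INR (S n))) * s)) <= exp (INR (S n) * (2 * PI * Rabs (Im s))).
Proof.
 replace (- (c * (INR (S n))) * s) with (c * (INR (S n)) * (- s)) by ring.
 replace (Rabs (Im s)) with (Rabs (Im (- s))); [apply Cmod_Cexp_n|].
 apply Rabs_Ropp.
Qed.

Lemma kterm_cser (s : C) : Rabs (Im s) < Im tau -> cser (kterm s) (kser s).
Proof.
 intros Hs. assert (P := PI_RGT_0).
 destruct (qcoef_bound u u_den) as [A [HA A1]]. destruct (qcoef_bound (/ u) uinv_den) as [B [HB B1]].
 set (x := exp (- (2 * PI) * (Im tau - Rabs (Im s)))).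
 assert (Hx : 0 < x < 1) by (apply exp_lt_1; nra).
 assert (E : forall n, (Cmod q ^ S n * exp (INR (S n) * (2 * PI * Rabs (Im s))) = x ^ S n)%R).
 { intros n. rewrite Cmod_q, <- exp_INR, <- exp_plus. unfold x. rewrite <- exp_INR. f_equal. ring. }
 destruct (cser_exists (kterm s) (fun n => (A + B) * x ^ (S n))%R) as [l Hl].
 - intros n. le_via Cmod_triangle. rewrite Cmod_opp, !Cmod_mult.
  rewrite Rmult_plus_distr_r, <- E, <- (Rmult_assoc A), <- (Rmult_assoc B).
  apply Rplus_le_compat; apply Rmult_le_compat; try apply Cmod_ge_0; trivial;
   [apply Cmod_Cexp_n | apply Cmod_Cexp_n'].
 - apply (ex_series_scal_l (A + B)%R (fun n => x ^ S n)%R), ex_series_geom1. lra.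
 - unfold kser. now rewrite (cser_CSeries _ _ Hl).
Qed.

Lemma kser_holo (s : C) : Rabs (Im s) < Im tau -> holo kser s.
Proof.
 intros Hs. assert (P := PI_RGT_0).
 destruct (qcoef_bound u u_den) as [A [HA A1]]. destruct (qcoef_bound (/ u) uinv_den) as [B [HB B1]].
 set (d := ((Im tau - Rabs (Im s)) / 2)%R). assert (Hd : 0 < d) by (unfold d; lra).
 set (x := exp (- (2 * PI) * d)).
 assert (Hx : 0 < x < 1) by (apply exp_lt_1; nra).
 assert (E : forall n, (Cmod q ^ S n * exp (INR (S n) * (2 * PI * Rabs (Im s))) * exp (INR (S n) * (2 * PI * d)) = x ^ S n)%R).
 { intros n. rewrite Cmod_q, <- exp_INR, <- !exp_plus. unfold x. rewrite <- exp_INR. f_equal. unfold d. field. }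
 assert (L : forall (k : C) n (h : C), Cmod h < d -> Cmod k = (2 * PI * INR (S n))%R ->
   Cmod (Cexp (k * s)) <= exp (INR (S n) * (2 * PI * Rabs (Im s))) ->
   Cmod q ^ S n * Cmod (Cexp (k * (s + h)) - Cexp (k * s))%C <= 2 * PI * (INR (S n) * x ^ (S n)) * Cmod h).
 { intros k n h Hh Hk Hks.
  replace (Cexp (k * (s + h)) - Cexp (k * s)) with (Cexp (k * s) * (Cexp (k * h) - 1)).
  2:{ replace (k * (s + h)) with (k * s + k * h) by ring. rewrite Cexp_add. ring. }
  rewrite Cmod_mult. assert (M := Cexp_m1_bound (k * h)). rewrite Cmod_mult, Hk in M.
  assert (C0 := Cmod_ge_0 h). assert (N0 := pos_INR (S n)).
  assert (M' : Cmod (Cexp (k * h) - 1)%C <= exp (INR (S n) * (2 * PI * d)) * (2 * PI * INR (S n) * Cmod h)).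
  { le_via M. apply Rmult_le_compat_r.
   - pos.
   - apply exp_le. replace (2 * PI * INR (S n) * Cmod h)%R with (INR (S n) * (2 * PI * Cmod h))%R by ring.
    mono. }
  rewrite <- E.
  replace (2 * PI * (INR (S n) * (Cmod q ^ S n * exp (INR (S n) * (2 * PI * Rabs (Im s))) * exp (INR (S n) * (2 * PI * d)))) * Cmod h)%R
   with (Cmod q ^ S n * (exp (INR (S n) * (2 * PI * Rabs (Im s))) * (exp (INR (S n) * (2 * PI * d)) * (2 * PI * INR (S n) * Cmod h))))%R by ring.
  mono. }
 assert (Ck : forall n, Cmod (c * RtoC (INR (S n))) = (2 * PI * INR (S n))%R).
 { intros n. rewrite Cmod_mult, Cmod_R, Rabs_pos_eq by apply pos_INR. unfold c. now rewrite Cmod_two_pi_i. }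
 apply (series_cder (fun n s => kterm s n) kser s
  (fun n => qcoef u n * (c * RtoC (INR (S n)) * Cexp (c * RtoC (INR (S n)) * s)) +
    - (1) * (qcoef (/ u) n * (- (c * RtoC (INR (S n))) * Cexp (- (c * RtoC (INR (S n))) * s))))
  (fun n => (A + B) * (2 * PI) * (INR (S n) * x ^ (S n)))%R d Hd).
 - intros n. apply (cder_ext (fun s => qcoef u n * Cexp (c * RtoC (INR (S n)) * s) + - (1) * (qcoef (/ u) n * Cexp (- (c * RtoC (INR (S n))) * s)))).
  { intros s'. unfold kterm. ring. }
  apply cder_plus; [|apply cder_scal]; apply cder_scal, cder_Cexp.
 - intros n h Hh. unfold kterm.
  replace (qcoef u n * Cexp (c * (INR (S n)) * (s + h)) +
    - (qcoef (/ u) n * Cexp (- (c * (INR (S n))) * (s + h))) -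
   (qcoef u n * Cexp (c * (INR (S n)) * s) + - (qcoef (/ u) n * Cexp (- (c * (INR (S n))) * s)))) with
   (qcoef u n * (Cexp (c * (INR (S n)) * (s + h)) - Cexp (c * (INR (S n)) * s)) +
    - (qcoef (/ u) n * (Cexp (- (c * (INR (S n))) * (s + h)) - Cexp (- (c * (INR (S n))) * s)))) by ring.
  le_via Cmod_triangle. rewrite Cmod_opp, !Cmod_mult.
  assert (L1 := L (c * (INR (S n))) n h Hh (Ck n) (Cmod_Cexp_n s n)).
  assert (L2 := L (- (c * (INR (S n)))) n h Hh ltac:(rewrite Cmod_opp; apply Ck) (Cmod_Cexp_n' s n)).
  set (D1 := Cmod (Cexp (c * (INR (S n)) * (s + h)) - Cexp (c * (INR (S n)) * s))) in *.
  set (D2 := Cmod (Cexp (- (c * (INR (S n))) * (s + h)) - Cexp (- (c * (INR (S n))) * s))) in *.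
  set (X := (2 * PI * (INR (S n) * x ^ S n) * Cmod h)%R) in *.
  replace ((A + B) * (2 * PI) * (INR (S n) * x ^ S n) * Cmod h)%R with (A * X + B * X)%R by (unfold X; ring).
  apply Rplus_le_compat.
  + apply Rle_trans with (A * Cmod q ^ S n * D1)%R; try mono.
   nra.
  + apply Rle_trans with (B * Cmod q ^ S n * D2)%R; try mono.
   nra.
 - apply (ex_series_scal_l ((A + B) * (2 * PI))%R (fun n => INR (S n) * x ^ (S n))%R), ex_series_n_geom. lra.
 - intros h Hh. apply kterm_cser.
  assert (I1 : Rabs (Im (s + h)) <= Rabs (Im s) + Rabs (Im h)) by (simpl; apply Rabs_triang).
  assert (I2 := Im_le_Cmod h). unfold d in Hh. lra.
Qed.

Definition isZ (s : C) : Prop := exists k : Z, s = RtoC (IZR k).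

Lemma lattice_strip (s : C) : Rabs (Im s) < Im tau -> lattice s -> isZ s.
Proof.
 intros Hs [m [n E]].
 assert (In : Im s = (IZR n * Im tau)%R) by (rewrite E; destruct tau; simpl; ring).
 rewrite In, Rabs_mult, (Rabs_pos_eq (Im tau)) in Hs by lra.
 assert (Hn : Rabs (IZR n) < 1) by nra.
 rewrite <- abs_IZR in Hn. apply lt_IZR in Hn. assert (n = 0%Z) by lia. subst n.
 exists m. rewrite E. ring.
Qed.

Lemma Cexp_m1_neq (s : C) : ~ isZ s -> Cexp (c * s) - 1 <> 0.
Proof.
 intros H E. apply H. apply Cexp_eq_1. fold c. replace (Cexp (c * s)) with (Cexp (c * s) - 1 + 1) by ring.
 rewrite E. ring.
Qed.

Lemma expm1_holo (s : C) : ~ isZ s -> holo (fun s => c / (Cexp (c * s) - 1)) s.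
Proof.
 intros H. apply holo_scal. apply (holo_inv (fun s => Cexp (c * s) - 1)); [now apply Cexp_m1_neq|].
 apply holo_minus; [eexists; apply cder_Cexp | apply holo_const].
Qed.

Lemma kron_holo (s : C) : Rabs (Im s) < Im tau -> ~ isZ s -> holo kron s.
Proof.
 intros Hs Hz. apply holo_plus; [apply holo_plus; [apply holo_const | now apply expm1_holo]|].
 apply (holo_ext (fun s => - c * kser s)); [intros; ring|]. now apply holo_scal, kser_holo.
Qed.

Lemma Cexp_c_1 (s : C) : Cexp (c * (s + 1)) = Cexp (c * s).
Proof.
 replace (c * (s + 1)) with (c * s + two_pi_i) by (unfold c; ring). rewrite Cexp_add, Cexp_two_pi_i. ring.
Qed.

Lemma Cexp_n (s : C) n : Cexp (c * (INR (S n)) * s) = Cpow (Cexp (c * s)) (S n).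
Proof. rewrite <- Cexp_nat. f_equal. ring. Qed.

Lemma Cexp_n' (s : C) n : Cexp (- (c * (INR (S n))) * s) = Cpow (/ Cexp (c * s)) (S n).
Proof. rewrite <- Cexp_opp, <- Cexp_nat. f_equal. ring. Qed.

Lemma kron_1 (s : C) : kron (s + 1) = kron s.
Proof.
 unfold kron. rewrite Cexp_c_1. do 2 f_equal. unfold kser. do 2 f_equal.
 apply functional_extensionality; intros n. unfold kterm.
 rewrite !Cexp_n, !Cexp_n', Cexp_c_1. pos.
Qed.

(** In this strip both exp(2 pi i (s + tau)) and exp(-2 pi i s) have modulus less than 1. The
    translation multiplies the n-th coefficients by powers of q, and 1/(1-x) = 1 + x/(1-x) leaves
    two geometric series, which account for the change of the two explicit terms. *)
Lemma kron_tau (s : C) : - Im tau < Im s < 0 -> kron (s + tau) = / u * kron s.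
Proof.
 intros Hs. assert (P := PI_RGT_0). assert (U0 := u_neq_0). assert (U1 := u_neq_1).
 assert (I2 : Im (s + tau) = (Im s + Im tau)%R) by pos.
 assert (H2 := kterm_cser (s + tau) ltac:(rewrite Rabs_pos_eq; lra)).
 set (U := Cexp (c * s)). assert (HU : U <> 0) by apply Cexp_neq_0.
 assert (EU : Cexp (c * (s + tau)) = U * q) by (unfold U, q; rewrite <- Cexp_add; f_equal; ring).
 assert (q0 : q <> 0) by apply Cexp_neq_0.
 assert (B1 : Cmod (U * q) < 1).
 { rewrite <- EU, Cmod_Cexp. rewrite Re_two_pi_i. apply exp_lt_1. nra. }
 assert (B2 : Cmod (/ U) < 1).
 { unfold U. rewrite <- Cexp_opp, Cmod_Cexp. replace (- (c * s)) with (two_pi_i * (- s)) by (unfold c; ring).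
  rewrite Re_two_pi_i. apply exp_lt_1. change (Im (- s)) with (- Im s)%R. nra. }
 assert (NZ : forall x : C, Cmod x < 1 -> 1 - x <> 0).
 { intros x Hx E. assert (E' : x = 1) by (replace x with (1 - (1 - x)) by ring; rewrite E; ring).
  rewrite E', Cmod_1 in Hx. lra. }
 assert (E : kser (s + tau) = / u * kser s + - (1) * (U * q / (1 - U * q) + / u * (/ U / (1 - / U)))).
 { apply (cser_unique (kterm (s + tau))); auto.
  apply cser_ext with (2 := (cser_plus _ _ _ _ (cser_scal (/ u) _ _ (kterm_cser s ltac:(rewrite Rabs_left; lra)))
   (cser_scal (- (1)) _ _ (cser_plus _ _ _ _ (cser_geom1 _ B1) (cser_scal (/ u) _ _ (cser_geom1 _ B2)))))). intros n. unfold kterm.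
  rewrite !Cexp_n, !Cexp_n', EU. fold U.
  replace (/ (U * q)) with (/ U * / q) by now field.
  rewrite !Cpow_mult_l, (Cpow_inv q) by pos.
  assert (D1 := u_den n). assert (D2 := uinv_den n).
  assert (qn := Cpow_nz q (S n) q0). unfold qcoef.
  set (x := Cpow q (S n)) in *.
  field. repeat split; trivial.
  intros Z. apply D2. replace (1 - x * / u) with ((u - x) / u) by now field. rewrite Z. field. exact U0. }
 unfold kron. rewrite E, EU. fold U.
 assert (N1 := NZ _ B1). assert (N2 := NZ _ B2).
 assert (N2' : U - 1 <> 0).
 { intros Z. apply N2. replace (1 - / U) with ((U - 1) / U) by now field. rewrite Z. now field. }
 assert (N1' : U * q - 1 <> 0).
 { intros Z. apply N1. replace (1 - U * q) with (- (U * q - 1)) by ring. rewrite Z. ring. }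
 field. tauto.
Qed.

Lemma expm1_pole : clim (fun h => h * (c / (Cexp (c * h) - 1))) 1.
Proof.
 assert (c0 : c <> 0) by apply two_pi_i_neq_0.
 apply (clim_val _ (c * / c)); [field; exact c0|].
 assert (A : clim (fun h => (Cexp (c * h) - 1) / h) c) by apply ctend0_Cexp.
 assert (B := clim_inv _ _ c0 A).
 destruct (A (Cmod c) ltac:(apply Cmod_gt_0; exact c0)) as [d [Hd H]].
 apply (clim_ext_loc (fun h => c * / ((Cexp (c * h) - 1) / h))); [|now apply clim_scal].
 exists d. split; auto. intros h Hh Hm. specialize (H h Hh Hm).
 field. split; auto.
 intros E. rewrite E in H. replace (0 / h - c) with (- c) in H by now field.
 rewrite Cmod_opp in H. lra.
Qed.

Lemma kron_pole : clim (fun h => h * kron h) 1.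
Proof.
 apply (clim_val _ ((c * u / (u - 1)) * 0 + 1 + (- c) * (0 * kser 0))); [ring|].
 apply (clim_ext (fun h => (c * u / (u - 1)) * h + h * (c / (Cexp (c * h) - 1)) + (- c) * (h * kser (0 + h)))).
 - intros h _. unfold kron. rewrite Cplus_0_l. ring.
 - apply clim_plus; [apply clim_plus; [apply clim_scal, clim_id | apply expm1_pole]|].
  apply clim_scal, clim_mult; [apply clim_id | exact (holo_clim kser 0 ltac:(apply kser_holo; simpl; rewrite Rabs_R0; exact tau_up))].
Qed.

Let D (s : C) : C := phi z s - kron s.

Lemma D_holo (s : C) : Rabs (Im s) < Im tau -> ~ isZ s -> holo D s.
Proof.
 intros Hs Hz. apply holo_minus; [|now apply kron_holo].
 apply phi_holo; auto. intros L. now apply Hz, lattice_strip.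
Qed.

Lemma D_1 (s : C) : D (s + 1) = D s.
Proof. unfold D. now rewrite kron_1, phi_1. Qed.

Lemma isZ_Im (s : C) : isZ s -> Im s = 0%R.
Proof. now intros [k ->]. Qed.

Lemma D_shift_tau (s : C) : - Im tau < Im s < 0 -> D (s + tau) = / u * D s.
Proof.
 intros Hs. unfold D. rewrite kron_tau by lra. rewrite phi_tau; trivial.
 - rewrite Cexp_opp. fold u. ring.
 - intros L. apply lattice_strip in L; [|rewrite Rabs_left; lra]. apply isZ_Im in L. lra.
Qed.

Lemma D_pole : clim (fun h => h * D h) 0.
Proof.
 apply (clim_val _ (1 + - (1) * 1)); [ring|].
 apply (clim_ext (fun h => h * phi z h + - (1) * (h * kron h))).
 - intros h _. unfold D. ring.
 - apply clim_plus; [now apply phi_pole | apply clim_scal, kron_pole].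
Qed.

Lemma pt_shift x y : pt (x + 1) y = pt x y + 1.
Proof. apply C_eq; simpl; ring. Qed.

Lemma pt_eta (s : C) : pt (Re s) (Im s) = s.
Proof. now destruct s. Qed.

(** * The residue argument for the difference of both sides *)

Section Residue.

Variable w : C.
Hypothesis w_up : 0 < Im w < Im tau.

(** The difference D has no pole but is multiplied by 1/u under s -> s + tau; [k], with the
    multiplier u and a simple pole at w, makes D k elliptic. [J] is an elementary function of period
    1 with the same residue 1 at w: subtracting D(w) J removes the pole, and the integrals of [J]
    below and above w are easily told apart. *)
Let J (s : C) : C := c / (Cexp (c * (- w + s)) - 1).
Let k (s : C) : C := phi (- z) (- w + s).

Lemma Im_mw (s : C) : Im (- w + s) = (Im s - Im w)%R.
Proof. simpl. auto with real. Qed.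

Lemma J_holo (s : C) : ~ isZ (- w + s) -> holo J s.
Proof. intros H. apply (holo_shift (fun s => c / (Cexp (c * s) - 1)) (- w) s). now apply expm1_holo. Qed.

Lemma J_1 (s : C) : J (s + 1) = J s.
Proof. unfold J. now rewrite Cplus_assoc, Cexp_c_1. Qed.

Lemma Cmod_J_exp x y : Cmod (Cexp (c * (- w + pt x y))) = exp (- (2 * PI) * (y - Im w)).
Proof. rewrite Cmod_Cexp. now rewrite Re_two_pi_i, Im_mw. Qed.

Lemma per_J_near (a y : R) (l : C) (M : R) : y <> Im w ->
 (forall x, Cmod (J (pt x y) - l) <= M) -> Cmod (per J a y - l) <= 2 * M.
Proof.
 intros Hy HM. replace l with (RtoC (a + 1 - a) * l).
 2:{ replace (a + 1 - a)%R with 1%R by lra. ring. }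
 replace (2 * M)%R with (2 * M * (a + 1 - a))%R by lra.
 apply cint_near; try pos.
 intros t _. apply rcont_horizontal, J_holo. intros L. apply isZ_Im in L. rewrite Im_mw in L. auto with real.
Qed.

(** [J] tends to 0 far below w and to -2 pi i far above. One unit away it is already within |2 pi i|
    / 6 of these values, since exp(2 pi) >= 7; the two integrals then lie within |2 pi i| / 3 of 0
    and of -2 pi i. *)
Lemma per_J_jump y0 y1 : y0 < Im w < y1 -> per J 0 y0 <> per J 0 y1.
Proof.
 intros Hy E. assert (P := PI_gt_3).
 assert (NZ : forall x v, v <> Im w -> ~ isZ (- w + pt x v)).
 { intros x v Hv L. apply isZ_Im in L. rewrite Im_mw in L. simpl in L. lra. }
 assert (X : forall t, 1 <= t -> 7 <= exp (2 * PI * t)).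
 { intros t Ht. assert (I := exp_ineq1_le (2 * PI * t)). nra. }
 assert (B : forall a b : C, b <> 0 -> 6 * Cmod a <= Cmod b -> Cmod (c * a / b) <= Cmod c / 6).
 { intros a b Hb H. rewrite Cmod_div, Cmod_mult by pos. assert (Pb := proj1 (Cmod_gt_0 b) Hb).
  apply (Rmult_le_reg_r (Cmod b)); auto. assert (Pc := Cmod_ge_0 c).
  replace (Cmod c * Cmod a / Cmod b * Cmod b)%R with (Cmod c * Cmod a)%R by (field; lra). nra. }
 assert (T : forall v : C, 1 <= Cmod (v - 1) + Cmod v /\ Cmod v <= Cmod (v - 1) + 1).
 { intros v. assert (A := Cmod_triangle (- (v - 1)) v). assert (A' := Cmod_triangle (v - 1) 1).
  rewrite Cmod_opp in A. replace (- (v - 1) + v) with (RtoC 1) in A by ring.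
  replace (v - 1 + 1) with v in A' by ring. rewrite Cmod_1 in *. tauto. }
 assert (U : Cmod (per J 0 y1 - - c) <= 2 * (Cmod c / 6)).
 { rewrite (per_strip J 0 y1 (y1 + 1)); try lra.
  2:{ intros x v Hv. apply J_holo, NZ. lra. }
  2:{ intros x v _. rewrite pt_shift. apply J_1. }
  apply per_J_near; [lra|]. intros x. unfold J.
  assert (N : Cexp (c * (- w + pt x (y1 + 1))) - 1 <> 0) by (apply Cexp_m1_neq, NZ; lra).
  assert (Hv := Cmod_J_exp x (y1 + 1)). set (v := Cexp (c * (- w + pt x (y1 + 1)))) in *.
  replace (c / (v - 1) - - c) with (c * v / (v - 1)) by now field. apply B; auto.
  assert (Hv' : Cmod v <= / 7).
  { rewrite Hv. replace (- (2 * PI) * (y1 + 1 - Im w))%R with (- (2 * PI * (y1 + 1 - Im w)))%R by lra.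
   rewrite exp_Ropp. apply Rinv_le_contravar; [lra | apply X; lra]. }
  destruct (T v). lra. }
 assert (L : Cmod (per J 0 y0 - 0) <= 2 * (Cmod c / 6)).
 { rewrite <- (per_strip J 0 (y0 - 1) y0); try lra.
  2:{ intros x v Hv. apply J_holo, NZ. lra. }
  2:{ intros x v _. rewrite pt_shift. apply J_1. }
  apply per_J_near; [lra|]. intros x. unfold J.
  assert (N : Cexp (c * (- w + pt x (y0 - 1))) - 1 <> 0) by (apply Cexp_m1_neq, NZ; lra).
  assert (Hv := Cmod_J_exp x (y0 - 1)). set (v := Cexp (c * (- w + pt x (y0 - 1)))) in *.
  replace (c / (v - 1) - 0) with (c * 1 / (v - 1)) by now field. apply B; auto.
  assert (X0 := X (Im w - (y0 - 1))%R ltac:(lra)).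
  replace (2 * PI * (Im w - (y0 - 1)))%R with (- (2 * PI) * (y0 - 1 - Im w))%R in X0 by lra.
  rewrite Cmod_1. destruct (T v). lra. }
 assert (Z := Cmod_triangle (per J 0 y1 - - c) (- (per J 0 y1 - 0))).
 rewrite E in L. rewrite Cmod_opp in Z. replace (per J 0 y1 - - c + - (per J 0 y1 - 0)) with c in Z by ring.
 unfold c in *. rewrite Cmod_two_pi_i in *. lra.
Qed.

Let Pf (s : C) : C := D s * k s.
Let Q (s : C) : C := Pf s - D w * J s.

Lemma k_lat (s : C) : Im w - Im tau < Im s < Im w + Im tau -> ~ isZ (- w + s) -> ~ lattice (- w + s).
Proof. intros Hs Hz L. apply Hz, lattice_strip; auto. rewrite Im_mw. apply Rabs_def1; lra. Qed.

Lemma mz_lat : ~ lattice (- z).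
Proof. intros L. now apply z_lat, lattice_opp. Qed.

Lemma k_holo (s : C) : Im w - Im tau < Im s < Im w + Im tau -> ~ isZ (- w + s) -> holo k s.
Proof.
 intros Hs Hz. apply (holo_shift (phi (- z)) (- w) s), phi_holo; [apply mz_lat | now apply k_lat].
Qed.

(* The residue of the doubly periodic function Pf at w is D(w), so it vanishes. *)
Lemma D_up_zero : D w = 0.
Proof.
 assert (c0 : c <> 0) by apply two_pi_i_neq_0.
 (* With this choice the strip of height Im tau above y0 has the heights 0 and Im w of the two
    singularities in its interior, and ym separates them. *)
 set (y0 := (Rmax (Im w - Im tau) (- Im w) / 2)%R).
 assert (Y0 : Im w - Im tau < y0 < 0 /\ - Im tau < y0).
 { unfold y0. assert (M1 := Rmax_l (Im w - Im tau) (- Im w)). assert (M2 := Rmax_r (Im w - Im tau) (- Im w)).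
  assert (M3 : Rmax (Im w - Im tau) (- Im w) < 0) by (apply Rmax_lub_lt; lra). lra. }
 destruct Y0 as [Y0 Y0'].
 set (y1 := (y0 + Im tau)%R). assert (Y1 : Im w < y1 < Im tau) by (unfold y1; lra).
 set (ym := (Im w / 2)%R). assert (Ym : 0 < ym < Im w) by (unfold ym; lra).
 assert (HD : forall x y, y0 <= y <= y1 -> (y <> 0 \/ forall k : Z, x <> 0 + IZR k)%R ->
   Rabs (Im (pt x y)) < Im tau /\ ~ isZ (pt x y)).
 { intros x y Hy H. split; [simpl; apply Rabs_def1; lra|]. intros [n E].
  assert (E1 := f_equal Re E). assert (E2 := f_equal Im E). simpl in E1, E2.
  destruct H as [H|H]; [lra | apply (H n); lra]. }
 assert (Hk : forall x y, y0 <= y <= y1 -> (y <> Im w \/ forall k : Z, x <> Re w + IZR k)%R ->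
   Im w - Im tau < Im (pt x y) < Im w + Im tau /\ ~ isZ (- w + pt x y)).
 { intros x y Hy H. split; [simpl; lra|]. intros [n E].
  assert (E1 := f_equal Re E). assert (E2 := f_equal Im E). rewrite Im_mw in E2. simpl in E1, E2.
  unfold Re in *. destruct H as [H|H]; [lra | apply (H n); lra]. }
 assert (Qholo : forall x y, y0 <= y <= y1 -> (y <> 0 \/ forall k : Z, x <> 0 + IZR k)%R ->
   (y <> Im w \/ forall k : Z, x <> Re w + IZR k)%R -> holo Q (pt x y)).
 { intros x y Hy A B. destruct (HD x y Hy A) as [A1 A2]. destruct (Hk x y Hy B) as [B1 B2].
  apply holo_minus; [apply holo_mult; [now apply D_holo | now apply k_holo]|]. now apply holo_scal, J_holo. }
 assert (P1 : forall x y, Pf (pt (x + 1) y) = Pf (pt x y)).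
 { intros x y. unfold Pf, k. rewrite pt_shift, D_1, Cplus_assoc, phi_1; [reflexivity | apply mz_lat]. }
 assert (Q1 : forall x y, Q (pt (x + 1) y) = Q (pt x y)).
 { intros x y. unfold Q. now rewrite P1, pt_shift, J_1. }
 assert (pole0 : ctend0 (fun h => h * Q (pt 0 0 + h))).
 { apply ctend0_clim. apply (clim_val _ (0 * k 0 + - (D w) * (0 * J 0))); [ring|].
  apply (clim_ext (fun h => (h * D h) * k (0 + h) + - (D w) * (h * J (0 + h)))).
  - intros h _. unfold Q, Pf. replace (pt 0 0) with (RtoC 0) by reflexivity.
   rewrite !Cplus_0_l. ring.
  - assert (Z0 : ~ isZ (- w + 0)) by (intros L; apply isZ_Im in L; rewrite Im_mw in L; simpl in L; lra).
   apply clim_plus.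
   + apply clim_mult; [apply D_pole|]. apply holo_clim, k_holo; [simpl; lra | exact Z0].
   + apply clim_scal, clim_mult; [apply clim_id|]. apply holo_clim, J_holo, Z0. }
 assert (polew : ctend0 (fun h => h * Q (pt (Re w) (Im w) + h))).
 { rewrite pt_eta. apply ctend0_clim. apply (clim_val _ (D w * 1 + - (D w) * 1)); [ring|].
  apply (clim_ext (fun h => D (w + h) * (h * phi (- z) h) + - (D w) * (h * (c / (Cexp (c * h) - 1))))).
  - intros h _. unfold Q, Pf, k, J. replace (- w + (w + h)) with h by ring. ring.
  - apply clim_plus.
   + apply clim_mult; [|apply phi_pole, mz_lat]. apply holo_clim, D_holo.
    * apply Rabs_def1; lra.
    * intros L. apply isZ_Im in L. lra.
   + apply clim_scal, expm1_pole. }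
 assert (E1 : per Q 0 y0 = per Q 0 ym).
 { apply (per_cross Q 0 0); [lra| |intros; apply Q1|exact pole0].
  intros x y Hy H. apply Qholo; [lra | exact H | left; lra]. }
 assert (E2 : per Q 0 ym = per Q 0 y1).
 { apply (per_cross Q (Re w) (Im w)); [lra| |intros; apply Q1|exact polew].
  intros x y Hy H. apply Qholo; [lra | left; lra | exact H]. }
 assert (split : forall y, y0 <= y <= y1 -> y <> 0%R -> y <> Im w -> per Q 0 y = per Pf 0 y - D w * per J 0 y).
 { intros y Hy A B. unfold per, Q.
  assert (CP : rconti (fun x => Pf (pt x y)) 0 (0 + 1)).
  { intros t _. apply rcont_horizontal. destruct (HD t y Hy (or_introl A)). destruct (Hk t y Hy (or_introl B)).
   apply holo_mult; [now apply D_holo | now apply k_holo]. }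
  assert (CJ : rconti (fun x => J (pt x y)) 0 (0 + 1)).
  { intros t _. apply rcont_horizontal, J_holo. now destruct (Hk t y Hy (or_introl B)). }
  rewrite cint_minus; [|lra|exact CP|]; [f_equal; apply cint_scal; [lra | exact CJ]|].
  intros t Ht. apply rcont_scal, CJ, Ht. }
 (* Pf is invariant under s -> s + tau, the multipliers 1/u and u cancelling; [per_base] absorbs the
    horizontal offset Re tau. *)
 assert (E3 : per Pf 0 y1 = per Pf 0 y0).
 { assert (HP : forall y, y0 <= y <= y1 -> y <> 0%R -> y <> Im w -> forall x, holo Pf (pt x y)).
  { intros y Hy A B x. destruct (HD x y Hy (or_introl A)). destruct (Hk x y Hy (or_introl B)).
   apply holo_mult; [now apply D_holo | now apply k_holo]. }
  rewrite (per_base Pf 0 (0 + Re tau) y1).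
  - unfold per. replace (0 + Re tau + 1)%R with (0 + 1 + Re tau)%R by ring.
   rewrite <- (cint_shift (fun x => Pf (pt x y1)) (Re tau) 0 (0 + 1)); [|lra|].
   2:{ intros t _. apply rcont_horizontal, HP; lra. }
   apply cint_ext; [lra|]. intros x _.
   replace (pt (x + Re tau) y1) with (pt x y0 + tau) by (apply C_eq; reflexivity).
   unfold Pf, k. rewrite D_shift_tau by (simpl; lra). rewrite Cplus_assoc, phi_tau.
   + replace (- (c * - z)) with (c * z) by ring. fold u. field. apply u_neq_0.
   + apply mz_lat.
   + destruct (Hk x y0 ltac:(lra) ltac:(lra)) as [A B]. apply k_lat; assumption.
  - apply HP; lra.
  - pos. }
 assert (F : D w * (per J 0 y1 - per J 0 y0) = 0).
 { rewrite (split y0) in E1 by lra. rewrite (split y1) in E2 by lra. rewrite E2, E3 in E1.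
  set (a := per Pf 0 y0) in *. transitivity ((a - D w * per J 0 y0) - (a - D w * per J 0 y1)); [ring|].
  rewrite E1. ring. }
 apply (Cmult_cancel (per J 0 y1 - per J 0 y0)).
 - intros Z. apply (per_J_jump y0 y1); [lra|]. symmetry. now apply Csub_eq.
 - rewrite Cmult_comm, F. ring.
Qed.

End Residue.

(** The upper half of the strip is [D_up_zero]; the lower half follows by translation by tau, the
    real line by continuity of the difference. *)
Lemma kernel_formula (s : C) : Rabs (Im s) < Im tau -> ~ isZ s -> phi z s = kron s.
Proof.
 intros Hs Hz. enough (E : D s = 0).
 { unfold D in E. replace (phi z s) with (phi z s - kron s + kron s) by ring. rewrite E. ring. }
 apply Rabs_def2 in Hs.
 destruct (Rtotal_order (Im s) 0) as [L|[L|L]].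
 - assert (E := D_shift_tau s ltac:(lra)).
  rewrite D_up_zero in E by (change (Im (s + tau)) with (Im s + Im tau)%R; lra).
  apply (Cmult_cancel (/ u)); [|rewrite <- E; ring].
  intros Z. apply C1_nz. replace (RtoC 1) with (u * / u) by (field; apply u_neq_0). rewrite Z. ring.
 -
  apply Cmod_small. intros e He. destruct ((holo_clim D s (D_holo s ltac:(rewrite L, Rabs_R0; exact tau_up) Hz)) e He) as [d [Hd HD]].
  set (r := (Rmin (d / 2) (Im tau / 2))).
  destruct (Rmin_le (d / 2) (Im tau / 2)) as [r1 r2]. fold r in r1, r2.
  assert (r0 : 0 < r) by pos.
  assert (Nz : pt 0 r <> 0) by (intros E; apply (f_equal Im) in E; simpl in E; lra).
  assert (Cr : Cmod (pt 0 r) <= r).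
  { le_via Cmod_le_parts. simpl. rewrite Rabs_R0, Rabs_pos_eq; lra. }
  specialize (HD (pt 0 r) Nz ltac:(lra)).
  rewrite D_up_zero in HD.
  + replace (0 - D s) with (- D s) in HD by ring. rewrite Cmod_opp in HD. lra.
  + change (Im (s + pt 0 r)) with (Im s + r)%R. lra.
 - apply D_up_zero. lra.
Qed.

End Expansion.
End Theta.

(** * The expansion of the KZB kernel *)

(** The terms at the interior point d/2 are bounded, so the series is dominated by a geometric one
    at all smaller |s|. *)
Lemma has_expansion_abs phi (a : nat -> C) : has_expansion phi a ->
 exists d, 0 < d /\ forall s : C, Cmod s < d -> ex_series (fun n => Cmod (a n * Cpow s n)).
Proof.
 intros [d [Hd H]]. set (s0 := RtoC (d / 2)).
 assert (C0 : Cmod s0 = (d / 2)%R) by (unfold s0; rewrite Cmod_R; apply Rabs_pos_eq; lra).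
 assert (N0 : s0 <> 0) by (apply RtoC_neq_0; lra).
 destruct ((H s0 N0 ltac:(lra)) 1%R ltac:(lra)) as [N HN].
 assert (B : forall n, (N <= n)%nat -> Cmod (a (S n) * Cpow s0 (S n)) <= 2).
 { intros n Hn. assert (E1 := HN n Hn). assert (E2 := HN (S n) ltac:(lia)). rewrite csum_S in E2.
  set (x := sum_n (fun n => a n * Cpow s0 n) n : C) in *. set (y := a (S n) * Cpow s0 (S n)) in *.
  replace y with ((x + y - phi s0) + - (x - phi s0)) by ring.
  le_via Cmod_triangle. rewrite Cmod_opp. lra. }
 assert (K : forall N', exists M, 0 <= M /\ forall n, (n <= N' \/ S N <= n)%nat -> Cmod (a n * Cpow s0 n) <= M).
 { induction N' as [|N' [M [HM IH]]].
  - exists (2 + Cmod (a O * Cpow s0 0))%R. assert (Z := Cmod_ge_0 (a O * Cpow s0 0)). split; [lra|].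
   intros n Hn. destruct n as [|n]; [lra|]. specialize (B n ltac:(lia)). lra.
  - exists (M + Cmod (a (S N') * Cpow s0 (S N')))%R. assert (Z := Cmod_ge_0 (a (S N') * Cpow s0 (S N'))).
   split; [lra|]. intros n Hn. destruct (Nat.eq_dec n (S N')) as [->|Hne]; [lra|].
   specialize (IH n ltac:(lia)). lra. }
 destruct (K (S N)) as [M [HM HK]]. exists (d / 2)%R. split; [lra|]. intros s Hm.
 apply (ex_series_geom_bound a M (/ (d / 2)) s HM).
 - pos.
 - intros n. specialize (HK n ltac:(lia)). rewrite Cmod_mult, Cmod_pow, C0 in HK.
  rewrite pow_inv. assert (P := pow_lt (d / 2) n ltac:(lra)).
  apply (Rmult_le_reg_r ((d / 2) ^ n)); auto.
  rewrite Rmult_assoc, Rinv_l by lra. lra.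
 - apply (Rmult_lt_reg_l (d / 2)); [lra|]. rewrite <- Rmult_assoc, Rinv_r by lra. lra.
Qed.

Lemma has_expansion_mult phi psi (a b : nat -> C) : has_expansion phi a -> has_expansion psi b ->
 has_expansion (fun s => phi s * psi s) (convol a b).
Proof.
 intros Ha Hb. destruct (has_expansion_abs _ _ Ha) as [d1 [Hd1 A1]].
 destruct (has_expansion_abs _ _ Hb) as [d2 [Hd2 A2]].
 destruct Ha as [d3 [Hd3 A3]]. destruct Hb as [d4 [Hd4 A4]].
 exists (Rmin (Rmin d1 d2) (Rmin d3 d4)). split; try pos.
 intros s Hs Hm.
 destruct (Rmin_le (Rmin d1 d2) (Rmin d3 d4)) as [M1 M2].
 destruct (Rmin_le d1 d2) as [M3 M4]. destruct (Rmin_le d3 d4) as [M5 M6].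
 apply (cser_ext (convol (fun n => a n * Cpow s n) (fun n => b n * Cpow s n))).
 { apply convol_weight. }
 apply cser_mult; [apply A3 | apply A4 | apply A1 | apply A2]; trivial; lra.
Qed.

Lemma has_expansion_cseq (k : C) j : has_expansion (fun s => k * Cpow s j) (cseq k j).
Proof. exists 1%R. split; [lra|]. intros s _ _. apply cser_cseq. Qed.

Lemma has_expansion_Cexp (k : C) : has_expansion (fun s => Cexp (k * s)) (eseq k).
Proof.
 exists 1%R. split; [lra|]. intros s _ _.
 apply cser_ext with (2 := cser_Cexp (k * s)). symmetry. apply eseq_scal.
Qed.

Lemma has_expansion_coef_ext phi (a b : nat -> C) : (forall n, a n = b n) -> has_expansion phi a -> has_expansion phi b.
Proof. intros E. replace b with a; [trivial | now apply functional_extensionality]. Qed.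

Definition shiftseq (a : nat -> C) (n : nat) : C := match n with O => 0 | S m => a m end.

Lemma has_expansion_shift phi (a : nat -> C) : has_expansion phi a ->
 has_expansion (fun s => s * phi s) (shiftseq a).
Proof.
 intros H. apply (has_expansion_coef_ext _ (convol (cseq 1 1) a)).
 - intros n. rewrite convol_shift. pos.
 - apply (has_expansion_ext_loc (fun s => (1 * Cpow s 1) * phi s)).
  + exists 1%R. split; [lra|]. intros s _ _. ring.
  + apply has_expansion_mult; [apply has_expansion_cseq | exact H].
Qed.

Section Kernel.

Variables (th : C -> C) (tau : C).
Hypothesis tau_up : 1 <= Im tau.
Hypothesis th_holo : forall z, holo th z.
Hypothesis th_1 : forall z, th (z + 1) = - th z.
Hypothesis th_tau : forall z, th (z + tau) = - Cexp (- (two_pi_i * z) - RtoC PI * Ci * tau) * th z.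
Hypothesis th_zero : forall z, th z = 0 <-> exists m n : Z, z = RtoC (IZR m) + RtoC (IZR n) * tau.
Hypothesis th_der0 : cder th 0 1.
Variable z : C.
Hypothesis z_lat : ~ lattice tau z.
Hypothesis z_strip : Rabs (Im z) <= Im tau / 2.

Let c := two_pi_i.
Let u := Cexp (c * z).
Let q := Cexp (c * tau).
Let al (n : nat) : C := qcoef tau u n.
Let be (n : nat) : C := qcoef tau (/ u) n.

Lemma tau_pos : 0 < Im tau. Proof. lra. Qed.

Lemma exp_m1_half (x : R) : x <= -1 -> exp x <= / 2.
Proof.
 intros H. apply Rle_trans with (exp (- (1))); try mono.
 rewrite exp_Ropp. apply Rinv_le_contravar; [lra|]. assert (E := exp_ineq1 1 ltac:(lra)). lra.
Qed.

(** For |Im z| <= Im tau / 2 both |u| and |1/u| are at most exp(pi Im tau), against |q|^(n+1) =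
    exp(-2 pi (n+1) Im tau). The error exp(-pi Im tau) of the kernel comes from n = 0; as Im tau >=
    1, the denominators stay above 1/2. *)
Lemma qcoef_unif (v : C) n : Cmod v <= exp (PI * Im tau) ->
 Cmod (qcoef tau v n) <= 2 * exp (- PI * Im tau - (2 * PI) * (INR n * Im tau)).
Proof.
 intros Hv. assert (P := PI_gt_3).
 assert (E : Cmod (Cpow q (S n) * v) <= exp (- PI * Im tau - (2 * PI) * (INR n * Im tau))).
 { rewrite Cmod_mult, Cmod_pow. unfold q. rewrite Cmod_q, <- exp_INR.
  apply Rle_trans with (exp (INR (S n) * (- (2 * PI) * Im tau)) * exp (PI * Im tau))%R.
  - mono.
  - rewrite <- exp_plus. apply exp_le. rewrite S_INR. lra. }
 assert (H2 : exp (- PI * Im tau - (2 * PI) * (INR n * Im tau)) <= / 2).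
 { apply exp_m1_half. assert (0 <= INR n * Im tau) by pos. nra. }
 unfold qcoef. fold c q.
 set (x := Cpow q (S n) * v) in *.
 assert (L : / 2 <= Cmod (1 - x)).
 { assert (T := Cmod_triangle (1 - x) x). replace (1 - x + x) with (RtoC 1) in T by ring.
  rewrite Cmod_1 in T. lra. }
 assert (NZ : 1 - x <> 0) by (intros Z; rewrite Z, Cmod_0 in L; lra).
 rewrite Cmod_div by pos.
 apply (Rmult_le_reg_r (Cmod (1 - x))); [lra|].
 unfold Rdiv. rewrite Rmult_assoc, Rinv_l by lra.
 assert (X0 := exp_pos (- PI * Im tau - (2 * PI) * (INR n * Im tau))). nra.
Qed.

Lemma Cmod_u : Cmod u <= exp (PI * Im tau) /\ Cmod (/ u) <= exp (PI * Im tau).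
Proof.
 assert (P := PI_gt_3). assert (A := Rle_abs (Im z)). assert (B := Rle_abs (- Im z)). rewrite Rabs_Ropp in B.
 unfold u. rewrite <- Cexp_opp, !Cmod_Cexp. split; apply exp_le.
 - rewrite Re_two_pi_i. nra.
 - simpl.
  change (snd z) with (Im z). nra.
Qed.

Definition kcoef (n j : nat) : C :=
 al n * eseq (c * RtoC (INR (S n))) j + - (be n * eseq (- (c * RtoC (INR (S n)))) j).

(** Majorant of the n-th term for |s| <= 1/2: there exp(2 pi (n+1) |s|) <= exp(pi (n+1)), and exp(-2
    pi n Im tau) makes up for it with exp(-pi n) to spare because Im tau >= 1. *)
Definition kbound (n : nat) : R := (4 * exp PI * exp (- PI * Im tau) * exp (- PI) ^ n)%R.

Lemma ex_kbound : ex_series kbound.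
Proof.
 apply (ex_series_scal_l (4 * exp PI * exp (- PI * Im tau))%R (fun n => exp (- PI) ^ n)%R).
 apply geom_ex. assert (P := PI_gt_3). destruct (exp_lt_1 (- PI) ltac:(lra)). rewrite Rabs_pos_eq; lra.
Qed.

Lemma Series_kbound : Series kbound = (exp (- PI * Im tau) * Series (fun n => 4 * exp PI * exp (- PI) ^ n))%R.
Proof. rewrite <- Series_scal_l. apply Series_ext. intros n. unfold kbound. ring. Qed.

Lemma eseq_abs (w : C) : ex_series (fun j => Cmod (eseq w j)) /\ Series (fun j => Cmod (eseq w j)) = exp (Cmod w).
Proof.
 assert (E : forall j, Cmod (eseq w j) = (Cmod w ^ j * / INR (fact j))%R).
 { intros j. unfold eseq. rewrite Cmod_mult, Cmod_pow, Cmod_R, Rabs_pos_eq by (left; apply Rinv_0_lt_compat, INR_fact_lt_0). ring. }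
 assert (S : is_series (fun j => Cmod (eseq w j)) (exp (Cmod w))).
 { apply is_series_ext with (2 := is_exp_Reals (Cmod w)). pos. }
 split; [now exists (exp (Cmod w)) | now apply is_series_unique].
Qed.

Lemma kcoef_row (s : C) n : Cmod s <= / 2 ->
 ex_series (fun j => Cmod (kcoef n j * Cpow s j)) /\
 (Series (fun j => Cmod (kcoef n j * Cpow s j)) <= kbound n).
Proof.
 intros Hs. assert (P := PI_gt_3). destruct Cmod_u as [U1 U2].
 assert (A := qcoef_unif u n U1). assert (B := qcoef_unif (/ u) n U2). fold (al n) in A. fold (be n) in B.
 set (w := c * (INR (S n)) * s).
 assert (Hw : Cmod w <= PI * INR (S n)).
 { unfold w, c. rewrite !Cmod_mult, Cmod_two_pi_i, Cmod_R, Rabs_pos_eq by pos.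
  replace (2 * PI * INR (S n) * Cmod s)%R with (PI * INR (S n) * (2 * Cmod s))%R by lra.
  rewrite <- (Rmult_1_r (PI * INR (S n))) at 2. mono. }
 assert (T : forall j, 0 <= Cmod (kcoef n j * Cpow s j) <=
   Cmod (al n) * Cmod (eseq w j) + Cmod (be n) * Cmod (eseq (- w) j)).
 { split; try pos.
  replace (kcoef n j * Cpow s j) with (al n * eseq w j + - (be n * eseq (- w) j)).
  - le_via Cmod_triangle. rewrite Cmod_opp, !Cmod_mult. lra.
  - unfold kcoef, w. replace (- (c * (INR (S n)) * s)) with (- (c * (INR (S n))) * s) by ring.
   rewrite <- !eseq_scal. ring. }
 destruct (eseq_abs w) as [E1 F1]. destruct (eseq_abs (- w)) as [E2 F2]. rewrite Cmod_opp in F2.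
 assert (X1 : ex_series (fun j => Cmod (al n) * Cmod (eseq w j))%R) by exact (ex_series_scal_l (Cmod (al n)) _ E1).
 assert (X2 : ex_series (fun j => Cmod (be n) * Cmod (eseq (- w) j))%R) by exact (ex_series_scal_l (Cmod (be n)) _ E2).
 assert (X := ex_series_plus _ _ X1 X2). split.
 - apply (ex_series_Rle _ _ T X).
 - le_via (Series_le _ _ T X).
  rewrite (Series_plus _ _ X1 X2 : Series (fun j => (Cmod (al n) * Cmod (eseq w j)) + (Cmod (be n) * Cmod (eseq (- w) j)))%R = _), !Series_scal_l, F1, F2.
  apply Rle_trans with ((4 * exp (- PI * Im tau - 2 * PI * (INR n * Im tau))) * exp (PI * INR (S n)))%R.
  + rewrite <- Rmult_plus_distr_r. mono.
  + unfold kbound. rewrite <- exp_INR. rewrite !Rmult_assoc, <- !exp_plus.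
   apply Rmult_le_compat_l; [lra|]. apply exp_le. rewrite S_INR.
   assert (0 <= INR n * (Im tau - 1)) by pos. nra.
Qed.

(** A Cauchy estimate by hand: each coefficient times (1/2)^j is at most the row sum at s = 1/2. *)
Lemma kcoef_col j : exists k : C, cser (fun n => kcoef n j) k /\ Cmod k <= 2 ^ j * Series kbound.
Proof.
 set (s := RtoC (/ 2)). assert (Cs : Cmod s = (/ 2)%R) by (unfold s; rewrite Cmod_R; apply Rabs_pos_eq; lra).
 assert (B : forall n, Cmod (kcoef n j) <= 2 ^ j * kbound n).
 { intros n. destruct (kcoef_row s n ltac:(lra)) as [E1 E2].
  assert (T : Cmod (kcoef n j * Cpow s j) <= kbound n).
  { eapply Rle_trans; [|exact E2].
   apply Rle_trans with (sum_n (fun j => Cmod (kcoef n j * Cpow s j)) j).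
   - destruct j as [|j]; [rewrite sum_O; lra|]. rewrite sum_Sn.
    assert (Z : (0 <= sum_n (fun j => Cmod (kcoef n j * Cpow s j)) j)).
    { le_via Cmod_ge_0. apply (Cmod_csum (fun j => kcoef n j * Cpow s j)). easy. }
    unfold plus; simpl. lra.
   - apply ex_series_nonneg_le; [intros; apply Cmod_ge_0 | exact E1]. }
  rewrite Cmod_mult, Cmod_pow, Cs, pow_inv in T.
  assert (P := pow_lt 2 j ltac:(lra)).
  apply Rmult_le_compat_l with (r := (2 ^ j)%R) in T; [|lra].
  replace (2 ^ j * (Cmod (kcoef n j) * / 2 ^ j))%R with (Cmod (kcoef n j)) in T by (field; lra). lra. }
 assert (E := ex_series_scal_l (2 ^ j)%R _ ex_kbound).
 destruct (cser_exists _ _ B E) as [k Hk]. exists k. split; auto.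
 rewrite <- Series_scal_l. apply (cser_bound (fun n => kcoef n j)); assumption.
Qed.

Definition kap (j : nat) : C := proj1_sig (constructive_indefinite_description _ (kcoef_col j)).

Lemma kap_cser j : cser (fun n => kcoef n j) (kap j).
Proof. exact (proj1 (proj2_sig (constructive_indefinite_description _ (kcoef_col j)))). Qed.

Lemma kap_bound j : Cmod (kap j) <= 2 ^ j * Series kbound.
Proof. exact (proj2 (proj2_sig (constructive_indefinite_description _ (kcoef_col j)))). Qed.

Lemma kser_expansion : has_expansion (kser tau z) kap.
Proof.
 exists (/ 2)%R. split; [lra|]. intros s Hs Hm.
 apply (cser_fubini (fun n j => kcoef n j * Cpow s j) kbound (kterm tau z s)).
 - intros n. apply kcoef_row. lra.
 - intros n. apply kcoef_row. lra.
 - apply ex_kbound.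
 - intros n. unfold kterm. fold c u. fold (al n) (be n).
  replace (- (be n * Cexp (- (c * (INR (S n))) * s))) with (- be n * Cexp (- (c * (INR (S n))) * s)) by ring.
  apply cser_ext with (2 := (cser_plus _ _ _ _ (cser_scal (al n) _ _ (cser_Cexp (c * (INR (S n)) * s))) (cser_scal (- (be n)) _ _ (cser_Cexp (- (c * (INR (S n))) * s))))). intros j. unfold kcoef. rewrite <- !eseq_scal. ring.
 - apply (kterm_cser tau tau_pos z z_lat).
  assert (I := Im_le_Cmod s). lra.
 - intros j. apply (cser_ext (fun n => Cpow s j * kcoef n j)); [intros; ring|].
  replace (kap j * Cpow s j) with (Cpow s j * kap j) by ring. apply cser_scal, kap_cser.
Qed.

Variable beta : nat -> C.
Hypothesis beta_exp : has_expansion (fun s => s / (Cexp (two_pi_i * s) - RtoC 1)) beta.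

Lemma isZ_small (s : C) : s <> 0 -> Cmod s < / 2 -> ~ isZ s.
Proof.
 intros Hs Hm [k E]. rewrite E, Cmod_R, <- abs_IZR in Hm.
 assert (L : IZR (Z.abs k) < 1) by lra. apply lt_IZR in L.
 apply Hs. rewrite E. replace k with 0%Z by lia. pos.
Qed.

Definition kernel_seq (n : nat) : C :=
 cseq (c * u / (u - 1)) 1 n + c * beta n + - c * shiftseq kap n.

Lemma kernel_expansion : has_expansion (fun s => th (z + s) * s / (th z * th s)) kernel_seq.
Proof.
 apply (has_expansion_ext_loc (fun s => c * u / (u - 1) * Cpow s 1 + c * (s / (Cexp (two_pi_i * s) - RtoC 1))
   + - c * (s * kser tau z s))).
 - exists (/ 2)%R. split; [lra|]. intros s Hs Hm.
  assert (K := kernel_formula th tau tau_pos th_holo th_1 th_tau th_zero th_der0 z z_lat s).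
  unfold phi, kron in K.
  replace (th (z + s) * s / (th z * th s)) with (s * (th (z + s) * / (th z * th s))) by (unfold Cdiv; ring).
  rewrite K.
  + fold c u. simpl. unfold Cdiv. ring.
  + assert (I := Im_le_Cmod s). lra.
  + now apply isZ_small.
 - apply (has_expansion_coef_ext _ (fun n => cseq (c * u / (u - 1)) 1 n + c * beta n + - c * shiftseq kap n)); [reflexivity|].
  apply has_expansion_plus; [apply has_expansion_plus; [apply has_expansion_cseq|]|]; apply has_expansion_scal.
  + pos.
  + apply has_expansion_shift, kser_expansion.
Qed.

Lemma kernel_Lser :
 (- fun_ad (fun s => th (z + s) * s / (th z * th s)) sx sy)%ncs = (- Lser kernel_seq)%ncs.
Proof. now rewrite (fun_ad_eq _ _ _ _ kernel_expansion). Qed.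

Lemma kernel_decomp :
 (- Lser kernel_seq = (c * u / (u - 1)) *: st + c *: (- Lser beta) + c *: Lser (shiftseq kap))%ncs.
Proof.
 assert (R := raising_adx). unfold kernel_seq, Lser.
 rewrite (opser_plus (fun n => cseq (c * u / (u - 1)) 1 n + c * beta n)), opser_plus, !opser_scal, opser_cseq by pos.
 unfold st. simpl Nat.iter. ncs_lin.
Qed.

End Kernel.

Lemma nrm_Lser N (a : nat -> C) (e : R) : (forall j, Cmod (a j) <= 2 ^ j * e) ->
 (nrm N (Lser a) <= sum_f_R0 (fun j => 2 ^ j * nrm N (Nat.iter j (bracket sx) sy)) N * e)%R.
Proof.
 intros H. unfold Lser, opser. rewrite nrm_ssum by apply graded_opser, raising_adx.
 rewrite Rmult_comm, scal_sum.
 apply nrm_nsum. intros k _. rewrite nrm_scal.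
 assert (P := nrm_ge0 N (Nat.iter k (bracket sx) sy)). specialize (H k).
 nra.
Qed.

Lemma theta_facts theta tau : is_theta theta -> upper tau ->
 let th := fun z => theta z tau in
 (forall z, holo th z) /\ (forall z, th (z + 1) = - th z) /\
 (forall z, th (z + tau) = - Cexp (- (two_pi_i * z) - PI * Ci * tau) * th z) /\
 (forall z, th z = 0 <-> exists m n : Z, z = (IZR m) + (IZR n) * tau) /\
 cder th 0 1.
Proof.
 intros [H1 H2] Ht th. destruct (H2 tau Ht) as [A [B [C0 [D E]]]].
 split; [|split; [exact A|split; [exact C0|split; auto]]].
 2:{ now apply cder_of_is_derive. }
 intros z. destruct (H1 z tau Ht) as [L [HL HD]].
 set (l := L (RtoC 1, RtoC 0)). exists l.
 intros e He. assert (He2 : 0 < e / 2) by lra.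
 specialize (HD (z, tau) (fun P HP => HP) (mkposreal _ He2)). destruct HD as [d HD].
 exists d. split; [apply cond_pos|]. intros h Hh Hm.
 assert (B1 : ball (M := prod_UniformSpace C_UniformSpace C_UniformSpace) (z, tau) d (z + h, tau)).
 { split; simpl.
  - split.
   + change (Rabs (Re (z + h) - Re z) < d). replace (Re (z + h) - Re z)%R with (Re h) by (destruct z, h; simpl; ring).
    eapply Rle_lt_trans; [apply Re_le_Cmod | exact Hm].
   + change (Rabs (Im (z + h) - Im z) < d). replace (Im (z + h) - Im z)%R with (Im h) by (destruct z, h; simpl; ring).
    eapply Rle_lt_trans; [apply Im_le_Cmod | exact Hm].
  - apply ball_center. }
 specialize (HD (z + h, tau) B1).
 assert (Ed : minus (G := prod_NormedModule C_AbsRing C_NormedModule C_NormedModule) (z + h, tau) (z, tau)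
   = scal (V := prod_NormedModule C_AbsRing C_NormedModule C_NormedModule) h (RtoC 1, RtoC 0)).
 { apply injective_projections.
  - change (z + h + - z = h * 1). ring.
  - change (tau + - tau = h * 0). ring. }
 rewrite Ed in HD. rewrite (linear_scal L HL h (RtoC 1, RtoC 0)) in HD.
 assert (Nd : norm (V := prod_NormedModule C_AbsRing C_NormedModule C_NormedModule)
   (scal (V := prod_NormedModule C_AbsRing C_NormedModule C_NormedModule) h (RtoC 1, RtoC 0)) = Cmod h).
 { change (sqrt (Cmod (h * 1) ^ 2 + Cmod (h * 0) ^ 2) = Cmod h). rewrite Cmult_1_r, Cmult_0_r, Cmod_0.
  replace (Cmod h ^ 2 + 0 ^ 2)%R with (Cmod h ^ 2)%R by lra. apply sqrt_pow2, Cmod_ge_0. }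
 rewrite Nd in HD.
 change (Cmod (th (z + h) + - th z + - (h * l)) <= e / 2 * Cmod h) in HD.
 replace ((th (z + h) - th z) / h - l) with ((th (z + h) + - th z + - (h * l)) / h) by now field.
 assert (Hp : 0 < Cmod h) by (apply Cmod_gt_0; exact Hh).
 rewrite Cmod_div by pos. apply (Rmult_lt_reg_r (Cmod h)); auto.
 unfold Rdiv. rewrite Rmult_assoc, Rinv_l by lra. nra.
Qed.

(* The value of the kernel at tau = i oo. *)
Definition trig_kernel (yt : ncs) (z : C) : ncs :=
 ((two_pi_i * Cexp (two_pi_i * z) / (Cexp (two_pi_i * z) - 1))%C *: st + two_pi_i *: yt)%ncs.

(** B does not depend on z, even near 0: the pole sits entirely in the trigonometric kernel. The
    vanishing constant term is recorded too, since the growth estimates rest on it. *)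
Lemma KZB_kernel_trig theta (beta : nat -> C) N : is_theta theta ->
 has_expansion (fun s => s / (Cexp (two_pi_i * s) - 1)) beta ->
 exists B, 0 <= B /\ forall tau z, 1 <= Im tau -> ~ lattice tau z -> Rabs (Im z) <= Im tau / 2 ->
  (KZB_kernel theta tau z nil = 0) /\
  nrm N (KZB_kernel theta tau z - trig_kernel (- Lser beta) z) <= B * exp (- PI * Im tau).
Proof.
 intros Hth Hb.
 set (K0 := Series (fun n => 4 * exp PI * exp (- PI) ^ n)%R).
 set (S0 := sum_f_R0 (fun j => 2 ^ j * nrm N (Nat.iter j (bracket sx) sy))%R N).
 assert (HK : 0 <= K0).
 { apply Series_nonneg.
  - intros n. pos.
  - apply (ex_series_scal_l (4 * exp PI)%R (fun n => exp (- PI) ^ n)%R). apply geom_ex.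
   assert (P := PI_gt_3). destruct (exp_lt_1 (- PI) ltac:(lra)). rewrite Rabs_pos_eq; lra. }
 assert (HS : 0 <= S0).
 { apply cond_pos_sum. intros j. pos. }
 exists (2 * PI * (S0 * K0))%R. split.
 { assert (P := PI_gt_3). pos. }
 intros tau z Ht Hz Hs.
 destruct (theta_facts theta tau Hth ltac:(unfold upper; lra)) as [A1 [A2 [A3 [A4 A5]]]].
 assert (E : KZB_kernel theta tau z = (- Lser (kernel_seq tau Ht z Hs beta))%ncs).
 {
  exact (kernel_Lser (fun z => theta z tau) tau Ht A1 A2 A3 A4 A5 z Hz Hs beta Hb). }
 split.
 - rewrite E. unfold sopp. rewrite Lser_nil. cring.
 - rewrite E, kernel_decomp. unfold trig_kernel.
  set (Rm := Lser (shiftseq (kap tau Ht z Hs))).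
  replace (nrm N _) with (nrm N (two_pi_i *: Rm)) by (f_equal; ncs_lin).
  rewrite nrm_scal, Cmod_two_pi_i, (Rmult_assoc (2 * PI)). apply Rmult_le_compat_l; [assert (P := PI_gt_3); lra|].
  replace (S0 * K0 * exp (- PI * Im tau))%R with (S0 * (exp (- PI * Im tau) * K0))%R by lra.
  rewrite <- Series_kbound. apply nrm_Lser.
  assert (HB : 0 <= Series (kbound tau)).
  { rewrite Series_kbound. pos. }
  intros [|j]; simpl shiftseq.
  + rewrite Cmod_0. lra.
  + le_via kap_bound. auto with real.
Qed.

(** Under z -> z + tau the symbol of the kernel is multiplied by exp(-2 pi i s), that is, exp(-2 pi
    i ad x) is applied; conjugation by exp(2 pi i x) undoes it. This makes exp(2 pi i x) F(z + tau)
    a solution of the equation of F. *)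
Lemma KZB_kernel_tau theta (beta : nat -> C) tau z : is_theta theta ->
 has_expansion (fun s => s / (Cexp (two_pi_i * s) - 1)) beta ->
 1 <= Im tau -> ~ lattice tau z -> Rabs (Im z) <= Im tau / 2 ->
 (sexp (two_pi_i *: sx) * KZB_kernel theta tau (z + tau) =
  KZB_kernel theta tau z * sexp (two_pi_i *: sx))%ncs.
Proof.
 intros Hth Hb Ht Hz Hs.
 destruct (theta_facts theta tau Hth ltac:(unfold upper; lra)) as [A1 [A2 [A3 [A4 A5]]]].
 assert (X := kernel_expansion (fun z => theta z tau) tau Ht A1 A2 A3 A4 A5 z Hz Hs beta Hb).
 set (a := kernel_seq tau Ht z Hs beta) in *.
 assert (E : KZB_kernel theta tau z = (- Lser a)%ncs).
 { unfold KZB_kernel. now rewrite (fun_ad_eq _ a). }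
 assert (E2 : KZB_kernel theta tau (z + tau) = (- opser (eseq (- two_pi_i)) (bracket sx) (Lser a))%ncs).
 { unfold KZB_kernel. f_equal. unfold Lser. rewrite opser_comp by apply raising_adx.
  apply fun_ad_eq.
  apply (has_expansion_ext_loc (fun s => Cexp (- two_pi_i * s) * (theta (z + s) tau * s / (theta z tau * theta s tau)))).
  - exists (/ 2)%R. split; [lra|]. intros s Hs0 Hm.
   assert (T1 : theta z tau <> 0) by (intros Z; apply Hz, A4, Z).
   assert (T2 : theta s tau <> 0).
   { intros Z. apply A4 in Z. apply (isZ_small s Hs0 Hm). apply (lattice_strip (fun z => theta z tau) tau ltac:(lra) A3 A4); auto.
    assert (I := Im_le_Cmod s). lra. }
   replace (z + tau + s) with (z + s + tau) by ring. rewrite !A3.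
   replace (- (two_pi_i * (z + s)) - PI * Ci * tau) with
    (- two_pi_i * s + (- (two_pi_i * z) - PI * Ci * tau)) by ring.
   rewrite Cexp_add. field. repeat split; trivial. apply Cexp_neq_0.
  - apply has_expansion_mult; [apply has_expansion_Cexp | exact X]. }
 rewrite sexp_ad by pos. f_equal. rewrite E, E2.
 rewrite (contin_opp _ _ (contin_opser (eseq two_pi_i) _ raising_adx)), opser_comp by apply raising_adx. f_equal.
 rewrite (opser_ext _ (eseq 0)).
 - rewrite (opser_ext _ (cseq 1 0)).
  + rewrite opser_cseq by apply raising_adx. apply sscal_one.
  + intros [|n]; [apply eseq_O|]. unfold eseq, cseq. simpl. ring.
 - intros n. rewrite eseq_convol. f_equal. ring.
Qed.

(** * Differential equations for noncommutative series *)

Definition nder (f : R -> ncs) (t : R) (f' : ncs) : Prop := forall w, rder (fun s => f s w) t (f' w).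

Lemma rder_val (f : R -> C) t (l l' : C) : l = l' -> rder f t l -> rder f t l'.
Proof. now intros ->. Qed.

Lemma rder_unique (f : R -> C) t (l l' : C) : rder f t l -> rder f t l' -> l = l'.
Proof.
 rewrite !rder_parts. intros [A B] [A' B']. apply C_eq.
 - now rewrite <- (is_derive_unique _ _ _ A), <- (is_derive_unique _ _ _ A').
 - now rewrite <- (is_derive_unique _ _ _ B), <- (is_derive_unique _ _ _ B').
Qed.

Lemma rder_real_comp (f : R -> C) (gam : R -> R) t (l : C) (k : R) :
 rder f (gam t) l -> is_derive gam t k -> rder (fun s => f (gam s)) t (k * l).
Proof.
 rewrite !rder_parts. intros [A B] G. split.
 - replace (Re (k * l)) with (k * Re l)%R by (destruct l; simpl; ring).
  exact (is_derive_comp (V := R_NormedModule) _ _ _ _ _ A G).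
 - replace (Im (k * l)) with (k * Im l)%R by (destruct l; simpl; ring).
  exact (is_derive_comp (V := R_NormedModule) _ _ _ _ _ B G).
Qed.

Lemma nder_val f t f1 f2 : f1 = f2 -> nder f t f1 -> nder f t f2.
Proof. now intros ->. Qed.

Lemma nder_const (f : ncs) t : nder (fun _ => f) t szero.
Proof. intros w. apply rder_const. Qed.

Lemma nder_smul (f g : R -> ncs) t f' g' : nder f t f' -> nder g t g' ->
 nder (fun s => f s * g s)%ncs t (f' * g t + f t * g').
Proof.
 intros Hf Hg w. revert f f' Hf. induction w as [|l w IH]; intros f f' Hf.
 - apply (rder_ext (fun s => f s nil * g s nil)); [intros s; now rewrite smul_nil|].
  unfold sadd. rewrite !smul_nil. apply rder_mult; auto.
 - apply (rder_ext (fun s => f s nil * g s (l :: w) + (shift l (f s) * g s)%ncs w)).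
  { intros s. now rewrite smul_cons. }
  apply (rder_val _ _ ((f' nil * g t (l :: w) + f t nil * g' (l :: w))
   + (shift l f' * g t + shift l (f t) * g')%ncs w)).
  + unfold sadd. rewrite !smul_cons. ring.
  + apply rder_plus; [apply rder_mult; auto|].
   apply (IH (fun s => shift l (f s)) (shift l f')). intros v. eauto.
Qed.

Lemma nder_smul_r h (f : R -> ncs) t f' : nder f t f' -> nder (fun s => f s * h)%ncs t (f' * h).
Proof.
 intros Hf. apply (nder_val _ _ (f' * h + f t * szero)).
 - rewrite smul_zero_r. ncs_lin.
 - apply (nder_smul f (fun _ => h)); [exact Hf | apply nder_const].
Qed.

Lemma nder_real_comp (f : R -> ncs) (gam : R -> R) t f' (k : R) :
 nder f (gam t) f' -> is_derive gam t k -> nder (fun s => f (gam s)) t (k *: f').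
Proof. intros Hf Hg w. apply (rder_real_comp (fun s => f s w)); auto. Qed.

Lemma rder_csum (a : nat -> R -> C) (a' : nat -> C) t n : (forall k, (k <= n)%nat -> rder (a k) t (a' k)) ->
 rder (fun s => sum_n (fun k => a k s) n : C) t (sum_n a' n).
Proof.
 intros H; induction n as [|n IH].
 - apply (rder_ext (a O)); [intros s; now rewrite csum_O|]. rewrite csum_O. pos.
 - apply (rder_ext (fun s => sum_n (fun k => a k s) n + a (S n) s)); [intros s; now rewrite csum_S|].
  rewrite csum_S. apply rder_plus; auto.
Qed.

Lemma ex_nder_pow (f : R -> ncs) t f' k : nder f t f' -> exists p, nder (fun s => spow (f s) k) t p.
Proof.
 intros H; induction k as [|k [p IH]].
 - exists szero. exact (nder_const sone t).
 - exists (f' * spow (f t) k + f t * p)%ncs. exact (nder_smul _ _ _ _ _ H IH).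
Qed.

(** The coefficients of the inverse are polynomials in those of f, so a derivative exists; its value
    is then read off from f f^-1 = 1. *)
Lemma nder_sinv (f : R -> ncs) t f' : (exists d, 0 < d /\ forall s, Rabs (s - t) < d -> f s nil = 1) ->
 nder f t f' -> nder (fun s => sinv (f s)) t (- (sinv (f t) * f' * sinv (f t))).
Proof.
 intros [d [Hd Hn]] Hf.
 assert (E : forall w, exists l : C, rder (fun s => sinv (f s) w) t l).
 { intros w. assert (P : forall k, exists l : C, rder (fun s => spow (sone - f s) k w) t l).
  { intros k. destruct (ex_nder_pow (fun s => sone - f s)%ncs t (szero - f') k) as [p Hp].
   - intros v. unfold sopp. apply rder_plus; [apply rder_const|].
    apply (rder_ext (fun s => - (1) * f s v)); [intros; ring|].
    apply (rder_val _ _ (- (1) * f' v)); [ring|]. apply rder_scal, Hf.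
   - eauto. }
  set (l := fun k => proj1_sig (constructive_indefinite_description _ (P k))).
  exists (sum_n l (length w)).
  apply (rder_ext_loc (fun s => sum_n (fun k => spow (sone - f s) k w) (length w))).
  - exists d. split; auto. intros s Hs. unfold sinv. rewrite (ssum_graded _ w (length w)); auto.
   apply graded_pow, sinv_aux, Hn, Hs.
  - apply (rder_csum (fun k s => spow (sone - f s) k w)). intros k _.
   exact (proj2_sig (constructive_indefinite_description _ (P k))). }
 set (g' := (fun w => proj1_sig (constructive_indefinite_description _ (E w))) : ncs).
 assert (Hg : nder (fun s => sinv (f s)) t g') by (intros w; exact (proj2_sig (constructive_indefinite_description _ (E w)))).
 assert (Ht : f t nil = 1) by (apply Hn; rewrite Rminus_diag, Rabs_R0; exact Hd).
 assert (Z : (f' * sinv (f t) + f t * g')%ncs = szero).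
 { apply ncs_ext; intros w. apply (rder_unique (fun s => (f s * sinv (f s))%ncs w) t).
  - now apply nder_smul.
  - apply (rder_ext_loc (fun _ => sone w)); [|apply rder_const].
   exists d. split; auto. intros s Hs. now rewrite sinv_r by pos. }
 apply (nder_val _ _ g'); auto.
 apply (f_equal (smul (sinv (f t)))) in Z.
 rewrite smul_add_r, smul_assoc, smul_assoc, sinv_l, smul_one_l, smul_zero_r in Z by pos.
 replace g' with (szero - sinv (f t) * f' * sinv (f t))%ncs by (rewrite <- Z; ncs_lin). ncs_lin.
Qed.

Lemma nder_sexp (k : ncs) t : k nil = 0 -> nder (fun s => sexp (s *: k)) t (k * sexp (t *: k)).
Proof.
 intros Hk w. assert (Rk := raising_smul k Hk).
 assert (E : (k * sexp (t *: k))%ncs =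
   opser (fun n => match n with O => 0 | S m => eseq t m end) (smul k) sone).
 { rewrite sexp_opser. transitivity (opser (cseq 1 1) (smul k) (opser (eseq t) (smul k) sone)).
  - rewrite opser_cseq by pos. now rewrite sscal_one.
  - rewrite opser_comp by pos. apply opser_ext. apply convol_shift. }
 rewrite E. apply (rder_ext (fun s => sum_n (fun n => eseq s n * Nat.iter n (smul k) sone w) (length w))).
 { intros s. rewrite sexp_opser. symmetry. now apply opser_val. }
 rewrite (opser_val _ _ _ w (length w)) by pos.
 apply (rder_csum (fun n s => eseq s n * Nat.iter n (smul k) sone w)). intros n _.
 apply (rder_val _ _ ((match n with O => 0 | S m => eseq t m end) * Nat.iter n (smul k) sone w
   + eseq t n * 0)); [ring|].
 apply (rder_mult (fun s => eseq s n) (fun _ => Nat.iter n (smul k) sone w)); [|apply rder_const].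
 induction n as [|n IH].
 - apply (rder_ext (fun _ => 1)); [intros; now rewrite eseq_O|]. apply rder_const.
 - assert (Hn := INR_S_neq_0 n).
  apply (rder_ext (fun s => / (INR (S n)) * (s * eseq s n))).
  { intros s. rewrite <- eseq_S. now field. }
  apply (rder_val _ _ (/ (INR (S n)) * (1 * eseq t n + t * match n with O => 0 | S m => eseq t m end))).
  + destruct n as [|n]; [rewrite eseq_O; simpl; field; exact C1_nz|].
   rewrite <- eseq_S. rewrite (S_INR (S n)), RtoC_plus. rewrite S_INR, RtoC_plus in Hn. now field.
  + apply rder_scal, rder_mult; [apply rder_id | apply IH].
Qed.

Lemma in_words w : In w (words (length w)).
Proof. induction w as [|[] w IH]; simpl; auto; apply in_flat_map; exists w; simpl; auto. Qed.

Lemma uniform_words (P : word -> R -> Prop) n :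
 (forall w, exists d, 0 < d /\ forall h, Rabs h < d -> P w h) ->
 exists d, 0 < d /\ forall h, Rabs h < d -> forall w, (length w <= n)%nat -> P w h.
Proof.
 intros W.
 assert (Min : forall (l : list word), exists d, 0 < d /\ forall h, Rabs h < d -> forall w, In w l -> P w h).
 { induction l as [|v l [d [Hd IH]]]; [exists 1%R; split; [lra|]; intros h _ v []|].
  destruct (W v) as [d' [Hd' H']]. exists (Rmin d d'). split; try pos.
  destruct (Rmin_le d d') as [M1 M2].
  intros h Hm u [<- | Hu]; [apply H'; lra | apply IH; trivial; lra]. }
 destruct (Min (flat_map words (seq 0 (S n)))) as [d [Hd H]].
 exists d. split; auto. intros h Hm v Hv. apply H; trivial.
 apply in_flat_map. exists (length v). split; [apply in_seq; lia | apply in_words].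
Qed.

(** T is bounded on truncations, so it may be applied to the difference quotients and their
    limit. *)
Lemma nder_contin (T : ncs -> ncs) (f : R -> ncs) t f' : contin T -> nder f t f' -> nder (fun s => T (f s)) t (T f').
Proof.
 intros HT Hf w e He. destruct (contin_bounded (length w) T HT) as [B [HB B1]].
 assert (K : forall n e, 0 < e -> exists d, 0 < d /\ forall h : R, h <> 0%R -> Rabs h < d ->
  nrm n (/ h *: (f (t + h)%R - f t) - f') < e).
 { clear e He. intros n e He. set (e1 := (e / 2 ^ S n)%R).
  assert (P := pow_lt 2 (S n) ltac:(lra)).
  assert (He1 : 0 < e1) by pos.
  destruct (uniform_words (fun v h => h <> 0%R -> Cmod ((/ h *: (f (t + h)%R - f t) - f')%ncs v) <= e1) n) as [d [Hd H]].
  { intros v. destruct (Hf v e1 He1) as [d [Hd H]]. exists d. split; auto. intros h Hm Hh.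
   specialize (H h Hh Hm). unfold sscal, sadd, sopp.
   replace (_ + _) with ((f (t + h)%R v - f t v) / h - f' v) by (unfold Cdiv; ring). lra. }
 exists d. split; auto. intros h Hh Hm.
  eapply Rle_lt_trans; [apply (nrm_words n _ e1); intros v Hv; now apply H|].
  unfold e1. apply Rmult_lt_reg_r with (2 ^ S n)%R; auto.
  replace ((2 ^ S n - 1) * (e / 2 ^ S n) * 2 ^ S n)%R with ((2 ^ S n - 1) * e)%R by (field; lra). nra. }
 destruct (K (length w) (e / (1 + B))%R) as [d [Hd H]]; try pos.
 exists d. split; auto. intros h Hh Hm. specialize (H h Hh Hm).
 set (r := (/ h *: (f (t + h)%R - f t) - f')%ncs) in *.
 assert (Er : (T (f (t + h)%R) w - T (f t) w) / h - T f' w = T r w).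
 { unfold r. rewrite (contin_add T HT), (contin_opp T _ HT), (contin_scal T HT), (contin_add T HT), (contin_opp T _ HT).
  unfold sadd, sopp, sscal, Cdiv. ring. }
 rewrite Er. eapply Rle_lt_trans; [apply (nrm_coef (length w)); lia|].
 eapply Rle_lt_trans; auto.
 apply Rmult_lt_compat_r with (r := (1 + B)%R) in H; [|lra].
 replace (e / (1 + B) * (1 + B))%R with e in H by (field; lra). nra.
Qed.

(** * Growth and comparison of solutions *)

Lemma mvt_le (phi phi' : R -> R) a b : a <= b ->
 (forall t, a <= t <= b -> is_derive phi t (phi' t)) -> (forall t, a <= t <= b -> 0 <= phi' t) ->
 phi a <= phi b.
Proof.
 intros Hab H H0. assert (Z := mvt_bound (fun _ => 0) (fun _ => 0) phi phi' a b Hab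
  (fun t _ => rder_const 0 t) H ltac:(intros t Ht; cbv beta; rewrite Cmod_0; now apply H0)).
 cbv beta in Z. replace (0 - 0) with (RtoC 0) in Z by ring. rewrite Cmod_0 in Z; lra.
Qed.

Lemma pow_ge_1 x n : 1 <= x -> 1 <= x ^ n.
Proof. intros H. rewrite <- (pow1 n). apply pow_incr. lra. Qed.

Definition between (p q s : R) : Prop := (p <= s <= q \/ q <= s <= p)%R.

(** Since K1 has no constant term, the derivative of the coefficient on a word involves only shorter
    words of H. Integrating n times gives a power of the integral of g, where Gronwall's inequality
    would give an exponential. G is a primitive of g, and the path may run in either direction. *)
Lemma ode_growth n : exists K, 1 <= K /\ forall (H K1 : R -> ncs) (g G : R -> R) p q,
 (forall s, between p q s -> nder H s (K1 s * H s)) ->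
 (forall s, between p q s -> K1 s nil = 0) ->
 (forall s, between p q s -> is_derive G s (g s)) ->
 (forall s, between p q s -> nrm n (K1 s) <= g s) ->
 nrm n (H q) <= K * (1 + Rabs (G q - G p)) ^ n * nrm n (H p).
Proof.
 induction n as [|n [K [HK IH]]].
 - exists 1%R. split; [lra|]. intros H K1 g G p q D0 D1 D2 D3. simpl nrm.
  assert (Z : Cmod (H q nil - H p nil) = 0%R).
  { assert (M : forall a b, a <= b -> (forall s, a <= s <= b -> between p q s) ->
    (Cmod (H b nil - H a nil) <= 0)).
   { intros a b Hab Hs. replace 0%R with (0 * (b - a))%R by lra.
    apply (mvt_const (fun s => H s nil) (fun _ => 0)); auto.
    - intros t Ht. apply (rder_val _ _ ((K1 t * H t)%ncs nil)).
     + rewrite smul_nil, D1 by pos. ring.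
     + apply D0. now apply Hs.
    - intros. rewrite Cmod_0. lra. }
   apply Rle_antisym; try pos.
   destruct (Rle_dec p q) as [L|L]; [|rewrite Cmod_sub_sym]; apply M; try lra; intros; unfold between; lra. }
  apply Cmod_eq_0 in Z. replace (H q nil) with (H p nil); try lra.
  replace (H q nil) with ((H q nil - H p nil) + H p nil) by ring. rewrite Z. ring.
 - exists (1 + 2 ^ S (S n) * K)%R. assert (P2 := pow_lt 2 (S (S n)) ltac:(lra)). split; [nra|].
  intros H K1 g G p q D0 D1 D2 D3.
  set (L := (1 + Rabs (G q - G p))%R). set (N := nrm (S n) (H p)).
  assert (HN : 0 <= N) by pos.
  assert (HL : 1 <= L) by (unfold L; assert (Z := Rabs_pos (G q - G p)); lra).
  assert (HLn := pow_ge_1 L n HL).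
  assert (Gm : forall a b, a <= b -> (forall s, a <= s <= b -> between p q s) -> G a <= G b).
  { intros a b Hab Hs. apply (mvt_le G g a b Hab).
   - pos.
   - intros t Ht. eapply Rle_trans; [apply nrm_ge0 | apply D3; now apply Hs]. }
  set (B := (K * L ^ n * N)%R).
  assert (HB : 0 <= B) by pos.
  assert (Hb : forall s, between p q s -> nrm n (H s) <= B).
  { intros s Hs. le_via (IH H K1 g G p s).
   - intros r Hr. apply D0. unfold between in *; lra.
   - intros r Hr. apply D1. unfold between in *; lra.
   - intros r Hr. apply D2. unfold between in *; lra.
   - intros r Hr. eapply Rle_trans; [apply nrm_mono_S | apply D3]. unfold between in *; lra.
   - assert (A : Rabs (G s - G p) <= Rabs (G q - G p)).
    { destruct (Rle_dec p q) as [C|C].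
     - assert (A1 := Gm p s ltac:(unfold between in *; lra) ltac:(unfold between in *; intros; lra)).
      assert (A2 := Gm s q ltac:(unfold between in *; lra) ltac:(unfold between in *; intros; lra)).
      rewrite !Rabs_pos_eq; lra.
     - assert (A1 := Gm s p ltac:(unfold between in *; lra) ltac:(unfold between in *; intros; lra)).
      assert (A2 := Gm q s ltac:(unfold between in *; lra) ltac:(unfold between in *; intros; lra)).
      rewrite !Rabs_left1; lra. }
    assert (N1 := nrm_mono_S n (H p)). assert (N0 := nrm_ge0 n (H p)).
    assert (A0 := Rabs_pos (G s - G p)).
    apply Rmult_le_compat; auto.
    + pos.
    + apply Rmult_le_compat_l; [lra|]. apply pow_incr. unfold L. lra. }
  assert (M : forall w a b, (length w <= S n)%nat -> a <= b -> (forall s, a <= s <= b -> between p q s) ->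
    (Cmod (H b w - H a w) <= B * (G b - G a))).
  { intros w a b Hw Hab Hs. replace (B * (G b - G a))%R with (B * G b - B * G a)%R by lra.
   apply (mvt_bound (fun s => H s w) (fun s => (K1 s * H s)%ncs w) (fun s => B * G s)%R (fun s => B * g s)%R); auto.
   - intros t Ht. now apply D0, Hs.
   - intros t Ht. apply is_derive_scal. pos.
   - intros t Ht. eapply Rle_trans; [now apply (nrm_coef (S n))|].
    eapply Rle_trans; [apply nrm_mul_raise; now apply D1, Hs|]. rewrite Rmult_comm.
    mono. }
  assert (Hw : forall w, (length w <= S n)%nat -> Cmod ((H q - H p)%ncs w) <= B * (L - 1)).
  { intros w Hw. change (Cmod (H q w - H p w) <= B * (L - 1)).
   unfold L. replace (1 + Rabs (G q - G p) - 1)%R with (Rabs (G q - G p)) by lra.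
   destruct (Rle_dec p q) as [C|C].
   - eapply Rle_trans; [apply M; trivial; unfold between; intros; lra|].
    apply Rmult_le_compat_l; [exact HB | apply Rle_abs].
   - rewrite Cmod_sub_sym, Rabs_minus_sym. eapply Rle_trans; [apply M; trivial; try lra; unfold between; intros; lra|].
    apply Rmult_le_compat_l; [exact HB | apply Rle_abs]. }
  apply nrm_words in Hw.
  replace (H q) with ((H q - H p) + H p)%ncs by ncs_lin.
  le_via nrm_add. fold N.
  assert (HLn1 : (L ^ S n = L * L ^ n)%R) by pos.
  assert (X : 0 <= K * L ^ n * N) by pos. unfold B in Hw.
  assert (Y : N <= L * L ^ n * N) by (rewrite <- (Rmult_1_l N) at 1; apply Rmult_le_compat_r; nra).
  nra.
Qed.

Lemma ode_growth_diff n : exists K, 0 <= K /\ forall (H K1 : R -> ncs) (g G : R -> R) p q, p <= q ->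
 (forall s, p <= s <= q -> nder H s (K1 s * H s)) ->
 (forall s, p <= s <= q -> K1 s nil = 0) ->
 (forall s, p <= s <= q -> is_derive G s (g s)) ->
 (forall s, p <= s <= q -> nrm n (K1 s) <= g s) -> G q - G p <= 1 ->
 nrm n (H q - H p) <= K * (G q - G p) * nrm n (H p).
Proof.
 destruct (ode_growth n) as [K [HK Gr]]. exists (2 ^ S n * (K * 2 ^ n))%R.
 split; try pos.
 intros H K1 g G p q Hpq D0 D1 D2 D3 HG.
 assert (Gm : forall a b, p <= a <= b -> b <= q -> G a <= G b).
 { intros a b Hab Hb. apply (mvt_le G g a b); [lra| |].
  - intros t Ht. apply D2. lra.
  - intros t Ht. eapply Rle_trans; [apply nrm_ge0 | apply D3; lra]. }
 set (B := (K * 2 ^ n * nrm n (H p))%R). assert (N0 := nrm_ge0 n (H p)).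
 assert (Hb : forall s, p <= s <= q -> nrm n (H s) <= B).
 { intros s Hs. eapply Rle_trans; [apply (Gr H K1 g G p s); intros r Hr; (apply D0 || apply D1 || apply D2 || apply D3); unfold between in Hr; lra|].
  apply Rmult_le_compat_r; auto. apply Rmult_le_compat_l; [lra|]. apply pow_incr.
  assert (A1 := Gm p s ltac:(lra) ltac:(lra)). assert (A2 := Gm s q ltac:(lra) ltac:(lra)).
  rewrite Rabs_pos_eq; lra. }
 assert (M : forall w, (length w <= n)%nat -> Cmod ((H q - H p)%ncs w) <= B * (G q - G p)).
 { intros w Hw.
  replace (B * (G q - G p))%R with (B * G q - B * G p)%R by lra.
  apply (mvt_bound (fun s => H s w) (fun s => (K1 s * H s)%ncs w) (fun s => B * G s)%R (fun s => B * g s)%R); auto.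
  - intros t Ht. now apply D0.
  - intros t Ht. apply is_derive_scal. pos.
  - intros t Ht. eapply Rle_trans; [now apply (nrm_coef n)|].
   le_via nrm_mul. rewrite Rmult_comm.
   mono. }
 apply nrm_words in M. le_via M.
 assert (A := Gm p q ltac:(lra) ltac:(lra)).
 replace (2 ^ S n * (K * 2 ^ n) * (G q - G p) * nrm n (H p))%R with
  (2 ^ S n * (K * 2 ^ n * nrm n (H p) * (G q - G p)))%R by lra.
 mono.
Qed.

Lemma nder_quotient (M f : R -> ncs) t K1 K2 :
 (exists d, 0 < d /\ forall s, Rabs (s - t) < d -> M s nil = 1) ->
 nder M t (K1 * M t) -> nder f t (K2 * f t) ->
 nder (fun s => sinv (M s) * f s)%ncs t ((sinv (M t) * (K2 - K1) * M t) * (sinv (M t) * f t)).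
Proof.
 intros Hn HM Hf.
 assert (Ht : M t nil = 1).
 { destruct Hn as [d [Hd H]]. apply H. rewrite Rminus_diag, Rabs_R0. lra. }
 apply (nder_val _ _ ((- (sinv (M t) * (K1 * M t) * sinv (M t))) * f t + sinv (M t) * (K2 * f t))).
 - replace (sinv (M t) * (K2 - K1) * M t * (sinv (M t) * f t))%ncs with
   (sinv (M t) * (K2 - K1) * (M t * sinv (M t)) * f t)%ncs by (rewrite !smul_assoc; reflexivity).
  replace (sinv (M t) * (K1 * M t) * sinv (M t))%ncs with
   (sinv (M t) * K1 * (M t * sinv (M t)))%ncs by (rewrite !smul_assoc; reflexivity).
  rewrite sinv_r, !smul_one_r by pos. ncs_ring.
 - apply nder_smul; [now apply nder_sinv | exact Hf].
Qed.

(** Variation of constants: M^-1 f satisfies an equation whose coefficient is the difference of the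
    two kernels conjugated by M. *)
Lemma ode_compare n : exists K, 0 <= K /\ forall (M f K1 K2 : R -> ncs) (g G : R -> R) p q, p <= q ->
 (exists d, 0 < d /\ forall s, p - d < s < q + d -> M s nil = 1) ->
 (forall s, p <= s <= q -> nder M s (K1 s * M s)) ->
 (forall s, p <= s <= q -> nder f s (K2 s * f s)) ->
 (forall s, p <= s <= q -> (K2 s - K1 s)%ncs nil = 0) ->
 (forall s, p <= s <= q -> is_derive G s (g s)) ->
 (forall s, p <= s <= q -> nrm n (sinv (M s) * (K2 s - K1 s) * M s) <= g s) -> G q - G p <= 1 ->
 nrm n (sinv (M q) * f q - sinv (M p) * f p) <= K * (G q - G p) * nrm n (sinv (M p) * f p).
Proof.
 destruct (ode_growth_diff n) as [K [HK Gr]]. exists K. split; auto.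
 intros M f K1 K2 g G p q Hpq [d [Hd Hn]] HM Hf HK0 HG Hg HG1.
 apply (Gr (fun s => sinv (M s) * f s)%ncs (fun s => sinv (M s) * (K2 s - K1 s) * M s)%ncs g G p q Hpq); trivial.
 - intros s Hs. apply nder_quotient; auto.
  exists d. split; auto. intros r Hr. apply Hn. apply Rabs_def2 in Hr. lra.
 - intros s Hs. rewrite !smul_nil, HK0 by lra. ring.
Qed.

Definition tends1 (f : R -> ncs) : Prop := forall n e, 0 < e ->
 exists d, 0 < d /\ forall y, 0 < y < d -> nrm n (f y - sone)%ncs < e.

Lemma tends1_words (f : R -> ncs) :
 (forall w e, 0 < e -> exists d, 0 < d /\ forall y, 0 < y < d -> Cmod (f y w - sone w) < e) ->
 tends1 f.
Proof.
 intros H n e He. set (e1 := (e / 2 ^ S n)%R). assert (P := pow_lt 2 (S n) ltac:(lra)).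
 assert (He1 : 0 < e1) by pos.
 destruct (uniform_words (fun w y => (0 < y) -> Cmod ((f y - sone)%ncs w) <= e1) n) as [d [Hd Hn]].
 { intros w. destruct (H w e1 He1) as [d [Hd Hw]]. exists d. split; auto. intros y Hy Hy0. left.
  apply Hw. apply Rabs_def2 in Hy. lra. }
 exists d. split; auto. intros y Hy.
 eapply Rle_lt_trans; [apply (nrm_words n _ e1); intros w Hw; apply Hn; trivial; rewrite ?Rabs_pos_eq; lra|].
 unfold e1. apply Rmult_lt_reg_r with (2 ^ S n)%R; auto.
 replace ((2 ^ S n - 1) * (e / 2 ^ S n) * 2 ^ S n)%R with ((2 ^ S n - 1) * e)%R by (field; lra). nra.
Qed.

Lemma nrm_near1 n f : nrm n f <= 1 + nrm n (f - sone).
Proof.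
 replace f with (sone + (f - sone))%ncs at 1 by ncs_lin. le_via nrm_add. rewrite nrm_one. lra.
Qed.

Lemma tends1_ext (f g : R -> ncs) : (exists d, 0 < d /\ forall y, 0 < y < d -> f y = g y) -> tends1 f -> tends1 g.
Proof.
 intros [d [Hd E]] H n e He. destruct (H n e He) as [d' [Hd' H']].
 exists (Rmin d d'). split; try pos. destruct (Rmin_le d d') as [M1 M2].
 intros y Hy. rewrite <- E by lra. apply H'. lra.
Qed.

Lemma tends1_mul (f g : R -> ncs) : tends1 f -> tends1 g -> tends1 (fun y => f y * g y)%ncs.
Proof.
 intros Hf Hg n e He. set (e1 := Rmin 1 (e / 4)).
 assert (He1 : 0 < e1) by pos. destruct (Rmin_le 1 (e / 4)) as [m1 m2].
 fold e1 in m1, m2.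
 destruct (Hf n e1 He1) as [d [Hd H]]. destruct (Hg n e1 He1) as [d' [Hd' H']].
 exists (Rmin d d'). split; try pos. destruct (Rmin_le d d') as [M1 M2].
 intros y Hy. specialize (H y ltac:(lra)). specialize (H' y ltac:(lra)).
 replace (f y * g y - sone)%ncs with ((f y - sone) * g y + (g y - sone))%ncs by (rewrite smul_add_l, smul_opp_l, smul_one_l; ncs_lin).
 eapply Rle_lt_trans; [apply nrm_add|]. assert (A := nrm_mul n (f y - sone) (g y)). assert (B := nrm_near1 n (g y)).
 assert (C0 := nrm_ge0 n (f y - sone)). nra.
Qed.

Lemma tends1_sinv (f : R -> ncs) : (exists d, 0 < d /\ forall y, 0 < y < d -> f y nil = 1) ->
 tends1 f -> tends1 (fun y => sinv (f y)).
Proof.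
 intros [d0 [Hd0 Hn]] Hf n e He. set (B := (INR (S n) * (1 + 2) ^ n)%R).
 assert (HB : 0 < B) by pos.
 destruct (Hf n (Rmin 1 (e / B))) as [d [Hd H]]; try pos.
 exists (Rmin d d0). split; try pos. destruct (Rmin_le d d0) as [M1 M2].
 destruct (Rmin_le 1 (e / B)) as [m1 m2].
 intros y Hy. specialize (H y ltac:(lra)). specialize (Hn y ltac:(lra)).
 replace (sinv (f y) - sone)%ncs with (sinv (f y) * (sone - f y))%ncs
  by (rewrite smul_add_r, smul_opp_r, sinv_l, smul_one_r by pos; reflexivity).
 eapply Rle_lt_trans; [apply nrm_mul|]. rewrite (nrm_sub_sym n sone).
 assert (Z := nrm_sinv n (f y) 2 Hn ltac:(assert (Z := nrm_near1 n (f y)); lra)).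
 apply Rle_lt_trans with (B * nrm n (f y - sone))%R; try mono.
 apply Rlt_le_trans with (B * (e / B))%R; [apply Rmult_lt_compat_l; lra|]. right. field. lra.
Qed.

Lemma nrm_mul_raise_r n (f g : ncs) : f nil = 0 -> nrm (S n) (g * f) <= nrm n g * nrm (S n) f.
Proof.
 intros Hf. revert g; induction n as [|n IH]; intros g.
 -
  simpl.
  rewrite !shift_smul. unfold sadd, sscal. rewrite !smul_nil, Hf, !Cmult_0_r, !Cplus_0_r, !Cmod_mult, Cmod_0. lra.
 - change (nrm (S (S n)) (g * f)) with
   (Cmod ((g * f)%ncs nil) + nrm (S n) (shift false (g * f)) + nrm (S n) (shift true (g * f)))%R.
  change (nrm (S n) g) with (Cmod (g nil) + nrm n (shift false g) + nrm n (shift true g))%R.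
  rewrite smul_nil, !shift_smul, Hf, Cmult_0_r, Cmod_0.
  assert (A1 := nrm_add (S n) (g nil *: shift false f) (shift false g * f)).
  assert (A2 := nrm_add (S n) (g nil *: shift true f) (shift true g * f)).
  rewrite nrm_scal in A1, A2. assert (I1 := IH (shift false g)). assert (I2 := IH (shift true g)).
  assert (E : nrm (S (S n)) f = (nrm (S n) (shift false f) + nrm (S n) (shift true f))%R).
  { change (nrm (S (S n)) f) with (Cmod (f nil) + nrm (S n) (shift false f) + nrm (S n) (shift true f))%R.
   rewrite Hf, Cmod_0. ring. }
  assert (Mo := nrm_mono_S (S n) f). assert (N1 := nrm_ge0 n (shift false g)). assert (N2 := nrm_ge0 n (shift true g)).
  nra.
Qed.

(* Conjugation by a series with constant term 1 changes a coefficient only through the coefficients of shorter words. *)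
Lemma nrm_conj n (M M' h : ncs) : M nil = 1 -> M' nil = 1 ->
 nrm (S n) (M * h * M' - h) <= 4 * (nrm (S n) M * nrm (S n) M') * nrm n h.
Proof.
 intros HM HM'.
 assert (E : (M * h * M' - h)%ncs = ((M - sone) * (h * M') + h * (M' - sone))%ncs)
  by (rewrite smul_add_l, smul_add_r, smul_opp_l, smul_opp_r, smul_one_l, smul_one_r, !smul_assoc; ncs_lin).
 assert (N1 := nrm_nil (S n) M). assert (N2 := nrm_nil (S n) M'). rewrite HM, Cmod_1 in N1. rewrite HM', Cmod_1 in N2.
 assert (Z : forall A : ncs, A nil = 1 -> 1 <= nrm (S n) A -> nrm (S n) (A - sone) <= 2 * nrm (S n) A).
 { intros A _ HA. le_via nrm_sub. rewrite nrm_one. lra. }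
 assert (Z0 : forall A : ncs, A nil = 1 -> (A - sone)%ncs nil = 0) by (intros A HA; unfold sadd, sopp; rewrite HA; simpl; ring).
 rewrite E. le_via nrm_add.
 assert (A1 := nrm_mul_raise n (M - sone) (h * M') (Z0 M HM)).
 assert (A2 := nrm_mul_raise_r n (M' - sone) h (Z0 M' HM')).
 assert (A3 := nrm_mul n h M'). assert (A4 := nrm_mono_S n M').
 assert (P1 := Z M HM N1). assert (P2 := Z M' HM' N2).
 assert (Q0 := nrm_ge0 n h). assert (Q1 := nrm_ge0 n (h * M')).
 set (m' := nrm (S n) M') in *. set (x := nrm n h) in *.
 assert (B1 : nrm n (h * M') <= x * m') by nra.
 nra.
Qed.

Lemma le_plus_small (x y : R) (k : R) : 0 <= k -> (forall e, 0 < e -> x <= y + k * e) -> x <= y.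
Proof.
 intros Hk H. apply le_epsilon. intros e He. specialize (H (e / (1 + k))%R ltac:(pos)).
 le_via H. apply Rplus_le_compat_l.
 apply (Rmult_le_reg_r (1 + k)); [lra|]. replace (k * (e / (1 + k)) * (1 + k))%R with (k * e)%R by (field; lra). nra.
Qed.

(* Solutions with the same behaviour at 0 are close to each other: the quotient H = M^{-1} f satisfies a regular
  equation, and M H M^{-1} -> 1; since conjugation by M only grows slower than the rate of convergence of H,
  induction on the length of the words gives H -> 1. *)
Lemma singular_compare n : exists K, 0 <= K /\ forall (M f K1 K2 : R -> ncs) (g G : R -> R) Y, 0 < Y ->
 (forall s, 0 < s -> M s nil = 1) ->
 (forall s, 0 < s <= Y -> nder M s (K1 s * M s)) ->
 (forall s, 0 < s <= Y -> nder f s (K2 s * f s)) ->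
 (forall s, 0 < s <= Y -> (K2 s - K1 s)%ncs nil = 0) ->
 (forall s, 0 < s <= Y -> is_derive G s (g s)) ->
 (forall s, 0 < s <= Y -> nrm n (sinv (M s) * (K2 s - K1 s) * M s) <= g s) ->
 (forall s, 0 < s -> 0 <= G s) ->
 (forall e, 0 < e -> exists d, 0 < d /\ forall s, 0 < s < d ->
   G s < e /\ nrm n (M s) * nrm n (sinv (M s)) * G s < e) ->
 tends1 (fun s => f s * sinv (M s))%ncs -> G Y <= 1 ->
 nrm n (sinv (M Y) * f Y - sone) <= K * G Y.
Proof.
 destruct (ode_compare n) as [K [HK Cmp]]. exists K. split; [exact HK|].
 intros M f K1 K2 g G Y HY Mn HM Hf HK0 HG Hg G0 Gs T1 GY.
 set (H := fun s => (sinv (M s) * f s)%ncs).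
 assert (Gm : forall a b, 0 < a <= b -> b <= Y -> G a <= G b).
 { intros a b Hab Hb. apply (mvt_le G g a b); [lra| |].
  - intros t Ht. apply HG. lra.
  - intros t Ht. eapply Rle_trans; [apply nrm_ge0 | apply Hg; lra]. }
 assert (D : forall a b, 0 < a <= b -> b <= Y -> nrm n (H b - H a) <= K * G b * nrm n (H a)).
 { intros a b Hab Hb. assert (g0 := G0 a ltac:(lra)). eapply Rle_trans; [apply (Cmp M f K1 K2 g G a b); try (intros s Hs; (apply HM || apply Hf || apply HK0 || apply HG || apply Hg); lra)|].
  - lra.
  - exists (a / 2)%R. split; [lra|]. intros s Hs. apply Mn. lra.
  - assert (g1 := Gm b Y ltac:(lra) ltac:(lra)). lra.
  - mono. }
 (* Below b0 one has K G <= 1/2, which bounds H near 0 by twice its norm at b0. *)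
 destruct (Gs (/ (2 * (1 + K)))%R) as [b1 [Hb1 Gb1]]; try pos.
 set (b0 := Rmin Y (b1 / 2)). assert (Hb0 : 0 < b0) by pos.
 destruct (Rmin_le Y (b1 / 2)) as [m1 m2]. fold b0 in m1, m2.
 set (C0 := (2 * nrm n (H b0))%R).
 assert (HC0 : forall a, 0 < a <= b0 -> nrm n (H a) <= C0).
 { intros a Ha. assert (Da := D a b0 Ha m1). destruct (Gb1 b0 ltac:(lra)) as [g1 _].
  assert (g0 := G0 b0 Hb0).
  assert (Kg : K * G b0 <= / 2).
  { apply Rle_trans with ((1 + K) * / (2 * (1 + K)))%R; [apply Rmult_le_compat; lra | right; field; lra]. }
  assert (X : K * G b0 * nrm n (H a) <= / 2 * nrm n (H a)) by mono.
  assert (Tr := nrm_sub n (H b0) (H b0 - H a)).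
  replace (H b0 - (H b0 - H a))%ncs with (H a) in Tr by ncs_lin. unfold C0. lra. }
 (* A coefficient that tends to its limit at all does so at the rate G. *)
 assert (Step : forall w, (forall e, 0 < e -> exists d, 0 < d /\ forall a, 0 < a < d -> Cmod ((H a - sone)%ncs w) <= e) ->
   (length w <= n)%nat -> forall b, 0 < b <= b0 -> Cmod ((H b - sone)%ncs w) <= K * C0 * G b).
 { intros w Hw Lw b Hb. apply (le_plus_small _ _ 1); [lra|]. intros e He. destruct (Hw e He) as [d [Hd Ha]].
  set (a := Rmin (d / 2) b). destruct (Rmin_le (d / 2) b) as [a1 a2]. fold a in a1, a2.
  assert (a0 : 0 < a) by pos.
  specialize (Ha a ltac:(lra)). assert (Dab := D a b ltac:(lra) ltac:(lra)).
  assert (Cw := nrm_coef n (H b - H a) w Lw).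
  replace ((H b - sone)%ncs w) with ((H b - H a)%ncs w + (H a - sone)%ncs w) by (unfold sadd, sopp; ring).
  le_via Cmod_triangle.
  assert (X : K * G b * nrm n (H a) <= K * G b * C0).
  { apply Rmult_le_compat_l; [|apply HC0; lra]. apply Rmult_le_pos; [exact HK | apply G0; lra]. }
  lra. }
 assert (Lim : forall m, (m <= n)%nat -> forall w, (length w <= m)%nat -> forall e, 0 < e ->
   exists d, 0 < d /\ forall a, 0 < a < d -> Cmod ((H a - sone)%ncs w) <= e).
 { assert (EP : forall a, 0 < a -> (M a * (H a - sone) * sinv (M a) = f a * sinv (M a) - sone)%ncs).
  { intros a Ha. unfold H.
   rewrite smul_add_r, smul_assoc, sinv_r, smul_one_l, smul_opp_r, smul_one_r by pos.
   rewrite smul_add_l, smul_opp_l, sinv_r by pos. pos. }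
  induction m as [|m IH]; intros Hm w Lw e He.
  - destruct w; [|simpl in Lw; lia]. destruct (T1 O e He) as [d [Hd HT]]. exists d. split; auto.
   intros a Ha. specialize (HT a Ha). rewrite <- EP in HT by lra. simpl in HT.
   rewrite !smul_nil, Mn, sinv_nil in HT by (try apply Mn; lra).
   replace (1 * (H a - sone)%ncs nil * 1) with ((H a - sone)%ncs nil) in HT by ring. lra.
  - specialize (IH ltac:(lia)). set (C1 := ((2 ^ S m - 1) * (K * C0))%R).
   assert (P := pow_ge_1 2 (S m) ltac:(lra)).
   assert (HC1 : 0 <= C1) by pos.
   assert (R1 : forall a, 0 < a <= b0 -> nrm m (H a - sone) <= C1 * G a).
   { intros a Ha. le_via ((nrm_words m _ (K * C0 * G a))).
    - intros v Hv. apply Step; trivial; [now apply IH | lia].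
    - right. unfold C1. ring. }
   destruct (T1 (S m) (e / 2)%R ltac:(lra)) as [d [Hd HT]].
   destruct (Gs (e / (8 * (1 + C1)))%R) as [d' [Hd' HG']]; try pos.
   exists (Rmin d (Rmin d' b0)). split; try pos.
   destruct (Rmin_le d (Rmin d' b0)) as [M1 M2].
   destruct (Rmin_le d' b0) as [M3 M4].
   intros a Ha. specialize (HT a ltac:(lra)). destruct (HG' a ltac:(lra)) as [_ g2].
   (* M h M^-1 is small by assumption and differs from h only through words of length at most m,
      where h is O(G); G outweighs the conjugation by M. *)
   rewrite <- EP in HT by lra. set (h := (H a - sone)%ncs) in *.
   assert (Cj := nrm_conj m (M a) (sinv (M a)) h (Mn a ltac:(lra)) (sinv_nil _ (Mn a ltac:(lra)))).
   replace (h w) with ((M a * h * sinv (M a))%ncs w - (M a * h * sinv (M a) - h)%ncs w) by (unfold sadd, sopp; ring).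
   le_via Cmod_triangle. rewrite Cmod_opp.
   assert (c1 := nrm_coef (S m) (M a * h * sinv (M a)) w Lw).
   assert (c2 := nrm_coef (S m) (M a * h * sinv (M a) - h) w Lw).
   assert (R2 := R1 a ltac:(lra)).
   assert (mo1 := nrm_mono (S m) n (M a) Hm). assert (mo2 := nrm_mono (S m) n (sinv (M a)) Hm).
   assert (q2 : 4 * (nrm (S m) (M a) * nrm (S m) (sinv (M a))) * nrm m h <=
     4 * (nrm n (M a) * nrm n (sinv (M a))) * (C1 * G a)) by mono.
   set (W := (nrm n (M a) * nrm n (sinv (M a)) * G a)%R) in *.
   replace (4 * (nrm n (M a) * nrm n (sinv (M a))) * (C1 * G a))%R with (4 * C1 * W)%R in q2 by (unfold W; ring).
   assert (q3 : 4 * C1 * W <= 4 * C1 * (e / (8 * (1 + C1)))) by nra.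
   assert (q4 : 4 * C1 * (e / (8 * (1 + C1))) <= e / 2).
   { apply (Rmult_le_reg_r (8 * (1 + C1))); [lra|].
    replace (4 * C1 * (e / (8 * (1 + C1))) * (8 * (1 + C1)))%R with (4 * C1 * e)%R by (field; lra). nra. }
   lra. }
 apply (le_plus_small _ _ (K * G Y + 1)).
 { pos. }
 intros e He. assert (P := pow_ge_1 2 (S n) ltac:(lra)).
 destruct (uniform_words (fun w a => (0 < a) -> (Cmod ((H a - sone)%ncs w) <= e / 2 ^ S n) \/ (n < length w)%nat) n) as [d [Hd Hn]].
 { intros w. destruct (le_lt_dec (length w) n) as [L|L]; [|exists 1%R; split; pos].
  destruct (Lim n ltac:(lia) w L (e / 2 ^ S n)%R) as [d [Hd Hw]]; try pos.
  exists d. split; auto. intros a Ha Ha0. left. apply Hw. apply Rabs_def2 in Ha. lra. }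
 set (a := Rmin (d / 2) Y). destruct (Rmin_le (d / 2) Y) as [a1 a2]. fold a in a1, a2.
 assert (a0 : 0 < a) by pos.
 assert (Na : nrm n (H a - sone) <= e).
 { le_via ((nrm_words n _ (e / 2 ^ S n))).
  - intros w Hw. destruct (Hn a ltac:(rewrite Rabs_pos_eq; lra) w Hw a0) as [Z|Z]; [exact Z | lia].
  - apply (Rmult_le_reg_r (2 ^ S n)); [lra|].
   replace ((2 ^ S n - 1) * (e / 2 ^ S n) * 2 ^ S n)%R with ((2 ^ S n - 1) * e)%R by (field; lra). nra. }
 assert (Da := D a Y ltac:(lra) ltac:(lra)). assert (Nb := nrm_near1 n (H a)).
 replace (sinv (M Y) * f Y - sone)%ncs with ((H Y - H a) + (H a - sone))%ncs by (unfold H; ncs_lin).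
 le_via nrm_add.
 assert (X : K * G Y * nrm n (H a) <= K * G Y * (1 + e)) by mono.
 lra.
Qed.

(** * Logarithmic weights *)

(** One weight for both ends: it dominates |ln y| at 0 and y at infinity, is at least 1, and each of
    its powers is negligible against 1 / sqrt y at 0. *)
Definition logw (y : R) : R := ((1 + y) * (1 + Rabs (ln y)))%R.

Lemma logw_ge_1 y : 0 < y -> 1 <= logw y.
Proof. unfold logw. assert (P := Rabs_pos (ln y)). nra. Qed.

Lemma logw_pow k : exists C, 0 <= C /\ forall y, 0 < y -> logw y ^ k * sqrt y <= C * (1 + y) ^ (2 * k + 1).
Proof.
 set (m := (2 * INR (k + 1))%R). assert (Hm : 2 <= m) by (unfold m; rewrite plus_INR; assert (Z := pos_INR k); simpl; lra).
 exists (1 + m ^ k)%R. assert (Pm := pow_ge_1 m k ltac:(lra)). split; [lra|]. intros y Hy.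
 unfold logw. rewrite Rpow_mult_distr.
 assert (P1 := pow_ge_1 (1 + y) k ltac:(lra)).
 assert (A : (1 + Rabs (ln y)) ^ k * sqrt y <= (1 + m ^ k) * (1 + y) ^ (k + 1)).
 { assert (P2 := pow_ge_1 (1 + y) (k + 1) ltac:(lra)).
  destruct (Rle_dec 1 y) as [H|H].
  - assert (L0 : 0 <= ln y) by (rewrite <- ln_1; destruct H as [H|<-]; [left; apply ln_increasing; lra | lra]).
   rewrite Rabs_pos_eq by lra.
   assert (L1 : ln y <= y) by (assert (Z := exp_ineq1_le (ln y)); rewrite exp_ln in Z; lra).
   assert (B : (1 + ln y) ^ k <= (1 + y) ^ k) by (apply pow_incr; lra).
   assert (Sy : sqrt y <= 1 + y).
   { rewrite <- (sqrt_sqrt y) at 2 by lra. nra. }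
   apply Rle_trans with ((1 + y) ^ k * (1 + y))%R.
   + mono.
   + replace ((1 + y) ^ k * (1 + y))%R with ((1 + y) ^ (k + 1))%R by (rewrite pow_add; simpl; ring). nra.
  - set (L := (- ln y)%R).
   assert (L0 : 0 <= L).
   { unfold L. assert (ln y < 0) by (rewrite <- ln_1; apply ln_increasing; lra). lra. }
   replace (Rabs (ln y)) with L by (unfold L in *; rewrite Rabs_left1; lra).
   assert (Sy : sqrt y = exp (- (L / 2))).
   { rewrite <- Rpower_sqrt by lra. unfold Rpower, L. f_equal. field. }
   assert (B : (1 + L) ^ k <= m ^ k * exp (L / 2)).
   { apply Rle_trans with ((m * exp (L / m)) ^ k)%R.
    - apply pow_incr. assert (Z := exp_ineq1_le (L / m)).
     assert (E : (m * (1 + L / m) = m + L)%R) by (field; lra). nra.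
    - rewrite Rpow_mult_distr. rewrite <- exp_INR.
     assert (Q : INR k * (L / m) <= L / 2).
     { apply (Rmult_le_reg_r m); [lra|]. replace (INR k * (L / m) * m)%R with (INR k * L)%R by (field; lra).
      unfold m. rewrite plus_INR. simpl. nra. }
     mono. }
   apply Rle_trans with (m ^ k * exp (L / 2) * exp (- (L / 2)))%R.
   + mono.
   + rewrite Rmult_assoc, <- exp_plus. replace (L / 2 + - (L / 2))%R with 0%R by lra. rewrite exp_0. nra. }
 replace (2 * k + 1)%nat with (k + (k + 1))%nat by lia. rewrite pow_add.
 nra.
Qed.

Lemma logw_sqrt_small k e : 0 < e -> exists d, 0 < d /\ forall y, 0 < y < d -> logw y ^ k * sqrt y < e.
Proof.
 intros He. destruct (logw_pow (k + k)) as [C [HC H]]. set (B := (C * 2 ^ (2 * (k + k) + 1) + 1)%R).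
 assert (HB : 0 < B) by (unfold B; assert (P := pow_lt 2 (2 * (k + k) + 1) ltac:(lra)); nra).
 set (d := Rmin 1 ((e * e / B) * (e * e / B))). destruct (Rmin_le 1 ((e * e / B) * (e * e / B))) as [m1 m2]. fold d in m1, m2.
 assert (Hq : 0 < e * e / B) by pos.
 exists d. split; try pos. intros y Hy. specialize (H y ltac:(lra)).
 assert (S1 : sqrt y < e * e / B).
 { rewrite <- (sqrt_square (e * e / B)) by lra. apply sqrt_lt_1; nra. }
 assert (S0 := sqrt_lt_R0 y ltac:(lra)). set (W := (logw y ^ k)%R) in *. rewrite pow_add in H. fold W in H.
 assert (P : (1 + y) ^ (2 * (k + k) + 1) <= 2 ^ (2 * (k + k) + 1)) by (apply pow_incr; lra).
 assert (H1 : W * W * sqrt y <= B).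
 { unfold B. nra. }
 assert (H2 : (W * sqrt y) * (W * sqrt y) < e * e).
 { apply Rle_lt_trans with (B * sqrt y)%R.
  - nra.
  - apply Rlt_le_trans with (B * (e * e / B))%R; [apply Rmult_lt_compat_l; lra | right; field; lra]. }
 nra.
Qed.

Definition log_growth (n : nat) (f : R -> ncs) : Prop :=
 exists C k, 0 <= C /\ forall s, 0 < s -> nrm n (f s) <= C * logw s ^ k.

Lemma log_growth_sinv n (f : R -> ncs) : (forall s, 0 < s -> f s nil = 1) -> log_growth n f -> log_growth n (fun s => sinv (f s)).
Proof.
 intros Hn [C [k [HC H]]]. exists (INR (S n) * (1 + C) ^ n)%R, (k * n)%nat.
 split; try pos. intros s Hs.
 le_via ((nrm_sinv n _ _ (Hn s Hs) (H s Hs))).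
 rewrite Rmult_assoc. apply Rmult_le_compat_l; try pos.
 rewrite pow_mult, <- Rpow_mult_distr. apply pow_incr.
 assert (L := pow_ge_1 (logw s) k (logw_ge_1 s Hs)). nra.
Qed.

(** The conjugated difference of the kernels is at most eta times a power of [logw], hence at most
    rho / sqrt s; the primitive G(s) = 2 rho sqrt s tends to 0 fast enough to outweigh the
    conjugation by M. *)
Lemma singular_compare_log n (M : R -> ncs) : (forall s, 0 < s -> M s nil = 1) -> log_growth n M ->
 exists D m, 0 <= D /\ forall (f K1 K2 : R -> ncs) eta Y, 0 < Y -> 0 <= eta ->
 (forall s, 0 < s <= Y -> nder M s (K1 s * M s)) ->
 (forall s, 0 < s <= Y -> nder f s (K2 s * f s)) ->
 (forall s, 0 < s <= Y -> (K2 s - K1 s)%ncs nil = 0) ->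
 (forall s, 0 < s <= Y -> nrm n (K2 s - K1 s) <= eta) ->
 tends1 (fun s => f s * sinv (M s))%ncs -> D * (1 + Y) ^ m * eta * sqrt Y <= 1 ->
 nrm n (sinv (M Y) * f Y - sone) <= D * (1 + Y) ^ m * eta * sqrt Y.
Proof.
 intros Mn HMg. assert (HMi := log_growth_sinv n M Mn HMg).
 destruct HMg as [C1 [k1 [HC1 B1]]]. destruct HMi as [C2 [k2 [HC2 B2]]].
 destruct (logw_pow (k1 + k2)) as [C3 [HC3 B3]]. set (m := (2 * (k1 + k2) + 1)%nat) in *.
 destruct (singular_compare n) as [K [HK Cmp]].
 set (E := (2 * (C1 * C2 * C3))%R).
 exists ((1 + K) * E)%R, m. split; try pos.
 intros f K1 K2 eta Y HY Heta HM Hf HK0 Hk HT Hs.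
 set (rho := (C1 * C2 * C3 * (1 + Y) ^ m * eta)%R).
 assert (Hrho : 0 <= rho) by pos.
 set (G := fun s => (2 * rho * sqrt s)%R).
 assert (EG : ((1 + K) * E * (1 + Y) ^ m * eta * sqrt Y = (1 + K) * G Y)%R) by (unfold G, rho, E; ring).
 assert (G0 : forall s, 0 < s -> 0 <= G s).
 { intros s Hs0. pos. }
 assert (GY := G0 Y HY).
 assert (NM : forall s, 0 < s -> nrm n (M s) * nrm n (sinv (M s)) <= C1 * C2 * logw s ^ (k1 + k2)).
 { intros s Hs0. rewrite pow_add. replace (C1 * C2 * (logw s ^ k1 * logw s ^ k2))%R with ((C1 * logw s ^ k1) * (C2 * logw s ^ k2))%R by lra.
  mono. }
 eapply Rle_trans.
 - apply (Cmp M f K1 K2 (fun s => rho / sqrt s)%R G Y HY Mn HM Hf HK0).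
  + intros s Hs0. assert (S := sqrt_lt_R0 s ltac:(lra)). unfold G. auto_derive; [lra|]. field. lra.
  + intros s Hs0. assert (S := sqrt_lt_R0 s ltac:(lra)).
   le_via nrm_mul3.
   assert (X1 := NM s ltac:(lra)). assert (X3 := B3 s ltac:(lra)).
   assert (p3 := nrm_ge0 n (K2 s - K1 s)).
   apply (Rmult_le_reg_r (sqrt s)); auto. unfold Rdiv. rewrite Rmult_assoc, (Rmult_assoc rho), Rinv_l, Rmult_1_r by lra.
   assert (P := pow_incr (1 + s) (1 + Y) m ltac:(lra)).
   replace (nrm n (sinv (M s)) * nrm n (K2 s - K1 s) * (nrm n (M s) * sqrt s))%R with
    ((nrm n (M s) * nrm n (sinv (M s))) * sqrt s * nrm n (K2 s - K1 s))%R by lra.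
   apply Rmult_le_compat; auto.
   * pos.
   * apply Rle_trans with (C1 * C2 * logw s ^ (k1 + k2) * sqrt s)%R; try mono.
    rewrite Rmult_assoc, (Rmult_assoc (C1 * C2)). apply Rmult_le_compat_l; try pos.
    nra.
  + pos.
  + intros e He. set (Q := (2 * rho * (1 + C1 * C2) + 1)%R).
   assert (HQ : 0 < Q) by (unfold Q; assert (0 <= 2 * rho * (1 + C1 * C2)) by pos; lra).
   destruct (logw_sqrt_small (k1 + k2) (e / Q) ltac:(pos)) as [d [Hd Hsm]].
   exists d. split; auto. intros s Hs0. specialize (Hsm s Hs0).
   assert (S := sqrt_pos s). assert (W := pow_ge_1 (logw s) (k1 + k2) (logw_ge_1 s ltac:(lra))).
   set (V := (logw s ^ (k1 + k2) * sqrt s)%R) in *. assert (V0 : sqrt s <= V) by (unfold V; nra).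
   assert (QV : Q * V < e).
   { apply Rlt_le_trans with (Q * (e / Q))%R; [now apply Rmult_lt_compat_l | right; field; lra]. }
   assert (Y1 : 2 * rho * V <= Q * V) by (apply Rmult_le_compat_r; unfold Q; assert (0 <= 2 * rho * (C1 * C2)) by pos; lra).
   assert (Y2 : C1 * C2 * (2 * rho) * V <= Q * V) by (apply Rmult_le_compat_r; unfold Q; lra).
   split.
   * apply Rle_lt_trans with (2 * rho * V)%R; try mono.
   * apply Rle_lt_trans with (C1 * C2 * (2 * rho) * V)%R; [|lra].
    apply Rle_trans with (C1 * C2 * logw s ^ (k1 + k2) * G s)%R; [apply Rmult_le_compat_r; [apply G0; lra | apply NM; lra]|].
    right. unfold G, V. ring.
  + pos.
  + nra.
 - lra.
Qed.

(** * The Knizhnik-Zamolodchikov equation *)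

Lemma asymp_near {T : Type} (F : (T -> Prop) -> Prop) (f g : T -> ncs) w e : asymp F f g -> 0 < e ->
 F (fun z => (Cmod ((f z * sinv (g z))%ncs w - sone w) < e)).
Proof.
 intros H He. apply (H w (fun v : C => (Cmod (v - sone w) < e))).
 assert (He2 : 0 < e / 2) by lra. exists (mkposreal _ He2). intros v [B1 B2].
 change (Rabs (Re v - Re (sone w)) < e / 2) in B1. change (Rabs (Im v - Im (sone w)) < e / 2) in B2.
 eapply Rle_lt_trans; [apply Cmod_le_parts|].
 replace (Re (v - sone w)) with (Re v - Re (sone w))%R by pos.
 replace (Im (v - sone w)) with (Im v - Im (sone w))%R by pos. lra.
Qed.

Lemma tends1_contin (T : ncs -> ncs) (f : R -> ncs) : contin T -> T sone = sone -> tends1 f -> tends1 (fun y => T (f y)).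
Proof.
 intros HT T1 Hf n e He. destruct (contin_bounded n T HT) as [B [HB Bd]].
 destruct (Hf n (e / (1 + B))%R) as [d [Hd H]]; try pos.
 exists d. split; auto. intros y Hy. specialize (H y Hy).
 replace (T (f y) - sone)%ncs with (T (f y - sone)%ncs) by now rewrite (contin_add T HT), (contin_opp T _ HT), T1.
 eapply Rle_lt_trans; auto.
 apply Rmult_lt_compat_r with (r := (1 + B)%R) in H; [|lra].
 replace (e / (1 + B) * (1 + B))%R with e in H by (field; lra). nra.
Qed.

Lemma tends1_comp (f : R -> ncs) (gam : R -> R) c : 0 < c -> (forall y, 0 < y -> 0 < gam y <= c * y) ->
 tends1 f -> tends1 (fun y => f (gam y)).
Proof.
 intros Hc Hg Hf n e He. destruct (Hf n e He) as [d [Hd H]]. exists (d / c)%R.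
 split; try pos. intros y Hy. apply H. destruct (Hg y ltac:(lra)) as [A B].
 destruct Hy as [_ Hy]. apply Rmult_lt_compat_l with (r := c) in Hy; auto.
 replace (c * (d / c))%R with d in Hy by (field; lra). lra.
Qed.

Lemma tends1_sexp (b : ncs) (h : R -> R) c : b nil = 0 -> 0 < c -> (forall y, 0 < y -> Rabs (h y) <= c * y) ->
 tends1 (fun y => sexp ((h y) *: b)).
Proof.
 intros Hb Hc Hh. apply tends1_words. intros w e He.
 assert (D := nder_sexp b 0 Hb w). set (l := (b * sexp (0 *: b))%ncs w : C) in *.
 destruct (D 1%R ltac:(lra)) as [d [Hd HD]]. assert (L := Cmod_ge_0 l).
 set (B := (c * (2 + Cmod l))%R). assert (HB : 0 < B) by pos.
 exists (Rmin (d / c) (e / B)). split; try pos.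
 destruct (Rmin_le (d / c) (e / B)) as [M1 M2].
 intros y Hy. assert (Hy' := Hh y ltac:(lra)). set (t := h y) in *.
 assert (Y1 : c * y < d) by (replace d with (c * (d / c))%R by (field; lra); apply Rmult_lt_compat_l; lra).
 assert (Y2 : B * y < e) by (replace e with (B * (e / B))%R by (field; lra); apply Rmult_lt_compat_l; lra).
 destruct (Req_dec t 0) as [T0|T0].
 - rewrite T0, sscal_zero_l, sexp_zero. unfold Cminus. rewrite Cplus_opp_r, Cmod_0. lra.
 - specialize (HD t T0 ltac:(lra)). rewrite Rplus_0_l, sscal_zero_l, sexp_zero in HD.
  set (x := sexp (t *: b) w - sone w) in *. assert (N := RtoC_neq_0 t T0).
  assert (E : (Cmod x = Rabs t * Cmod (x / t))%R).
  { rewrite <- Cmod_R, <- Cmod_mult. f_equal. now field. }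
  assert (E2 : Cmod (x / t) <= 1 + Cmod l).
  { replace (x / t) with ((x / t - l) + l) by ring. le_via Cmod_triangle. lra. }
  rewrite E. assert (Z2 := Rabs_pos t).
  apply Rle_lt_trans with (c * y * (1 + Cmod l))%R; try mono.
  unfold B in Y2. lra.
Qed.

Definition kz_form (z : R) : ncs := (RtoC (/ z) *: sx + RtoC (/ (z - 1)) *: sy)%ncs.

Lemma KZ_nder G z : KZ_solution G -> 0 < z < 1 -> nder G z (kz_form z * G z).
Proof. intros H Hz w. apply rder_of_is_derive. pos. Qed.

Lemma KZ_nil_const G z : KZ_solution G -> 0 < z < 1 -> G z nil = G (/ 2)%R nil.
Proof.
 intros H Hz.
 assert (M : forall a b, a <= b -> 0 < a -> b < 1 -> G b nil = G a nil).
 { intros a b Hab Ha Hb. assert (Z : Cmod (G b nil - G a nil) <= 0 * (b - a)).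
  { apply (mvt_const (fun s => G s nil) (fun _ => 0)); auto.
   - intros t Ht. apply (rder_val _ _ ((kz_form t * G t)%ncs nil)); [|apply KZ_nder; pos].
    rewrite smul_nil. unfold kz_form, sadd, sscal. simpl. ring.
   - intros. rewrite Cmod_0. lra. }
  assert (Z' := Cmod_ge_0 (G b nil - G a nil)).
  assert (E : Cmod (G b nil - G a nil) = 0%R) by lra. apply Cmod_eq_0 in E.
  replace (G b nil) with ((G b nil - G a nil) + G a nil) by ring. rewrite E. ring. }
 destruct (Rle_dec z (/ 2)) as [L|L]; [symmetry|]; apply M; lra.
Qed.

Lemma near_eq (z : C) : (forall e, 0 < e -> Cmod (z - 1) < e) -> z = 1.
Proof.
 intros H. assert (E : Cmod (z - 1) = 0%R).
 { apply Rle_antisym; try pos. apply le_epsilon. intros e He. rewrite Rplus_0_l. left. pos. }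
 apply Cmod_eq_0 in E. replace z with ((z - 1) + 1) by ring. rewrite E. ring.
Qed.

Lemma real_spow_nil u (f : ncs) : f nil = 0 -> real_spow u f nil = 1.
Proof. intros H. apply sexp_nil. unfold sscal. rewrite H. ring. Qed.

Lemma KZ_nil_right G : KZ_solution G -> asymp (at_right 0%R) G (fun z => real_spow z (letter false)) ->
 forall z, 0 < z < 1 -> G z nil = 1.
Proof.
 intros H HA z Hz. rewrite (KZ_nil_const G z H Hz). apply near_eq. intros e He.
 destruct (asymp_near _ _ _ nil e HA He) as [d Hd].
 set (u := Rmin (d / 2) (/ 2)). destruct (Rmin_le (d / 2) (/ 2)) as [m1 m2].
 fold u in m1, m2. assert (P := cond_pos d). assert (u0 : 0 < u) by pos.
 assert (B : ball 0%R d u) by (change (Rabs (u - 0) < d); rewrite Rabs_pos_eq; lra).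
 specialize (Hd u B u0). rewrite smul_nil, sinv_nil in Hd by now apply real_spow_nil.
 rewrite <- (KZ_nil_const G u H ltac:(lra)). replace (G u nil) with (G u nil * 1) by ring. pos.
Qed.

Lemma KZ_left G : asymp (at_left 1%R) G (fun z => real_spow (1 - z) (letter true)) ->
 tends1 (fun v => G (1 - v)%R * sinv (real_spow v sy))%ncs.
Proof.
 intros HA. apply tends1_words. intros w e He. destruct (asymp_near _ _ _ w e HA He) as [d Hd].
 exists d. split; [apply cond_pos|]. intros v Hv.
 assert (B : ball 1%R d (1 - v)%R) by (change (Rabs (1 - v - 1) < d); rewrite Rabs_left; lra).
 specialize (Hd _ B ltac:(lra)). replace (1 - (1 - v))%R with v in Hd by lra. pos.
Qed.

Lemma KZ_nil_left G : KZ_solution G -> asymp (at_left 1%R) G (fun z => real_spow (1 - z) (letter true)) ->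
 forall z, 0 < z < 1 -> G z nil = 1.
Proof.
 intros H HA z Hz. rewrite (KZ_nil_const G z H Hz). apply near_eq. intros e He.
 destruct (KZ_left G HA O e He) as [d [Hd HT]].
 set (u := Rmin (d / 2) (/ 2)). destruct (Rmin_le (d / 2) (/ 2)) as [m1 m2].
 fold u in m1, m2. assert (u0 : 0 < u) by pos.
 specialize (HT u ltac:(lra)). simpl in HT. unfold sadd in HT.
 rewrite smul_nil, sinv_nil in HT by now apply real_spow_nil.
 rewrite <- (KZ_nil_const G (1 - u) H ltac:(lra)). replace (G (1 - u)%R nil) with (G (1 - u)%R nil * 1) by ring. pos.
Qed.

Lemma log_growth_sexp n (b : ncs) (h : R -> R) c : b nil = 0 -> 0 <= c ->
 (forall s, 0 < s -> Rabs (h s) <= c * logw s) -> log_growth n (fun s => sexp ((h s) *: b)).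
Proof.
 intros Hb Hc Hh. set (B := (1 + c * nrm n b)%R). assert (N := nrm_ge0 n b).
 exists (INR (S n) * B ^ n)%R, n. split; try pos. intros s Hs.
 assert (L := logw_ge_1 s Hs).
 assert (Z : nrm n ((h s) *: b) <= c * nrm n b * logw s).
 { rewrite nrm_scal, Cmod_R. specialize (Hh s Hs). nra. }
 eapply Rle_trans; [apply (nrm_sexp n _ (c * nrm n b * logw s)); [unfold sscal; rewrite Hb; ring | exact Z]|].
 rewrite (Rmult_assoc (INR (S n))). apply Rmult_le_compat_l; try pos. rewrite <- Rpow_mult_distr.
 assert (0 <= c * nrm n b) by pos.
 apply pow_incr. unfold B. nra.
Qed.

Lemma nder_real_spow (b : ncs) u : b nil = 0 -> 0 < u ->
 nder (fun s => real_spow s b) u (RtoC (/ u) *: b * real_spow u b).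
Proof.
 intros Hb Hu. apply (nder_val _ _ (RtoC (/ u) *: (b * sexp ((ln u) *: b)))); [now rewrite smul_scal_l|].
 apply (nder_real_comp (fun t => sexp (t *: b)) ln); [now apply nder_sexp | now apply is_derive_ln].
Qed.

(** The asymptotic condition is a limit without a rate. Comparison with z^x, whose equation differs
    by the term y / (z - 1), regular at 0, supplies the rate sqrt u. *)
Lemma KZ_at_0 n G : KZ_solution G -> asymp (at_right 0%R) G (fun z => real_spow z (letter false)) ->
 exists C d, 0 < d /\ forall u, 0 < u < d ->
  nrm n (sinv (real_spow u sx) * G u - sone) <= C * sqrt u.
Proof.
 intros H HA. assert (Sx : sx nil = 0) by pos.
 destruct (singular_compare_log n (fun s => real_spow s sx)) as [D [m [HD Cmp]]].
 { intros s _. now apply real_spow_nil. }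
 { apply (log_growth_sexp n sx ln 1 Sx ltac:(lra)). intros s Hs. unfold logw. assert (Z := Rabs_pos (ln s)). nra. }
 set (eta := (2 * nrm n sy)%R). assert (Ny := nrm_ge0 n sy).
 set (B := (D * 2 ^ m * eta)%R).
 assert (HB : 0 <= B) by pos.
 assert (q0 : 0 < / (1 + B)) by pos.
 exists B, (Rmin (/ 2) (/ (1 + B) * / (1 + B))). split; try pos.
 destruct (Rmin_le (/ 2) (/ (1 + B) * / (1 + B))) as [M1 M2].
 intros u Hu.
 assert (HX : D * (1 + u) ^ m * eta * sqrt u <= B * sqrt u).
 { apply Rmult_le_compat_r; try pos. unfold B, eta. apply Rmult_le_compat_r; [lra|].
  apply Rmult_le_compat_l; auto. apply pow_incr. lra. }
 eapply Rle_trans; [|exact HX].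
 apply (Cmp G (fun z => RtoC (/ z) *: sx)%ncs kz_form eta u); try lra.
 - pos.
 - intros s Hs. apply nder_real_spow; pos.
 - intros s Hs. apply KZ_nder; pos.
 - intros s Hs. unfold kz_form, sadd, sopp, sscal. simpl; ring.
 - intros s Hs. unfold kz_form. replace (RtoC (/ s) *: sx + RtoC (/ (s - 1)) *: sy - RtoC (/ s) *: sx)%ncs with (RtoC (/ (s - 1)) *: sy)%ncs by ncs_lin.
  rewrite nrm_scal, Cmod_R. unfold eta.
  rewrite Rabs_inv, Rabs_left by lra. rewrite <- (Rinv_inv 2). mono.
 - apply tends1_words. intros w e He. destruct (asymp_near _ _ _ w e HA He) as [d Hd].
  exists d. split; [apply cond_pos|]. intros v Hv. apply Hd; [|lra].
  change (Rabs (v - 0) < d). rewrite Rabs_pos_eq; lra.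
 - le_via HX.
  assert (S1 : sqrt u <= / (1 + B)).
  { rewrite <- (sqrt_square (/ (1 + B))) by lra. apply sqrt_le_1; nra. }
  apply Rle_trans with (B * / (1 + B))%R; try mono.
  apply (Rmult_le_reg_r (1 + B)); [lra|]. rewrite Rmult_assoc, Rinv_l; lra.
Qed.

(** * The KZ equation in the variable u = exp(-2 pi y) *)

Section Path.

Variables a b : ncs.
Hypothesis a_nil : a nil = 0.
Hypothesis b_nil : b nil = 0.

(** This variable sends y -> 0 to the singular point 1 and y -> infinity to the singular point 0. A
    solution normalised at 1 thus behaves like (2 pi y)^b for y -> 0, as a KZB solution does with b
    = t. *)
Definition uexp (y : R) : R := exp (- (2 * PI) * y).
Definition kz_path (G : R -> ncs) (y : R) : ncs := subst (G (uexp y)) a b.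
Definition kz_coef (y : R) : ncs :=
 (RtoC (- (2 * PI)) *: (a + RtoC (uexp y / (uexp y - 1)) *: b))%ncs.

Lemma uexp_bounds y : 0 < y -> 0 < uexp y < 1.
Proof.
 split; try pos. rewrite <- exp_0. apply exp_increasing.
 assert (P := PI_RGT_0). nra.
Qed.

Lemma uexp_low y : 1 - 2 * PI * y <= uexp y.
Proof. unfold uexp. assert (Z := exp_ineq1_le (- (2 * PI) * y)). lra. Qed.

Lemma kz_coef_nil y : kz_coef y nil = 0.
Proof. unfold kz_coef, sscal, sadd. rewrite a_nil, b_nil. ring. Qed.

Variable G : R -> ncs.
Hypothesis G_sol : KZ_solution G.
Hypothesis G_1 : asymp (at_left 1%R) G (fun z => real_spow (1 - z)%R (letter true)).

Lemma kz_path_nil y : 0 < y -> kz_path G y nil = 1.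
Proof. intros Hy. unfold kz_path. rewrite subst_nil by pos. apply KZ_nil_left; trivial. now apply uexp_bounds. Qed.

Lemma kz_path_nder y : 0 < y -> nder (kz_path G) y (kz_coef y * kz_path G y).
Proof.
 intros Hy. destruct (uexp_bounds y Hy) as [U1 U2].
 apply (nder_val _ _ (RtoC (- (2 * PI) * uexp y) *: subst (kz_form (uexp y) * G (uexp y)) a b)).
 - rewrite subst_mul by pos. rewrite <- smul_scal_l. f_equal.
  unfold kz_form, kz_coef. rewrite subst_add, !subst_scal by pos. unfold sx, sy. rewrite !subst_letter by pos.
  apply ncs_ext; intros w. unfold sscal, sadd.
  rewrite RtoC_mult, RtoC_div, !RtoC_inv by lra. rewrite RtoC_minus.
  assert (N1 : RtoC (uexp y) <> 0) by (apply RtoC_neq_0; lra).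
  assert (N2 : (uexp y) - 1 <> 0) by (rewrite <- RtoC_minus; apply RtoC_neq_0; lra).
  now field.
 - apply (nder_real_comp (fun s => subst (G s) a b) uexp).
  + apply (nder_contin (fun f => subst f a b)); [now apply contin_subst | now apply KZ_nder].
  + unfold uexp. auto_derive; lra.
Qed.

(** The coefficient is bounded by a multiple of 1 + 1/y, whose primitive y + ln y is dominated by
    [logw]. *)
Lemma kz_path_growth n : log_growth n (kz_path G).
Proof.
 destruct (ode_growth n) as [K [HK Gr]].
 set (c := (2 * PI * (nrm n a + nrm n b))%R). assert (P := PI_gt_3).
 assert (Na := nrm_ge0 n a). assert (Nb := nrm_ge0 n b).
 assert (Hc : 0 <= c) by pos.
 assert (N1 := nrm_ge0 n (kz_path G 1)).
 exists (K * (1 + 2 * c) ^ n * nrm n (kz_path G 1))%R, n.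
 split; try pos.
 intros s Hs. eapply Rle_trans.
 - apply (Gr (kz_path G) kz_coef (fun y => c * (1 + / y))%R (fun y => c * (y + ln y))%R 1%R s).
  + intros t Ht. apply kz_path_nder. unfold between in Ht. lra.
  + intros t _. apply kz_coef_nil.
  + intros t Ht. unfold between in Ht. auto_derive; [lra|]. lra.
  + intros t Ht. assert (t0 : 0 < t) by (unfold between in Ht; lra). destruct (uexp_bounds t t0) as [U1 U2].
   assert (Ub : uexp t / (1 - uexp t) <= / t).
   { apply (Rmult_le_reg_r (t * (1 - uexp t))); try pos.
    replace (uexp t / (1 - uexp t) * (t * (1 - uexp t)))%R with (uexp t * t)%R by (field; lra).
    replace (/ t * (t * (1 - uexp t)))%R with (1 - uexp t)%R by (field; lra).
    assert (Z : (uexp t * exp (2 * PI * t) = 1)%R) by (unfold uexp; rewrite <- exp_plus; replace (- (2 * PI) * t + 2 * PI * t)%R with 0%R by lra; apply exp_0).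
    assert (Z2 := exp_ineq1_le (2 * PI * t)). nra. }
   unfold kz_coef. rewrite nrm_scal, Cmod_R, Rabs_Ropp, Rabs_pos_eq by lra. unfold c. rewrite (Rmult_assoc (2 * PI)).
   apply Rmult_le_compat_l; [lra|]. le_via nrm_add. rewrite nrm_scal, Cmod_R.
   replace (uexp t / (uexp t - 1))%R with (- (uexp t / (1 - uexp t)))%R by (field; lra).
   assert (Up : 0 <= uexp t / (1 - uexp t)) by pos.
   rewrite Rabs_Ropp, Rabs_pos_eq by lra. nra.
 - replace (K * (1 + 2 * c) ^ n * nrm n (kz_path G 1) * logw s ^ n)%R with (K * ((1 + 2 * c) ^ n * logw s ^ n) * nrm n (kz_path G 1))%R by lra.
  apply Rmult_le_compat_r; auto. apply Rmult_le_compat_l; [lra|].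
  rewrite <- Rpow_mult_distr. apply pow_incr. rewrite ln_1.
  assert (L := Rabs_pos (ln s)). assert (Z := Rabs_pos (c * (s + ln s) - c * (1 + 0))).
  assert (A : Rabs (c * (s + ln s) - c * (1 + 0)) <= c * (s + Rabs (ln s) + 1)).
  { replace (c * (s + ln s) - c * (1 + 0))%R with (c * (s + ln s - 1))%R by lra.
   rewrite Rabs_mult, (Rabs_pos_eq c) by lra. apply Rmult_le_compat_l; auto.
   assert (A1 := Rle_abs (ln s)). assert (A2 := Rle_abs (- ln s)). rewrite Rabs_Ropp in A2. apply Rabs_le. lra. }
  assert (W : 1 + s + Rabs (ln s) <= logw s) by (unfold logw; nra). nra.
Qed.

Lemma ln_uexp_bound y : 0 < y -> Rabs (ln (1 - uexp y) - ln (2 * PI * y)) <= 2 * PI * y.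
Proof.
 intros Hy. set (x := (2 * PI * y)%R).
 destruct (uexp_bounds y Hy) as [U1 U2].
 assert (A : 1 - uexp y <= x) by (assert (Z := uexp_low y); unfold x; lra).
 assert (E : (uexp y * exp x = 1)%R).
 { unfold uexp, x. rewrite <- exp_plus. replace (- (2 * PI) * y + 2 * PI * y)%R with 0%R by lra. apply exp_0. }
 assert (B : x * uexp y <= 1 - uexp y) by (assert (Z := exp_ineq1_le x); nra).
 assert (B1 : ln (1 - uexp y) <= ln x) by (apply ln_le; lra).
 assert (B2 : ln (x * uexp y) <= ln (1 - uexp y)) by (apply ln_le; pos).
 rewrite ln_mult in B2 by lra. unfold uexp at 1 in B2. rewrite ln_exp in B2.
 replace (- (2 * PI) * y)%R with (- x)%R in B2 by (unfold x; ring). rewrite Rabs_left1; lra.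
Qed.

Lemma kz_path_at_0 : tends1 (fun y => kz_path G y * sinv (sexp ((ln (2 * PI * y)) *: b)))%ncs.
Proof.
 assert (P := PI_gt_3).
 assert (T := tends1_mul _ _ (tends1_comp _ (fun y => 1 - uexp y)%R (2 * PI) ltac:(lra)
  ltac:(intros y Hy; destruct (uexp_bounds y Hy); assert (Z := uexp_low y); cbv beta; lra) (tends1_contin (fun f => subst f a b) _ (contin_subst a b a_nil b_nil) (subst_one a b a_nil b_nil) (KZ_left G G_1))) (tends1_sexp b (fun y => ln (1 - uexp y) - ln (2 * PI * y))%R (2 * PI) b_nil ltac:(lra) ln_uexp_bound)). revert T. apply tends1_ext. exists 1%R. split; [lra|]. intros y Hy.
 replace (1 - (1 - uexp y))%R with (uexp y) by lra.
 rewrite subst_mul, subst_sinv by (trivial; now apply real_spow_nil). rewrite <- smul_assoc. f_equal.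
 unfold real_spow. rewrite subst_sexp by (trivial; unfold sscal; simpl; ring).
 rewrite subst_scal by pos. unfold sy. rewrite subst_letter by pos.
 rewrite !sexp_inv, sexp_add by pos. f_equal. f_equal. rewrite RtoC_minus. ring.
Qed.

Variables (G0 : R -> ncs) (Phi : ncs).
Hypothesis G0_sol : KZ_solution G0.
Hypothesis G0_0 : asymp (at_right 0%R) G0 (fun z => real_spow z (letter false)).
Hypothesis Phi_def : forall z : R, 0 < z < 1 -> Phi = (sinv (G z) * G0 z)%ncs.

Lemma Phi_nil : Phi nil = 1.
Proof.
 rewrite (Phi_def (/ 2)) by lra. rewrite smul_nil, sinv_nil, (KZ_nil_right G0) by (trivial; try lra; apply KZ_nil_left; trivial; lra). ring.
Qed.

(** By definition of Phi one has G Phi = G0, and G0(u) follows u^a = exp(-2 pi y a) with error sqrt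
    u = exp(-pi y). *)
Lemma kz_path_infty n : exists C y0, 0 < y0 /\ forall y, y0 <= y ->
 nrm n (sexp (RtoC (2 * PI * y) *: a) * kz_path G y * subst Phi a b - sone) <= C * exp (- PI * y).
Proof.
 destruct (contin_bounded n _ (contin_subst a b a_nil b_nil)) as [B [HB Bd]].
 destruct (KZ_at_0 n G0 G0_sol G0_0) as [C [d [Hd H]]]. assert (P := PI_gt_3).
 exists (B * C)%R, (1 / (2 * PI * d) + 1)%R.
 assert (Q : 0 < 1 / (2 * PI * d)) by pos.
 split; [lra|]. intros y Hy. destruct (uexp_bounds y ltac:(lra)) as [U1 U2].
 assert (Ud : uexp y < d).
 { assert (E : (uexp y * exp (2 * PI * y) = 1)%R).
  { unfold uexp. rewrite <- exp_plus. replace (- (2 * PI) * y + 2 * PI * y)%R with 0%R by lra. apply exp_0. }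
  assert (Z := exp_ineq1_le (2 * PI * y)).
  assert (Y2 : 1 < d * (2 * PI * y)).
  { replace 1%R with (d * (2 * PI * (1 / (2 * PI * d))))%R at 1 by (field; lra).
   apply Rmult_lt_compat_l; auto. nra. }
  assert (exp (2 * PI * y) > 0) by pos. nra. }
 assert (E : (sexp (RtoC (2 * PI * y) *: a) * kz_path G y * subst Phi a b - sone =
   subst (sinv (real_spow (uexp y) sx) * G0 (uexp y) - sone) a b)%ncs).
 { rewrite subst_add, subst_opp, subst_one, subst_mul, subst_sinv by (trivial; now apply real_spow_nil).
  unfold real_spow. rewrite subst_sexp by (trivial; unfold sscal; simpl; ring).
  rewrite subst_scal by pos. unfold sx. rewrite subst_letter by pos.
  rewrite sexp_inv by pos. assert (El : ln (uexp y) = (- (2 * PI) * y)%R) by apply ln_exp. rewrite El.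
  replace (- RtoC (- (2 * PI) * y)) with (RtoC (2 * PI * y)) by (rewrite <- RtoC_opp; f_equal; ring).
  rewrite <- smul_assoc. unfold kz_path. rewrite <- subst_mul by pos.
  rewrite (Phi_def (uexp y)) by lra. rewrite smul_assoc, sinv_r, smul_one_l; auto. apply KZ_nil_left; trivial; lra. }
 rewrite E. le_via Bd. rewrite Rmult_assoc. apply Rmult_le_compat_l; auto.
 replace (exp (- PI * y)) with (sqrt (uexp y)); auto.
 replace (uexp y) with (exp (- PI * y) * exp (- PI * y))%R by (rewrite <- exp_plus; unfold uexp; f_equal; ring).
 apply sqrt_square. pos.
Qed.

End Path.

(** * The KZB equation along rays and horizontal segments *)

Lemma dom_strip tau z : upper tau -> 0 < Im z < Im tau -> dom tau z.
Proof.
 exists (Re z - Im z / Im tau * Re tau)%R, (Im z / Im tau)%R. split.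
 - destruct z as [x y], tau as [u v]. simpl in *. apply C_eq; simpl; field; lra.
 - right. split; try pos. apply (Rmult_lt_reg_r (Im tau)); auto.
  unfold Rdiv. rewrite Rmult_assoc, Rinv_l by lra. lra.
Qed.

Lemma dom_real tau x : 0 < x < 1 -> dom tau x.
Proof. exists x, 0%R. split; [ring | now left]. Qed.

Lemma dom_real_tau tau x : 0 < x < 1 -> dom tau (x + tau).
Proof. exists x, 1%R. split; [ring | now left]. Qed.

Lemma lie_poly_nil f : lie_poly f -> f nil = 0.
Proof.
 induction 1 as [l|f g _ IH1 _ IH2|c f _ IH|f g _ IH1 _ IH2].
 - pos.
 - unfold sadd. rewrite IH1, IH2. ring.
 - unfold sscal. rewrite IH. ring.
 - unfold bracket, sadd, sopp. rewrite !smul_nil. ring.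
Qed.

Lemma exp_lie_nil f : exp_lie f -> f nil = 1.
Proof.
 intros [g [H ->]]. apply sexp_nil. exact (lie_poly_nil _ (H O)).
Qed.

Lemma Cmod_bernoulli (w : C) : w <> 0 -> Cmod w <= / 8 ->
 Cmod (w * Cexp w / (Cexp w - 1) - 1) <= 12 * Cmod w.
Proof.
 intros H0 Hw. assert (Pw : 0 < Cmod w) by now apply (Cmod_gt_0 w).
 assert (E3 : exp (Cmod w) <= 3) by (apply Rle_trans with (exp 1); [apply exp_le; lra | apply exp_le_3]).
 assert (B := Cexp_m1w_bound w).
 assert (L : Cmod w / 2 <= Cmod (Cexp w - 1)).
 { assert (T := Cmod_triangle (Cexp w - 1) (- (Cexp w - 1 - w))). rewrite Cmod_opp in T.
  replace (Cexp w - 1 + - (Cexp w - 1 - w)) with w in T by ring. nra. }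
 assert (N : Cexp w - 1 <> 0) by (intros Z; rewrite Z, Cmod_0 in L; lra).
 replace (w * Cexp w / (Cexp w - 1) - 1) with ((w * (Cexp w - 1) + - (Cexp w - 1 - w)) / (Cexp w - 1)) by now field.
 rewrite Cmod_div by pos. apply (Rmult_le_reg_r (Cmod (Cexp w - 1))); [lra|].
 unfold Rdiv. rewrite Rmult_assoc, Rinv_l, Rmult_1_r by lra.
 le_via Cmod_triangle. rewrite Cmod_opp, Cmod_mult.
 nra.
Qed.

Lemma Cexp_RtoC x : Cexp (RtoC x) = (exp x).
Proof. unfold Cexp. simpl. rewrite cos_0, sin_0. apply C_eq; simpl; ring. Qed.

Lemma Ci_two_pi_i : Ci * two_pi_i = RtoC (- (2 * PI)).
Proof. apply C_eq; simpl; ring. Qed.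

Lemma Cexp_two_pi_i_iR x : Cexp (two_pi_i * (Ci * RtoC x)) = (exp (- (2 * PI) * x)).
Proof. replace (two_pi_i * (Ci * x)) with ((Ci * two_pi_i) * x) by ring. rewrite Ci_two_pi_i, <- RtoC_mult. apply Cexp_RtoC. Qed.

Lemma sexp_st_mul c d : (sexp (c *: st) * sexp (d *: st) = sexp ((c + d) *: st))%ncs.
Proof. apply sexp_add, st_nil. Qed.

Section Ray.

Variables (theta : C -> C -> C) (beta : nat -> C) (G : R -> ncs).
Hypothesis Hth : is_theta theta.
Hypothesis beta_exp : has_expansion (fun s => s / (Cexp (two_pi_i * s) - RtoC 1)) beta.
Hypothesis G_sol : KZ_solution G.
Hypothesis G_1 : asymp (at_left 1%R) G (fun z => real_spow (1 - z)%R (letter true)).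
Let yt : ncs := (- Lser beta)%ncs.
Let K (tau z : C) := KZB_kernel theta tau z.

Lemma yt_0 : yt nil = 0.
Proof. unfold yt, sopp. rewrite Lser_nil. ring. Qed.

(** The first letter of the KZ equation along z = i sg y: yt for sg = 1, and -yt - t for sg = -1. On
    the lower half-axis exp(2 pi i z) = 1/U with U = exp(-2 pi y), and -(1/U) / (1/U - 1) = -1 + U /
    (U - 1) moves one copy of -t into this letter. *)
Definition ray_a (sg : R) : ncs := (RtoC sg *: yt + RtoC ((sg - 1) / 2) *: st)%ncs.

Lemma ray_a_nil sg : ray_a sg nil = 0.
Proof. unfold ray_a, sadd, sscal. rewrite yt_0, st_nil. ring. Qed.

Lemma ray_kernel sg y : (sg = 1 \/ sg = -1) -> 0 < y ->
 ((Ci * sg) *: trig_kernel yt (Ci * RtoC (sg * y)))%ncs = kz_coef (ray_a sg) st y.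
Proof.
 intros Hs Hy. destruct (uexp_bounds y Hy) as [U1 U2].
 set (U := RtoC (uexp y)).
 assert (N1 : U <> 0) by (apply RtoC_neq_0; lra).
 assert (N2 : U - 1 <> 0) by (unfold U; rewrite <- RtoC_minus; apply RtoC_neq_0; lra).
 assert (E : sg * (Cexp (two_pi_i * (Ci * RtoC (sg * y))) / (Cexp (two_pi_i * (Ci * RtoC (sg * y))) - 1)) =
  RtoC ((sg - 1) / 2) + U / (U - 1)).
 { rewrite Cexp_two_pi_i_iR. destruct Hs as [-> | ->].
  - replace (- (2 * PI) * (1 * y))%R with (- (2 * PI) * y)%R by lra. fold (uexp y). fold U.
   replace ((1 - 1) / 2)%R with 0%R by lra. ring.
  - replace (exp (- (2 * PI) * (-1 * y))) with (/ uexp y)%R by (unfold uexp; rewrite <- exp_Ropp; f_equal; ring).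
   rewrite RtoC_inv by lra. fold U. replace ((-1 - 1) / 2)%R with (- (1))%R by lra.
   rewrite RtoC_opp.
   assert (N3 : 1 - U <> 0) by (intros Z; apply N2; replace (U - 1) with (- (1 - U)) by ring; rewrite Z; ring).
   now field. }
 unfold trig_kernel, kz_coef, ray_a. replace (RtoC (uexp y / (uexp y - 1))) with (U / (U - 1)) by (rewrite RtoC_div, RtoC_minus by lra; reflexivity). apply ncs_ext; intros w. unfold sscal, sadd.
 set (V := Cexp (two_pi_i * (Ci * RtoC (sg * y)))) in *.
 transitivity ((Ci * two_pi_i) * ((sg * (V / (V - 1))) * st w + sg * yt w)); [unfold Cdiv; ring|].
 rewrite E, Ci_two_pi_i. ring.
Qed.

Lemma not_lattice_small tau (z : C) : 1 <= Im tau -> z <> 0 -> Cmod z < / 2 -> ~ lattice tau z.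
Proof.
 intros Ht H0 Hz L. destruct (theta_facts theta tau Hth ltac:(unfold upper; lra)) as [_ [_ [A3 [A4 _]]]].
 apply (isZ_small z H0 Hz). apply (lattice_strip (fun z => theta z tau) tau ltac:(lra) A3 A4); auto.
 assert (I := Im_le_Cmod z). lra.
Qed.

(** The residue of the kernel at 0 is t. The radius 1/64 ensures |2 pi i z| <= 1/8, as
    [Cmod_bernoulli] requires, by way of pi <= 4. *)
Lemma kernel_at_0 n tau : 1 <= Im tau -> exists C0, 0 <= C0 /\ forall z : C, z <> 0 -> Cmod z < / 64 ->
 nrm n (z *: K tau z - st) <= C0 * Cmod z.
Proof.
 intros Ht. destruct (KZB_kernel_trig theta beta n Hth beta_exp) as [B [HB Bd]].
 assert (P := PI_gt_3). assert (P4 := PI_4).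
 exists (B + 24 * PI * nrm n st + 2 * PI * nrm n yt)%R.
 split; try pos.
 intros z H0 Hz. assert (I := Im_le_Cmod z).
 destruct (Bd tau z Ht (not_lattice_small tau z Ht H0 ltac:(lra)) ltac:(lra)) as [_ B1].
 assert (B2 : nrm n (KZB_kernel theta tau z - trig_kernel yt z) <= B).
 { le_via B1. rewrite <- (Rmult_1_r B) at 2. apply Rmult_le_compat_l; auto.
  rewrite <- exp_0. apply exp_le. nra. }
 set (w := two_pi_i * z). assert (Hw : Cmod w = (2 * PI * Cmod z)%R) by (unfold w; now rewrite Cmod_mult, Cmod_two_pi_i).
 assert (w0 : w <> 0) by (apply Cmult_neq_0; [apply two_pi_i_neq_0 | exact H0]).
 assert (Cz := Cmod_ge_0 z).
 assert (Bw := Cmod_bernoulli w w0 ltac:(nra)).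
 assert (E : (z *: K tau z - st = z *: (KZB_kernel theta tau z - trig_kernel yt z)
   + ((w * Cexp w / (Cexp w - 1) - 1) *: st + w *: yt))%ncs).
 { unfold K, trig_kernel. apply ncs_ext; intros v. unfold sscal, sadd, sopp, w, Cdiv. ring. }
 rewrite E. le_via nrm_add. rewrite nrm_scal.
 assert (Q2 : nrm n ((w * Cexp w / (Cexp w - 1) - 1) *: st + w *: yt) <= 12 * Cmod w * nrm n st + Cmod w * nrm n yt).
 { le_via nrm_add. rewrite !nrm_scal. mono. }
 nra.
Qed.

(** * Behaviour near 0 along the two imaginary half-axes *)

Section Solution.

(** Both half-axes are treated at once. For sg = 1, phi is F and D is 1; for sg = -1, phi is exp(2
    pi i x) F(z + tau) and D is B. The link with F is made on the positive reals, where the branch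
    of the logarithm is given explicitly. *)
Variables (tau : C) (F : C -> ncs) (sg : R) (phi : C -> ncs) (D : ncs).
Hypothesis Ht : 1 <= Im tau.
Hypothesis HF : is_KZB_solution theta tau F.
Hypothesis Hsg : (sg = 1 \/ sg = -1)%R.
Hypothesis phi_der : forall z : C, z <> 0 -> 0 <= Re z < / 2 -> 0 <= sg * Im z <= Im tau / 2 ->
 forall w, cder (fun s => phi s w) z ((K tau z * phi z)%ncs w).
Hypothesis phi_real : forall x, 0 < x < / 2 -> phi (RtoC x) = (F (RtoC x) * D)%ncs.
Hypothesis D_nil : D nil = 1.

Lemma F_at_0 : tends1 (fun x => F x * sinv (sexp (((ln (2 * PI * x)) - Ci * RtoC (PI / 2)) *: st)))%ncs.
Proof.
 destruct HF as [_ [_ [L [[r [Hr [L1 L2]]] HA]]]].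
 apply tends1_words. intros w e He. destruct (asymp_near _ _ _ w e HA He) as [d Hd].
 exists (Rmin (Rmin 1 r) d). destruct (Rmin_le (Rmin 1 r) d) as [m1 m2].
 destruct (Rmin_le 1 r) as [m3 m4]. assert (P := cond_pos d).
 split; try mono. intros x Hx.
 assert (B : ball (RtoC 0) d (RtoC x)).
 { split.
  - change (Rabs (x - 0) < d). rewrite Rabs_pos_eq; lra.
  - change (Rabs (0 - 0) < d). rewrite Rminus_0_r, Rabs_R0. lra. }
 specialize (Hd (RtoC x) B (dom_real tau x ltac:(lra))).
 replace ((ln (2 * PI * x)) - Ci * RtoC (PI / 2)) with (L x); auto.
 assert (HI := L2 x ltac:(lra)).
 destruct (L1 x (dom_real tau x ltac:(lra))) as [_ HL].
 { rewrite Cmod_R, Rabs_pos_eq; lra. }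
 apply (f_equal Im) in HL. rewrite Im_Cexp, HI, sin_neg, sin_PI2 in HL. simpl in HL.
 apply C_eq.
 - replace ((2 * PI * x)%R) with (exp (Re (L x))) by lra. rewrite ln_exp. simpl; lra.
 - simpl; lra.
Qed.

Let T := sexp ((Ci * RtoC (sg * PI / 2))%C *: st)%ncs.
Let gam (x al : R) : C := RtoC x * Cexp (RtoC al * (Ci * RtoC sg)).

Lemma gam_parts x al : Re (gam x al) = (x * cos al)%R /\ (sg * Im (gam x al) = x * sin al)%R /\ Cmod (gam x al) = Rabs x.
Proof.
 unfold gam.
 replace (al * (Ci * sg)) with ((0%R, (sg * al)%R)) by (apply C_eq; simpl; ring). split; [|split].
 - simpl. rewrite exp_0. destruct Hsg as [-> | ->].
  + rewrite !Rmult_1_l. ring.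
  + replace (-1 * al)%R with (- al)%R by lra. rewrite cos_neg. ring.
 - simpl. rewrite exp_0. destruct Hsg as [-> | ->].
  + rewrite !Rmult_1_l. ring.
  + replace (-1 * al)%R with (- al)%R by lra. rewrite sin_neg. ring.
 - rewrite Cmod_mult, Cmod_Cexp, Cmod_R. simpl. rewrite exp_0. ring.
Qed.

Lemma gam_0 x : gam x 0 = x.
Proof. unfold gam. replace (0 * (Ci * sg)) with (RtoC 0) by ring. rewrite Cexp_0. ring. Qed.

Lemma gam_end x : gam x (PI / 2) = Ci * RtoC (sg * x).
Proof.
 unfold gam.
 replace (RtoC (PI / 2) * (Ci * sg)) with ((0%R, (sg * (PI / 2))%R)) by (apply C_eq; simpl; ring). unfold Cexp. simpl. rewrite exp_0. destruct Hsg as [-> | ->].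
 - rewrite !Rmult_1_l, cos_PI2, sin_PI2. apply C_eq; simpl; ring.
 - replace (-1 * (PI / 2))%R with (- (PI / 2))%R by lra. rewrite cos_neg, sin_neg, cos_PI2, sin_PI2. apply C_eq; simpl; ring.
Qed.

Lemma nder_path (f : C -> ncs) (g : R -> C) t (k : C) f' : (forall w, cder (fun s => f s w) (g t) (f' w)) -> rder g t k ->
 nder (fun s => f (g s)) t (k *: f').
Proof.
 intros Hf Hg w. apply (rder_val _ _ (f' w * k)); [unfold sscal; ring|].
 apply (rder_comp (fun s => f s w)); auto.
Qed.

(** In the angle along the quarter circle of radius x the coefficient is i sg z K(z) = i sg t +
    O(x), so the transport from x to i sg x is exp(i sg (pi/2) t) up to a relative error O(x). *)
Lemma arc n : exists C0 r, 0 <= C0 /\ 0 < r <= / 64 /\ forall x, 0 < x < r ->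
 nrm n (sinv T * phi (Ci * RtoC (sg * x)) - phi x) <= C0 * x * nrm n (phi x).
Proof.
 destruct (kernel_at_0 n tau Ht) as [C1 [HC1 B1]]. destruct (ode_compare n) as [K0 [HK0 Cmp]].
 assert (P := PI_gt_3). assert (P4 := PI_4). assert (Ns := nrm_ge0 n st).
 set (k := ((Ci * RtoC sg)%C *: st)%ncs).
 assert (k_nil : k nil = 0) by (unfold k, sscal; rewrite st_nil; ring).
 assert (Cs : Cmod (Ci * RtoC sg) = 1%R).
 { rewrite Cmod_mult, Cmod_R. replace (Cmod Ci) with 1%R; [destruct Hsg as [-> | ->]; rewrite ?Rabs_R1, ?Rabs_left; lra|].
  unfold Cmod; simpl. replace (0 * (0 * 1) + 1 * (1 * 1))%R with 1%R by ring. symmetry. apply sqrt_1. }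
 set (W := (INR (S n) * (1 + 4 * nrm n st) ^ n)%R).
 assert (HW : 0 <= W) by (apply Rmult_le_pos; [apply pos_INR | apply pow_le; lra]).
 assert (MW : forall t, Rabs t <= 2 -> nrm n (sexp (RtoC t *: k)%ncs) <= W).
 { intros t Htt. apply nrm_sexp; [unfold sscal; rewrite k_nil; ring|]. unfold k. rewrite !nrm_scal, Cs, Cmod_R.
  mono. }
 set (rho := (W * C1 * W)%R). assert (Hrho : 0 <= rho) by (unfold rho; apply Rmult_le_pos; [now apply Rmult_le_pos | exact HW]).
 exists (K0 * (rho * 2))%R, (/ (64 * (1 + rho)))%R. split; [apply Rmult_le_pos; lra|]. split.
 { split; [apply Rinv_0_lt_compat; lra | apply Rinv_le_contravar; lra]. }
 intros x Hx.
 assert (X1 : x < / 64) by (eapply Rlt_le_trans; [apply Hx | apply Rinv_le_contravar; lra]).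
 assert (X2 : rho * x <= / 64).
 { destruct Hx as [Hx0 Hx]. apply Rlt_le in Hx. apply Rmult_le_compat_l with (r := rho) in Hx; auto.
  le_via Hx. apply (Rmult_le_reg_r (64 * (1 + rho))); [lra|].
  rewrite Rmult_assoc, Rinv_l by lra. lra. }
 assert (reg : forall al, 0 <= al <= PI / 2 -> gam x al <> 0 /\ 0 <= Re (gam x al) < / 2 /\ 0 <= sg * Im (gam x al) <= Im tau / 2).
 { intros al Hal. destruct (gam_parts x al) as [G1' [G2' G3']]. rewrite Rabs_pos_eq in G3' by lra.
  split; [intros Z; rewrite Z, Cmod_0 in G3'; lra|].
  assert (C1' := cos_ge_0 al ltac:(lra) ltac:(lra)). assert (C2' := COS_bound al).
  assert (S1 := sin_ge_0 al ltac:(lra) ltac:(lra)). assert (S2 := SIN_bound al). nra. }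
 set (M := fun s : R => sexp (s *: k)).
 assert (M0 : M 0%R = sone) by (unfold M; rewrite sscal_zero_l; apply sexp_zero).
 assert (ME : M (PI / 2)%R = T).
 { unfold M, T, k. f_equal. apply ncs_ext; intros w. unfold sscal.
  replace (sg * PI / 2)%R with (PI / 2 * sg)%R by lra. rewrite RtoC_mult. ring. }
 assert (S1 : sinv sone = sone) by (symmetry; apply sinv_unique; [reflexivity | apply smul_one_l]).
 assert (R0 := Cmp M (fun al => phi (gam x al)) (fun _ => k) (fun al => (Ci * sg * gam x al) *: K tau (gam x al))%ncs
   (fun _ => rho * x)%R (fun al => rho * x * al)%R 0%R (PI / 2)%R ltac:(lra)).
 rewrite M0, ME, S1, smul_one_l, gam_0, gam_end in R0.
 eapply Rle_trans; [apply R0; clear R0|].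
 - exists 1%R. split; [lra|]. intros s _. apply sexp_nil. unfold sscal. rewrite k_nil. ring.
 - intros s _. now apply nder_sexp.
 - intros al Hal. destruct (reg al Hal) as [r1 [r2 r3]].
  apply (nder_val _ _ ((Ci * sg * gam x al) *: (K tau (gam x al) * phi (gam x al)))); [now rewrite smul_scal_l|].
  apply (nder_path phi (gam x)); auto. unfold gam.
  apply (rder_val _ _ (x * ((Ci * sg) * Cexp (al * (Ci * sg))))); [ring|].
  apply rder_scal, rder_Cexp.
 - intros al Hal. destruct (reg al Hal) as [r1 [r2 r3]]. destruct (gam_parts x al) as [_ [_ G3']].
  rewrite Rabs_pos_eq in G3' by lra.
  destruct (KZB_kernel_trig theta beta n Hth beta_exp) as [B [_ Bd]].
  destruct (Bd tau (gam x al) Ht) as [Kn _].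
  + apply not_lattice_small; trivial. lra.
  + assert (I := Im_le_Cmod (gam x al)). lra.
  + unfold sadd, sopp, sscal. fold (K tau (gam x al)) in Kn. rewrite Kn, k_nil. ring.
 - intros al _. auto_derive; lra.
 - intros al Hal. destruct (reg al Hal) as [r1 [r2 r3]]. destruct (gam_parts x al) as [_ [_ G3']].
  rewrite Rabs_pos_eq in G3' by lra.
  le_via nrm_mul3.
  assert (Z1 : nrm n (M al) <= W) by (apply MW; rewrite Rabs_pos_eq; lra).
  assert (Z2 : nrm n (sinv (M al)) <= W).
  { unfold M. rewrite sexp_inv by pos. rewrite <- RtoC_opp. apply MW. rewrite Rabs_Ropp, Rabs_pos_eq; lra. }
  assert (Z3 : nrm n ((Ci * sg * gam x al) *: K tau (gam x al) - k) <= C1 * x).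
  { replace ((Ci * sg * gam x al) *: K tau (gam x al) - k)%ncs with
    ((Ci * sg) *: (gam x al *: K tau (gam x al) - st))%ncs by (unfold k; ncs_lin).
   rewrite nrm_scal. assert (B2 := B1 _ r1 ltac:(lra)). nra. }
  replace (rho * x)%R with (W * (C1 * x) * W)%R by (unfold rho; ring).
  mono.
 - nra.
 - apply Rmult_le_compat_r; try pos. replace (K0 * (rho * 2) * x)%R with (K0 * (rho * x * 2))%R by lra. apply Rmult_le_compat_l; auto.
  assert (0 <= rho * x) by pos. nra.
Qed.

(** On the positive reals F starts with the phase exp(-i (pi/2) t) of its branch. The quarter turn T
    cancels it for sg = 1 and doubles it to exp(-pi i t) for sg = -1; this is the origin of exp(pi i
    t) in B. *)
Definition ray_const : ncs := (T * sexp ((- (Ci * RtoC (PI / 2)))%C *: st) * D)%ncs.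

Lemma ray_at_0 (a : ncs) : a nil = 0 ->
 tends1 (fun x => (phi (Ci * RtoC (sg * x)) * sinv ray_const) * sinv (kz_path a st G x))%ncs.
Proof.
 intros Ha. set (l := fun x : R => RtoC (ln (2 * PI * x))). set (h := Ci * RtoC (PI / 2)).
 set (Sx := fun x => sexp (l x *: st)%ncs). set (Q := sexp ((- h)%C *: st)%ncs).
 assert (sn : forall c : C, (c *: st)%ncs nil = 0) by (intros c; unfold sscal; rewrite st_nil; ring).
 assert (Tn : T nil = 1) by apply sexp_nil, sn. assert (Qn : Q nil = 1) by apply sexp_nil, sn.
 assert (Sn : forall x, Sx x nil = 1) by (intros x; apply sexp_nil, sn).
 (* phi is F D on the real axis, up to the quarter arc *)
 set (A := fun x => (T * (F (RtoC x) * sinv (sexp ((l x - h)%C *: st))) * sinv T)%ncs).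
 set (B := fun x => (T * (sinv T * phi (Ci * RtoC (sg * x))%C - phi (RtoC x)) * sinv ray_const * sinv (Sx x))%ncs).
 assert (TA : tends1 A).
 { assert (CT : contin (fun f => T * f * sinv T)%ncs).
  { assert (H1 := contin_smul_l T). assert (H2 := contin_smul_r (sinv T)). split.
   - intros f g. now rewrite (contin_add _ H1), (contin_add _ H2).
   - intros c f. now rewrite (contin_scal _ H1), (contin_scal _ H2).
   - intros n f Hf. apply (contin_vanish _ H2), (contin_vanish _ H1), Hf. }
  exact (tends1_contin _ _ CT ltac:(cbv beta; now rewrite smul_one_r, sinv_r) F_at_0). }
 (* The error of the arc is O(x), while F and the logarithmic factors only bring powers of
    [logw]. *)
 assert (TB : forall n e, 0 < e -> exists d, 0 < d /\ forall x, 0 < x < d -> nrm n (B x) < e).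
 { intros n e He. destruct (arc n) as [C0 [r [HC0 [Hr HA]]]].
  assert (P := PI_gt_3). assert (P4 := PI_4).
  assert (LG : log_growth n (fun x => sexp (RtoC (ln (2 * PI * x)) *: st)%ncs)).
  { apply (log_growth_sexp n st (fun x => ln (2 * PI * x)) (1 + Rabs (ln (2 * PI)))%R st_nil).
   - assert (Z := Rabs_pos (ln (2 * PI))). lra.
   - intros s Hs. rewrite ln_mult by lra. le_via Rabs_triang.
    assert (Z := Rabs_pos (ln (2 * PI))). assert (Z2 := Rabs_pos (ln s)). unfold logw.
    set (p := Rabs (ln (2 * PI))) in *. set (q := Rabs (ln s)) in *.
    assert (0 <= p * q) by now apply Rmult_le_pos. assert (0 <= s * (1 + q) * (1 + p)) by (apply Rmult_le_pos; [apply Rmult_le_pos|]; lra). lra. }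
  assert (LI := log_growth_sinv n _ (fun s _ => Sn s) LG).
  destruct LG as [g1 [k1 [Hg1 LG]]]. destruct LI as [g2 [k2 [Hg2 LI]]].
  destruct (F_at_0 n 1%R ltac:(lra)) as [d1 [Hd1 HF1]]. fold h in HF1.
  set (q := nrm n Q). set (tc := (nrm n T * nrm n (sinv ray_const))%R). set (dd := nrm n D).
  assert (q0 : 0 <= q) by apply nrm_ge0. assert (tc0 : 0 <= tc) by (apply Rmult_le_pos; apply nrm_ge0).
  assert (dd0 : 0 <= dd) by apply nrm_ge0.
  set (Z := (tc * C0 * (2 * (g1 * q) * dd) * g2)%R).
  assert (HZ : 0 <= Z) by (unfold Z; repeat (apply Rmult_le_pos; trivial); lra).
  destruct (logw_sqrt_small (k1 + k2) (e / (1 + Z))%R) as [d2 [Hd2 HL]]; [apply Rdiv_lt_0_compat; lra|].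
  exists (Rmin (Rmin d1 d2) r). split; [apply Rmin_glb_lt; [now apply Rmin_glb_lt | lra]|].
  destruct (Rmin_le (Rmin d1 d2) r) as [m1 m2].
  destruct (Rmin_le d1 d2) as [m3 m4].
  intros x Hx. specialize (HF1 x ltac:(lra)). specialize (HL x ltac:(lra)). specialize (HA x ltac:(lra)).
  specialize (LG x ltac:(lra)). specialize (LI x ltac:(lra)).
  assert (NF : nrm n (F (RtoC x)) <= 2 * (g1 * logw x ^ k1 * q)).
  { set (E := sexp ((RtoC (ln (2 * PI * x)) - h)%C *: st)%ncs) in *.
   assert (En : E nil = 1) by apply sexp_nil, sn.
   replace (F (RtoC x)) with ((F (RtoC x) * sinv E) * E)%ncs by (rewrite <- smul_assoc, sinv_l, smul_one_r by exact En; reflexivity).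
   le_via nrm_mul. assert (N1 := nrm_near1 n (F (RtoC x) * sinv E)%ncs).
   apply Rmult_le_compat; try apply nrm_ge0; [lra|].
   unfold E, Cminus. rewrite <- sexp_st_mul. fold Q. le_via nrm_mul. apply Rmult_le_compat_r; [exact q0 | exact LG]. }
  assert (NP : nrm n (phi (RtoC x)) <= 2 * (g1 * logw x ^ k1 * q) * dd).
  { rewrite phi_real by lra. le_via nrm_mul. now apply Rmult_le_compat_r. }
  assert (W1 := pow_ge_1 (logw x) k1 (logw_ge_1 x ltac:(lra))). assert (W2 := pow_ge_1 (logw x) k2 (logw_ge_1 x ltac:(lra))).
  assert (NB : nrm n (B x) <= nrm n T * (C0 * x * (2 * (g1 * logw x ^ k1 * q) * dd)) * nrm n (sinv ray_const) * (g2 * logw x ^ k2)).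
  { unfold B. le_via nrm_mul. apply Rmult_le_compat; try apply nrm_ge0; [|exact LI].
   le_via nrm_mul. apply Rmult_le_compat_r; [apply nrm_ge0|].
   le_via nrm_mul. apply Rmult_le_compat_l; [apply nrm_ge0|].
   le_via HA. apply Rmult_le_compat_l; [apply Rmult_le_pos; lra | exact NP]. }
  eapply Rle_lt_trans; [exact NB|]. rewrite pow_add in HL.
  replace (nrm n T * (C0 * x * (2 * (g1 * logw x ^ k1 * q) * dd)) * nrm n (sinv ray_const) * (g2 * logw x ^ k2))%R
   with (Z * (logw x ^ k1 * logw x ^ k2 * x))%R by (unfold Z, tc; ring).
  assert (Sq : x <= sqrt x).
  { assert (S0 := sqrt_pos x). rewrite <- (sqrt_sqrt x) at 1 by lra.
   assert (S1 : sqrt x <= 1) by (rewrite <- sqrt_1; apply sqrt_le_1; lra). nra. }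
  assert (V : logw x ^ k1 * logw x ^ k2 * x <= logw x ^ k1 * logw x ^ k2 * sqrt x) by (apply Rmult_le_compat_l; nra).
  set (U := (logw x ^ k1 * logw x ^ k2 * sqrt x)%R) in *.
  assert (U0 : 0 <= logw x ^ k1 * logw x ^ k2 * x) by (apply Rmult_le_pos; nra).
  apply Rmult_lt_compat_r with (r := (1 + Z)%R) in HL; [|lra].
  replace (e / (1 + Z) * (1 + Z))%R with e in HL by (field; lra). nra. }
 assert (E1 : forall x, 0 < x < / 2 -> (phi (Ci * RtoC (sg * x))%C * sinv ray_const * sinv (Sx x) = A x + B x)%ncs).
 { intros x Hx. set (err := (sinv T * phi (Ci * RtoC (sg * x))%C - phi (RtoC x))%ncs).
  assert (Ep : phi (Ci * RtoC (sg * x))%C = (T * (F (RtoC x) * D) + T * err)%ncs).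
  { unfold err. rewrite <- phi_real by exact Hx.
   rewrite <- smul_add_r. replace (phi (RtoC x) + (sinv T * phi (Ci * RtoC (sg * x))%C - phi (RtoC x)))%ncs with
    (sinv T * phi (Ci * RtoC (sg * x))%C)%ncs by ncs_lin. now rewrite smul_assoc, sinv_r, smul_one_l. }
  unfold B. fold err. rewrite Ep, !smul_add_l. f_equal. unfold A.
  assert (ER : (D * sinv ray_const * sinv (Sx x) = sinv (sexp ((l x - h)%C *: st)) * sinv T)%ncs).
  { unfold ray_const. fold h. fold Q. rewrite !sinv_mul by (trivial; rewrite ?smul_nil, ?Tn, ?Qn; ring).
   rewrite !smul_assoc, sinv_r, smul_one_l by pos.
   unfold Q, T, Sx. rewrite !sexp_inv by apply st_nil. rewrite !sexp_st_mul. f_equal. f_equal. ring. }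
  rewrite <- !smul_assoc. rewrite <- !smul_assoc in ER. now rewrite ER. }
 assert (T1 : tends1 (fun x => phi (Ci * RtoC (sg * x)) * sinv ray_const * sinv (Sx x))%ncs).
 { intros n e He. destruct (TA n (e / 2)%R ltac:(lra)) as [d1 [Hd1 H1]]. destruct (TB n (e / 2)%R ltac:(lra)) as [d2 [Hd2 H2]].
  exists (Rmin (Rmin d1 d2) (/ 2)). split; try pos.
  destruct (Rmin_le (Rmin d1 d2) (/ 2)) as [m1 m2].
  destruct (Rmin_le d1 d2) as [m3 m4].
  intros x Hx. rewrite E1 by lra. specialize (H1 x ltac:(lra)). specialize (H2 x ltac:(lra)).
  replace (A x + B x - sone)%ncs with ((A x - sone) + B x)%ncs by ncs_lin.
  eapply Rle_lt_trans; [apply nrm_add | lra]. }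
 assert (kn : forall x, 0 < x -> kz_path a st G x nil = 1) by (intros x Hx; apply kz_path_nil; trivial; apply st_nil).
 assert (T2 := kz_path_at_0 a st Ha st_nil G G_1).
 apply tends1_sinv in T2.
 - assert (T3 := tends1_mul _ _ T1 T2). revert T3. apply tends1_ext. exists 1%R. split; [lra|]. intros x Hx.
  fold (l x). fold (Sx x).
  rewrite sinv_mul, sinv_sinv by (trivial; try (apply sinv_nil; trivial); apply kn; lra).
  rewrite <- (smul_assoc (phi _ * sinv ray_const)). f_equal. rewrite smul_assoc, sinv_l, smul_one_l; trivial.
 - exists 1%R. split; [lra|]. intros x Hx. fold (l x). fold (Sx x). rewrite smul_nil, kn, sinv_nil by pos. ring.
Qed.

End Solution.

(** On the whole half-axis the kernels differ by O(exp(-pi Im tau)), and the two solutions have the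
    same singular behaviour at 0, so [singular_compare_log] applies up to height Im tau / 2; the
    smallness assumption is the one required there. *)
Lemma ray_compare n sg : (sg = 1 \/ sg = -1) -> exists D0 m, 0 <= D0 /\
 forall tau (F phi : C -> ncs) (D : ncs), 1 <= Im tau -> is_KZB_solution theta tau F ->
 (forall z : C, z <> 0 -> 0 <= Re z < / 2 -> 0 <= sg * Im z <= Im tau / 2 ->
   forall w, cder (fun s => phi s w) z ((KZB_kernel theta tau z * phi z)%ncs w)) ->
 (forall x, 0 < x < / 2 -> phi x = (F x * D)%ncs) -> D nil = 1 ->
 D0 * (1 + Im tau) ^ m * exp (- PI * Im tau) <= 1 ->
 nrm n (sinv (kz_path (ray_a sg) st G (Im tau / 2)) *
   (phi (Ci * RtoC (sg * (Im tau / 2))) * sinv (ray_const sg D)) - sone)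
   <= D0 * (1 + Im tau) ^ m * exp (- PI * Im tau).
Proof.
 intros Hsg. destruct (KZB_kernel_trig theta beta n Hth beta_exp) as [B [HB Bd]].
 assert (an := ray_a_nil sg). assert (sn := st_nil).
 destruct (singular_compare_log n (kz_path (ray_a sg) st G)) as [D1 [m [HD1 Cmp]]].
 { now apply kz_path_nil. }
 { now apply kz_path_growth. }
 exists (D1 * B)%R, (m + 1)%nat. split; try pos.
 intros tau F phi D Ht HF Hphi Hreal HD Hsm. set (Y := (Im tau / 2)%R) in *.
 set (eta := (B * exp (- PI * Im tau))%R). assert (X0 := exp_pos (- PI * Im tau)).
 assert (He : 0 <= eta) by pos.
 assert (Cs : Cmod (Ci * sg) = 1%R).
 { rewrite Cmod_mult, Cmod_R. replace (Cmod Ci) with 1%R; [destruct Hsg as [-> | ->]; rewrite ?Rabs_R1, ?Rabs_left; lra|].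
  unfold Cmod; simpl. replace (0 * (0 * 1) + 1 * (1 * 1))%R with 1%R by lra. symmetry. apply sqrt_1. }
 assert (LE : D1 * (1 + Y) ^ m * eta * sqrt Y <= D1 * B * (1 + Im tau) ^ (m + 1) * exp (- PI * Im tau)).
 { unfold eta. replace (D1 * (1 + Y) ^ m * (B * exp (- PI * Im tau)) * sqrt Y)%R with
   (D1 * B * ((1 + Y) ^ m * sqrt Y) * exp (- PI * Im tau))%R by lra.
  apply Rmult_le_compat_r; [lra|]. apply Rmult_le_compat_l; try pos.
  rewrite pow_add. apply Rmult_le_compat.
  - pos.
  - pos.
  - apply pow_incr. unfold Y. lra.
  - assert (S1 : (sqrt Y * sqrt Y = Y)%R) by (apply sqrt_sqrt; unfold Y; lra). unfold Y in *. nra. }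
 assert (reg : forall s, 0 < s <= Y -> let z := Ci * RtoC (sg * s) in
  z <> 0 /\ 0 <= Re z < / 2 /\ 0 <= sg * Im z <= Im tau / 2 /\ ~ lattice tau z /\ Rabs (Im z) <= Im tau / 2).
 { intros s Hs z. assert (Iz : Im z = (sg * s)%R) by (unfold z; simpl; ring). assert (Rz : Re z = 0%R) by (unfold z; simpl; ring).
  fold Y. rewrite Iz. assert (z0 : Im z <> 0%R) by nra.
  assert (Ab : Rabs (sg * s) <= Y) by (destruct Hsg as [-> | ->]; [rewrite Rabs_pos_eq; lra | rewrite Rabs_left; lra]).
  split; [intros Z; apply z0; rewrite Z; reflexivity|]. split; [lra|]. split; [destruct Hsg as [-> | ->]; lra|]. split; auto.
  intros L. destruct (theta_facts theta tau Hth ltac:(unfold upper; lra)) as [_ [_ [A3 [A4 _]]]].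
  apply (lattice_strip (fun z => theta z tau) tau ltac:(lra) A3 A4) in L; [|rewrite Iz; unfold Y in Ab; lra].
  apply z0. apply isZ_Im, L. }
 eapply Rle_trans; [|exact LE].
 apply (Cmp (fun s => phi (Ci * RtoC (sg * s))%C * sinv (ray_const sg D))%ncs
  (kz_coef (ray_a sg) st) (fun s => (Ci * sg) *: K tau (Ci * RtoC (sg * s)))%ncs eta Y); trivial.
 - pos.
 - intros s Hs. apply kz_path_nder; trivial. lra.
 - intros s Hs. destruct (reg s Hs) as [r1 [r2 [r3 [r4 r5]]]].
  rewrite smul_assoc. apply (nder_smul_r _ (fun s => phi (Ci * RtoC (sg * s)))).
  rewrite smul_scal_l. apply (nder_path phi (fun s => Ci * RtoC (sg * s))); auto.
  apply (rder_ext (fun s => (Ci * sg) * s)); [intros t; rewrite RtoC_mult; ring|].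
  apply (rder_val _ _ ((Ci * sg) * 1)); [ring|]. apply rder_scal, rder_id.
 - intros s Hs. destruct (reg s Hs) as [r1 [r2 [r3 [r4 r5]]]].
  destruct (Bd tau _ Ht r4 r5) as [Kn _]. unfold sadd, sopp. rewrite kz_coef_nil by pos.
  unfold sscal, K. rewrite Kn. ring.
 - intros s Hs. destruct (reg s Hs) as [r1 [r2 [r3 [r4 r5]]]].
  destruct (Bd tau _ Ht r4 r5) as [_ Kb]. rewrite <- ray_kernel by lra.
  replace (_ - _)%ncs with ((Ci * sg) *: (KZB_kernel theta tau (Ci * RtoC (sg * s)) - trig_kernel yt (Ci * RtoC (sg * s))))%ncs
   by (unfold K; ncs_lin).
  rewrite nrm_scal, Cs, Rmult_1_l. pos.
 - now apply (ray_at_0 tau F).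
 - lra.
Qed.

(** At height Im tau / 2 one has |exp(2 pi i z)| = exp(-pi Im tau), so the term in t of the
    trigonometric kernel is as small as the error, and the transport is that of the constant kernel
    2 pi i yt. *)
Lemma horizontal n S0 : 0 <= S0 -> exists C0, 0 <= C0 /\
 forall tau (F : C -> ncs) s0, 1 <= Im tau -> is_KZB_solution theta tau F -> Rabs s0 <= S0 ->
 C0 * exp (- PI * Im tau) <= 1 ->
 nrm n (sinv (sexp ((two_pi_i * s0) *: yt)) * F (Ci * RtoC (Im tau / 2) + s0) - F (Ci * RtoC (Im tau / 2)))
   <= C0 * exp (- PI * Im tau) * nrm n (F (Ci * RtoC (Im tau / 2))).
Proof.
 intros HS. destruct (KZB_kernel_trig theta beta n Hth beta_exp) as [B [HB Bd]].
 destruct (ode_compare n) as [K0 [HK0 Cmp]]. assert (P := PI_gt_3).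
 assert (Ns := nrm_ge0 n st). assert (Ny := nrm_ge0 n yt).
 set (W := (INR (S n) * (1 + 2 * PI * S0 * nrm n yt) ^ n)%R).
 set (rho := (W * (S0 * (B + 4 * PI * nrm n st)) * W)%R).
 assert (Hrho : 0 <= rho) by pos.
 exists ((1 + K0) * rho)%R. split; try pos.
 intros tau F s0 Ht HF Hs0 Hsm. set (Y := (Im tau / 2)%R) in *. set (X := exp (- PI * Im tau)) in *.
 assert (X0 : 0 < X) by pos. assert (XH : X <= / 2) by (apply exp_m1_half; nra).
 set (k := ((two_pi_i * s0) *: yt)%ncs).
 assert (k_nil : k nil = 0) by (unfold k, sscal; rewrite yt_0; ring).
 set (M := fun s : R => sexp (s *: k)).
 assert (MW : forall t, Rabs t <= 1 -> nrm n (sexp (t *: k)) <= W).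
 { intros t Htt. apply nrm_sexp; [unfold sscal; rewrite k_nil; ring|]. unfold k.
  rewrite !nrm_scal, Cmod_mult, Cmod_two_pi_i, !Cmod_R. assert (T0 := Rabs_pos t).
  apply Rle_trans with (1 * (2 * PI * S0 * nrm n yt))%R; [|lra].
  apply Rmult_le_compat; auto.
  - apply Rmult_le_pos; pos.
  - apply Rmult_le_compat_r; auto. apply Rmult_le_compat_l; lra. }
 assert (M0 : M 0%R = sone) by (unfold M; rewrite sscal_zero_l; apply sexp_zero).
 assert (M1 : M 1%R = sexp k) by (unfold M; now rewrite sscal_one).
 assert (S1 : sinv sone = sone) by (symmetry; apply sinv_unique; [reflexivity | apply smul_one_l]).
 set (z := fun s : R => Ci * Y + RtoC (s * s0)).
 assert (Imz : forall s, Im (z s) = Y) by (intros s; unfold z; simpl; ring).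
 assert (reg : forall s, dom tau (z s) /\ ~ lattice tau (z s) /\ Rabs (Im (z s)) <= Im tau / 2).
 { split; [apply dom_strip; [unfold upper; lra | rewrite Imz; unfold Y; lra]|]. rewrite Imz. split; [|unfold Y; rewrite Rabs_pos_eq; lra].
  intros L. destruct (theta_facts theta tau Hth ltac:(unfold upper; lra)) as [_ [_ [A3 [A4 _]]]].
  apply (lattice_strip (fun z => theta z tau) tau ltac:(lra) A3 A4) in L; [|rewrite Imz; unfold Y; rewrite Rabs_pos_eq; lra].
  apply isZ_Im in L. rewrite Imz in L. unfold Y in L. lra. }
 assert (z0 : z 0%R = Ci * Y) by (unfold z; rewrite Rmult_0_l; ring).
 assert (z1 : z 1%R = Ci * Y + s0) by (unfold z; now rewrite Rmult_1_l).
 assert (R0 := Cmp M (fun s => F (z s)) (fun _ => k) (fun s => s0 *: K tau (z s))%ncs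
   (fun _ => rho * X)%R (fun s => rho * X * s)%R 0%R 1%R ltac:(lra)).
 rewrite M0, M1, S1, smul_one_l, z0, z1 in R0.
 eapply Rle_trans; [apply R0; clear R0|].
 - exists 1%R. split; [lra|]. intros s _. apply sexp_nil. unfold sscal. rewrite k_nil. ring.
 - intros s _. now apply nder_sexp.
 - intros s Hs. rewrite smul_scal_l. apply (nder_path F z).
  + intros w. apply cder_of_is_derive. apply HF. apply reg.
  + apply (rder_val _ _ (0 + s0 * 1)); [ring|]. apply rder_plus; [apply rder_const|].
   apply (rder_ext (fun s => s0 * s)); [intros t; rewrite RtoC_mult; ring|]. apply rder_scal, rder_id.
 - intros s Hs. destruct (reg s) as [_ [r4 r5]]. destruct (Bd tau _ Ht r4 r5) as [Kn _].
  unfold sadd, sopp, sscal, K. rewrite Kn, k_nil. ring.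
 - intros s _. auto_derive; lra.
 - intros s Hs. destruct (reg s) as [_ [r4 r5]]. destruct (Bd tau _ Ht r4 r5) as [_ Kb].
  le_via nrm_mul3.
  assert (Z1 : nrm n (M s) <= W) by (apply MW; rewrite Rabs_pos_eq; lra).
  assert (Z2 : nrm n (sinv (M s)) <= W).
  { unfold M. rewrite sexp_inv by pos. rewrite <- RtoC_opp. apply MW. rewrite Rabs_Ropp, Rabs_pos_eq; lra. }
  set (u := Cexp (two_pi_i * z s)).
  assert (Cu : Cmod u = X).
  { unfold u. rewrite Cmod_Cexp, Re_two_pi_i, Imz. unfold X, Y. f_equal. field. }
  assert (U1 : / 2 <= Cmod (u - 1)).
  { assert (T := Cmod_triangle u (- (u - 1))). rewrite Cmod_opp in T. replace (u + - (u - 1)) with (RtoC 1) in T by ring.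
   rewrite Cmod_1 in T. lra. }
  assert (UN : u - 1 <> 0) by (intros Z; rewrite Z, Cmod_0 in U1; lra).
  assert (Z3 : nrm n (s0 *: K tau (z s) - k) <= S0 * (B + 4 * PI * nrm n st) * X).
  { replace (s0 *: K tau (z s) - k)%ncs with (s0 *: ((KZB_kernel theta tau (z s) - trig_kernel yt (z s)) +
    (two_pi_i * u / (u - 1)) *: st))%ncs by (unfold k, K, trig_kernel; fold u; ncs_lin).
   rewrite nrm_scal, Cmod_R, Rmult_assoc. apply Rmult_le_compat; try pos.
   le_via nrm_add. rewrite nrm_scal, Cmod_div, Cmod_mult, Cmod_two_pi_i by pos.
   rewrite Rmult_plus_distr_r.
   replace (4 * PI * nrm n st * X)%R with ((2 * PI * X * 2) * nrm n st)%R by lra.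
   rewrite <- (Rinv_inv 2). mono. }
  replace (rho * X)%R with (W * (S0 * (B + 4 * PI * nrm n st) * X) * W)%R by (unfold rho; ring).
  mono.
 - nra.
 - apply Rmult_le_compat_r; try pos. nra.
Qed.

End Ray.

(** * Exponentially small errors *)

Lemma poly_exp_small m : exists K, 0 <= K /\ forall x, 0 <= x -> (1 + x) ^ m * exp (- x) <= K / (1 + x).
Proof.
 set (k := (2 * INR (m + 1))%R). assert (Hk : 2 <= k) by (unfold k; rewrite plus_INR; assert (Z := pos_INR m); simpl; lra).
 exists (k ^ (m + 1))%R. split; try pos. intros x Hx.
 assert (E : (1 + x) ^ (m + 1) <= k ^ (m + 1) * exp x).
 { apply Rle_trans with ((k * exp (x / k)) ^ (m + 1))%R.
  - apply pow_incr. assert (Z := exp_ineq1_le (x / k)). assert (E : (k * (1 + x / k) = k + x)%R) by (field; lra). nra.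
  - rewrite Rpow_mult_distr. apply Rmult_le_compat_l; try pos. rewrite <- exp_INR. apply exp_le.
   unfold k. replace (INR (m + 1) * (x / (2 * INR (m + 1))))%R with (x / 2)%R; [lra|].
   field. apply not_0_INR. lia. }
 apply (Rmult_le_reg_r (1 + x)); [lra|].
 replace (k ^ (m + 1) / (1 + x) * (1 + x))%R with (k ^ (m + 1))%R by (field; lra).
 replace ((1 + x) ^ m * exp (- x) * (1 + x))%R with ((1 + x) ^ (m + 1) * exp (- x))%R by (rewrite pow_add; simpl; ring).
 apply (Rmult_le_reg_r (exp x)); try pos.
 rewrite Rmult_assoc, <- exp_plus, Rplus_opp_l, exp_0. lra.
Qed.

Section Classes.

Variable M0 : R.

(** The rate e is 0 for factors of polynomial growth and 1 for errors. The value 1 lies below both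
    pi, the rate of the kernel error, and pi/2, the rate at which the KZ solutions reach their
    asymptotics at height Im tau / 2. *)
Definition gro (e : R) (n : nat) (f : C -> ncs) : Prop := exists C0 k N, 0 <= C0 /\
 forall tau, N <= Im tau -> 1 <= Im tau -> Rabs (Re tau) <= M0 ->
  nrm n (f tau) <= C0 * ((1 + Im tau) ^ k * exp (- e * Im tau)).

Definition tame (f : C -> ncs) : Prop := forall n, gro 0 n f.
Definition eqv (f g : C -> ncs) : Prop := forall n, gro 1 n (fun tau => f tau - g tau)%ncs.

Lemma gro_add e n f g : gro e n f -> gro e n g -> gro e n (fun tau => f tau + g tau)%ncs.
Proof.
 intros [C1 [k1 [N1 [HC1 H1]]]] [C2 [k2 [N2 [HC2 H2]]]]. exists (C1 + C2)%R, (k1 + k2)%nat, (Rmax N1 N2).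
 split; [lra|]. intros tau HN Ht HM. assert (m1 := Rmax_l N1 N2). assert (m2 := Rmax_r N1 N2).
 specialize (H1 tau ltac:(lra) Ht HM). specialize (H2 tau ltac:(lra) Ht HM).
 assert (X := exp_pos (- e * Im tau)). assert (P1 := pow_ge_1 (1 + Im tau) k1 ltac:(lra)). assert (P2 := pow_ge_1 (1 + Im tau) k2 ltac:(lra)).
 le_via nrm_add. rewrite pow_add. set (a := ((1 + Im tau) ^ k1)%R) in *. set (b := ((1 + Im tau) ^ k2)%R) in *.
 set (x := exp (- e * Im tau)) in *.
 assert (Z1 : C1 * (a * x) <= C1 * (a * b * x)) by (apply Rmult_le_compat_l; [exact HC1 | apply Rmult_le_compat_r; nra]).
 assert (Z2 : C2 * (b * x) <= C2 * (a * b * x)) by (apply Rmult_le_compat_l; [exact HC2 | apply Rmult_le_compat_r; nra]).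
 lra.
Qed.

Lemma gro_mul e e' n f g : gro e n f -> gro e' n g -> gro (e + e') n (fun tau => f tau * g tau)%ncs.
Proof.
 intros [C1 [k1 [N1 [HC1 H1]]]] [C2 [k2 [N2 [HC2 H2]]]]. exists (C1 * C2)%R, (k1 + k2)%nat, (Rmax N1 N2).
 split; try pos. intros tau HN Ht HM. assert (m1 := Rmax_l N1 N2). assert (m2 := Rmax_r N1 N2).
 specialize (H1 tau ltac:(lra) Ht HM). specialize (H2 tau ltac:(lra) Ht HM).
 le_via nrm_mul. rewrite pow_add.
 replace (- (e + e') * Im tau)%R with (- e * Im tau + - e' * Im tau)%R by lra. rewrite exp_plus.
 eapply Rle_trans; [apply Rmult_le_compat; [apply nrm_ge0 | apply nrm_ge0 | exact H1 | exact H2]|]. lra.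
Qed.

Lemma gro_ext e n (f g : C -> ncs) : (forall tau, 1 <= Im tau -> f tau = g tau) -> gro e n f -> gro e n g.
Proof.
 intros E [C0 [k [N [HC H]]]]. exists C0, k, N. split; auto. intros tau H1 H2 H3. rewrite <- E by lra. pos.
Qed.

Lemma gro_opp e n f : gro e n f -> gro e n (fun tau => - f tau)%ncs.
Proof.
 intros [C0 [k [N [HC H]]]]. exists C0, k, N. split; auto. intros tau H1 H2 H3. rewrite nrm_opp. pos.
Qed.

Lemma gro_small n f : gro 1 n f -> gro 0 n f.
Proof.
 intros [C0 [k [N [HC H]]]]. exists C0, k, N. split; auto. intros tau H1 H2 H3.
 eapply Rle_trans; auto. mono.
Qed.

Lemma tame_const h : tame (fun _ => h).
Proof.
 intros n. exists (nrm n h), 0%nat, 0%R. split; try pos. intros tau _ _ _.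
 replace (- 0 * Im tau)%R with 0%R by lra. rewrite exp_0. lra.
Qed.

Lemma tame_mul f g : tame f -> tame g -> tame (fun tau => f tau * g tau)%ncs.
Proof. intros Hf Hg n. rewrite <- (Rplus_0_r 0). now apply gro_mul. Qed.

Lemma tame_sinv (f : C -> ncs) : (forall tau, 1 <= Im tau -> f tau nil = 1) -> tame f -> tame (fun tau => sinv (f tau)).
Proof.
 intros Hn Hf n. destruct (Hf n) as [C0 [k [N [HC H]]]]. exists (INR (S n) * (1 + C0) ^ n)%R, (k * n)%nat, N.
 split; try pos. intros tau H1 H2 H3.
 specialize (H tau H1 H2 H3). replace (- 0 * Im tau)%R with 0%R in * by lra. rewrite exp_0, Rmult_1_r in *.
 le_via ((nrm_sinv n _ _ (Hn tau H2) H)).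
 rewrite (Rmult_assoc (INR (S n))). apply Rmult_le_compat_l; try pos. rewrite pow_mult, <- Rpow_mult_distr.
 assert (P := pow_ge_1 (1 + Im tau) k ltac:(lra)). apply pow_incr. nra.
Qed.

Lemma tame_sexp (c : C -> C) c0 (b : ncs) : b nil = 0 -> 0 <= c0 ->
 (forall tau, 1 <= Im tau -> Rabs (Re tau) <= M0 -> Cmod (c tau) <= c0 * (1 + Im tau)) ->
 tame (fun tau => sexp (c tau *: b)).
Proof.
 intros Hb Hc0 Hc n. set (A := (c0 * nrm n b)%R).
 assert (HA : 0 <= A) by pos.
 exists (INR (S n) * (1 + A) ^ n)%R, n, 0%R. split; try pos.
 intros tau _ H2 H3. replace (- 0 * Im tau)%R with 0%R by lra. rewrite exp_0, Rmult_1_r.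
 le_via ((nrm_sexp n _ (A * (1 + Im tau)))).
 - unfold sscal. rewrite Hb. ring.
 - rewrite nrm_scal. unfold A. replace (c0 * nrm n b * (1 + Im tau))%R with (c0 * (1 + Im tau) * nrm n b)%R by lra.
  mono.
 - rewrite (Rmult_assoc (INR (S n))). apply Rmult_le_compat_l; try pos. rewrite <- Rpow_mult_distr. apply pow_incr. nra.
Qed.

Lemma eqv_ext (f g f' g' : C -> ncs) : (forall tau, 1 <= Im tau -> f tau = f' tau) -> (forall tau, 1 <= Im tau -> g tau = g' tau) ->
 eqv f g -> eqv f' g'.
Proof. intros E E' H n. apply (gro_ext 1 n (fun tau => f tau - g tau)%ncs); auto. intros tau Ht. now rewrite E, E'. Qed.

Lemma eqv_refl f : eqv f f.
Proof.
 exists 0%R, 0%nat, 0%R. split; [lra|]. intros tau _ _ _.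
 replace (f tau - f tau)%ncs with szero by ncs_lin. rewrite nrm_zero. lra.
Qed.

Lemma eqv_trans f g h : eqv f g -> eqv g h -> eqv f h.
Proof.
 intros A B n. apply (gro_ext 1 n (fun tau => (f tau - g tau) + (g tau - h tau))%ncs); [intros; ncs_lin|].
 apply gro_add; auto.
Qed.

Lemma eqv_mul f f' g g' : tame f -> tame g' -> eqv f f' -> eqv g g' ->
 eqv (fun tau => f tau * g tau)%ncs (fun tau => f' tau * g' tau)%ncs.
Proof.
 intros Tf Tg A B n. apply (gro_ext 1 n (fun tau => f tau * (g tau - g' tau) + (f tau - f' tau) * g' tau)%ncs); [intros; ncs_ring|].
 apply gro_add.
 - rewrite <- (Rplus_0_l 1). apply gro_mul; auto.
 - rewrite <- (Rplus_0_r 1). apply gro_mul; auto.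
Qed.

Lemma eqv_tame f g : eqv f g -> tame g -> tame f.
Proof.
 intros A Tg n. apply (gro_ext 0 n (fun tau => (f tau - g tau) + g tau)%ncs); [intros; ncs_lin|].
 apply gro_add; [apply gro_small, A | apply Tg].
Qed.

Lemma eqv_sinv (f g : C -> ncs) : (forall tau, 1 <= Im tau -> f tau nil = 1) -> (forall tau, 1 <= Im tau -> g tau nil = 1) ->
 tame g -> eqv f g -> eqv (fun tau => sinv (f tau)) (fun tau => sinv (g tau)).
Proof.
 intros Fn Gn Tg A n. assert (Tf := eqv_tame f g A Tg).
 apply (gro_ext 1 n (fun tau => sinv (f tau) * (- (f tau - g tau)) * sinv (g tau))%ncs).
 - intros tau Ht. rewrite smul_opp_r, smul_add_r, sinv_l, smul_opp_r by pos.
  rewrite smul_opp_l, smul_add_l, smul_one_l, smul_opp_l, <- smul_assoc, sinv_r, smul_one_r by pos. ncs_lin.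
 - rewrite <- (Rplus_0_r 1). apply gro_mul; [|now apply tame_sinv].
  rewrite <- (Rplus_0_l 1). apply gro_mul; [now apply tame_sinv | apply gro_opp, A].
Qed.

Lemma eqv_cancel (f g h : C -> ncs) : (forall tau, 1 <= Im tau -> h tau nil = 1) -> tame h ->
 eqv (fun tau => sinv (h tau) * f tau)%ncs g -> tame g -> eqv f (fun tau => h tau * g tau)%ncs.
Proof.
 intros Hn Th A Tg. apply (eqv_ext (fun tau => h tau * (sinv (h tau) * f tau))%ncs (fun tau => h tau * g tau)%ncs).
 - intros tau Ht. now rewrite smul_assoc, sinv_r, smul_one_l by pos.
 - pos.
 - apply eqv_mul; trivial. apply eqv_refl.
Qed.

Lemma limit_of_eqv (f g : C -> ncs) (l : ncs) w : eqv f g ->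
 (forall tau, 1 <= Im tau -> exp_der (D_tau tau) (g tau) = l) ->
 filterlim (fun tau => exp_der (D_tau tau) (f tau) w) (i_infty M0) (locally (l w)).
Proof.
 intros A E. destruct (exp_der_bound w) as [B [HB Bd]]. set (n := length w) in *.
 destruct (A n) as [C0 [k [N [HC H]]]]. destruct (poly_exp_small (n + k)) as [K [HK PK]].
 set (R0 := (1 + Rabs M0)%R).
 set (Z := (B * R0 ^ n * C0 * K)%R).
 intros P [e HP]. exists (Rmax N (Rmax 1 (Z / e))). intros tau Ht HM.
 assert (m1 := Rmax_l N (Rmax 1 (Z / e))). assert (m2 := Rmax_r N (Rmax 1 (Z / e))).
 assert (m3 := Rmax_l 1 (Z / e)). assert (m4 := Rmax_r 1 (Z / e)). assert (He := cond_pos e).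
 assert (S0 : Cmod (exp_der (D_tau tau) (f tau) w - l w) < e).
 { rewrite <- (E tau) by lra. rewrite <- exp_der_sub. eapply Rle_lt_trans; auto.
  specialize (H tau ltac:(lra) ltac:(lra) HM). specialize (PK (Im tau) ltac:(lra)).
  assert (Ct : 1 + Cmod tau <= R0 * (1 + Im tau)).
  { assert (Z1 := Cmod_le_parts tau). rewrite (Rabs_pos_eq (Im tau)) in Z1 by lra.
   assert (Z2 := Rle_abs M0). assert (Z3 := Rabs_pos M0). unfold R0. nra. }
  assert (Cp : (1 + Cmod tau) ^ n <= R0 ^ n * (1 + Im tau) ^ n).
  { rewrite <- Rpow_mult_distr. apply pow_incr. assert (Z1 := Cmod_ge_0 tau). lra. }
  apply Rle_lt_trans with (B * (R0 ^ n * (1 + Im tau) ^ n) * (C0 * ((1 + Im tau) ^ k * exp (- 1 * Im tau))))%R.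
  - mono.
  - replace (- 1 * Im tau)%R with (- Im tau)%R by lra. rewrite pow_add in PK.
   apply Rle_lt_trans with (B * R0 ^ n * C0 * (K / (1 + Im tau)))%R.
   + replace (B * (R0 ^ n * (1 + Im tau) ^ n) * (C0 * ((1 + Im tau) ^ k * exp (- Im tau))))%R with
     (B * R0 ^ n * C0 * ((1 + Im tau) ^ n * (1 + Im tau) ^ k * exp (- Im tau)))%R by lra.
    mono.
   + apply Rle_lt_trans with (Z / (1 + Im tau))%R; [right; unfold Z; field; lra|].
    apply (Rmult_lt_reg_r (1 + Im tau)); [lra|]. unfold Rdiv. rewrite Rmult_assoc, Rinv_l by lra.
    assert (Y : Z / e < Im tau) by lra. apply Rmult_lt_compat_r with (r := e : R) in Y; auto.
    replace (Z / e * e)%R with Z in Y by (field; lra). nra. }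
 apply HP. set (v := exp_der (D_tau tau) (f tau) w) in *. split.
 - change (Rabs (Re v - Re (l w)) < e). replace (Re v - Re (l w))%R with (Re (v - l w)) by pos.
  eapply Rle_lt_trans; [apply Re_le_Cmod | exact S0].
 - change (Rabs (Im v - Im (l w)) < e). replace (Im v - Im (l w))%R with (Im (v - l w)) by pos.
  eapply Rle_lt_trans; [apply Im_le_Cmod | exact S0].
Qed.

End Classes.

(** * The explicit form of the associator *)

Lemma subst_Lser (a : nat -> C) (c : C) : c <> 0 ->
 subst (Lser a) (c *: sx) (/ c *: sy) = Lser (fun n => / c * (a n * Cpow c n)).
Proof.
 intros Hc. set (x := (c *: sx)%ncs). set (y := (/ c *: sy)%ncs).
 assert (Hx : x nil = 0) by (unfold x, sscal; simpl; ring). assert (Hy : y nil = 0) by (unfold y, sscal; simpl; ring).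
 unfold Lser, opser. rewrite subst_ssum by (trivial; apply graded_opser, raising_adx).
 f_equal. apply functional_extensionality; intros n. rewrite subst_scal by pos.
 assert (E : subst (Nat.iter n (bracket sx) sy) x y = (/ c * Cpow c n *: Nat.iter n (bracket sx) sy)%ncs).
 { induction n as [|n IH].
  - simpl. unfold sy at 1. rewrite subst_letter by pos. unfold y. ncs_lin.
  - simpl Nat.iter. rewrite subst_bracket, IH by pos. unfold sx at 1. rewrite subst_letter by pos. unfold x.
   change (Cpow c (S n)) with (c * Cpow c n). unfold bracket.
   rewrite !smul_scal_l, !smul_scal_r. ncs_lin. }
 rewrite E. ncs_lin.
Qed.

Section Explicit.

Variable beta : nat -> C.
Hypothesis beta_exp : has_expansion (fun s => s / (Cexp (two_pi_i * s) - RtoC 1)) beta.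

Lemma y_tilde_Lser : y_tilde = (- Lser beta)%ncs.
Proof. unfold y_tilde. now rewrite (fun_ad_eq _ beta). Qed.

(** The Taylor form of beta(-s) = beta(s) + s; after rescaling it turns the argument v of the
    associator into minus y tilde minus t. *)
Lemma beta_opp n : beta n * Cpow (- (1)) n = beta n + cseq 1 1 n.
Proof.
 apply (expansion_unique (fun s => - (1) * s / (Cexp (two_pi_i * (- (1) * s)) - 1))
  (fun n => beta n * Cpow (- (1)) n) (fun n => beta n + cseq 1 1 n)).
 - apply (has_expansion_comp_scal (fun s => s / (Cexp (two_pi_i * s) - 1)) beta (- (1))); auto.
  intros Z. apply (f_equal Re) in Z. simpl in Z. lra.
 - apply (has_expansion_ext_loc (fun s => s / (Cexp (two_pi_i * s) - 1) + 1 * Cpow s 1)).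
  + exists (/ 2)%R. split; [lra|]. intros s Hs Hm.
   assert (N : Cexp (two_pi_i * s) - 1 <> 0).
   { intros Z. apply (isZ_small s Hs Hm). apply Cexp_eq_1. replace (Cexp (two_pi_i * s)) with (Cexp (two_pi_i * s) - 1 + 1) by ring.
    rewrite Z. ring. }
   assert (N0 := Cexp_neq_0 (two_pi_i * s)).
   replace (two_pi_i * (- (1) * s)) with (- (two_pi_i * s)) by ring. rewrite Cexp_opp. set (u := Cexp (two_pi_i * s)) in *.
   assert (N1 : 1 - u <> 0) by (intros Z; apply N; replace (u - 1) with (- (1 - u)) by ring; rewrite Z; ring).
   now field.
  + apply has_expansion_plus; [exact beta_exp | apply has_expansion_cseq].
Qed.

Variable b : nat -> C.
Hypothesis b_exp : has_expansion (fun s => s / (Cexp s - RtoC 1)) b.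

Lemma beta_b n : / two_pi_i * (b n * Cpow two_pi_i n) = beta n.
Proof.
 assert (N := two_pi_i_neq_0).
 apply (expansion_unique (fun s => / two_pi_i * (two_pi_i * s / (Cexp (two_pi_i * s) - 1)))
  (fun n => / two_pi_i * (b n * Cpow two_pi_i n)) beta).
 - apply has_expansion_scal. now apply (has_expansion_comp_scal (fun s => s / (Cexp s - 1))).
 - apply (has_expansion_ext_loc (fun s => s / (Cexp (two_pi_i * s) - 1))); auto.
  exists 1%R. split; [lra|]. intros s _ _. unfold Cdiv. now rewrite !Cmult_assoc, Cinv_l, Cmult_1_l by pos.
Qed.

Lemma ell_sigma_eq (Phi : ncs) : Phi nil = 1 ->
 (rescale (fst (ell_sigma two_pi_i Phi)), rescale (snd (ell_sigma two_pi_i Phi))) = ell_sigma_explicit Phi.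
Proof.
 intros HP. assert (N := two_pi_i_neq_0).
 set (phi := fun s : C => s / (Cexp s - RtoC 1)).
 assert (R0 := raising_adx).
 assert (Hu : fun_ad phi sx (- sy)%ncs = (- Lser b)%ncs).
 { unfold Lser. rewrite (fun_ad_eq phi b) by exact b_exp. apply contin_opp, contin_opser, R0. }
 assert (Hv : fun_ad phi (- sx)%ncs sy = Lser (fun n => b n * Cpow (- (1)) n)).
 { rewrite (fun_ad_eq phi b) by exact b_exp. unfold Lser, opser. f_equal. apply functional_extensionality; intros n.
  assert (E : Nat.iter n (bracket (- sx)) sy = (Cpow (- (1)) n *: Nat.iter n (bracket sx) sy)%ncs).
  { induction n as [|n IH]; [simpl; ncs_lin|]. simpl Nat.iter. rewrite IH.
   change (Cpow (- (1)) (S n)) with (- (1) * Cpow (- (1)) n). unfold bracket.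
   rewrite !smul_scal_l, !smul_scal_r, smul_opp_l, smul_opp_r. ncs_lin. }
  rewrite E. ncs_lin. }
 set (x := (two_pi_i *: sx)%ncs). set (y := (/ two_pi_i *: sy)%ncs).
 assert (Hx : x nil = 0) by (unfold x, sscal; simpl; ring). assert (Hy : y nil = 0) by (unfold y, sscal; simpl; ring).
 assert (st0 := st_nil).
 assert (Rst : subst st x y = st).
 { unfold st, sx, sy. rewrite subst_opp, subst_bracket, !subst_letter by trivial. unfold x, y, bracket.
  rewrite !smul_scal_l, !smul_scal_r. apply ncs_ext; intros w. unfold sadd, sopp, sscal, sx, sy. field. exact N. }
 set (u := (- Lser b)%ncs) in *. set (v := Lser (fun n => b n * Cpow (- (1)) n)) in *.
 assert (u0 : u nil = 0) by (unfold u, sopp; rewrite Lser_nil; ring).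
 assert (v0 : v nil = 0) by apply Lser_nil.
 assert (Ru : subst u x y = y_tilde).
 { unfold u, x, y. rewrite subst_opp, subst_Lser, y_tilde_Lser by trivial. f_equal. apply opser_ext. apply beta_b. }
 assert (Rv : subst v x y = (- y_tilde - st)%ncs).
 { unfold v, x. rewrite subst_Lser by pos. rewrite y_tilde_Lser, st_Lser. unfold Lser.
  rewrite (opser_ext _ (fun n => beta n + - (1) * cseq (- (1)) 1 n)).
  - rewrite opser_plus, opser_scal by pos. ncs_lin.
  - intros n. replace (/ two_pi_i * (b n * Cpow (- (1)) n * Cpow two_pi_i n)) with
    (/ two_pi_i * (b n * Cpow two_pi_i n) * Cpow (- (1)) n) by ring.
   rewrite beta_b, beta_opp. unfold cseq. destruct (Nat.eqb n 1); ring. }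
 assert (P1 : subst (subst Phi u st) x y = subst Phi y_tilde st) by (rewrite subst_subst, Ru, Rst by pos; reflexivity).
 assert (P2 : subst (subst Phi v st) x y = subst Phi (- y_tilde - st) st) by (rewrite subst_subst, Rv, Rst by pos; reflexivity).
 assert (Pn : subst Phi u st nil = 1) by (rewrite subst_nil; trivial).
 assert (sn : forall (c : C) (f : ncs), f nil = 0 -> (c *: f)%ncs nil = 0) by (intros c f Hf; unfold sscal; rewrite Hf; ring).
 unfold ell_sigma, ell_sigma_explicit, rescale. fold phi. rewrite Hu, Hv. simpl fst. simpl snd. fold x y.
 f_equal.
 - rewrite !subst_mul, subst_sinv, P1, subst_sexp, subst_scal, Ru by pos. pos.
 - rewrite !subst_mul, subst_sinv, P1, P2, !subst_sexp, subst_scal, Rst by pos.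
  unfold sx at 1. rewrite subst_letter by pos.
  replace (two_pi_i / 2) with (PI * Ci); auto.
  unfold two_pi_i. rewrite RtoC_mult. field.
Qed.

End Explicit.

(** * The limit *)

Lemma cder_smul_l (h : ncs) (f : C -> ncs) z f' : (forall w, cder (fun s => f s w) z (f' w)) ->
 forall w, cder (fun s => (h * f s)%ncs w) z ((h * f')%ncs w).
Proof.
 intros Hf w. revert h. induction w as [|l w IH]; intros h.
 - apply (cder_ext (fun s => h nil * f s nil)); [intros s; now rewrite smul_nil|]. rewrite smul_nil. apply cder_scal, Hf.
 - apply (cder_ext (fun s => h nil * f s (l :: w) + (shift l h * f s)%ncs w)); [intros s; now rewrite smul_cons|].
  rewrite smul_cons. apply cder_plus; [apply cder_scal, Hf | apply IH].
Qed.

Section Limit.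

Variables (Phi : ncs) (theta : C -> C -> C) (F : C -> C -> ncs) (e : C -> ncs * ncs) (G0 G1 : R -> ncs) (beta : nat -> C) (M0 : R).
Hypothesis Hth : is_theta theta.
Hypothesis HF : forall tau, upper tau -> is_KZB_solution theta tau (F tau).
Hypothesis He : forall tau, upper tau -> is_KZB_pair tau (F tau) (e tau).
Hypothesis G0_sol : KZ_solution G0.
Hypothesis G0_0 : asymp (at_right 0%R) G0 (fun z => real_spow z (letter false)).
Hypothesis G1_sol : KZ_solution G1.
Hypothesis G1_1 : asymp (at_left 1%R) G1 (fun z => real_spow (1 - z)%R (letter true)).
Hypothesis Phi_def : forall z : R, 0 < z < 1 -> Phi = (sinv (G1 z) * G0 z)%ncs.
Hypothesis beta_rec : forall n, convol (eseq two_pi_i) beta n = beta n + cseq 1 1 n.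
Hypothesis beta_exp : has_expansion (fun s => s / (Cexp (two_pi_i * s) - RtoC 1)) beta.

Let yt : ncs := (- Lser beta)%ncs.
Let X : ncs := sexp (two_pi_i *: sx)%ncs.
Let c (tau : C) : R := (PI * Im tau)%R.
Let E (tau : C) : ncs := sexp ((- RtoC (c tau))%C *: yt)%ncs.
Let P : ncs := subst Phi yt st.
Let M (sg : R) (tau : C) : ncs := kz_path (ray_a beta sg) st G1 (Im tau / 2).
Let Fy (tau : C) : ncs := F tau (Ci * RtoC (Im tau / 2)).
Notation tame := (tame M0).
Notation eqv := (eqv M0).

Lemma upper_1 tau : 1 <= Im tau -> upper tau.
Proof. unfold upper. lra. Qed.

Lemma yt_nil_0 : yt nil = 0.
Proof. exact (yt_0 beta). Qed.

Lemma sexp_yt_nil (k : C) : sexp (k *: yt) nil = 1.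
Proof. apply sexp_nil. unfold sscal. rewrite yt_nil_0. ring. Qed.

Lemma sexp_st_nil (k : C) : sexp (k *: st) nil = 1.
Proof. apply sexp_nil. unfold sscal. rewrite st_nil. ring. Qed.

Lemma F_nil tau z : 1 <= Im tau -> dom tau z -> F tau z nil = 1.
Proof. intros Ht Hz. apply exp_lie_nil. now apply (proj1 (HF tau (upper_1 tau Ht))). Qed.

Lemma dom_mid tau s : 1 <= Im tau -> dom tau (Ci * RtoC (Im tau / 2) + RtoC s).
Proof.
 intros Ht. apply dom_strip; [now apply upper_1|].
 simpl; lra.
Qed.

Lemma Fy_nil tau : 1 <= Im tau -> Fy tau nil = 1.
Proof.
 intros Ht. apply F_nil; auto. replace (Ci * RtoC (Im tau / 2)) with (Ci * RtoC (Im tau / 2) + 0) by ring.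
 now apply dom_mid.
Qed.

Lemma Phi_1 : Phi nil = 1.
Proof. now apply (Phi_nil G1 G1_sol G1_1 G0). Qed.

Lemma P_nil : P nil = 1.
Proof. unfold P. rewrite subst_nil; [apply Phi_1 | apply yt_nil_0 | apply st_nil]. Qed.

Lemma M_nil sg tau : 1 <= Im tau -> M sg tau nil = 1.
Proof. intros Ht. unfold M. apply kz_path_nil; trivial; [apply ray_a_nil | apply st_nil | lra]. Qed.

Lemma tame_M sg : tame (M sg).
Proof.
 intros n. destruct (kz_path_growth _ _ (ray_a_nil beta sg) st_nil G1 G1_sol n) as [C0 [k [HC H]]].
 exists C0, (2 * k)%nat, 2%R. split; auto. intros tau Ht _ _. set (Y := (Im tau / 2)%R).
 assert (HY : 1 <= Y) by (unfold Y; lra). unfold M. fold Y.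
 eapply Rle_trans; [apply H; lra|]. apply Rmult_le_compat_l; auto.
 replace (- 0 * Im tau)%R with 0%R by lra. rewrite exp_0, Rmult_1_r, pow_mult.
 assert (L := logw_ge_1 Y ltac:(lra)). apply pow_incr. split; [lra|]. unfold logw.
 assert (L0 : 0 <= ln Y) by (rewrite <- ln_1; apply ln_le; lra).
 rewrite Rabs_pos_eq by lra. assert (L1 : ln Y <= Y) by (assert (Z := exp_ineq1_le (ln Y)); rewrite exp_ln in Z; lra).
 unfold Y in *. mono.
Qed.

Lemma tame_sexp_c (a : ncs) (s : R) : a nil = 0 -> Rabs s <= 1 -> tame (fun tau => sexp (RtoC (s * c tau) *: a)).
Proof.
 intros Ha Hs. assert (Pi := PI_gt_3). apply (tame_sexp M0 (fun tau => RtoC (s * c tau)) PI a Ha); [lra|]. intros tau Ht _. rewrite Cmod_R, Rabs_mult.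
 unfold c. rewrite (Rabs_pos_eq (PI * Im tau)) by nra.
 apply Rle_trans with (1 * (PI * Im tau))%R; try mono.
Qed.

(** This is [kz_path_infty] at y = Im tau / 2, where 2 pi y = [c tau], solved for the KZ
    solution. *)
Lemma eqv_M sg : eqv (M sg) (fun tau => sexp ((- (c tau)) *: ray_a beta sg) * sinv (subst Phi (ray_a beta sg) st))%ncs.
Proof.
 set (a := ray_a beta sg). assert (an : a nil = 0) by apply ray_a_nil. assert (sn := st_nil).
 set (Pa := subst Phi a st). assert (Pn : Pa nil = 1) by (unfold Pa; rewrite subst_nil; trivial; apply Phi_1).
 set (V := fun tau => (sexp (RtoC (1 * c tau) *: a) * M sg tau * Pa)%ncs).
 assert (HV : eqv V (fun _ => sone)).
 { intros n. destruct (kz_path_infty a st an sn G1 G1_sol G1_1 G0 Phi G0_sol G0_0 Phi_def n) as [C0 [y0 [Hy0 H]]].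
  exists (Rabs C0), 0%nat, (2 * y0)%R. split; try pos. intros tau Ht _ _. specialize (H (Im tau / 2)%R ltac:(lra)).
  unfold V, c. replace (1 * (PI * Im tau))%R with (2 * PI * (Im tau / 2))%R by lra.
  le_via H. assert (A := Rle_abs C0). assert (A0 := Rabs_pos C0). assert (Pi := PI_gt_3).
  assert (X1 : exp (- PI * (Im tau / 2)) <= exp (- (1) * Im tau)) by (apply exp_le; nra).
  assert (X0 := exp_pos (- PI * (Im tau / 2))). nra. }
 assert (TS' := tame_sexp_c a (- (1)) an ltac:(rewrite Rabs_Ropp, Rabs_R1; lra)).
 apply (eqv_ext M0 (fun tau => sexp (RtoC (- (1) * c tau) *: a) * V tau * sinv Pa)%ncs
   (fun tau => sexp (RtoC (- (1) * c tau) *: a) * sone * sinv Pa)%ncs).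
 - intros tau _. unfold V. rewrite !smul_assoc, sexp_add by pos. rewrite <- RtoC_plus.
  replace (- (1) * c tau + 1 * c tau)%R with 0%R by lra. rewrite sscal_zero_l, sexp_zero, smul_one_l.
  now rewrite <- smul_assoc, sinv_r, smul_one_r.
 - intros tau _. rewrite smul_one_r. f_equal. f_equal. f_equal. rewrite <- RtoC_opp. f_equal. ring.
 - apply eqv_mul; [apply tame_mul; auto | apply tame_const | | apply eqv_refl].
  + apply (eqv_tame M0 V (fun _ => sone)); [exact HV | apply tame_const].
  + apply eqv_mul; [exact TS' | apply tame_const | apply eqv_refl | exact HV].
Qed.

Lemma ray_a_1 : ray_a beta 1 = yt.
Proof.
 unfold ray_a. fold yt. replace ((1 - 1) / 2)%R with 0%R by lra. ncs_lin.
Qed.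

Lemma ray_a_m1 : ray_a beta (-1) = (- yt - st)%ncs.
Proof.
 unfold ray_a. fold yt. replace ((-1 - 1) / 2)%R with (- (1))%R by lra.
 rewrite RtoC_opp. ncs_lin.
Qed.

(** Supplies both the rate demanded by [eqv] and the bound by 1 that the comparison lemmas
    assume. *)
Lemma small_eventually D0 m : 0 <= D0 -> exists N, forall tau : C, N <= Im tau -> 1 <= Im tau ->
 (D0 * (1 + Im tau) ^ m * exp (- PI * Im tau) <= D0 * ((1 + Im tau) ^ m * exp (- (1) * Im tau)) /\
  D0 * (1 + Im tau) ^ m * exp (- PI * Im tau) <= 1).
Proof.
 destruct (poly_exp_small m) as [K [HK H]]. exists (D0 * K)%R. intros tau H1 H2.
 specialize (H (Im tau) ltac:(lra)). assert (Pi := PI_gt_3).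
 assert (LE : D0 * (1 + Im tau) ^ m * exp (- PI * Im tau) <= D0 * ((1 + Im tau) ^ m * exp (- (1) * Im tau))).
 { rewrite Rmult_assoc. mono. }
 split; auto. le_via LE. replace (- (1) * Im tau)%R with (- Im tau)%R by lra.
 apply Rle_trans with (D0 * (K / (1 + Im tau)))%R; try mono.
 apply (Rmult_le_reg_r (1 + Im tau)); [lra|]. replace (D0 * (K / (1 + Im tau)) * (1 + Im tau))%R with (D0 * K)%R by (field; lra). lra.
Qed.

Lemma eqv_ray sg (phi : C -> C -> ncs) (D : C -> ncs) : (sg = 1 \/ sg = -1) ->
 (forall tau, 1 <= Im tau ->
   (forall z : C, z <> 0 -> 0 <= Re z < / 2 -> 0 <= sg * Im z <= Im tau / 2 ->
    forall w, cder (fun s => phi tau s w) z ((KZB_kernel theta tau z * phi tau z)%ncs w)) /\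
   (forall x, 0 < x < / 2 -> phi tau x = (F tau x * D tau)%ncs) /\ D tau nil = 1) ->
 eqv (fun tau => sinv (M sg tau) * (phi tau (Ci * RtoC (sg * (Im tau / 2)))%C * sinv (ray_const sg (D tau))))%ncs (fun _ => sone).
Proof.
 intros Hs Hphi n. destruct (ray_compare theta beta G1 Hth beta_exp G1_sol G1_1 n sg Hs) as [D0 [m [HD0 H]]].
 destruct (small_eventually D0 m HD0) as [N HN]. exists D0, m, N. split; auto. intros tau HNt Ht _.
 destruct (Hphi tau Ht) as [h1 [h2 h3]]. destruct (HN tau HNt Ht) as [LE L1].
 eapply Rle_trans; [|exact LE]. now apply (H tau (F tau) (phi tau) (D tau) Ht (HF tau (upper_1 tau Ht)) h1 h2 h3).
Qed.

Lemma tame_target : tame (fun tau => E tau * sinv P)%ncs.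
Proof.
 apply tame_mul; [|apply tame_const]. intros n. apply (gro_ext M0 0 n (fun tau => sexp (RtoC (- (1) * c tau) *: yt))).
 - intros tau _. unfold E. f_equal. f_equal. rewrite <- RtoC_opp. f_equal. ring.
 - apply tame_sexp_c; [apply yt_nil_0 | rewrite Rabs_Ropp, Rabs_R1; lra].
Qed.

Lemma eqv_Fy : eqv Fy (fun tau => E tau * sinv P)%ncs.
Proof.
 assert (H := eqv_M 1). rewrite ray_a_1 in H.
 apply (eqv_trans M0 Fy (M 1)); auto.
 assert (V := eqv_ray 1 F (fun _ => sone) (or_introl eq_refl)).
 assert (C1 : ray_const 1 sone = sone).
 { unfold ray_const. rewrite sexp_st_mul. replace (1 * PI / 2)%R with (PI / 2)%R by lra.
  replace (Ci * RtoC (PI / 2) + - (Ci * RtoC (PI / 2))) with (RtoC 0) by ring. now rewrite sscal_zero_l, sexp_zero, smul_one_l. }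
 assert (S1 : sinv sone = sone) by (symmetry; apply sinv_unique; [reflexivity | apply smul_one_l]).
 apply (eqv_ext M0 Fy (fun tau => M 1 tau * sone)%ncs); [reflexivity | intros; apply smul_one_r |].
 apply eqv_cancel; [intros; now apply M_nil | apply tame_M | | apply tame_const].
 revert V. intros V. eapply eqv_ext; [| |apply V].
 - intros tau _. rewrite C1, S1, smul_one_r. now rewrite Rmult_1_l.
 - pos.
 - intros tau Ht. split; [|split].
  + intros z Hz Hr Hi w. apply cder_of_is_derive.
   destruct (HF tau (upper_1 tau Ht)) as [_ [HD _]]. apply HD.
   destruct (Req_dec (Im z) 0) as [I0|I0].
   * replace z with (RtoC (Re z)) by (apply C_eq; auto).
    apply dom_real. split; [|lra]. destruct Hr as [[Hr|Hr] _]; auto. exfalso. apply Hz. apply C_eq; auto.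
   * apply dom_strip; [now apply upper_1 | lra].
  + intros x _. now rewrite smul_one_r.
  + pos.
Qed.

Lemma eqv_horizontal (s : C -> R) S0 : 0 <= S0 -> (forall tau, Rabs (Re tau) <= M0 -> Rabs (s tau) <= S0) ->
 eqv (fun tau => F tau (Ci * RtoC (Im tau / 2) + (s tau)))
   (fun tau => sexp ((two_pi_i * (s tau)) *: yt) * (E tau * sinv P))%ncs.
Proof.
 intros HS Hs. assert (Pi := PI_gt_3).
 assert (TY : tame Fy) by apply (eqv_tame M0 Fy _ eqv_Fy), tame_target.
 apply eqv_cancel.
 - intros tau _. apply sexp_yt_nil.
 - apply (tame_sexp M0 (fun tau => two_pi_i * (s tau)) (2 * PI * S0)); [apply yt_nil_0 | apply Rmult_le_pos; lra|].
  intros tau Ht HM. rewrite Cmod_mult, Cmod_two_pi_i, Cmod_R. specialize (Hs tau HM).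
  assert (0 <= 2 * PI * S0) by pos. nra.
 - apply (eqv_trans M0 _ Fy); [|exact eqv_Fy]. intros n.
  destruct (horizontal theta beta Hth beta_exp n S0 HS) as [C0 [HC0 H]]. destruct (TY n) as [C1 [k [N1 [HC1 H1]]]].
  destruct (small_eventually C0 0 HC0) as [N HN]. exists (C0 * C1)%R, k, (Rmax N N1). split; try pos.
  intros tau HNt Ht HM. assert (m1 := Rmax_l N N1). assert (m2 := Rmax_r N N1).
  destruct (HN tau ltac:(lra) Ht) as [LE L1]. rewrite Rmult_1_r in LE, L1.
  specialize (H1 tau ltac:(lra) Ht HM). replace (- 0 * Im tau)%R with 0%R in H1 by lra. rewrite exp_0, Rmult_1_r in H1.
  le_via ((H tau (F tau) (s tau) Ht (HF tau (upper_1 tau Ht)) (Hs tau HM) L1)).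
  replace (C0 * C1 * ((1 + Im tau) ^ k * exp (- (1) * Im tau)))%R with
   (C0 * exp (- (1) * Im tau) * (C1 * (1 + Im tau) ^ k))%R by lra.
  mono.
 - apply tame_target.
Qed.

Lemma E_commute tau (k : C) : (E tau * sexp (k *: yt) = sexp (k *: yt) * E tau)%ncs.
Proof. unfold E. rewrite !sexp_add by apply yt_nil_0. f_equal. f_equal. ring. Qed.

Lemma target_nil tau : (E tau * sinv P)%ncs nil = 1.
Proof. rewrite smul_nil, sinv_nil by apply P_nil. unfold E. rewrite sexp_yt_nil. ring. Qed.

Lemma sinv_target tau : sinv (E tau * sinv P) = (P * sinv (E tau))%ncs.
Proof.
 rewrite sinv_mul, sinv_sinv; trivial; try apply sexp_yt_nil; try (apply sinv_nil, P_nil). apply P_nil.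
Qed.

(** With F close to E P^-1 at i Im tau / 2, horizontal transport by 1 makes A close to P E^-1 exp(2
    pi i yt) E P^-1; exponentials of yt commute, and the factor E, whose size depends on tau, drops
    out. *)
Lemma eqv_A : eqv (fun tau => fst (e tau)) (fun _ => P * sexp (two_pi_i *: yt) * sinv P)%ncs.
Proof.
 assert (TS : tame (fun tau => sexp ((two_pi_i * 1) *: yt) * (E tau * sinv P))%ncs).
 { apply tame_mul; [apply tame_const | apply tame_target]. }
 assert (TY : tame (fun tau => sinv (Fy tau))).
 { apply tame_sinv; [exact Fy_nil|]. apply (eqv_tame M0 Fy _ eqv_Fy), tame_target. }
 assert (H := eqv_mul M0 _ _ _ _ TY TS (eqv_sinv M0 Fy _ Fy_nil (fun tau _ => target_nil tau) tame_target eqv_Fy) (eqv_horizontal (fun _ => 1%R) 1 ltac:(lra) ltac:(intros; right; apply Rabs_R1))). revert H. apply eqv_ext.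
 - intros tau Ht.
  replace (Ci * RtoC (Im tau / 2)) with (Ci * RtoC (Im tau / 2) + 0) at 1 by ring.
  destruct (He tau (upper_1 tau Ht)) as [HA _]. rewrite (HA (Ci * RtoC (Im tau / 2))).
  + now rewrite Cplus_0_r.
  + replace (Ci * RtoC (Im tau / 2)) with (Ci * RtoC (Im tau / 2) + 0) by ring. now apply dom_mid.
  + now apply dom_mid.
 - intros tau Ht. rewrite sinv_target, Cmult_1_r.
  rewrite !smul_assoc. f_equal. rewrite <- (smul_assoc P). rewrite <- (smul_assoc P). f_equal.
  rewrite <- smul_assoc, <- E_commute, smul_assoc, sinv_l, smul_one_l by apply sexp_yt_nil. pos.
Qed.

Let phi_m (tau z : C) : ncs := (X * F tau (z + tau)%C)%ncs.

Lemma phi_m_facts tau : 1 <= Im tau ->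
 (forall z : C, z <> 0 -> 0 <= Re z < / 2 -> 0 <= -1 * Im z <= Im tau / 2 ->
   forall w, cder (fun s => phi_m tau s w) z ((KZB_kernel theta tau z * phi_m tau z)%ncs w)) /\
 (forall x, 0 < x < / 2 -> phi_m tau x = (F tau x * snd (e tau))%ncs) /\ snd (e tau) nil = 1.
Proof.
 intros Ht.
 assert (R1 : forall x, 0 < x < / 2 -> phi_m tau x = (F tau x * snd (e tau))%ncs).
 { intros x Hx. destruct (He tau (upper_1 tau Ht)) as [_ HB].
  rewrite (HB x) by (apply dom_real || apply dom_real_tau; lra).
  rewrite smul_assoc, sinv_r, smul_one_l; auto. apply F_nil; auto. apply dom_real; lra. }
 assert (Xn : X nil = 1) by (apply sexp_nil; unfold sscal; simpl; ring).
 split; [|split; auto].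
 - intros z Hz Hr Hi w.
  assert (Dz : dom tau (z + tau)).
  { destruct (Req_dec (Im z) 0) as [I0|I0].
   - replace z with (RtoC (Re z)) by (apply C_eq; auto).
    apply dom_real_tau. split; [|lra]. destruct Hr as [[Hr|Hr] _]; auto. exfalso. apply Hz. apply C_eq; auto.
   - apply dom_strip; [now apply upper_1|]. replace (Im (z + tau)) with (Im z + Im tau)%R by pos. lra. }
  assert (Nl : ~ lattice tau z).
  { intros L. destruct (theta_facts theta tau Hth (upper_1 tau Ht)) as [_ [_ [A3 [A4 _]]]].
   apply (lattice_strip (fun z => theta z tau) tau ltac:(lra) A3 A4) in L; [|apply Rabs_def1; lra].
   destruct L as [k Ek]. assert (Rk : Re z = IZR k) by (rewrite Ek; reflexivity). rewrite Rk in Hr. destruct Hr as [k1 k2].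
   apply le_IZR in k1. assert (k3 : IZR k < 1) by lra. apply lt_IZR in k3. apply Hz. rewrite Ek. replace k with 0%Z by lia. pos. }
  unfold phi_m. rewrite smul_assoc. unfold X.
  rewrite <- (KZB_kernel_tau theta beta tau z Hth beta_exp Ht Nl) by (apply Rabs_le; lra).
  rewrite <- smul_assoc. apply cder_smul_l. intros v.
  apply (cder_ext (fun s => F tau (tau + s) v)); [intros s; now rewrite (Cplus_comm tau s)|].
  apply (cder_shift (fun s => F tau s v)). replace (tau + z) with (z + tau) by ring.
  apply cder_of_is_derive. destruct (HF tau (upper_1 tau Ht)) as [_ [HD _]]. pos.
 (* Constant terms in the relation on the real axis, at the point 1/4, show that B has constant term
    1. *)
 - specialize (R1 (/ 4)%R ltac:(lra)). apply (f_equal (fun f : ncs => f nil)) in R1. unfold phi_m in R1.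
  rewrite !smul_nil, Xn, !F_nil in R1 by (trivial; apply dom_real || apply dom_real_tau; lra).
  rewrite Cmult_1_l in R1. rewrite Cmult_1_l in R1. pos.
Qed.

Let P2 : ncs := subst Phi (- yt - st)%ncs st.
Let Z : ncs := sexp ((- (RtoC PI * Ci))%C *: st)%ncs.

(** The end of the lower half-axis, translated by tau, lands on the horizontal line through the end
    of the upper one, at signed distance Re tau. Bridging this gap by [eqv_horizontal] uses the
    bound on Re tau. *)
Lemma mid_shift tau : Ci * RtoC (-1 * (Im tau / 2)) + tau = Ci * RtoC (Im tau / 2) + (Re tau).
Proof. destruct tau as [x y]. apply C_eq; simpl; field. Qed.

Lemma eqv_B : eqv (fun tau => snd (e tau))
 (fun tau => sexp ((PI * Ci) *: st) * P2 * X * sexp ((two_pi_i * tau) *: yt) * sinv P)%ncs.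
Proof.
 assert (Xn : X nil = 1) by (apply sexp_nil; unfold sscal; simpl; ring).
 assert (yn := yt_nil_0). assert (sn := st_nil). assert (Pn := P_nil).
 assert (an : (- yt - st)%ncs nil = 0) by (unfold sadd, sopp; rewrite yn, sn; ring).
 assert (P2n : P2 nil = 1) by (unfold P2; rewrite subst_nil; trivial; apply Phi_1).
 assert (Zn : Z nil = 1) by apply sexp_st_nil.
 set (E2 := fun tau => sexp ((- RtoC (c tau))%C *: (- yt - st))%ncs).
 assert (E2n : forall tau, E2 tau nil = 1) by (intros tau; apply sexp_nil; unfold sscal; rewrite an; ring).
 set (ph := fun tau => (X * F tau (Ci * RtoC (Im tau / 2) + RtoC (Re tau))%C)%ncs).
 set (R0 := fun tau => (sexp ((two_pi_i * RtoC (Re tau))%C *: yt) * (E tau * sinv P))%ncs).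
 assert (HR := eqv_horizontal Re (Rabs M0) (Rabs_pos M0) ltac:(intros tau Ht; eapply Rle_trans; [exact Ht | apply Rle_abs])).
 fold R0 in HR.
 assert (TR : tame R0).
 { apply tame_mul; [|apply tame_target].
  assert (Pi := PI_gt_3). assert (A0 := Rabs_pos M0).
  apply (tame_sexp M0 (fun tau => two_pi_i * RtoC (Re tau)) (2 * PI * Rabs M0)); [exact yn | apply Rmult_le_pos; lra|].
  intros tau Ht HM. rewrite Cmod_mult, Cmod_two_pi_i, Cmod_R. assert (A := Rle_abs M0).
  apply Rle_trans with (2 * PI * Rabs M0)%R; [apply Rmult_le_compat_l; lra|].
  assert (0 <= 2 * PI * Rabs M0) by (apply Rmult_le_pos; lra). nra. }
 assert (Hph : eqv ph (fun tau => X * R0 tau)%ncs) by (apply eqv_mul; trivial; [apply tame_const | apply eqv_refl]).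
 assert (TXR : tame (fun tau => X * R0 tau)%ncs) by (apply tame_mul; [apply tame_const | exact TR]).
 assert (Tph := eqv_tame M0 _ _ Hph TXR).
 (* The comparison on the lower half-axis says that V is close to 1; solving for B gives B = Z^-1
    V^-1 M^-1 ph, all of whose factors are known up to small errors. *)
 set (V := fun tau => (sinv (M (-1) tau) * (ph tau * sinv (Z * snd (e tau))))%ncs).
 assert (HV : eqv V (fun _ => sone)).
 { assert (H := eqv_ray (-1) phi_m (fun tau => snd (e tau)) (or_intror eq_refl) phi_m_facts). revert H. apply eqv_ext; [|reflexivity].
  intros tau Ht. unfold V, phi_m. rewrite mid_shift. f_equal. f_equal. f_equal. unfold ray_const. rewrite sexp_st_mul. unfold Z.
  f_equal. f_equal. f_equal. replace (-1 * PI / 2)%R with (- (PI / 2))%R by lra. rewrite RtoC_opp.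
  replace (RtoC PI) with (RtoC (PI / 2) + RtoC (PI / 2)) by (rewrite <- RtoC_plus; f_equal; field). ring. }
 assert (Bn : forall tau, 1 <= Im tau -> snd (e tau) nil = 1) by (intros tau Ht; apply phi_m_facts, Ht).
 assert (phn : forall tau, 1 <= Im tau -> ph tau nil = 1).
 { intros tau Ht. unfold ph. rewrite smul_nil, Xn, F_nil by (trivial; now apply dom_mid). ring. }
 assert (ZBn : forall tau, 1 <= Im tau -> (Z * snd (e tau))%ncs nil = 1).
 { intros tau Ht. rewrite smul_nil, Zn, Bn by lra. ring. }
 assert (Vn : forall tau, 1 <= Im tau -> V tau nil = 1).
 { intros tau Ht. unfold V. rewrite !smul_nil, !sinv_nil, phn by (trivial; try apply ZBn; try apply M_nil; trivial). ring. }
 assert (HM := eqv_M (-1)). rewrite ray_a_m1 in HM.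
 assert (TM' : tame (fun tau => E2 tau * sinv P2)%ncs).
 { apply tame_mul; [|apply tame_const]. intros n. apply (gro_ext M0 0 n (fun tau => sexp (RtoC (- (1) * c tau) *: (- yt - st)))).
  - intros tau _. unfold E2. f_equal. f_equal. rewrite <- RtoC_opp. f_equal. ring.
  - apply tame_sexp_c; [exact an | rewrite Rabs_Ropp, Rabs_R1; lra]. }
 assert (T1 : forall tau, 1 <= Im tau -> (E2 tau * sinv P2)%ncs nil = 1).
 { intros tau _. rewrite smul_nil, sinv_nil, E2n by pos. ring. }
 assert (TS1 : tame (fun tau => sinv (E2 tau * sinv P2) * (X * R0 tau))%ncs).
 { apply tame_mul; auto. now apply tame_sinv. }
 assert (TS2 : tame (fun tau => sinv sone * (sinv (E2 tau * sinv P2) * (X * R0 tau)))%ncs) by (apply tame_mul; [apply tame_const | exact TS1]).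
 assert (S3 := eqv_mul M0 _ _ _ _ (tame_const M0 (sinv Z)) TS2 (eqv_refl M0 (fun _ => sinv Z)) (eqv_mul M0 _ _ _ _ (tame_sinv M0 V Vn (eqv_tame M0 V _ HV (tame_const M0 sone))) TS1 (eqv_sinv M0 V (fun _ => sone) Vn (fun _ _ => eq_refl) (tame_const M0 sone) HV) (eqv_mul M0 _ _ _ _ (tame_sinv M0 _ (M_nil (-1)) (tame_M (-1))) TXR (eqv_sinv M0 _ _ (M_nil (-1)) T1 TM' HM) Hph))).
 revert S3. apply eqv_ext.
 - intros tau Ht. assert (zb := ZBn tau Ht).
  replace (sinv (M (-1) tau) * ph tau)%ncs with (V tau * (Z * snd (e tau)))%ncs.
  + now rewrite (smul_assoc (sinv (V tau))), sinv_l, smul_one_l, smul_assoc, sinv_l, smul_one_l by pos.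
  + unfold V. rewrite <- !(smul_assoc (sinv (M (-1) tau))). now rewrite <- smul_assoc, sinv_l, smul_one_r.
 - intros tau Ht.
  assert (So : sinv sone = sone) by (symmetry; apply sinv_unique; [reflexivity | apply smul_one_l]).
  assert (SZ : sinv Z = sexp ((PI * Ci) *: st)).
  { unfold Z. rewrite sexp_inv by pos. f_equal. f_equal. ring. }
  rewrite So, smul_one_l, SZ, sinv_mul, sinv_sinv by (trivial; now apply sinv_nil).
  (* The relation X yt = (yt + t) X carries exp(-c (yt + t)) across X, where it becomes E. With the
     transport by Re tau and the factor E of F the exponents add up: 2 pi i Re tau - 2 pi Im tau = 2
     pi i tau. *)
  assert (IE : (sinv (E2 tau) * X = X * E tau)%ncs).
  { unfold E2. rewrite sexp_inv by pos. unfold E.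
   assert (XY := X_yt two_pi_i beta beta_rec). fold yt X in XY.
   rewrite (sexp_intertwine ((- (c tau)) *: yt) ((- (c tau)) *: (yt + st)) X).
   - f_equal. f_equal. ncs_lin.
   - unfold sscal. rewrite yn. ring.
   - unfold sscal, sadd. rewrite yn, sn. ring.
   - rewrite smul_scal_r, XY, smul_scal_l. pos. }
  unfold R0. rewrite !smul_assoc. f_equal. rewrite <- !smul_assoc. f_equal. f_equal. rewrite !smul_assoc.
  rewrite IE. rewrite <- !smul_assoc. f_equal. unfold E. rewrite !sexp_add by pos. f_equal. f_equal.
  unfold c. destruct tau as [a b]. apply C_eq; simpl; ring.
Qed.

Hypothesis pser_rec : forall n, pser zcoef n - convol (eseq (- two_pi_i)) (pser zcoef) n =
 match n with O => 0 | S m => two_pi_i * two_pi_i * beta m end.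

Lemma limits w :
 filterlim (fun tau => exp_der (D_tau tau) (fst (e tau)) w) (i_infty M0) (locally ((P * sexp (two_pi_i *: yt) * sinv P)%ncs w)) /\
 filterlim (fun tau => exp_der (D_tau tau) (snd (e tau)) w) (i_infty M0)
  (locally ((sexp ((PI * Ci) *: st) * P2 * sexp (two_pi_i *: sx) * sinv P)%ncs w)).
Proof.
 assert (yn := yt_nil_0). assert (sn := st_nil). assert (pn := D0x_nil). assert (qn := D0y_nil).
 assert (Dy : D0 yt = szero) by (apply D0_yt; trivial; apply two_pi_i_neq_0).
 assert (Ds := D0_st). assert (CD := contin_D0).
 assert (Dys : D0 (- yt - st) = szero).
 { rewrite (contin_add _ CD), !(contin_opp _ _ CD), Dy, Ds. ncs_lin. }
 assert (an : (- yt - st)%ncs nil = 0) by (unfold sadd, sopp; rewrite yn, sn; ring).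
 assert (DP : D0 P = szero) by now apply der_subst.
 assert (DP2 : D0 P2 = szero) by now apply der_subst.
 assert (DPi : D0 (sinv P) = szero) by (apply der_sinv; trivial; apply P_nil).
 assert (Dm : forall f g : ncs, D0 f = szero -> D0 g = szero -> D0 (f * g) = szero).
 { intros f g Hf Hg. unfold D0. rewrite der_smul by pos. fold D0. rewrite Hf, Hg, smul_zero_l, smul_zero_r. ncs_lin. }
 assert (De : forall (k : C) (f : ncs), f nil = 0 -> D0 f = szero -> D0 (sexp (k *: f)) = szero).
 { intros k f Hf Df. apply der_sexp; trivial; [unfold sscal; rewrite Hf; ring|]. rewrite (contin_scal _ CD), Df. ncs_lin. }
 split.
 - apply (limit_of_eqv M0 _ _ _ w eqv_A). intros tau _. apply exp_der_killed. auto.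
 - apply (limit_of_eqv M0 _ _ _ w eqv_B). intros tau _. apply exp_der_X; trivial; auto. apply two_pi_i_neq_0.
Qed.

End Limit.

Theorem proposition5p3
 (Phi : ncs) (hPhi : is_PhiKZ Phi)
 (theta : C -> C -> C) (htheta : is_theta theta)
 (F : C -> C -> ncs)
 (hF : forall tau, upper tau -> is_KZB_solution theta tau (F tau))
 (e : C -> ncs * ncs)
 (he : forall tau, upper tau -> is_KZB_pair tau (F tau) (e tau)) :
 let lhs := (rescale (fst (ell_sigma two_pi_i Phi)), rescale (snd (ell_sigma two_pi_i Phi))) in
 lim_i_infty (fun tau => star (e tau) (exp_der (D_tau tau))) lhs /\
 lhs = ell_sigma_explicit Phi.
Proof.
 intros lhs. destruct hPhi as [G0 [G1 [s0 [a0 [s1 [a1 HPhi]]]]]].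
 destruct (bernoulli_exists two_pi_i two_pi_i_neq_0) as [beta [_ [_ [_ [_ [_ [beta_rec beta_exp]]]]]]].
 (* The associator is built from s / (exp s - 1), the kernel from s / (exp(2 pi i s) - 1); each
    needs its own expansion. *)
 destruct (bernoulli_exists 1 C1_nz) as [b [_ [_ [_ [_ [_ [_ b_exp]]]]]]].
 assert (b_exp' : has_expansion (fun s => s / (Cexp s - 1)) b).
 { apply (has_expansion_ext_loc (fun s => s / (Cexp (1 * s) - 1))); auto.
  exists 1%R. split; [lra|]. intros s _ _. now rewrite Cmult_1_l. }
 assert (Pn : Phi nil = 1) by now apply (Phi_nil G1 s1 a1 G0).
 assert (El : lhs = ell_sigma_explicit Phi) by now apply (ell_sigma_eq beta beta_exp b).
 split; auto. rewrite El. intros M w.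
 assert (L := limits Phi theta F e G0 G1 beta M htheta hF he s0 a0 s1 a1 HPhi beta_rec beta_exp (pser_zcoef_rec beta beta_exp) w).
 unfold ell_sigma_explicit. rewrite (y_tilde_Lser beta beta_exp). pos.
Qed.
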